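(* Let $d\ge 1$, let $R\subset\mathbb{R}^d$ be a root system with positive subsystem $R_+$ and finite reflection group $G$, and let $k\colon R\to[0,\infty)$ be a $G$-invariant multiplicity function. Put $|k|=\sum_{a\in R_+}k(a)$ and $\lambda_k=\frac d2-1+|k|$, and let $0\le\beta<\lambda_k+1$. Let $C(\beta,k)$ denote the smallest constant $C$ such that $$\bigl\||y|^{-\beta}F_k(f)(y)\bigr\|_{2,d\mu_k}\le C\,\bigl\||x|^{\beta}f(x)\bigr\|_{2,d\mu_k}\qquad\text{for all } f\in\mathcal{S}(\mathbb{R}^d),$$ where $F_k$ is the Dunkl transform. Then $$C(\beta,k)=2^{-\beta}\,\frac{\Gamma\bigl(\frac12(\lambda_k+1-\beta)\bigr)}{\Gamma\bigl(\frac12(\lambda_k+1+\beta)\bigr)}.$$ Moreover, the sharpness is already seen on radial functions: no smaller constant works in the inequality even when $f$ is restricted to radial functions in $\mathcal{S}(\mathbb{R}^d)$.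
   Context: $\mathbb{R}^d$ carries the standard scalar product $\langle x,y\rangle$ and norm $|x|$; $\mathcal{S}(\mathbb{R}^d)$ is the (complex-valued) Schwartz space; $\Gamma$ is the gamma function. For $a\ne 0$, $\sigma_a$ is the orthogonal reflection in the hyperplane $\langle a,x\rangle=0$. A root system $R$ is a finite set of nonzero vectors with $\sigma_a(R)=R$ and $R\cap\mathbb{R}a=\{\pm a\}$ for all $a\in R$; $R_+$ is a positive subsystem; $G=G(R)\subset O(d)$ is the finite group generated by $\{\sigma_a\colon a\in R\}$. A multiplicity function is a $G$-invariant function $k\colon R\to[0,\infty)$. The Dunkl weight is $v_k(x)=\prod_{a\in R_+}|\langle a,x\rangle|^{2k(a)}$, and $d\mu_k(x)=c_kv_k(x)\,dx$ with $c_k^{-1}=\int_{\mathbb{R}^d}e^{-|x|^2/2}v_k(x)\,dx$. The norm is $\|f\|_{2,d\mu_k}=\bigl(\int_{\mathbb{R}^d}|f(x)|^2\,d\mu_k(x)\bigr)^{1/2}$. The Dunkl operators are $$D_jf(x)=\frac{\partial f(x)}{\partial x_j}+\sum_{a\in R_+}k(a)\langle a,e_j\rangle\frac{f(x)-f(\sigma_ax)}{\langle a,x\rangle},\qquad j=1,\dots,d.$$ For $y\in\mathbb{R}^d$, the Dunkl kernel $x\mapsto e_k(x,y)=E_k(x,iy)$ is the unique (real-analytic) solution $f$ of $D_jf(x)=iy_jf(x)$, $j=1,\dots,d$, $f(0)=1$. The Dunkl transform is $F_k(f)(y)=\int_{\mathbb{R}^d}f(x)\overline{e_k(x,y)}\,d\mu_k(x)$.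 *)

(* Defs.v *)
From HB Require Import structures.
From mathcomp Require Import all_boot all_order all_algebra finmap.
From mathcomp Require Import complex.
From mathcomp Require Import all_classical all_reals all_analysis.

Set Implicit Arguments.
Unset Strict Implicit.
Unset Printing Implicit Defensive.

Import Order.TTheory GRing.Theory Num.Theory.
Import numFieldNormedType.Exports.

Local Open Scope classical_set_scope.
Local Open Scope ring_scope.

(* Lebesgue measure on R^n, constructed as an iterated product measure on the
   sigma-algebra generated by the coordinates. *)

Definition rV_display : measure_display -> measure_display.
Proof. exact. Qed.

Definition rV_coord {R : realType} {n : nat} (i : 'I_n) (v : 'rV[R]_n) :
  measurableTypeR R := v ord0 i.

Section measurable_rV.
Context {R : realType} {n : nat}.

Let rV_set0 : g_sigma_preimage (@rV_coord R n) set0.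
Proof. exact: sigma_algebra0. Qed.

Let rV_setC A :
  g_sigma_preimage (@rV_coord R n) A -> g_sigma_preimage rV_coord (~` A).
Proof. exact: sigma_algebraC. Qed.

Let rV_bigcup (F : (set 'rV[R]_n)^nat) :
  (forall i, g_sigma_preimage rV_coord (F i)) ->
  g_sigma_preimage rV_coord (\bigcup_i (F i)).
Proof. exact: sigma_algebra_bigcup. Qed.

HB.instance Definition _ := @isMeasurable.Build
  (rV_display (R.-ocitv.-measurable.-sigma)%mdisp) 'rV[R]_n
  (g_sigma_preimage (@rV_coord R n)) rV_set0 rV_setC rV_bigcup.

Lemma measurable_rV_coord (i : 'I_n) :
  measurable_fun [set: 'rV[R]_n] (rV_coord i).
Proof.
move=> _ Y mY; rewrite setTI; apply: sub_sigma_algebra => /=.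
rewrite -bigcup_seq/=; exists i => /=; first by rewrite mem_index_enum.
by exists Y => //; rewrite setTI.
Qed.

Lemma measurable_fun_rV_coordP d (T : measurableType d) (f : T -> 'rV[R]_n) :
  (forall i, measurable_fun [set: T] (rV_coord i \o f)) ->
  measurable_fun [set: T] f.
Proof.
move=> mf.
suff H : g_sigma_preimage (@rV_coord R n) `<=`
    [set A | measurable (f @^-1` A)].
  by move=> _ A mA; rewrite setTI; exact: H.
apply: smallest_sub.
  split => [|A mA|F mF] /=.
  - by rewrite preimage_set0.
  - by rewrite setTD preimage_setC; exact: measurableC.
  - by rewrite preimage_bigcup; by apply: bigcup_measurable => i _; exact: mF.
rewrite -bigcup_seq => A [i _ [B mB <-]] /=.
rewrite setTI -comp_preimage -[X in measurable X]setTI.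
exact: mf.
Qed.

End measurable_rV.

Section lebesgue_rV.
Context {R : realType}.

Definition rV_cons n (p : measurableTypeR R * 'rV[R]_n) : 'rV[R]_n.+1 :=
  \row_i oapp (fun j => p.2 ord0 j) p.1 (unlift ord0 i).

Lemma measurable_rV_cons n :
  measurable_fun [set: measurableTypeR R * 'rV[R]_n] (@rV_cons n).
Proof.
apply: measurable_fun_rV_coordP => i.
case: (unliftP ord0 i) => [j ->|->].
- rewrite (_ : _ \o _ = rV_coord j \o snd); last first.
    by apply/funext => p; rewrite /= /rV_coord mxE liftK.
  by apply: measurableT_comp => //; exact: measurable_rV_coord.
- rewrite (_ : _ \o _ = fst)//.
  by apply/funext => p; rewrite /= /rV_coord mxE unlift_none.
Qed.

HB.instance Definition _ n := isMeasurableFun.Build _ _ _ _ (@rV_cons n)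
  (@measurable_rV_cons n).

Section lebesgue_rV_step.
Context n (mu : {sigma_finite_measure set 'rV[R]_n -> \bar R}).

Definition lebesgue_rV_step : set 'rV[R]_n.+1 -> \bar R :=
  pushforward (@lebesgue_measure R \x mu)%E (@rV_cons n).

Let step0 : lebesgue_rV_step set0 = 0%E.
Proof. exact: measure0. Qed.

Let step_ge0 A : (0 <= lebesgue_rV_step A)%E.
Proof. exact: measure_ge0. Qed.

Let step_sigma_additive : semi_sigma_additive lebesgue_rV_step.
Proof. exact: measure_semi_sigma_additive. Qed.

HB.instance Definition _ := isMeasure.Build _ _ _ lebesgue_rV_step
  step0 step_ge0 step_sigma_additive.

Let step_sigma_finite : sigma_finite setT lebesgue_rV_step.
Proof.
have /sigma_finiteP[F [TF ndF Foo]] := sigma_finiteT (@lebesgue_measure R).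
have /sigma_finiteP[G [TG ndG Goo]] := sigma_finiteT mu.
pose uncons (v : 'rV[R]_n.+1) : measurableTypeR R * 'rV[R]_n :=
  (v ord0 ord0, \row_j v ord0 (lift ord0 j)).
have consK : cancel (@rV_cons n) uncons.
  case=> x v; rewrite /uncons /rV_cons /= mxE unlift_none /=; congr pair.
  by apply/rowP => j; rewrite !mxE liftK.
have muncons : measurable_fun setT uncons.
  apply/measurable_fun_pairP; split; first exact: measurable_rV_coord.
  apply: measurable_fun_rV_coordP => j.
  rewrite (_ : _ \o _ = rV_coord (lift ord0 j)); first exact: measurable_rV_coord.
  by apply/funext => v; rewrite /= /rV_coord mxE.
exists (fun i => uncons @^-1` (F i `*` G i)).
  rewrite -preimage_bigcup (_ : \bigcup_i _ = setT) ?preimage_setT//.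
  apply/seteqP; split => // -[x v] _.
  have [i _ Fx] : (\bigcup_i F i) x by rewrite -TF.
  have [j _ Gv] : (\bigcup_i G i) v by rewrite -TG.
  exists (maxn i j) => //; split => /=.
    by move: x Fx; exact/subsetPset/ndF/leq_maxl.
  by move: v Gv; exact/subsetPset/ndG/leq_maxr.
move=> i; have [mF Ffin] := Foo i; have [mG Gfin] := Goo i; split.
  by rewrite -[X in measurable X]setTI; apply: muncons => //; exact: measurableX.
rewrite /lebesgue_rV_step /pushforward -comp_preimage (_ : uncons \o _ = id).
  by rewrite preimage_id product_measure1E// lte_mul_pinfty// ge0_fin_numE.
exact/funext/consK.
Qed.

HB.instance Definition _ := Measure_isSigmaFinite.Build _ _ _ lebesgue_rV_step
  step_sigma_finite.

End lebesgue_rV_step.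

Fixpoint lebesgue_rV n : {sigma_finite_measure set 'rV[R]_n -> \bar R} :=
  if n is m.+1 then lebesgue_rV_step (lebesgue_rV m) else \d_(0 : 'rV[R]_0).

End lebesgue_rV.

Section euclidean.
Context {R : realType} {d : nat}.
Implicit Types a x y : 'rV[R]_d.

Definition dotp x y : R := \sum_(i < d) x ord0 i * y ord0 i.

(* The library norm on row vectors is the sup norm; this is the Euclidean one. *)
Definition enorm x : R := Num.sqrt (dotp x x).

Definition reflection a x : 'rV[R]_d := x - (2 * dotp a x / dotp a a) *: a.

Definition basis_vec (j : 'I_d) : 'rV[R]_d := delta_mx ord0 j.

Definition radial (T : Type) (f : 'rV[R]_d -> T) : Prop :=
  forall x y, enorm x = enorm y -> f x = f y.

End euclidean.

Section complex_calculus.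
Context {R : realType} {d : nat}.
Implicit Types (f : 'rV[R]_d -> R[i]) (x v : 'rV[R]_d).

Definition cdifferentiable f x : Prop :=
  differentiable (fun z => complex.Re (f z)) x /\
  differentiable (fun z => complex.Im (f z)) x.

Definition cderive v f x : R[i] :=
  ('D_v (fun z => complex.Re (f z)) x +i*
   'D_v (fun z => complex.Im (f z)) x)%C.

Fixpoint iter_partial (s : seq 'I_d) f : 'rV[R]_d -> R[i] :=
  if s is j :: s' then cderive (basis_vec j) (iter_partial s' f) else f.

(* Differentiability of all iterated partial derivatives makes f smooth. *)
Definition schwartz f : Prop :=
  forall s : seq 'I_d,
    (forall x, cdifferentiable (iter_partial s f) x) /\
    (forall N : nat, exists M : R, forall x,
       (1 + enorm x) ^+ N * Normc.normc (iter_partial s f x) <= M).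

(* The degree-n part, at h, of the power series with coefficients c; a
   multi-index of length n has all its entries at most n. *)
Definition homogeneous_part (c : ('I_d -> nat) -> R) (n : nat) (h : 'rV[R]_d) :
    R :=
  \sum_(alpha : {ffun 'I_d -> 'I_n.+1} | (\sum_i alpha i == n)%N)
    c (fun i => alpha i : nat) * \prod_i h ord0 i ^+ alpha i.

Definition absolute_homogeneous_part (c : ('I_d -> nat) -> R) (n : nat)
    (h : 'rV[R]_d) : R :=
  \sum_(alpha : {ffun 'I_d -> 'I_n.+1} | (\sum_i alpha i == n)%N)
    `|c (fun i => alpha i : nat) * \prod_i h ord0 i ^+ alpha i|.

Definition real_analytic (g : 'rV[R]_d -> R) : Prop :=
  forall x, exists c : ('I_d -> nat) -> R, exists2 r : R, 0 < r &
    forall h, enorm h < r ->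
      cvgn (series (fun n => absolute_homogeneous_part c n h)) /\
      series (fun n => homogeneous_part c n h) @ \oo --> g (x + h).

Definition creal_analytic f : Prop :=
  real_analytic (fun x => complex.Re (f x)) /\
  real_analytic (fun x => complex.Im (f x)).

End complex_calculus.

Section root_systems.
Context {R : realType} {d : nat}.
Implicit Types (Rs Rp : {fset 'rV[R]_d}) (k : 'rV[R]_d -> R).

Definition root_system Rs : Prop :=
  [/\ forall a, a \in Rs -> a != 0,
      forall a, a \in Rs -> [fset reflection a b | b in Rs]%fset = Rs &
      forall a, a \in Rs -> forall b,
        (b \in Rs /\ exists c : R, b = c *: a) <-> (b = a \/ b = - a)].

Definition positive_subsystem Rs Rp : Prop :=
  exists2 u : 'rV[R]_d, forall a, a \in Rs -> dotp a u != 0 &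
    forall a, a \in Rp <-> a \in Rs /\ 0 < dotp a u.

(* Reflections are involutions, so closure under composition with generators
   already yields the generated group. *)
Inductive reflection_group Rs : ('rV[R]_d -> 'rV[R]_d) -> Prop :=
| reflection_group_id : reflection_group Rs id
| reflection_group_comp a g :
    a \in Rs -> reflection_group Rs g -> reflection_group Rs (reflection a \o g).

(* Only the values of k on Rs are meaningful. *)
Definition multiplicity Rs k : Prop :=
  (forall a, a \in Rs -> 0 <= k a) /\
  (forall g a, reflection_group Rs g -> a \in Rs -> k (g a) = k a).

End root_systems.

Section dunkl.
Context {R : realType} {d : nat}.
Variables (Rp : {fset 'rV[R]_d}) (k : 'rV[R]_d -> R).
Implicit Types (f g : 'rV[R]_d -> R[i]) (x y : 'rV[R]_d).

Local Notation mu := (@lebesgue_rV R d).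

Definition lambda_k : R := d%:R / 2 - 1 + \sum_(a <- Rp) k a.

Definition dunkl_weight x : R := \prod_(a <- Rp) `|dotp a x| `^ (2 * k a).

Definition dunkl_cst : R :=
  (\int[mu]_x (expR (- (enorm x ^+ 2) / 2) * dunkl_weight x))^-1.

Definition dunkl_density x : R := dunkl_cst * dunkl_weight x.

Definition dunkl_integral f : R[i] :=
  ((\int[mu]_x (complex.Re (f x) * dunkl_density x)) +i*
   (\int[mu]_x (complex.Im (f x) * dunkl_density x)))%C.

Definition dunkl_norm2 f : \bar R :=
  ((\int[mu]_x ((Normc.normc (f x)) ^+ 2 * dunkl_density x)%:E) `^ 2^-1)%E.

(* On the hyperplane <a, x> = 0 the quotient takes its limit value
   (2 / |a|^2) (derivative of f along a), as usual for smooth f. *)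
Definition dunkl_quotient (a : 'rV[R]_d) f x : R[i] :=
  if dotp a x == 0 then (2 / dotp a a)%:C%C * cderive a f x
  else (f x - f (reflection a x)) / (dotp a x)%:C%C.

Definition dunkl_op (j : 'I_d) f x : R[i] :=
  cderive (basis_vec j) f x +
  \sum_(a <- Rp) (k a * dotp a (basis_vec j))%:C%C * dunkl_quotient a f x.

(* [e x y] stands for e_k(x, y) = E_k(x, i y). *)
Definition is_dunkl_kernel (e : 'rV[R]_d -> 'rV[R]_d -> R[i]) : Prop :=
  forall y,
    [/\ creal_analytic (fun x => e x y),
        forall j x, dunkl_op j (fun z => e z y) x =
                    ('i * (y ord0 j)%:C)%C * e x y &
        e 0 y = 1].

Definition dunkl_transform (e : 'rV[R]_d -> 'rV[R]_d -> R[i]) f y : R[i] :=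
  dunkl_integral (fun x => f x * (e x y)^*%C).

Definition norm_power_mul (s : R) f x : R[i] := (enorm x `^ s)%:C%C * f x.

Definition pitt_bound (e : 'rV[R]_d -> 'rV[R]_d -> R[i]) (beta : R)
    (F : set ('rV[R]_d -> R[i])) (C : R) : Prop :=
  forall f, F f ->
    (dunkl_norm2 (norm_power_mul (- beta) (dunkl_transform e f)) <=
     C%:E * dunkl_norm2 (norm_power_mul beta f))%E.

End dunkl.

(* Euler's integral; meaningful for s > 0. *)
Definition Gamma {R : realType} (s : R) : R :=
  \int[lebesgue_measure]_(t in `]0, +oo[) (t `^ (s - 1) * expR (- t)).

Definition is_smallest_constant {R : realType} (P : set R) (C : R) : Prop :=
  P C /\ forall C', P C' -> C <= C'.

(* Main.v *)
(** Put [nu = lambda_k + 1] and write the Dunkl kernel as [e = C + i S].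
    Contracting its defining equations with [x] gives first-order equations
    for [C] and [S] along rays, and a maximum principle for such equations
    (with reflection terms) yields uniqueness, [|e| <= 1],
    [e(x, y) = e(y, x)] and invariance under the reflections.  In its
    minimum form, combined with integration by parts for Dunkl operators, the
    same principle shows that the kernel
      [K_t(x, z) = int exp(-t|y|^2) Re(e(x, y) conj(e(z, y))) dmu_k(y)]
    is nonnegative, and that [K_t] maps [exp(-u|z|^2)] to
    [(1 + 4tu)^(-nu) exp(-u|x|^2 / (1 + 4tu))].

    Upper bound: [int exp(-t|y|^2) |F_k f(y)|^2 dmu_k(y)] is the quadratic form
    of [K_t] at [f].  Schur's test with the weight [h(x) = |x|^(-nu-beta)],
    which is a superposition of Gaussians, followed by integration against
    [t^(beta-1) dt], gives the inequality with the sharp constant; for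
    [beta = 0] take [h = 1] and [t -> 0].

    Sharpness: take [f = sum_(i < n) u_i^((nu+beta)/2) exp(-u_i|x|^2)] with
    [u_i = q^i].  Both squared norms are multiples of quadratic forms of
    the Toeplitz matrices of [psi_a(r) = (sqrt r / (1 + r))^a], with
    [a = nu - beta] on the left and [a = nu + beta] on the right.  As [n -> oo]
    and then [q -> 1], their ratio tends to the ratio of the integrals
    [int psi_a dr/r = Gamma(a/2)^2 / Gamma(a)]. *)

From HB Require Import structures.
From mathcomp Require Import all_boot all_order all_algebra finmap.
From mathcomp Require Import complex.
From mathcomp Require Import all_classical all_reals all_analysis.
From mathcomp Require Import measurable_realfun.
From mathcomp Require Import ring lra.
Require Import Defs.

Set Implicit Arguments.
Unset Strict Implicit.
Unset Printing Implicit Defensive.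

Import Order.TTheory GRing.Theory Num.Theory.
Import numFieldNormedType.Exports.

Local Open Scope classical_set_scope.
Local Open Scope ring_scope.

(** Positivity of the heat kernel is often derived from an integral representation of the Dunkl
    kernel; here only the defining equations of [e] are at hand. The way out is that contraction
    with x multiplies each difference quotient by <a, x>: the singular denominators disappear, and
    the remaining difference between x and its reflection has a definite sign at an extremum over a
    ball, since reflections preserve balls. Regularity of [e] in its second argument is not assumed
    either and comes from the same principle. The exponent of the Schur weight |x|^(-s) is a choice:
    scaling alone makes the t-integral of K_t h a multiple of |x|^(2 beta) h, and s = nu + beta
    makes the two Gamma quotients in that multiple coincide, so that the squared constant is a
    perfect square. The Schur weight is also the formal extremiser: the test functions are Riemann
    sums, in log u, of the Gaussian superposition representing it, which is why upper and lower
    bound meet. All explicit transforms are those of Gaussians; inversion, Plancherel's identity and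
    polar coordinates are avoided. *)

Section pointwise_derivatives.
Context {R : realType} {V : normedModType R}.
Implicit Types (f g : V -> R) (x v : V).

Lemma is_derive_add f g x v (df dg : R) : is_derive x v f df ->
  is_derive x v g dg -> is_derive x v (fun y => f y + g y) (df + dg).
Proof. exact: is_deriveD. Qed.

Lemma is_derive_sub f g x v (df dg : R) : is_derive x v f df ->
  is_derive x v g dg -> is_derive x v (fun y => f y - g y) (df - dg).
Proof. exact: is_deriveB. Qed.

Lemma is_derive_mulc (c : R) f x v (df : R) : is_derive x v f df ->
  is_derive x v (fun y => c * f y) (c * df).
Proof. exact: is_deriveZ. Qed.

Lemma is_derive_opp f x v (df : R) : is_derive x v f df ->
  is_derive x v (fun y => - f y) (- df).
Proof. exact: is_deriveN. Qed.

Lemma is_derive_mul f g x v (df dg : R) : is_derive x v f df ->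
  is_derive x v g dg ->
  is_derive x v (fun y => f y * g y) (df * g x + f x * dg).
Proof.
by move=> h1 h2; have := is_deriveM h1 h2; rewrite addrC /GRing.scale/= (mulrC _ df).
Qed.

Lemma is_derive_comp (h : R -> R) (f : R -> R) (t : R) (dh df : R) :
  is_derive (f t) (1 : R) h dh -> is_derive t (1 : R) f df ->
  is_derive t (1 : R) (fun s => h (f s)) (dh * df).
Proof. exact: is_derive1_comp. Qed.

Lemma is_derive_exp (f : R -> R) (t df : R) : is_derive t (1 : R) f df ->
  is_derive t (1 : R) (fun s => expR (f s)) (expR (f t) * df).
Proof. by apply: is_derive_comp; exact: is_derive_expR. Qed.

End pointwise_derivatives.

Lemma is_derive_linear {R : realType} (c t : R) :
  is_derive t (1 : R) (fun s : R => c * s) c.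
Proof.
exact: (is_derive_eq (is_derive_mulc c (is_derive_id t (1 : R))) (mulr1 c)).
Qed.


(** * Euclidean geometry of row vectors *)
Section euclidean_facts.
Context {R : realType} {d : nat}.
Implicit Types a b x y z : 'rV[R]_d.

Lemma dotpC x y : dotp x y = dotp y x.
Proof. by apply: eq_bigr => i _; rewrite mulrC. Qed.

Lemma dotpDl x y z : dotp (x + y) z = dotp x z + dotp y z.
Proof. by rewrite -big_split; apply: eq_bigr => i _; rewrite mxE mulrDl. Qed.

Lemma dotpZl c x y : dotp (c *: x) y = c * dotp x y.
Proof. by rewrite /dotp mulr_sumr; apply: eq_bigr => i _; rewrite mxE mulrA. Qed.

Lemma dotpDr x y z : dotp x (y + z) = dotp x y + dotp x z.
Proof. by rewrite dotpC dotpDl !(dotpC _ x). Qed.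

Lemma dotpZr c x y : dotp x (c *: y) = c * dotp x y.
Proof. by rewrite dotpC dotpZl (dotpC x). Qed.

Lemma dotpNl x y : dotp (- x) y = - dotp x y.
Proof. by rewrite -scaleN1r dotpZl mulN1r. Qed.

Lemma dotpNr x y : dotp x (- y) = - dotp x y.
Proof. by rewrite dotpC dotpNl dotpC. Qed.

Lemma dotpBl x y z : dotp (x - y) z = dotp x z - dotp y z.
Proof. by rewrite dotpDl dotpNl. Qed.

Lemma dotpBr x y z : dotp x (y - z) = dotp x y - dotp x z.
Proof. by rewrite dotpDr dotpNr. Qed.

Lemma dotp0r x : dotp x 0 = 0.
Proof. by rewrite -(scale0r 0) dotpZr mul0r. Qed.

Lemma dotp0l x : dotp 0 x = 0.
Proof. by rewrite dotpC dotp0r. Qed.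

Lemma dotp_ge0 x : 0 <= dotp x x.
Proof. by apply: sumr_ge0 => i _; rewrite -expr2 sqr_ge0. Qed.

Lemma dotp_eq0 x : (dotp x x == 0) = (x == 0).
Proof.
apply/eqP/eqP => [/psumr_eq0P H|->]; last by rewrite dotp0l.
apply/rowP => i; rewrite mxE; apply/eqP.
rewrite -sqrf_eq0 expr2 H// => j _; by rewrite -expr2 sqr_ge0.
Qed.

Lemma enorm_ge0 x : 0 <= enorm x.
Proof. exact: sqrtr_ge0. Qed.

Lemma enorm_sqr x : enorm x ^+ 2 = dotp x x.
Proof. by rewrite sqr_sqrtr ?dotp_ge0. Qed.

Lemma enorm_eq0 x : (enorm x == 0) = (x == 0).
Proof. by rewrite -dotp_eq0 -enorm_sqr sqrf_eq0. Qed.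

Lemma enorm_gt0 x : (0 < enorm x) = (x != 0).
Proof. by rewrite lt_neqAle enorm_ge0 andbT eq_sym enorm_eq0. Qed.

Lemma enorm0 : enorm (0 : 'rV[R]_d) = 0.
Proof. by apply/eqP; rewrite enorm_eq0. Qed.

Lemma enormZ c x : enorm (c *: x) = `|c| * enorm x.
Proof.
by rewrite /enorm dotpZl dotpZr mulrA -expr2 sqrtrM ?sqr_ge0// sqrtr_sqr.
Qed.

Lemma enormN x : enorm (- x) = enorm x.
Proof. by rewrite -scaleN1r enormZ normrN1 mul1r. Qed.

Lemma dotp_le_enorm x y : dotp x y <= enorm x * enorm y.
Proof.
have [->|x0] := eqVneq x 0; first by rewrite dotp0l enorm0 mul0r.
(* Expanding this square gives 2|x||y|(|x||y| - <x, y>) >= 0, from which the positive factor is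
   cancelled. *)
have := dotp_ge0 (enorm y *: x - enorm x *: y).
rewrite !(dotpBl, dotpBr, dotpZl, dotpZr) (dotpC y x) -!enorm_sqr => H.
have [->|y0] := eqVneq y 0; first by rewrite dotp0r enorm0 mulr0.
have p : 0 < enorm x * enorm y by rewrite mulr_gt0 ?enorm_gt0.
rewrite -(ler_pM2l p); nra.
Qed.

Lemma normr_dotp_le x y : `|dotp x y| <= enorm x * enorm y.
Proof.
by rewrite ler_norml dotp_le_enorm -(enormN x) lerNl -dotpNl dotp_le_enorm.
Qed.

Lemma normr_coord_le_enorm x i : `|x ord0 i| <= enorm x.
Proof.
rewrite -sqrtr_sqr ler_wsqrtr// /dotp (bigD1 i)//= expr2 lerDl.
by apply: sumr_ge0 => j _; rewrite -expr2 sqr_ge0.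
Qed.

Lemma normr_le_enorm x : `|x| <= enorm x.
Proof.
rewrite /Num.norm/= mx_normrE.
apply/bigmax_leP; split; first exact: enorm_ge0.
move=> [i j] _ /=; rewrite (ord1 i); exact: normr_coord_le_enorm.
Qed.

Lemma normr_coord_le x i : `|x ord0 i| <= `|x|.
Proof.
rewrite /Num.norm/= mx_normrE.
exact: (@le_bigmax _ _ _ 0 (fun ij : 'I_1 * 'I_d => `|x ij.1 ij.2|) (ord0, i)).
Qed.

Lemma enorm_le_normr x : enorm x <= Num.sqrt d%:R * `|x|.
Proof.
rewrite -[leRHS]ger0_norm ?mulr_ge0 ?sqrtr_ge0// -sqrtr_sqr ler_wsqrtr//.
rewrite exprMn sqr_sqrtr ?ler0n// /dotp mulr_natl -[X in _ *+ X]card_ord.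
rewrite -sumr_const ler_sum// => i _.
by rewrite -expr2 -real_normK ?num_real// lerXn2r ?nnegrE ?normr_coord_le.
Qed.

Lemma dotp_reflection a x y :
  dotp (reflection a x) (reflection a y) = dotp x y.
Proof.
have [->|a0] := eqVneq a 0; first by rewrite /reflection !scaler0 !subr0.
have : dotp a a != 0 by rewrite dotp_eq0.
rewrite /reflection !(dotpBl, dotpBr, dotpZl, dotpZr) (dotpC x a) => h.
by field.
Qed.

Lemma enorm_reflection a x : enorm (reflection a x) = enorm x.
Proof. by rewrite /enorm dotp_reflection. Qed.

Lemma dotp_reflectionr a x : dotp a (reflection a x) = - dotp a x.
Proof.
have [->|a0] := eqVneq a 0; first by rewrite !dotp0l oppr0.
have : dotp a a != 0 by rewrite dotp_eq0.
by rewrite /reflection dotpBr dotpZr => h; field.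
Qed.

Lemma reflectionK a : involutive (reflection a).
Proof.
move=> x; rewrite {1}/reflection dotp_reflectionr /reflection.
by rewrite mulrN mulNr scaleNr opprK subrK.
Qed.

Lemma reflectionD a x y : reflection a (x + y) = reflection a x + reflection a y.
Proof.
by rewrite /reflection dotpDr mulrDr mulrDl scalerDl opprD addrACA.
Qed.

Lemma reflectionZ a c x : reflection a (c *: x) = c *: reflection a x.
Proof. by rewrite /reflection dotpZr scalerBr scalerA mulrCA !mulrA. Qed.

Lemma reflectionB a x y : reflection a (x - y) = reflection a x - reflection a y.
Proof. by rewrite reflectionD -scaleN1r reflectionZ scaleN1r. Qed.

Lemma reflection0 a : reflection a 0 = 0.
Proof. by rewrite -{1}(scale0r (0 : 'rV[R]_d)) reflectionZ scale0r. Qed.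

Lemma reflectionNl a : reflection (- a) = reflection a.
Proof.
apply/funext => x; rewrite /reflection !dotpNl dotpNr opprK scalerN.
by rewrite mulrN mulNr scaleNr !opprK.
Qed.

Lemma reflection_self a : reflection a a = - a.
Proof.
have [->|a0] := eqVneq a 0; first by rewrite reflection0 oppr0.
rewrite /reflection mulfK ?dotp_eq0// scaler_nat mulr2n opprD addrA subrr.
by rewrite sub0r.
Qed.

Lemma reflection_dotpC a x y : dotp (reflection a x) y = dotp x (reflection a y).
Proof. by rewrite -[X in dotp _ X](reflectionK a) dotp_reflection. Qed.

Lemma reflection_conj a b x :
  reflection (reflection a b) (reflection a x) = reflection a (reflection b x).
Proof.
by rewrite [in LHS]/reflection !dotp_reflection -reflectionZ -reflectionB.
Qed.

Lemma enorm_sub_reflection a x : a != 0 ->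
  enorm (x - reflection a x) = 2 * `|dotp a x| / enorm a.
Proof.
move=> a0; rewrite /reflection opprB addrC subrK enormZ normrM normfV normrM.
rewrite (ger0_norm (dotp_ge0 a)) -enorm_sqr ger0_norm//.
by have : enorm a != 0; [rewrite enorm_eq0|move=> h; field].
Qed.

Lemma dotp_basis_vec x j : dotp x (basis_vec j) = x ord0 j.
Proof.
rewrite /dotp (bigD1 j)//= !mxE !eqxx mulr1 big1 ?addr0// => i ij.
by rewrite mxE (negbTE ij) andbF mulr0.
Qed.

Lemma row_sum_basis x : x = \sum_j x ord0 j *: basis_vec j.
Proof. exact: row_sum_delta. Qed.

Lemma cvg_coord (T : Type) (F : set_system T) {FF : Filter F}
    (f : T -> 'rV[R]_d) x i :
  f @ F --> x -> (fun t => f t ord0 i) @ F --> x ord0 i.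
Proof.
move=> fx; apply: (cvg_comp f (fun v : 'rV[R]_d => v ord0 i) fx).
exact: coord_continuous.
Qed.

Lemma cvg_dotp (T : Type) (F : set_system T) {FF : Filter F}
    (f g : T -> 'rV[R]_d) x y :
  f @ F --> x -> g @ F --> y -> (fun t => dotp (f t) (g t)) @ F --> dotp x y.
Proof.
move=> fx gy; apply: cvg_big => [|i _]; first exact: add_continuous.
by apply: cvgM; exact: cvg_coord.
Qed.

Lemma continuous_dotp y : continuous (fun x => dotp x y).
Proof.
move=> x; apply: (@cvg_dotp _ (nbhs x) _ id (fun=> y) x y).
  exact: cvg_id.
exact: cvg_cst.
Qed.

Lemma continuous_dotp_self : continuous (fun x => dotp x x).
Proof. by move=> x; apply: (@cvg_dotp _ (nbhs x) _ id id x x); exact: cvg_id. Qed.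

Lemma continuous_enorm : continuous (@enorm R d).
Proof.
move=> x; apply: (@continuous_comp _ _ _ (fun x => dotp x x) Num.sqrt).
  exact: continuous_dotp_self.
exact: sqrt_continuous.
Qed.

Lemma continuous_reflection a : continuous (reflection a).
Proof.
move=> x; apply: (@cvgB _ _ _ (nbhs x) _ id
  (fun x => (2 * dotp a x / dotp a a) *: a) x); first exact: cvg_id.
apply: (@cvgZl _ _ _ (nbhs x)); apply: (@cvgM _ _ (nbhs x)); last exact: cvg_cst.
apply: (@cvgM _ _ (nbhs x)); first exact: cvg_cst.
apply: (@cvg_dotp _ (nbhs x) _ (fun=> a) id a x); first exact: cvg_cst.
exact: cvg_id.
Qed.

Lemma compact_eball r : compact [set x : 'rV[R]_d | enorm x <= r].
Proof.
apply: bounded_closed_compact.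
  exists r; split; first exact: num_real.
  by move=> M rM x /= xr; rewrite (le_trans (normr_le_enorm x))// (le_trans xr)// ltW.
apply: (@closed_comp _ _ (@enorm R d) [set t | t <= r]); last exact: closed_le.
by move=> x _; exact: continuous_enorm.
Qed.

End euclidean_facts.

(** * Maximum principles along rays *)

Section analytic_facts.
Context {R : realType} {d : nat}.
Implicit Types (c : ('I_d -> nat) -> R) (x h u v rho : 'rV[R]_d).

Lemma homogeneous_partZ c n t h :
  homogeneous_part c n (t *: h) = t ^+ n * homogeneous_part c n h.
Proof.
rewrite /homogeneous_part mulr_sumr; apply: eq_bigr => al /eqP aln.
have -> : t ^+ n = \prod_i t ^+ al i by rewrite prodrXr aln.
rewrite mulrCA -big_split/=; congr (_ * _).
by apply: eq_bigr => i _; rewrite mxE exprMn.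
Qed.

(** A multi-index of weight one has a single entry 1, so its monomial is one coordinate and hence
    additive; this makes the degree-one part the candidate for the differential. *)
Lemma homogeneous_part1D c u v : homogeneous_part c 1 (u + v) =
  homogeneous_part c 1 u + homogeneous_part c 1 v.
Proof.
rewrite /homogeneous_part -big_split/=; apply: eq_bigr => al /eqP al1.
rewrite -mulrDr; congr (_ * _).
have [j aj] : exists j, nat_of_ord (al j) != 0%N.
  case: (pickP (fun j => nat_of_ord (al j) != 0%N)) => [j aj|al0].
    by exists j.
  by move: al1; rewrite big1// => i _; apply/eqP; have := al0 i => /negbFE.
have aj1 : al j = 1%N :> nat.
  by apply/eqP; rewrite eqn_leq lt0n aj andbT -ltnS ltn_ord.
have al0 i : i != j -> al i = 0%N :> nat.
  move=> ij; move: al1; rewrite (bigD1 j)//= aj1 add1n => /eqP.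
  by rewrite eqSS sum_nat_eq0 => /forall_inP/(_ i ij)/eqP.
have prodE (w : 'rV[R]_d) : \prod_i w ord0 i ^+ al i = w ord0 j.
  by rewrite (bigD1 j)//= aj1 expr1 big1 ?mulr1// => i ij; rewrite al0.
by rewrite !prodE mxE.
Qed.

Lemma absolute_homogeneous_part_ge0 c n h : 0 <= absolute_homogeneous_part c n h.
Proof. exact: sumr_ge0. Qed.

(** Cauchy-type estimate: absolute convergence at one corner [rho] controls every point of the box
    scaled by t, with a gain t^n in degree n. The tail from degree two on is then of order t^2. *)
Lemma normr_homogeneous_part_le c (n : nat) h rho (t : R) : 0 <= t ->
  (forall i, `|h ord0 i| <= t * `|rho ord0 i|) ->
  `|homogeneous_part c n h| <= t ^+ n * absolute_homogeneous_part c n rho.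
Proof.
move=> t0 hrho; apply: (le_trans (ler_norm_sum _ _ _)).
rewrite /absolute_homogeneous_part mulr_sumr ler_sum// => al /eqP aln.
have -> : t ^+ n = \prod_i t ^+ al i by rewrite prodrXr aln.
rewrite [in leRHS]normrM mulrCA normrM ler_wpM2l//.
rewrite !normr_prod -big_split/=; apply: ler_prod => i _.
rewrite normr_ge0/= !normrX -exprMn lerXn2r ?nnegrE//.
by rewrite mulr_ge0.
Qed.

(** The linear map is the degree-one part of the series; the remainder is the tail from degree two
    on, bounded through the absolute series at the corner of a box. *)
Lemma real_analytic_expansion (g : 'rV[R]_d -> R) x : real_analytic g ->
  exists2 L : 'rV[R]_d -> R,
    (forall u v, L (u + v) = L u + L v) /\ (forall t u, L (t *: u) = t * L u) &
  exists2 M : R, 0 <= M & exists2 s : R, 0 < s & forall h, `|h| <= s ->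
    `|g (x + h) - g x - L h| <= M * `|h| ^+ 2.
Proof.
move=> /(_ x)[c [r r0 cvr]]; exists (homogeneous_part c 1).
  split; first exact: homogeneous_part1D.
  by move=> t u; rewrite homogeneous_partZ expr1.
(* Convergence is given on Euclidean balls, while the estimate needs the corner of a sup-norm box
   inside them. Adding 1 keeps [D] positive for every d, and halving r / D puts the corner strictly
   inside. *)
pose D : R := Num.sqrt d%:R + 1.
have D0 : 0 < D by rewrite ltr_wpDl// sqrtr_ge0.
pose s : R := r / D / 2; have s0 : 0 < s by rewrite !divr_gt0.
pose rho : 'rV[R]_d := const_mx s.
have small h : `|h| <= s -> enorm h < r.
  move=> hs; apply: (le_lt_trans (enorm_le_normr h)).
  have h1 : Num.sqrt d%:R * `|h| <= D * s.
    by rewrite ler_pM ?sqrtr_ge0// lerDl.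
  apply: (le_lt_trans h1); rewrite /s mulrA mulrCA divff ?gt_eqF// mulr1.
  by rewrite ltr_pdivrMr// ltr_pMr// ltr1n.
have rhos : `|rho| <= s.
  rewrite /Num.norm/= mx_normrE; apply/bigmax_leP; split; first exact: ltW.
  by move=> i _ /=; rewrite mxE gtr0_norm.
have [crho _] := cvr rho (small _ rhos).
pose A : R := limn (series (fun n => absolute_homogeneous_part c n rho)).
have ser_le n : series (fun n => absolute_homogeneous_part c n rho) n <= A.
  apply: nondecreasing_cvgn_le => //; apply: nondecreasing_series => i _ _.
  exact: absolute_homogeneous_part_ge0.
have A0 : 0 <= A by have := ser_le 0%N; rewrite /series/= big_geq.
have part0 h : homogeneous_part c 0 h = homogeneous_part c 0 0.
  by rewrite -(scale0r h) homogeneous_partZ expr0 mul1r.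
have gx : g x = homogeneous_part c 0 0.
  have h0 : `|0 : 'rV[R]_d| <= s by rewrite normr0 ltW.
  have [_] := cvr 0 (small _ h0); rewrite addr0 => /cvg_lim <-//.
  apply/cvg_lim => //; rewrite -cvg_shiftS/=.
  suff -> : (fun n => series (homogeneous_part c ^~ 0) n.+1) =
    cst (homogeneous_part c 0 0) by exact: cvg_cst.
  apply/funext => n; rewrite /series/= big_nat_recl//= big1 ?addr0//.
  move=> i _; rewrite -[X in homogeneous_part _ _ X](scale0r 0).
  by rewrite homogeneous_partZ exprS !mul0r.
exists (A / s ^+ 2); first by rewrite divr_ge0// exprn_ge0 ?ltW.
exists s => // h hs; rewrite gx -(part0 h).
pose t : R := `|h| / s; have t0 : 0 <= t by rewrite divr_ge0// ltW.
have t1 : t <= 1 by rewrite ler_pdivrMr// mul1r.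
have hle i : `|h ord0 i| <= t * `|rho ord0 i|.
  by rewrite mxE (gtr0_norm s0) divfK ?gt_eqF// normr_coord_le.
rewrite mulrAC -mulrA -expr_div_n -/t.
have [_ cg] := cvr h (small _ hs).
have cg2 : (fun n => `|series (homogeneous_part c ^~ h) n
    - homogeneous_part c 0 h - homogeneous_part c 1 h|) @ \oo -->
   `|g (x + h) - homogeneous_part c 0 h - homogeneous_part c 1 h|.
  apply: cvg_norm; apply: cvgB; last exact: cvg_cst.
  by apply: cvgB => //; exact: cvg_cst.
rewrite -(cvg_lim _ cg2)//; apply: limr_le; first by apply/cvg_ex; eexists; exact: cg2.
near=> m; have /subnKC : (2 <= m)%N by near: m; exists 2%N.
move: (m - 2)%N => n <-; rewrite !addSn add0n /series/= !big_nat_recl//=.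
rewrite (addrC (homogeneous_part c 0 h)) addrK.
rewrite (addrC (homogeneous_part c 1 h)) addrK.
apply: (le_trans (ler_norm_sum _ _ _)).
apply: (@le_trans _ _ (\sum_(0 <= i < n)
    t ^+ 2 * absolute_homogeneous_part c i.+2 rho)).
  apply: ler_sum => i _; apply: (le_trans (normr_homogeneous_part_le _ _ t0 hle)).
  apply: ler_wpM2r; first exact: absolute_homogeneous_part_ge0.
  by rewrite ler_wiXn2l.
rewrite -mulr_sumr mulrC ler_wpM2r ?exprn_ge0//.
apply: le_trans (ser_le n.+2); rewrite /series/= !big_nat_recl//=.
rewrite addrA lerDr addr_ge0//; exact: absolute_homogeneous_part_ge0.
Unshelve. all: by end_near. Qed.

Lemma real_analytic_continuous (g : 'rV[R]_d -> R) :
  real_analytic g -> continuous g.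
Proof.
move=> ga x; have [L [LD LZ] [M M0 [s s0 gM]]] := real_analytic_expansion x ga.
have L0 : L 0 = 0 by rewrite -(scale0r 0) LZ mul0r.
pose B : R := \sum_j `|L (basis_vec j)|.
have B0 : 0 <= B by apply: sumr_ge0.
have LB h : `|L h| <= B * `|h|.
  rewrite [in leLHS](row_sum_basis h) (big_morph L LD L0) /B mulr_suml.
  apply: (le_trans (ler_norm_sum _ _ _)); apply: ler_sum => j _.
  by rewrite LZ normrM mulrC ler_wpM2l// normr_coord_le.
apply/(@cvgrPdist_le _ _ _ (nbhs x)) => e e0.
pose t : R := Num.min s (e / (M * s + B + 1)).
have MB : 0 < M * s + B + 1 by rewrite ltr_wpDl// addr_ge0// mulr_ge0// ltW.
have t0 : 0 < t by rewrite lt_min s0 divr_gt0.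
near=> y; have : `|x - y| <= t by near: y; exact: cvgr_dist_le.
rewrite distrC le_min => /andP[ys yt].
have := gM _ ys; rewrite [x + _]addrC subrK => H.
rewrite distrC -(subrK (L (y - x)) (g y - g x)).
apply: (le_trans (ler_normD _ _)); apply: (le_trans (lerD H (LB _))).
have : `|y - x| * (M * s + B + 1) <= e by rewrite -ler_pdivlMr.
have : M * `|y - x| ^+ 2 <= M * s * `|y - x|.
  by rewrite -mulrA ler_wpM2l// expr2 ler_wpM2r.
have := normr_ge0 (y - x); nra.
Unshelve. all: by end_near. Qed.

(** [L] is produced explicitly because directional derivatives alone need not depend linearly on the
    direction. *)
Lemma real_analytic_is_derive (g : 'rV[R]_d -> R) x : real_analytic g ->
  exists2 L : 'rV[R]_d -> R,
    (forall u v, L (u + v) = L u + L v) /\ (forall t u, L (t *: u) = t * L u) &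
  forall v, is_derive x v g (L v).
Proof.
move=> ga; have [L [LD LZ] [M M0 [s s0 gM]]] := real_analytic_expansion x ga.
exists L => // v.
suff H : (fun h : R => h^-1 *: ((g \o shift x) (h *: v) - g x)) @ 0^' --> L v.
  by apply: DeriveDef; [apply/cvg_ex; exists (L v)|apply/cvg_lim].
apply/cvgrPdist_le => e e0.
pose t : R := Num.min (s / (`|v| + 1)) (e / (M * `|v| ^+ 2 + 1)).
have v1 : 0 < `|v| + 1 by rewrite ltr_wpDl.
have MB : 0 < M * `|v| ^+ 2 + 1 by rewrite ltr_wpDl// mulr_ge0// exprn_ge0.
have t0 : 0 < t by rewrite lt_min !divr_gt0.
near=> h; have h0 : h != 0 by near: h; exact: nbhs_dnbhs_neq.
have : `|h| <= t by near: h; apply: dnbhs0_le.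
rewrite le_min !ler_pdivlMr// => /andP[hs ht].
have hv : `|h *: v| <= s by rewrite normrZ (le_trans _ hs)// ler_wpM2l// lerDl.
have := gM _ hv; rewrite LZ [x + _]addrC normrZ => H.
rewrite -[L v](mulKf h0) -/(h^-1 *: (h * L v)) -scalerBr normrZ normfV.
rewrite ler_pdivrMl ?normr_gt0// distrC /= (le_trans H)//.
have : 0 <= `|h| by []. rewrite exprMn; nra.
Unshelve. all: by end_near. Qed.

(** The Dunkl equations prescribe derivatives along basis vectors only; analyticity turns them into
    derivatives along arbitrary directions, in particular along x itself. *)
Lemma is_derive_sum_basis (g : 'rV[R]_d -> R) x : real_analytic g ->
  forall v, is_derive x v g (\sum_j v ord0 j * 'D_(basis_vec j) g x).
Proof.
move=> ga; have [L [LD LZ] dL] := real_analytic_is_derive x ga => v.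
have L0 : L 0 = 0 by rewrite -(scale0r 0) LZ mul0r.
suff -> : \sum_j v ord0 j * 'D_(basis_vec j) g x = L v by [].
rewrite [in RHS](row_sum_basis v).
rewrite (big_morph L LD L0); apply: eq_bigr => j _.
by rewrite LZ; have [_ ->] := dL (basis_vec j).
Qed.

End analytic_facts.

(** * The ray equation with reflection terms *)

Section radial_equation.
Context {R : realType} {d : nat}.
Variables (Rp : {fset 'rV[R]_d}) (k : 'rV[R]_d -> R).
Hypothesis k_ge0 : forall a, a \in Rp -> 0 <= k a.
Implicit Types (x : 'rV[R]_d) (f u : 'rV[R]_d -> R).

(** The difference part of sum_j x_j D_j: the factor <a, x> cancels the denominator of each Dunkl
    quotient, so nothing singular is left on the hyperplanes. *)
Definition reflection_defect f x : R :=
  \sum_(a <- Rp) k a * (f x - f (reflection a x)).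

(** Left difference quotients at 1 are nonnegative. Only s <= 1 is compared because the maximiser
    over a closed ball may lie on its boundary, beyond which the ray leaves the ball. *)
Lemma derive_left_max_ge0 (v : R -> R) (D : R) : is_derive (1 : R) (1 : R) v D ->
  (forall s, 0 <= s <= 1 -> v s <= v 1) -> 0 <= D.
Proof.
move=> [dv Dv] vle; rewrite leNgt; apply/negP => D0.
have H : (fun h : R => h^-1 *: ((v \o shift 1) (h *: 1) - v 1)) @ 0^' --> D.
  by rewrite -Dv; exact: dv.
move/cvgrPdist_lt : H => /(_ (- D)); rewrite oppr_gt0 => /(_ D0).
rewrite near_withinE => /nbhs_ballP[e /= e0 He].
(* Small enough for the limit estimate, and at most 1 in size so that 1 + h stays in [0, 1]. *)
pose h : R := - Num.min (e / 2) 1.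
have h0 : h < 0 by rewrite oppr_lt0 lt_min divr_gt0/=.
have := He h; rewrite /ball/= sub0r normrN ltr0_norm// opprK.
have he : Num.min (e / 2) 1 < e.
  by rewrite gt_min; apply/orP; left; lra.
move=> /(_ he (ltr0_neq0 h0)).
have : 0 <= h^-1 *: (v (h *: 1 + 1) - v 1).
  rewrite /GRing.scale/= mulr_le0// ?invr_le0 ?(ltW h0)// subr_le0.
  apply: vle; rewrite /h /GRing.scale/= mulr1.
  have : 0 < Num.min (e / 2) 1 <= 1.
    by rewrite lt_min divr_gt0//= ltr01 ge_min lexx orbT.
  lra.
move: (h^-1 *: _) => q q0; rewrite ltr_norml => /andP[]; lra.
Qed.

(** [f1] and [f2] are the two parts of a complex f with ray derivative i al f + b minus the defect.
    At a maximiser z of |f| - (c + e)|x|, project f on the direction of f(z): the rotation i al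
    contributes nothing, the defect has the good sign because reflections preserve ball and norm,
    and the source is at most c|z|. The ray derivative is then at most -e|z| < 0, against
    maximality. *)
Lemma radial_max_principle (f1 f2 al b1 b2 : 'rV[R]_d -> R) (c : R) : 0 <= c ->
  continuous f1 -> continuous f2 ->
  (forall x, is_derive (1 : R) (1 : R) (fun s => f1 (s *: x))
     (- al x * f2 x + b1 x - reflection_defect f1 x)) ->
  (forall x, is_derive (1 : R) (1 : R) (fun s => f2 (s *: x))
     (al x * f1 x + b2 x - reflection_defect f2 x)) ->
  (forall x w1 w2, w1 ^+ 2 + w2 ^+ 2 = 1 -> w1 * b1 x + w2 * b2 x <= c * enorm x) ->
  forall x, Num.sqrt (f1 x ^+ 2 + f2 x ^+ 2) <=
            Num.sqrt (f1 0 ^+ 2 + f2 0 ^+ 2) + c * enorm x.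
Proof.
move=> c0 cf1 cf2 df1 df2 bc x.
pose m y := Num.sqrt (f1 y ^+ 2 + f2 y ^+ 2); rewrite -/(m x) -/(m 0).
have m0 y : 0 <= m y by exact: sqrtr_ge0.
have mE y : m y ^+ 2 = f1 y ^+ 2 + f2 y ^+ 2.
  by rewrite sqr_sqrtr// addr_ge0// sqr_ge0.
have wle y w1 w2 : w1 ^+ 2 + w2 ^+ 2 = 1 -> w1 * f1 y + w2 * f2 y <= m y.
  move=> w; rewrite (le_trans (ler_norm _))// -ler_sqr ?nnegrE//.
  rewrite real_normK ?num_real// mE.
  have := sqr_ge0 (w1 * f2 y - w2 * f1 y); nra.
have cm : continuous m.
  move=> y; apply: (@continuous_comp _ _ _ (fun y => f1 y ^+ 2 + f2 y ^+ 2) Num.sqrt).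
    apply: (@cvgD _ _ _ (nbhs y)); apply: (@cvgM _ _ (nbhs y));
      by [exact: cf1|exact: cf2].
  exact: sqrt_continuous.
(* The slack e makes the final inequality strict; it is removed right here, scaled by |x| + 1. *)
suff H (e : R) : 0 < e -> m x <= m 0 + (c + e) * enorm x.
  apply/ler_addgt0Pr => e e0.
  have e1 : 0 < e / (enorm x + 1) by rewrite divr_gt0// ltr_wpDl// enorm_ge0.
  apply: (le_trans (H _ e1)); rewrite -addrA lerD2l mulrDl lerD2l.
  rewrite mulrAC ler_pdivrMr ?ltr_wpDl ?enorm_ge0//.
  by rewrite ler_wpM2l ?(ltW e0)// lerDl.
move=> e0; pose Phi y := m y - (c + e) * enorm y.
have cPhi : continuous Phi.
  move=> y; apply: (@cvgB _ _ _ (nbhs y)); first exact: cm.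
  by apply: (@cvgM _ _ (nbhs y)); [exact: cvg_cst|exact: continuous_enorm].
have [] := @EVT_max_rV _ _ Phi [set y | enorm y <= enorm x].
- by exists x => /=.
- exact: compact_eball.
- exact: continuous_subspaceT.
move=> z; rewrite inE/= => zx Phimax.
have Phix : m x - (c + e) * enorm x <= m z - (c + e) * enorm z.
  by apply: Phimax; rewrite inE/=.
have cez : 0 <= (c + e) * enorm z by rewrite mulr_ge0 ?enorm_ge0// addr_ge0// ltW.
have [mz0|mz0] := eqVneq (m z) 0; first by have := m0 0; lra.
have [z0|z0] := eqVneq z 0; first by move: Phix; rewrite z0 enorm0; lra.
have mz : 0 < m z by rewrite lt_neqAle eq_sym mz0 m0.
exfalso.
(* Fixing this unit vector replaces the modulus, which need not be differentiable, by a linear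
   functional of f that lies below it and agrees with it at z. *)
pose w1 := f1 z / m z; pose w2 := f2 z / m z.
have w : w1 ^+ 2 + w2 ^+ 2 = 1.
  by rewrite /w1 /w2 !expr_div_n -mulrDl -mE divff// expf_neq0.
have wz : w1 * f1 z + w2 * f2 z = m z.
  by rewrite /w1 /w2 !(mulrAC _ (m z)^-1) -mulrDl -!expr2 -mE expr2 mulfK.
have wz' : w1 * f2 z = w2 * f1 z by rewrite /w1 /w2; ring.
pose v s := w1 * f1 (s *: z) + w2 * f2 (s *: z) - (c + e) * enorm z * s.
have dv : is_derive (1 : R) (1 : R) v
    (w1 * (- al z * f2 z + b1 z - reflection_defect f1 z) +
     w2 * (al z * f1 z + b2 z - reflection_defect f2 z) - (c + e) * enorm z).
  have h1 := df1 z; have h2 := df2 z.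
  exact: (is_derive_sub (is_derive_add (is_derive_mulc w1 h1)
    (is_derive_mulc w2 h2)) (is_derive_linear _ _)).
have vle s : 0 <= s <= 1 -> v s <= v 1.
  move=> /andP[s0 s1]; rewrite /v scale1r wz mulr1.
  have sz : enorm (s *: z) = s * enorm z by rewrite enormZ ger0_norm.
  have : m (s *: z) - (c + e) * enorm (s *: z) <= m z - (c + e) * enorm z.
    apply: Phimax; rewrite inE/= sz (le_trans _ zx)//.
    by rewrite ler_piMl ?enorm_ge0.
  rewrite sz; have := wle (s *: z) _ _ w; clear; lra.
have := derive_left_max_ge0 dv vle; apply/negP; rewrite -ltNge.
have defE : w1 * reflection_defect f1 z + w2 * reflection_defect f2 z >= 0.
  rewrite /reflection_defect !mulr_sumr -big_split/= big_seq sumr_ge0// => a aR.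
  rewrite mulrCA [X in _ + X]mulrCA -mulrDr mulr_ge0 ?k_ge0//.
  have : m (reflection a z) - (c + e) * enorm (reflection a z) <=
         m z - (c + e) * enorm z.
    by apply: Phimax; rewrite inE/= enorm_reflection.
  by rewrite enorm_reflection; have := wle (reflection a z) _ _ w; lra.
have := bc z _ _ w.
have : 0 < e * enorm z by rewrite mulr_gt0// enorm_gt0.
have : w1 * (al z * f2 z) = w2 * (al z * f1 z) by rewrite mulrCA wz' mulrCA.
move: defE; rewrite !(mulrDr, mulrBr) mulNr mulrN mulrDl; clear; lra.
Qed.

(** Multiplying by exp(-c'|x|) with c' = c + 1 shifts the multiplier m to m - c'|x| <= -|x|. At a
    negative minimum z of the product the multiplier term is then strictly positive and the defect
    nonpositive, so the product would strictly increase along the ray up to z, against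
    minimality. *)
Lemma radial_min_principle (u m : 'rV[R]_d -> R) (c : R) : continuous u ->
  (forall x, is_derive (1 : R) (1 : R) (fun s => u (s *: x))
     (m x * u x - reflection_defect u x)) ->
  (forall x, m x <= c * enorm x) -> 0 <= u 0 -> forall x, 0 <= u x.
Proof.
move=> cu du mc u0 x; rewrite leNgt; apply/negP => ux.
pose c' := c + 1.
pose Phi y := - (u y * expR (- (c' * enorm y))).
have cPhi : continuous Phi.
  move=> y; apply: (@cvgN _ _ _ (nbhs y)); apply: (@cvgM _ _ (nbhs y)); first exact: cu.
  apply: (@continuous_comp _ _ _ (fun y => - (c' * enorm y)) expR).
    apply: (@cvgN _ _ _ (nbhs y)); apply: (@cvgM _ _ (nbhs y)); first exact: cvg_cst.
    exact: continuous_enorm.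
  exact: continuous_expR.
have [] := @EVT_max_rV _ _ Phi [set y | enorm y <= enorm x].
- by exists x => /=.
- exact: compact_eball.
- exact: continuous_subspaceT.
move=> z; rewrite inE/= => zx Phimax.
have uz : u z < 0.
  have : Phi x <= Phi z by apply: Phimax; rewrite inE/=.
  rewrite /Phi lerN2 => H.
  have : u x * expR (- (c' * enorm x)) < 0 by rewrite pmulr_llt0// expR_gt0.
  by move=> /(le_lt_trans H); rewrite pmulr_llt0// expR_gt0.
have z0 : z != 0 by apply/eqP => z0; move: uz; rewrite z0; lra.
pose v s := - (u (s *: z) * expR (- (c' * enorm z * s))).
have dv : is_derive (1 : R) (1 : R) v (- ((m z * u z - reflection_defect u z) -
    c' * enorm z * u z) * expR (- (c' * enorm z))).
  have h1 := du z.
  have h2 : is_derive (1 : R) (1 : R) (fun s => expR (- (c' * enorm z * s)))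
      (expR (- (c' * enorm z * 1)) * - (c' * enorm z)).
    by apply: is_derive_exp; apply: is_derive_opp; exact: is_derive_linear.
  apply: (is_derive_eq (is_derive_opp (is_derive_mul h1 h2))).
  by rewrite /= mulr1 scale1r; ring.
have vle s : 0 <= s <= 1 -> v s <= v 1.
  move=> /andP[s0 s1]; rewrite /v scale1r mulr1.
  have sz : enorm (s *: z) = s * enorm z by rewrite enormZ ger0_norm.
  have : Phi (s *: z) <= Phi z.
    apply: Phimax; rewrite inE/= sz (le_trans _ zx)//.
    by rewrite ler_piMl ?enorm_ge0.
  by rewrite /Phi sz -[c' * enorm z * s]mulrA (mulrC s).
have := derive_left_max_ge0 dv vle; apply/negP; rewrite -ltNge.
rewrite pmulr_llt0 ?expR_gt0// oppr_lt0.
have def0 : reflection_defect u z <= 0.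
  rewrite /reflection_defect big_seq sumr_le0// => a aR.
  rewrite mulr_ge0_le0 ?k_ge0// subr_le0.
  have : Phi (reflection a z) <= Phi z.
    by apply: Phimax; rewrite inE/= enorm_reflection.
  by rewrite /Phi enorm_reflection lerN2 ler_pM2r ?expR_gt0.
have := mc z.
have : 0 < enorm z by rewrite enorm_gt0.
rewrite /c'; nra.
Qed.

End radial_equation.

(** * The Dunkl kernel *)

Section root_system_facts.
Context {R : realType} {d : nat}.
Variables (Rs Rp : {fset 'rV[R]_d}) (k : 'rV[R]_d -> R).
Hypotheses (hRs : root_system Rs) (hRp : positive_subsystem Rs Rp)
  (hk : multiplicity Rs k).
Implicit Types (a b x : 'rV[R]_d).

Lemma root_neq0 a : a \in Rs -> a != 0.
Proof. by case: hRs => h _ _; exact: h. Qed.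

Lemma positive_root a : a \in Rp -> a \in Rs.
Proof. by case: hRp => u _ h /h[]. Qed.

Lemma rootN a : a \in Rs -> - a \in Rs.
Proof. by case: hRs => _ _ h aR; have /(h _ aR)[] : - a = a \/ - a = - a by right. Qed.

Lemma root_reflection a b : a \in Rs -> b \in Rs -> reflection a b \in Rs.
Proof.
case: hRs => _ h _ aR bR; rewrite -(h a aR).
by apply/imfsetP; exists b.
Qed.

Lemma multiplicity_reflection a b : a \in Rs -> b \in Rs ->
  k (reflection a b) = k b.
Proof.
case: hk => _ h aR bR; apply: (h (reflection a \o id)) => //.
by apply: reflection_group_comp => //; exact: reflection_group_id.
Qed.

Lemma multiplicityN a : a \in Rs -> k (- a) = k a.
Proof. by move=> aR; rewrite -reflection_self multiplicity_reflection. Qed.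

Lemma multiplicity_ge0 a : a \in Rp -> 0 <= k a.
Proof. by case: hk => h _ /positive_root/h. Qed.

Lemma positive_root_neq0 a : a \in Rp -> a != 0.
Proof. by move=> /positive_root/root_neq0. Qed.

Lemma perm_roots_positive : perm_eq Rs (Rp ++ [seq - a | a <- Rp]).
Proof.
case: hRp => u u0 hu; apply: uniq_perm.
- exact: fset_uniq.
- rewrite cat_uniq fset_uniq (map_inj_uniq oppr_inj) fset_uniq andbT /=.
  apply/hasPn => _ /mapP[a /hu[_ ua] ->]; apply/negP => /hu[_].
  by rewrite dotpNl oppr_gt0 ltNge (ltW ua).
- move=> a; rewrite mem_cat; apply/idP/orP => [aR|[/hu[]//|/mapP[b bR ->]]].
    have := u0 a aR; rewrite neq_lt => /orP[ua|ua]; last by left; apply/hu.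
    right; apply/mapP; exists (- a); last by rewrite opprK.
    by apply/hu; rewrite rootN// dotpNl oppr_gt0.
  exact/rootN/positive_root.
Qed.

Lemma perm_roots_reflection a : a \in Rs ->
  perm_eq Rs [seq reflection a b | b <- Rs].
Proof.
move=> aR; have inj := can_inj (reflectionK a).
apply: uniq_perm; rewrite ?(map_inj_uniq inj) ?fset_uniq// => b.
apply/idP/mapP => [bR|[c cR ->]]; last exact: root_reflection.
by exists (reflection a b); rewrite ?reflectionK// root_reflection.
Qed.

(** A reflection permutes [Rs] but in general not [Rp]. Splitting [Rs] into [Rp] and its negative
    shows that, for even [F], the total over [Rs] is that over [Rp] taken twice, which carries
    invariance over to sums and products indexed by [Rp]. *)
Lemma big_positive_roots (I : Type) (idx : I) (op : Monoid.com_law idx)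
    (F : 'rV[R]_d -> I) : (forall a, a \in Rs -> F (- a) = F a) ->
  \big[op/idx]_(a <- Rs) F a =
  op (\big[op/idx]_(a <- Rp) F a) (\big[op/idx]_(a <- Rp) F a).
Proof.
move=> FN; rewrite (perm_big _ perm_roots_positive) big_cat/= big_map.
by congr (op _ _); apply: eq_big_seq => a /positive_root /FN.
Qed.

Lemma big_roots_reflection (I : Type) (idx : I) (op : Monoid.com_law idx)
    (F : 'rV[R]_d -> I) a : a \in Rs ->
  \big[op/idx]_(b <- Rs) F (reflection a b) = \big[op/idx]_(b <- Rs) F b.
Proof.
by move=> aR; rewrite [RHS](perm_big _ (perm_roots_reflection aR))/= big_map.
Qed.

Lemma sum_positive_roots_reflection (F : 'rV[R]_d -> R) a : a \in Rs ->
  (forall b, b \in Rs -> F (- b) = F b) ->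
  \sum_(b <- Rp) F (reflection a b) = \sum_(b <- Rp) F b.
Proof.
move=> aR FN; have FaN b : b \in Rs -> F (reflection a (- b)) = F (reflection a b).
  by move=> bR; rewrite -scaleN1r reflectionZ scaleN1r FN// root_reflection.
have := big_roots_reflection +%R F aR.
rewrite (big_positive_roots +%R FN) (big_positive_roots +%R FaN)/= -!mulr2n.
by rewrite !mulr2n; lra.
Qed.

(** The doubling argument yields equality of squares, and nonnegativity of [F] selects the root. *)
Lemma prod_positive_roots_reflection (F : 'rV[R]_d -> R) a : a \in Rs ->
  (forall b, 0 <= F b) -> (forall b, b \in Rs -> F (- b) = F b) ->
  \prod_(b <- Rp) F (reflection a b) = \prod_(b <- Rp) F b.
Proof.
move=> aR F0 FN.
have FaN b : b \in Rs -> F (reflection a (- b)) = F (reflection a b).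
  by move=> bR; rewrite -scaleN1r reflectionZ scaleN1r FN// root_reflection.
have := big_roots_reflection *%R F aR.
rewrite (big_positive_roots *%R FN) (big_positive_roots *%R FaN)/= -!expr2.
by move/eqP; rewrite eqrXn2// ?prodr_ge0// => /eqP.
Qed.

(** Reflecting a root conjugates its reflection and leaves k unchanged, so the two sums differ by a
    reindexing of the roots. *)
Lemma reflection_defect_reflection (f : 'rV[R]_d -> R) a x : a \in Rs ->
  reflection_defect Rp k (fun y => f (reflection a y)) x =
  reflection_defect Rp k f (reflection a x).
Proof.
move=> aR; rewrite /reflection_defect.
rewrite -(sum_positive_roots_reflection (F := fun b =>
  k b * (f (reflection a x) - f (reflection b (reflection a x)))) aR); last first.
  by move=> b bR; rewrite multiplicityN// reflectionNl.
apply: eq_big_seq => b /positive_root bR.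
by rewrite multiplicity_reflection// reflection_conj.
Qed.

End root_system_facts.

(** * Dunkl operators in real and imaginary parts *)

Section real_dunkl_quotient.
Context {R : realType} {d : nat}.
Variables (Rp : {fset 'rV[R]_d}) (k : 'rV[R]_d -> R).
Implicit Types (a b x y xi : 'rV[R]_d).

(** Real counterpart of [dunkl_quotient]: the coefficients being real, Dunkl operators act on real
    and imaginary parts separately. *)
Definition real_dunkl_quotient a (f : 'rV[R]_d -> R) x : R :=
  if dotp a x == 0 then 2 / dotp a a * 'D_a f x
  else (f x - f (reflection a x)) / dotp a x.

Lemma Re_realM (r : R) (z : R[i]) : complex.Re (r%:C%C * z) = r * complex.Re z.
Proof. by case: z => u v /=; rewrite mul0r subr0. Qed.

Lemma Im_realM (r : R) (z : R[i]) : complex.Im (r%:C%C * z) = r * complex.Im z.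
Proof. by case: z => u v /=; rewrite mul0r addr0. Qed.

Lemma Re_real_div (r : R) (z : R[i]) :
  complex.Re (z / r%:C%C) = complex.Re z / r.
Proof. by rewrite mulrC -(fmorphV (real_complex R)) Re_realM mulrC. Qed.

Lemma Im_real_div (r : R) (z : R[i]) :
  complex.Im (z / r%:C%C) = complex.Im z / r.
Proof. by rewrite mulrC -(fmorphV (real_complex R)) Im_realM mulrC. Qed.

Lemma Re_dunkl_op j (f : 'rV[R]_d -> R[i]) x :
  complex.Re (dunkl_op Rp k j f x) =
  'D_(basis_vec j) (fun z => complex.Re (f z)) x + \sum_(a <- Rp)
     k a * dotp a (basis_vec j) *
     real_dunkl_quotient a (fun z => complex.Re (f z)) x.
Proof.
rewrite /dunkl_op.
rewrite (_ : complex.Re (_ + _) = complex.Re (cderive (basis_vec j) f x) +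
  complex.Re (\sum_(a <- Rp) (k a * dotp a (basis_vec j))%:C%C *
    dunkl_quotient a f x)); last by case: (\sum_(_ <- _) _) (cderive _ _ _) => ? ? [].
congr (_ + _).
rewrite (big_morph (@complex.Re R) (id1 := 0) (op1 := +%R))//; last by move=> [? ?] [].
apply: eq_bigr => a _; rewrite Re_realM; congr (_ * _).
rewrite /dunkl_quotient /real_dunkl_quotient; case: ifP => _.
  by rewrite Re_realM.
by rewrite Re_real_div; move: (f x) (f (reflection a x)) => [? ?] [? ?].
Qed.

Lemma Im_dunkl_op j (f : 'rV[R]_d -> R[i]) x :
  complex.Im (dunkl_op Rp k j f x) =
  'D_(basis_vec j) (fun z => complex.Im (f z)) x + \sum_(a <- Rp)
     k a * dotp a (basis_vec j) *
     real_dunkl_quotient a (fun z => complex.Im (f z)) x.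
Proof.
rewrite /dunkl_op.
rewrite (_ : complex.Im (_ + _) = complex.Im (cderive (basis_vec j) f x) +
  complex.Im (\sum_(a <- Rp) (k a * dotp a (basis_vec j))%:C%C *
    dunkl_quotient a f x)); last by case: (\sum_(_ <- _) _) (cderive _ _ _) => ? ? [].
congr (_ + _).
rewrite (big_morph (@complex.Im R) (id1 := 0) (op1 := +%R))//; last by move=> [? ?] [].
apply: eq_bigr => a _; rewrite Im_realM; congr (_ * _).
rewrite /dunkl_quotient /real_dunkl_quotient; case: ifP => _.
  by rewrite Im_realM.
by rewrite Im_real_div; move: (f x) (f (reflection a x)) => [? ?] [? ?].
Qed.

Lemma is_derive_line (f : 'rV[R]_d -> R) x v (t D : R) :
  is_derive (t *: v + x) v f D ->
  is_derive t (1 : R) (fun s => f (s *: v + x)) D.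
Proof.
move=> [df Df].
have E : (fun h : R => h^-1 *: (((fun s => f (s *: v + x)) \o shift t) (h *: 1) -
     f (t *: v + x))) =
   (fun h : R => h^-1 *: ((f \o shift (t *: v + x)) (h *: v) - f (t *: v + x))).
  apply/funext => h /=; congr (_ *: (f _ - _)).
  by rewrite (_ : h *: (1 : R) = h) ?[LHS]mulr1// scalerDl addrA.
by apply: DeriveDef; rewrite /derivable /derive /= E.
Qed.

Lemma is_derive_ray (f : 'rV[R]_d -> R) x (D : R) :
  is_derive x x f D -> is_derive (1 : R) (1 : R) (fun s => f (s *: x)) D.
Proof.
move=> df; rewrite (_ : (fun s => _) = (fun s : R => f (s *: x + 0))); last first.
  by apply/funext => s; rewrite addr0.
by apply: is_derive_line; rewrite scale1r addr0.
Qed.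

Lemma reflection_id a x : dotp a x = 0 -> reflection a x = x.
Proof. by move=> ax; rewrite /reflection ax mulr0 mul0r scale0r subr0. Qed.

(** On a hyperplane both summands vanish for different reasons: one through the factor <a, x>, the
    other because the reflection fixes x. The value chosen there for the quotient thus does not
    matter along rays. *)
Lemma sum_radial_quotient (f : 'rV[R]_d -> R) x :
  \sum_(a <- Rp) k a * dotp a x * real_dunkl_quotient a f x =
  reflection_defect Rp k f x.
Proof.
apply: eq_bigr => a _; rewrite -mulrA; congr (_ * _); rewrite /real_dunkl_quotient.
case: eqVneq => [ax|ax]; first by rewrite ax mul0r reflection_id// subrr.
by rewrite mulrC divfK.
Qed.

End real_dunkl_quotient.

Lemma lipschitz_continuous_rV {R : realType} {d : nat} (f : 'rV[R]_d -> R) (c : R) :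
  (forall x x', `|f x - f x'| <= c * enorm (x - x')) -> continuous f.
Proof.
move=> fc x; apply/(@cvgrPdist_le _ _ _ (nbhs x)) => e e0.
have H : (fun y => c * enorm (x - y)) @ x --> (0 : R).
  rewrite [X in _ --> X](_ : 0 = c * enorm (x - x)); last by rewrite subrr enorm0 mulr0.
  apply: (@cvgM _ _ (nbhs x)); first exact: cvg_cst.
  apply: (@cvg_comp _ _ _ (fun y => x - y) (@enorm R d) (nbhs x) (nbhs (x - x))).
    by apply: (@cvgB _ _ _ (nbhs x)); [exact: cvg_cst|exact: cvg_id].
  exact: continuous_enorm.
move/(@cvgrPdist_le _ _ _ (nbhs x)) : H => /(_ e e0).
apply: filterS => y; rewrite sub0r normrN => /(le_trans (ler_norm _)).
exact: le_trans (fc x y).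
Qed.

Section radial_uniqueness.
Context {R : realType} {d : nat}.
Variables (Rp : {fset 'rV[R]_d}) (k : 'rV[R]_d -> R).
Hypothesis k_ge0 : forall a, a \in Rp -> 0 <= k a.
Implicit Types (x : 'rV[R]_d) (f g : 'rV[R]_d -> R).

Lemma reflection_defectB f g x :
  reflection_defect Rp k (fun y => f y - g y) x =
  reflection_defect Rp k f x - reflection_defect Rp k g x.
Proof.
rewrite /reflection_defect -sumrB; apply: eq_bigr => a _.
by rewrite -mulrBr; congr (_ * _); ring.
Qed.

(** The maximum principle without source, applied to the difference of the two solutions, which
    vanishes at the origin. *)
Lemma radial_unique (f1 f2 g1 g2 al : 'rV[R]_d -> R) :
  continuous f1 -> continuous f2 -> continuous g1 -> continuous g2 ->
  (forall x, is_derive (1 : R) (1 : R) (fun s => f1 (s *: x))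
     (- al x * f2 x - reflection_defect Rp k f1 x)) ->
  (forall x, is_derive (1 : R) (1 : R) (fun s => f2 (s *: x))
     (al x * f1 x - reflection_defect Rp k f2 x)) ->
  (forall x, is_derive (1 : R) (1 : R) (fun s => g1 (s *: x))
     (- al x * g2 x - reflection_defect Rp k g1 x)) ->
  (forall x, is_derive (1 : R) (1 : R) (fun s => g2 (s *: x))
     (al x * g1 x - reflection_defect Rp k g2 x)) ->
  f1 0 = g1 0 -> f2 0 = g2 0 -> forall x, f1 x = g1 x /\ f2 x = g2 x.
Proof.
move=> cf1 cf2 cg1 cg2 df1 df2 dg1 dg2 e1 e2 x.
have cB (u v : 'rV[R]_d -> R) : continuous u -> continuous v ->
    continuous (fun y => u y - v y).
  by move=> cu cv y; apply: (@cvgB _ _ _ (nbhs y)); [exact: cu|exact: cv].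
have := radial_max_principle (al := al) (b1 := fun=> 0) (b2 := fun=> 0) k_ge0
  (lexx 0) (cB _ _ cf1 cg1) (cB _ _ cf2 cg2).
have H1 y : is_derive (1 : R) (1 : R) (fun s => f1 (s *: y) - g1 (s *: y))
    (- al y * (f2 y - g2 y) + 0 - reflection_defect Rp k (fun z => f1 z - g1 z) y).
  apply: (is_derive_eq (is_derive_sub (df1 y) (dg1 y))).
  by rewrite reflection_defectB; ring.
have H2 y : is_derive (1 : R) (1 : R) (fun s => f2 (s *: y) - g2 (s *: y))
    (al y * (f1 y - g1 y) + 0 - reflection_defect Rp k (fun z => f2 z - g2 z) y).
  apply: (is_derive_eq (is_derive_sub (df2 y) (dg2 y))).
  by rewrite reflection_defectB; ring.
move=> /(_ H1 H2) H.
have K : forall (y : 'rV[R]_d) (w1 w2 : R), w1 ^+ 2 + w2 ^+ 2 = 1 ->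
    w1 * 0 + w2 * 0 <= 0 * enorm y by move=> *; rewrite !mulr0 mul0r addr0.
move: (H K x); rewrite e1 e2 !subrr mul0r expr0n/= !addr0 sqrtr0 => H0.
have : (f1 x - g1 x) ^+ 2 + (f2 x - g2 x) ^+ 2 <= 0.
  by rewrite -sqrtr_eq0 eq_le H0 sqrtr_ge0.
have := sqr_ge0 (f1 x - g1 x); have := sqr_ge0 (f2 x - g2 x) => h1 h2 h3.
have /eqP : (f1 x - g1 x) ^+ 2 = 0 by lra.
have /eqP : (f2 x - g2 x) ^+ 2 = 0 by lra.
by rewrite !sqrf_eq0 !subr_eq0 => /eqP -> /eqP ->.
Qed.

End radial_uniqueness.

(** * Bounds and symmetries of the kernel *)

Section dunkl_kernel.
Context {R : realType} {d : nat}.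
Variables (Rs Rp : {fset 'rV[R]_d}) (k : 'rV[R]_d -> R).
Hypotheses (hRs : root_system Rs) (hRp : positive_subsystem Rs Rp)
  (hk : multiplicity Rs k).
Variable e : 'rV[R]_d -> 'rV[R]_d -> R[i].
Hypothesis he : is_dunkl_kernel Rp k e.
Implicit Types (a x y xi : 'rV[R]_d).

Definition ker_cos x y : R := complex.Re (e x y).
Definition ker_sin x y : R := complex.Im (e x y).
Local Notation C := ker_cos.
Local Notation S := ker_sin.
Local Notation defect := (reflection_defect Rp k).

Let k_ge0 a : a \in Rp -> 0 <= k a.
Proof. exact: multiplicity_ge0 hRp hk a. Qed.

(** Real part of the defining equations contracted with xi, solved for the ordinary derivative. *)
Lemma is_derive_ker_cos x xi y : is_derive x xi (C^~ y) (- dotp xi y * S x y -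
  \sum_(a <- Rp) k a * dotp a xi * real_dunkl_quotient a (C^~ y) x).
Proof.
have [[aC _] eqD _] := he y.
apply: (is_derive_eq (is_derive_sum_basis x aC xi)).
have E j : 'D_(basis_vec j) (C^~ y) x = - y ord0 j * S x y -
    \sum_(a <- Rp) k a * dotp a (basis_vec j) * real_dunkl_quotient a (C^~ y) x.
  have h := congr1 (@complex.Re R) (eqD j x); rewrite Re_dunkl_op in h.
  have h2 : complex.Re ('i%C * (y ord0 j)%:C%C * e x y) = - y ord0 j * S x y.
    by rewrite /ker_sin; case: (e x y) => u v /=; ring.
  by rewrite -h2 -h addrK.
under eq_bigr do rewrite E mulrBr.
rewrite sumrB; congr (_ - _).
  by rewrite /dotp mulNr mulr_suml -sumrN; apply: eq_bigr => j _; ring.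
under eq_bigr do rewrite mulr_sumr.
rewrite exchange_big/=; apply: eq_bigr => a _.
rewrite {2}/dotp mulr_sumr mulr_suml; apply: eq_bigr => j _.
by rewrite dotp_basis_vec; ring.
Qed.

Lemma is_derive_ker_sin x xi y : is_derive x xi (S^~ y) (dotp xi y * C x y -
  \sum_(a <- Rp) k a * dotp a xi * real_dunkl_quotient a (S^~ y) x).
Proof.
have [[_ aS] eqD _] := he y.
apply: (is_derive_eq (is_derive_sum_basis x aS xi)).
have E j : 'D_(basis_vec j) (S^~ y) x = y ord0 j * C x y -
    \sum_(a <- Rp) k a * dotp a (basis_vec j) * real_dunkl_quotient a (S^~ y) x.
  have h := congr1 (@complex.Im R) (eqD j x); rewrite Im_dunkl_op in h.
  have h2 : complex.Im ('i%C * (y ord0 j)%:C%C * e x y) = y ord0 j * C x y.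
    by rewrite /ker_cos; case: (e x y) => u v /=; ring.
  by rewrite -h2 -h addrK.
under eq_bigr do rewrite E mulrBr.
rewrite sumrB; congr (_ - _).
  by rewrite /dotp mulr_suml; apply: eq_bigr => j _; ring.
under eq_bigr do rewrite mulr_sumr.
rewrite exchange_big/=; apply: eq_bigr => a _.
rewrite {2}/dotp mulr_sumr mulr_suml; apply: eq_bigr => j _.
by rewrite dotp_basis_vec; ring.
Qed.

Lemma continuous_ker_cos y : continuous (C^~ y).
Proof. by apply: real_analytic_continuous; have [[]] := he y. Qed.

Lemma continuous_ker_sin y : continuous (S^~ y).
Proof. by apply: real_analytic_continuous; have [[]] := he y. Qed.

Lemma ker_cos0l y : C 0 y = 1.
Proof. by rewrite /C; have [_ _ ->] := he y. Qed.

Lemma ker_sin0l y : S 0 y = 0.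
Proof. by rewrite /S; have [_ _ ->] := he y. Qed.

Lemma radial_ker_cos x y : is_derive (1 : R) (1 : R) (fun s => C (s *: x) y)
  (- dotp x y * S x y - defect (C^~ y) x).
Proof.
rewrite -sum_radial_quotient.
exact: (is_derive_ray (f := C^~ y)) (is_derive_ker_cos x x y).
Qed.

Lemma radial_ker_sin x y : is_derive (1 : R) (1 : R) (fun s => S (s *: x) y)
  (dotp x y * C x y - defect (S^~ y) x).
Proof.
rewrite -sum_radial_quotient.
exact: (is_derive_ray (f := S^~ y)) (is_derive_ker_sin x x y).
Qed.

(** As functions of x both sides solve the ray equation with multiplier i <x, s y>, and both kernels
    equal 1 at x = 0. *)
Lemma ker_scale s x y :
  C (s *: x) y = C x (s *: y) /\ S (s *: x) y = S x (s *: y).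
Proof.
have cont (f : 'rV[R]_d -> R) : continuous f -> continuous (fun z : 'rV[R]_d => f (s *: z)).
  move=> cf z; apply: (@cvg_comp _ _ _ (fun z => s *: z) f (nbhs z) (nbhs (s *: z)));
    last exact: cf.
  exact: scaler_continuous.
have defectZ (f : 'rV[R]_d -> R) z : defect (fun z => f (s *: z)) z = defect f (s *: z).
  by apply: eq_bigr => a _; rewrite reflectionZ.
apply: (radial_unique k_ge0 (f1 := fun z => C (s *: z) y)
  (f2 := fun z => S (s *: z) y) (g1 := C^~ (s *: y)) (g2 := S^~ (s *: y))
  (al := fun z => dotp z (s *: y))).
- exact: (cont (C^~ y) (@continuous_ker_cos y)).
- exact: (cont (S^~ y) (@continuous_ker_sin y)).
- exact: continuous_ker_cos.
- exact: continuous_ker_sin.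
- move=> z; rewrite (defectZ (C^~ y)) dotpZr -dotpZl.
  under eq_fun do rewrite scalerA mulrC -scalerA.
  exact: radial_ker_cos.
- move=> z; rewrite (defectZ (S^~ y)) dotpZr -dotpZl.
  under eq_fun do rewrite scalerA mulrC -scalerA.
  exact: radial_ker_sin.
- by move=> z; exact: radial_ker_cos.
- by move=> z; exact: radial_ker_sin.
- by rewrite scaler0 !ker_cos0l.
- by rewrite scaler0 !ker_sin0l.
Qed.

(** The defect and the scalar product are compatible with reflections, so the left side solves the
    ray equation with multiplier i <x, y>; uniqueness does the rest. *)
Lemma ker_reflection a x y : a \in Rs ->
  C (reflection a x) (reflection a y) = C x y /\
  S (reflection a x) (reflection a y) = S x y.
Proof.
move=> aR.
have cont (f : 'rV[R]_d -> R) : continuous f ->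
    continuous (fun z => f (reflection a z)).
  move=> cf z; apply: (@continuous_comp _ _ _ (reflection a) f); last exact: cf.
  exact: continuous_reflection.
apply: (radial_unique k_ge0 (f1 := fun z => C (reflection a z) (reflection a y))
  (f2 := fun z => S (reflection a z) (reflection a y)) (g1 := C^~ y) (g2 := S^~ y)
  (al := fun z => dotp z y)).
- exact/(cont (C^~ _))/continuous_ker_cos.
- exact/(cont (S^~ _))/continuous_ker_sin.
- exact: continuous_ker_cos.
- exact: continuous_ker_sin.
- move=> z; rewrite (reflection_defect_reflection hRs hRp hk (C^~ _) _ aR).
  rewrite -(dotp_reflection a z); under eq_fun do rewrite reflectionZ.
  exact: radial_ker_cos.
- move=> z; rewrite (reflection_defect_reflection hRs hRp hk (S^~ _) _ aR).
  rewrite -(dotp_reflection a z); under eq_fun do rewrite reflectionZ.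
  exact: radial_ker_sin.
- by move=> z; exact: radial_ker_cos.
- by move=> z; exact: radial_ker_sin.
- by rewrite reflection0 !ker_cos0l.
- by rewrite reflection0 !ker_sin0l.
Qed.

(** The multiplier i <x, y> only rotates, so the modulus obeys the maximum principle with no source
    and stays below its value 1 at the origin. *)
Lemma ker_modulus_le1 x y : C x y ^+ 2 + S x y ^+ 2 <= 1.
Proof.
have := radial_max_principle (al := fun z => dotp z y) (b1 := fun=> 0)
  (b2 := fun=> 0) k_ge0 (lexx 0) (@continuous_ker_cos y) (@continuous_ker_sin y).
have H1 z : is_derive (1 : R) (1 : R) (fun s => C (s *: z) y)
  (- dotp z y * S z y + 0 - defect (C^~ y) z) by rewrite addr0; exact: radial_ker_cos.
have H2 z : is_derive (1 : R) (1 : R) (fun s => S (s *: z) y)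
  (dotp z y * C z y + 0 - defect (S^~ y) z) by rewrite addr0; exact: radial_ker_sin.
move=> /(_ H1 H2) H.
have K : forall (z : 'rV[R]_d) (w1 w2 : R), w1 ^+ 2 + w2 ^+ 2 = 1 ->
    w1 * 0 + w2 * 0 <= 0 * enorm z by move=> *; rewrite !mulr0 mul0r addr0.
move: (H K x); rewrite ker_cos0l ker_sin0l mul0r addr0 expr1n expr0n/= addr0 sqrtr1.
by rewrite -[X in _ <= X -> _]sqrtr1 ler_sqrt.
Qed.

Lemma normr_ker_cos_le1 x y : `|C x y| <= 1.
Proof.
rewrite -(@ler_pXn2r _ 2) ?nnegrE// expr1n real_normK ?num_real//.
by rewrite (le_trans _ (ker_modulus_le1 x y))// lerDl sqr_ge0.
Qed.

Lemma normr_ker_sin_le1 x y : `|S x y| <= 1.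
Proof.
rewrite -(@ler_pXn2r _ 2) ?nnegrE// expr1n real_normK ?num_real//.
by rewrite (le_trans _ (ker_modulus_le1 x y))// lerDr sqr_ge0.
Qed.

(** The difference e(., y) - e(., y') solves the ray equation of y with source i <z, y - y'> e(z,
    y'), of modulus at most |y - y'||z|. Regularity in the second argument originates here, the
    definition of the kernel imposing none. *)
Lemma ker_lipschitz_r x y y' :
  Num.sqrt ((C x y - C x y') ^+ 2 + (S x y - S x y') ^+ 2) <=
  enorm x * enorm (y - y').
Proof.
have cB (u v : 'rV[R]_d -> R) : continuous u -> continuous v ->
    continuous (fun y => u y - v y).
  by move=> cu cv z; apply: (@cvgB _ _ _ (nbhs z)); [exact: cu|exact: cv].
have := radial_max_principle (al := fun z => dotp z y)
  (b1 := fun z => - dotp z (y - y') * S z y')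
  (b2 := fun z => dotp z (y - y') * C z y') k_ge0 (enorm_ge0 (y - y'))
  (cB _ _ (@continuous_ker_cos y) (@continuous_ker_cos y'))
  (cB _ _ (@continuous_ker_sin y) (@continuous_ker_sin y')).
have H1 z : is_derive (1 : R) (1 : R) (fun s => C (s *: z) y - C (s *: z) y')
    (- dotp z y * (S z y - S z y') + - dotp z (y - y') * S z y'
     - defect (fun w => C w y - C w y') z).
  apply: (is_derive_eq (is_derive_sub (radial_ker_cos z y) (radial_ker_cos z y'))).
  by rewrite reflection_defectB dotpBr; ring.
have H2 z : is_derive (1 : R) (1 : R) (fun s => S (s *: z) y - S (s *: z) y')
    (dotp z y * (C z y - C z y') + dotp z (y - y') * C z y'
     - defect (fun w => S w y - S w y') z).
  apply: (is_derive_eq (is_derive_sub (radial_ker_sin z y) (radial_ker_sin z y'))).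
  by rewrite reflection_defectB dotpBr; ring.
move=> /(_ H1 H2) H.
have /H/(_ x) : forall z (w1 w2 : R), w1 ^+ 2 + w2 ^+ 2 = 1 ->
    w1 * (- dotp z (y - y') * S z y') + w2 * (dotp z (y - y') * C z y') <=
    enorm (y - y') * enorm z.
  move=> z w1 w2 w; rewrite [leRHS]mulrC.
  apply: le_trans (normr_dotp_le _ _).
  rewrite (_ : _ + _ = dotp z (y - y') * (w2 * C z y' - w1 * S z y')); last by ring.
  apply: (le_trans (ler_norm _)); rewrite normrM ler_piMr//.
  rewrite -(@ler_pXn2r _ 2) ?nnegrE// expr1n real_normK ?num_real//.
  have := ker_modulus_le1 z y'; have := sqr_ge0 (w1 * C z y' + w2 * S z y').
  by nra.
by rewrite !ker_cos0l !ker_sin0l !subrr expr0n/= addr0 sqrtr0 add0r mulrC.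
Qed.

Lemma ker_cos_lipschitz_r x y y' :
  `|C x y - C x y'| <= enorm x * enorm (y - y').
Proof.
apply: le_trans (ker_lipschitz_r x y y'); rewrite -sqrtr_sqr ler_sqrt.
  by rewrite lerDl sqr_ge0.
by rewrite addr_ge0// sqr_ge0.
Qed.

Lemma ker_sin_lipschitz_r x y y' :
  `|S x y - S x y'| <= enorm x * enorm (y - y').
Proof.
apply: le_trans (ker_lipschitz_r x y y'); rewrite -sqrtr_sqr ler_sqrt.
  by rewrite lerDr sqr_ge0.
by rewrite addr_ge0// sqr_ge0.
Qed.

(* As functions of y, both e(x, y) and e(y, x) solve the radial equation with
   multiplier i <x, y>, hence they coincide. *)
Lemma ker_sym x y : C x y = C y x /\ S x y = S y x.
Proof.
have defC z : defect (C x) z = defect (C^~ z) x.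
  apply: eq_big_seq => a /(positive_root hRp) aR; congr (_ * (_ - _)).
  by rewrite -(ker_reflection x (reflection a z) aR).1 reflectionK.
have defS z : defect (S x) z = defect (S^~ z) x.
  apply: eq_big_seq => a /(positive_root hRp) aR; congr (_ * (_ - _)).
  by rewrite -(ker_reflection x (reflection a z) aR).2 reflectionK.
apply: (radial_unique k_ge0 (f1 := C x) (f2 := S x) (g1 := C^~ x) (g2 := S^~ x)
  (al := fun z => dotp z x)).
- exact: lipschitz_continuous_rV (ker_cos_lipschitz_r x).
- exact: lipschitz_continuous_rV (ker_sin_lipschitz_r x).
- exact: continuous_ker_cos.
- exact: continuous_ker_sin.
- move=> z; rewrite defC dotpC; under eq_fun do rewrite -(ker_scale _ _ _).1.
  exact: radial_ker_cos.
- move=> z; rewrite defS dotpC; under eq_fun do rewrite -(ker_scale _ _ _).2.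
  exact: radial_ker_sin.
- by move=> z; exact: radial_ker_cos.
- by move=> z; exact: radial_ker_sin.
- by rewrite ker_cos0l -(scale0r 0) -(ker_scale _ _ _).1 scale0r ker_cos0l.
- by rewrite ker_sin0l -(scale0r 0) -(ker_scale _ _ _).2 scale0r ker_sin0l.
Qed.

Lemma ker_cos_lipschitz_l x x' y :
  `|C x y - C x' y| <= enorm y * enorm (x - x').
Proof. by rewrite !(ker_sym _ y).1 ker_cos_lipschitz_r. Qed.

Lemma ker_sin_lipschitz_l x x' y :
  `|S x y - S x' y| <= enorm y * enorm (x - x').
Proof. by rewrite !(ker_sym _ y).2 ker_sin_lipschitz_r. Qed.

End dunkl_kernel.

(** * Lebesgue integration on row vectors *)

Section measurability_rV.
Context {R : realType} {d : nat}.
Local Notation V := 'rV[R]_d.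

(** The sigma-algebra is generated by the coordinates, the topology by the sup norm; an open set is
    the countable union of the rational boxes that it contains. *)
Lemma measurable_open_rV (U : set V) : open U -> measurable U.
Proof.
move=> oU.
pose box (q : 'rV[rat]_d * nat) : set V :=
  \big[setI/setT]_(i < d) (rV_coord i @^-1` ball (ratr (q.1 ord0 i) : R) q.2.+1%:R^-1).
have boxE q x : box q x <-> forall i, `|ratr (q.1 ord0 i) - x ord0 i| < q.2.+1%:R^-1.
  rewrite /box -bigcap_seq; split => [qx i|qx i _]; last exact: qx.
  by apply: (qx i); rewrite /= mem_index_enum.
pose F q := if `[< box q `<=` U >] then box q else set0.
rewrite (_ : U = \bigcup_q F q).
  apply: countable_bigcupT_measurable; first exact: countableP.
  move=> q; rewrite /F; case: ifP => // _; apply: bigsetI_measurable => i _.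
  rewrite -[X in measurable X]setTI; apply: measurable_rV_coord => //.
  exact: measurable_ball.
apply/seteqP; split => [x Ux|x [q _]]; last first.
  by rewrite /F; case: ifPn => // /asboolP qU /qU.
have := oU; rewrite openE => /(_ x Ux); rewrite /interior => /nbhs_ballP[r /= r0 rU].
(* A box of radius 1/(n + 1) around a rational point that close to x must still lie in the ball of
   radius r around x, hence the factor 2. *)
have [n nr] : exists n, 2 * n.+1%:R^-1 < r.
  exists (Num.trunc (2 / r)); rewrite -ltr_pdivlMr ?ltr0Sn// invrK mulrC.
  by rewrite -ltr_pdivrMr// truncnS_gt.
have [q qx] : exists q : 'rV[rat]_d, forall i, `|ratr (q ord0 i) - x ord0 i| < n.+1%:R^-1.
  have qi i : exists q : rat, `|ratr q - x ord0 i| < n.+1%:R^-1.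
    have [|y [] /= xy [q _ qy]] := @dense_rat R (ball (x ord0 i) n.+1%:R^-1) _ (ball_open _ _).
      by exists (x ord0 i); apply: ballxx; rewrite invr_gt0.
    by exists q; rewrite qy distrC.
  exists (\row_i projT1 (cid (qi i))) => i; rewrite mxE.
  exact: (projT2 (cid (qi i))).
exists (q, n) => //; rewrite /F; case: ifPn; first by move=> _; apply/boxE.
move=> /asboolP[] y /boxE /= qy; apply: rU.
split => // i j; rewrite (ord1 i) /ball/=.
rewrite -(subrK (ratr (q ord0 j)) (x ord0 j)) -addrA (le_lt_trans (ler_normD _ _))//.
by rewrite (lt_trans _ nr)// mulr2n mulrDl !mul1r ltrD// distrC.
Qed.

Lemma continuous_measurable_rV (f : V -> R) :
  continuous f -> measurable_fun setT f.
Proof.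
move=> cf; apply: (measurability _ (RGenOpens.measurableE R)) => //.
move=> _ [_ [a [b ->] <-]]; rewrite setTI; apply: measurable_open_rV.
by move/continuousP : cf; apply; exact: interval_open.
Qed.

Lemma measurable_rV_dotp a : measurable_fun setT (fun x : V => dotp x a).
Proof. apply: continuous_measurable_rV; exact: continuous_dotp. Qed.

Lemma measurable_enorm : measurable_fun setT (@enorm R d).
Proof. apply: continuous_measurable_rV; exact: continuous_enorm. Qed.

Context {dT : measure_display} {T : measurableType dT}.

Lemma measurable_rV_add (F G : T -> V) : measurable_fun setT F ->
  measurable_fun setT G -> measurable_fun setT (fun t => F t + G t).
Proof.
move=> mF mG; apply: measurable_fun_rV_coordP => i.
rewrite (_ : _ \o _ = fun t => (F t ord0 i + G t ord0 i)%R); last first.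
  by apply/funext => t; rewrite /= /rV_coord mxE.
by apply: measurable_funD;
  [apply: (measurableT_comp (measurable_rV_coord i) mF)|
   apply: (measurableT_comp (measurable_rV_coord i) mG)].
Qed.

Lemma measurable_rV_scale (s : R) (F : T -> V) : measurable_fun setT F ->
  measurable_fun setT (fun t => s *: F t).
Proof.
move=> mF; apply: measurable_fun_rV_coordP => i.
rewrite (_ : _ \o _ = fun t => (s * F t ord0 i)%R); last first.
  by apply/funext => t; rewrite /= /rV_coord mxE.
by apply: measurable_funM => //; apply: (measurableT_comp (measurable_rV_coord i) mF).
Qed.

Lemma measurable_rV_opp (F : T -> V) : measurable_fun setT F ->
  measurable_fun setT (fun t => - F t).
Proof. by move=> mF; under eq_fun do rewrite -scaleN1r; exact: measurable_rV_scale. Qed.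

Lemma measurable_rV_reflection a (F : T -> V) : measurable_fun setT F ->
  measurable_fun setT (fun t => reflection a (F t)).
Proof.
move=> mF; apply: measurable_fun_rV_coordP => i.
rewrite (_ : _ \o _ = fun t => (F t ord0 i -
    (2 * dotp (F t) a / dotp a a) * a ord0 i)%R); last first.
  by apply/funext => t; rewrite /= /rV_coord !mxE (dotpC a).
apply: measurable_funB; first exact: (measurableT_comp (measurable_rV_coord i) mF).
apply: measurable_funM => //; apply: measurable_funM => //; apply: measurable_funM => //.
exact: (measurableT_comp (measurable_rV_dotp a) mF).
Qed.

End measurability_rV.

Section measurability_rV_pair.
Context {R : realType} {d : nat}.
Local Notation V := 'rV[R]_d.

(* The coordinates of (x, y) are those of the concatenated row vector, so joint
   measurability is measurability of a continuous function on R^(d+d). *)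
Lemma lipschitz_measurable_pair (f : V -> V -> R) :
  (forall x x' y, `|f x y - f x' y| <= enorm y * enorm (x - x')) ->
  (forall x y y', `|f x y - f x y'| <= enorm x * enorm (y - y')) ->
  measurable_fun setT (fun p : V * V => f p.1 p.2).
Proof.
move=> f1 f2.
pose g (z : 'rV[R]_(d + d)) := f (lsubmx z) (rsubmx z).
have cg : continuous g.
  move=> z; apply/(@cvgrPdist_le _ _ _ (nbhs z)) => e e0.
  pose h (w : 'rV[R]_(d + d)) := enorm (rsubmx w) * enorm (lsubmx z - lsubmx w) +
     enorm (lsubmx z) * enorm (rsubmx z - rsubmx w).
  have hz : h z = 0 by rewrite /h !subrr !enorm0 !mulr0 addr0.
  have ch : h w @[w --> z] --> (0 : R).
    rewrite -hz.
    have cl : lsubmx w @[w --> z] --> lsubmx z.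
      apply/(@cvgrPdist_le _ _ _ (nbhs z)) => r r0; near=> w.
      have : `|z - w| <= r by near: w; exact: (@cvgr_dist_le _ _ _ (nbhs z) _ id z).
      apply: le_trans; rewrite -linearB/= {1}/Num.norm/= mx_normrE.
      apply/bigmax_leP; split => // -[i j] _ /=.
      by rewrite mxE (ord1 i) normr_coord_le.
    have cr : rsubmx w @[w --> z] --> rsubmx z.
      apply/(@cvgrPdist_le _ _ _ (nbhs z)) => r r0; near=> w.
      have : `|z - w| <= r by near: w; exact: (@cvgr_dist_le _ _ _ (nbhs z) _ id z).
      apply: le_trans; rewrite -linearB/= {1}/Num.norm/= mx_normrE.
      apply/bigmax_leP; split => // -[i j] _ /=.
      by rewrite mxE (ord1 i) normr_coord_le.
    have ce (F : 'rV[R]_(d + d) -> V) : F w @[w --> z] --> F z ->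
        enorm (F w) @[w --> z] --> enorm (F z).
      by move=> cF; apply: (cvg_comp _ _ cF); exact: continuous_enorm.
    apply: (@cvgD _ _ _ (nbhs z)); apply: (@cvgM _ _ (nbhs z)).
    - exact: (ce rsubmx).
    - apply: (ce (fun w => lsubmx z - lsubmx w)).
      by apply: (@cvgB _ _ _ (nbhs z)) => //; exact: cvg_cst.
    - exact: cvg_cst.
    - apply: (ce (fun w => rsubmx z - rsubmx w)).
      by apply: (@cvgB _ _ _ (nbhs z)) => //; exact: cvg_cst.
  move/(@cvgrPdist_le _ _ _ (nbhs z)) : ch => /(_ e e0).
  apply: filterS => w; rewrite sub0r normrN => /(le_trans (ler_norm _)).
  apply: le_trans.
  rewrite /g -(subrK (f (lsubmx z) (rsubmx w)) (f (lsubmx z) (rsubmx z))) -addrA.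
  by rewrite (le_trans (ler_normD _ _))// [h w]/h [leRHS]addrC lerD.
rewrite (_ : (fun p => _) = g \o (fun p : V * V => row_mx p.1 p.2)); last first.
  by apply/funext => -[x y]; rewrite /g /= row_mxKl row_mxKr.
apply: measurableT_comp; first exact: continuous_measurable_rV.
apply: measurable_fun_rV_coordP => i.
case: (split_ordP i) => j ->.
  rewrite (_ : _ \o _ = rV_coord j \o fst); last first.
    by apply/funext => -[x y]; rewrite /rV_coord /= row_mxEl.
  by apply: measurableT_comp => //; exact: measurable_rV_coord.
rewrite (_ : _ \o _ = rV_coord j \o snd); last first.
  by apply/funext => -[x y]; rewrite /rV_coord /= row_mxEr.
by apply: measurableT_comp => //; exact: measurable_rV_coord.
Unshelve. all: by end_near. Qed.

End measurability_rV_pair.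

Section affine_substitution.
Context {R : realType}.
Local Open Scope ereal_scope.

Definition affine (s h t : R) : R := (s * t + h)%R.

Lemma measurable_affine s h :
  measurable_fun [set: measurableTypeR R] (affine s h : measurableTypeR R -> measurableTypeR R).
Proof. by apply: measurable_funD => //; apply: measurable_funM. Qed.

(** By uniqueness on half-open intervals, Lebesgue measure is s times its own image under t -> s t +
    h; the formula is integration against that image. *)
Lemma lebesgue_integral_affine (s h : R) (f : R -> \bar R) : (0 < s)%R ->
  measurable_fun [set: R] f -> (forall t, 0 <= f t) ->
  \int[lebesgue_measure]_t f (s * t + h)%R =
  (s^-1)%:E * \int[lebesgue_measure]_t f t.
Proof.
move=> s0 mf f0.
pose nu0 : {measure set (measurableTypeR R) -> \bar R} :=
  pushforward (@lebesgue_measure R) (affine s h : measurableTypeR R -> measurableTypeR R).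
pose nu := nu0 (measurable_affine s h).
have s0' : (0 <= s)%R by exact: ltW.
have nuE (A : set (measurableTypeR R)) : measurable A ->
    @lebesgue_measure R A = mscale (NngNum s0') nu A.
  move=> mA; apply: lebesgue_measure_unique => // _ [[a b] _ <-].
  change (@lebesgue_measure R `]a, b]%classic =
    s%:E * @lebesgue_measure R (affine s h @^-1` `]a, b]%classic)).
  rewrite (_ : affine s h @^-1` _ = `]((a - h) / s)%R, ((b - h) / s)%R]%classic).
    rewrite !lebesgue_measure_itv/= !lte_fin.
    rewrite ltr_pM2r ?invr_gt0// ltrBlDr subrK.
    case: ifPn => ab; last by rewrite mule0.
    rewrite -!EFinB -EFinM; congr EFin.
    by field; rewrite gt_eqF.
  apply/seteqP; split => t; rewrite /affine /= !in_itv/= ltr_pdivrMr// ler_pdivlMr//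
    ltrBlDr lerBrDr mulrC; exact.
rewrite [X in _ = _ * X](eq_measure_integral (mscale (NngNum s0') nu)); last first.
  by move=> A mA _; exact: nuE.
rewrite ge0_integral_mscale// muleA -EFinM mulVf ?gt_eqF// mul1e.
exact: (esym (ge0_integral_pushforward (measurable_affine s h)
  (@lebesgue_measure R) measurableT mf (fun y _ => f0 y))).
Qed.

End affine_substitution.

Section integral_rV.
Context {R : realType}.
Local Open Scope ereal_scope.
Implicit Types n : nat.

Lemma integral_rV0 (f : 'rV[R]_0 -> \bar R) : measurable_fun setT f ->
  \int[lebesgue_rV 0]_x f x = f 0%R.
Proof. by move=> mf; rewrite /= integral_dirac// diracT mul1e. Qed.

Lemma integral_rVS n (f : 'rV[R]_n.+1 -> \bar R) : measurable_fun setT f ->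
  (forall x, 0 <= f x) -> \int[lebesgue_rV n.+1]_x f x =
  \int[lebesgue_measure]_t \int[lebesgue_rV n]_x f (rV_cons (t, x)).
Proof.
move=> mf f0; rewrite /= ge0_integral_pushforward//.
rewrite preimage_setT fubini_tonelli1//; last by move=> x; exact: f0.
by apply: measurableT_comp => //; exact: measurable_rV_cons.
Qed.

Lemma integral_rV_affine n (s : R) (h : 'rV[R]_n) (f : 'rV[R]_n -> \bar R) :
  (0 < s)%R -> measurable_fun setT f -> (forall x, 0 <= f x) ->
  \int[lebesgue_rV n]_x f (s *: x + h)%R =
  (s ^- n)%:E * \int[lebesgue_rV n]_x f x.
Proof.
move=> s0; elim: n h f => [|n IH] h f mf f0.
  rewrite !integral_rV0//; last first.
    apply: (measurableT_comp mf); apply: measurable_rV_add => //.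
    exact: measurable_rV_scale.
  by rewrite expr0 invr1 mul1e; congr f; apply/rowP => -[].
have mT : measurable_fun setT (fun x : 'rV[R]_n.+1 => (s *: x + h)%R).
  by apply: measurable_rV_add => //; exact: measurable_rV_scale.
rewrite !integral_rVS//; last exact: measurableT_comp.
have consE t (x : 'rV[R]_n) : (s *: rV_cons (t, x) + h =
    rV_cons (s * t + h ord0 ord0, s *: x + \row_j h ord0 (lift ord0 j)))%R.
  apply/rowP => i; rewrite !mxE; case: unliftP => [j ->|->] /=; by rewrite ?mxE.
have mc : measurable_fun setT (fun p : measurableTypeR R * 'rV[R]_n => f (rV_cons p)).
  by apply: measurableT_comp => //; exact: measurable_rV_cons.
pose G t := \int[lebesgue_rV n]_x f (rV_cons (t, x)).
have mG : measurable_fun [set: R] G.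
  exact: (measurable_fun_fubini_tonelli_F (fun p => f (rV_cons p))).
have G0 t : 0 <= G t by exact: integral_ge0.
have s1 : (0 <= s ^- n)%R by rewrite invr_ge0 exprn_ge0// ltW.
transitivity (\int[lebesgue_measure]_t ((s ^- n)%:E * G (s * t + h ord0 ord0)%R)).
  apply: eq_integral => t _; under eq_integral do rewrite consE.
  apply: (IH _ (fun x => f (rV_cons ((s * t + h ord0 ord0)%R, x)))) => //.
  exact: (measurableT_comp mc (pair1_measurable _)).
have mGs : measurable_fun [set: R] (fun t => G (s * t + h ord0 ord0)%R).
  by apply: (measurableT_comp mG); exact: measurable_affine.
apply: (eq_trans (ge0_integralZl_EFin (@lebesgue_measure R) measurableT
  (f1 := fun t => G (s * t + h ord0 ord0)%R) (fun t _ => G0 _) mGs s1)).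
by rewrite lebesgue_integral_affine// muleA -EFinM exprS invfM mulrC.
Qed.

Lemma integral_rV_translate n (h : 'rV[R]_n) (f : 'rV[R]_n -> \bar R) :
  measurable_fun setT f -> (forall x, 0 <= f x) ->
  \int[lebesgue_rV n]_x f (x + h)%R = \int[lebesgue_rV n]_x f x.
Proof.
move=> mf f0; have := integral_rV_affine h (@ltr01 R) mf f0.
rewrite expr1n invr1 mul1e => <-.
by apply: eq_integral => x _; rewrite scale1r.
Qed.

Lemma integral_rV_scale n (s : R) (f : 'rV[R]_n -> \bar R) : (0 < s)%R ->
  measurable_fun setT f -> (forall x, 0 <= f x) ->
  \int[lebesgue_rV n]_x f (s *: x)%R = (s ^- n)%:E * \int[lebesgue_rV n]_x f x.
Proof.
move=> s0 mf f0; rewrite -(integral_rV_affine 0 s0 mf f0).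
by apply: eq_integral => x _; rewrite addr0.
Qed.

End integral_rV.

Section nonnegative_integrals.
Context {d : measure_display} {T : measurableType d} {R : realType}.
Variable mu : {measure set T -> \bar R}.
Local Open Scope ereal_scope.

Lemma ge0_integral_mulc (c : R) (f : T -> R) : (0 <= c)%R ->
  measurable_fun setT f -> (forall x, (0 <= f x)%R) ->
  \int[mu]_x (c * f x)%:E = c%:E * \int[mu]_x (f x)%:E.
Proof.
move=> c0 mf f0; have mEf : measurable_fun setT (fun x => (f x)%:E).
  exact/measurable_EFinP.
have f0' (x : T) : setT x -> 0 <= (f x)%:E by rewrite lee_fin.
rewrite -(ge0_integralZl_EFin mu measurableT f0' mEf c0).
by apply: eq_integral => x _; rewrite EFinM.
Qed.

Lemma ge0_integralTZl (k : \bar R) (f : T -> \bar R) : measurable_fun setT f ->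
  (forall x, 0 <= f x) -> 0 <= k -> \int[mu]_x (k * f x) = k * \int[mu]_x f x.
Proof. by move=> mf f0 k0; rewrite ge0_integralZl. Qed.

Lemma ge0_integralTZr (k : \bar R) (f : T -> \bar R) : measurable_fun setT f ->
  (forall x, 0 <= f x) -> 0 <= k -> \int[mu]_x (f x * k) = (\int[mu]_x f x) * k.
Proof. by move=> mf f0 k0; rewrite ge0_integralZr. Qed.

Lemma ge0_integral_mono (f g : T -> R) : measurable_fun setT f ->
  measurable_fun setT g -> (forall x, (0 <= f x)%R) -> (forall x, (f x <= g x)%R) ->
  \int[mu]_x (f x)%:E <= \int[mu]_x (g x)%:E.
Proof.
move=> mf mg f0 fg; have mEf : measurable_fun setT (fun x => (f x)%:E).
  exact/measurable_EFinP.
have mEg : measurable_fun setT (fun x => (g x)%:E) by exact/measurable_EFinP.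
apply: (ge0_le_integral mu measurableT _ mEf mEg) => x _; first by rewrite lee_fin.
by rewrite lee_fin.
Qed.

End nonnegative_integrals.

Section gaussian.
Context {R : realType}.
Local Open Scope ereal_scope.

Definition gauss {n} (b : R) (x : 'rV[R]_n) : R := expR (- (b * dotp x x)).

Lemma gauss_gt0 n b (x : 'rV[R]_n) : (0 < gauss b x)%R.
Proof. exact: expR_gt0. Qed.

Lemma gauss_ge0 n b (x : 'rV[R]_n) : (0 <= gauss b x)%R.
Proof. exact/ltW/gauss_gt0. Qed.

Lemma continuous_gauss n (b : R) : continuous (@gauss n b).
Proof.
move=> x; apply: (@cvg_comp _ _ _ (fun x => (- (b * dotp x x))%R) expR (nbhs x)
    (nbhs (- (b * dotp x x))%R)); last exact: continuous_expR.
apply: (@cvgN _ _ _ (nbhs x)); apply: (@cvgM _ _ (nbhs x)); first exact: cvg_cst.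
exact: continuous_dotp_self.
Qed.

Lemma measurable_gauss n (b : R) : measurable_fun setT (@gauss n b).
Proof. by apply: continuous_measurable_rV; exact: continuous_gauss. Qed.

Lemma integral_gauss1 (b : R) : (0 < b)%R ->
  \int[lebesgue_measure]_t (expR (- (b * t ^+ 2)))%:E = (Num.sqrt (pi / b))%:E.
Proof.
move=> b0; have sb0 : (0 < Num.sqrt b)%R by rewrite sqrtr_gt0.
have mg : measurable_fun [set: R] (fun t : R => (gauss_fun t)%:E).
  apply/measurable_EFinP; apply: measurableT_comp => //.
  by apply: measurable_funN => //; exact: measurable_funX.
have g0 (t : R) : 0 <= (gauss_fun t)%:E by rewrite lee_fin expR_ge0.
have := lebesgue_integral_affine 0 sb0 mg g0; rewrite integralT_gauss -EFinM.
rewrite mulrC sqrtrM ?pi_ge0// sqrtrV ?(ltW b0)// => <-.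
apply: eq_integral => t _; rewrite /gauss_fun addr0 exprMn sqr_sqrtr//.
exact: ltW.
Qed.

Lemma dotp_rV_cons n (t : R) (x : 'rV[R]_n) :
  dotp (rV_cons (t, x)) (rV_cons (t, x)) = (t ^+ 2 + dotp x x)%R.
Proof.
rewrite /dotp big_ord_recl !mxE unlift_none /= expr2; congr (_ + _)%R.
by apply: eq_bigr => i _; rewrite !mxE liftK.
Qed.

Lemma integral_gauss n (b : R) : (0 < b)%R ->
  \int[lebesgue_rV n]_x (gauss b x)%:E = (Num.sqrt (pi / b) ^+ n)%:E.
Proof.
move=> b0; elim: n => [|n IH].
  rewrite integral_rV0; last (apply/measurable_EFinP; exact: measurable_gauss).
  by rewrite /gauss dotp0r mulr0 oppr0 expR0 expr0.
rewrite integral_rVS; [|(apply/measurable_EFinP; exact: measurable_gauss)|]; last first.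
  by move=> x; rewrite lee_fin gauss_ge0.
transitivity (\int[lebesgue_measure]_t (Num.sqrt (pi / b) ^+ n * expR (- (b * t ^+ 2)))%:E).
  apply: eq_integral => t _; rewrite mulrC EFinM -IH.
  rewrite -ge0_integral_mulc ?expR_ge0//; first last.
  - exact: gauss_ge0.
  - exact: measurable_gauss.
  apply: eq_integral => x _; rewrite /gauss dotp_rV_cons -expRD; congr (expR _)%:E.
  by rewrite mulrDr opprD.
rewrite ge0_integral_mulc; first last.
- by move=> t; rewrite expR_ge0.
- apply: measurableT_comp => //; apply: measurable_funN => //.
  by apply: measurable_funM => //; exact: measurable_funX.
- by rewrite exprn_ge0// sqrtr_ge0.
by rewrite integral_gauss1// exprSr EFinM.
Qed.

End gaussian.

Section isometry_invariance.
Context {R : realType} {d : nat}.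
Local Notation V := 'rV[R]_d.
Local Notation mu := (@lebesgue_rV R d).
Local Open Scope ereal_scope.

(* Both sides are compared after multiplication by the integral of an invariant
   Gaussian; Tonelli and translation invariance then do the job, as in the
   uniqueness proof of Haar measure. *)
Lemma integral_rV_isometry_opp (T : V -> V) (f : V -> \bar R) :
  measurable_fun setT T -> (forall x y, T (x + y) = T x + T y)%R ->
  involutive T -> (forall x, dotp (T x) (T x) = dotp x x) ->
  measurable_fun setT f -> (forall x, 0 <= f x) ->
  \int[mu]_x f (T x) = \int[mu]_x f (- x)%R.
Proof.
move=> mT TD TT Tdot mf f0.
pose g (x : V) := (gauss 1 x)%:E : \bar R.
have g0 x : 0 <= g x by rewrite lee_fin gauss_ge0.
have mg : measurable_fun setT g by (apply/measurable_EFinP; exact: measurable_gauss).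
have gE : \int[mu]_x g x = (Num.sqrt (pi / 1) ^+ d)%:E by exact: integral_gauss.
have c0 : (0 < Num.sqrt (pi / 1 : R) ^+ d)%R by rewrite exprn_gt0// sqrtr_gt0 divr1 pi_gt0.
have mfT : measurable_fun setT (fun x => f (T x)) by exact: measurableT_comp.
have mfN : measurable_fun setT (fun x : V => f (- x)%R).
  by apply: (measurableT_comp mf); exact: measurable_rV_opp.
have gT x : g (T x) = g x by rewrite /g /gauss Tdot.
suff H : \int[mu]_x f (T x) * \int[mu]_x g x = \int[mu]_x f (- x)%R * \int[mu]_x g x.
  have cV : (Num.sqrt (pi / 1 : R) ^+ d)%:E * (Num.sqrt (pi / 1 : R) ^+ d)^-1%:E = 1.
    by rewrite -EFinM divff// gt_eqF.
  have := congr1 (fun z => z * (Num.sqrt (pi / 1 : R) ^+ d)^-1%:E) H.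
  by rewrite gE -!muleA cV !mule1.
have mgT (y : V) : measurable_fun setT (fun x : V => g (x + T y)%R).
  by apply: (measurableT_comp mg); exact: measurable_rV_add.
have mfTN (x : V) : measurable_fun setT (fun y : V => f (T y - x)%R).
  by apply: (measurableT_comp mf); exact: measurable_rV_add.
have mfTN' (y : V) : measurable_fun setT (fun x : V => f (T y - x)%R).
  by apply: (measurableT_comp mf); apply: measurable_rV_add => //; exact: measurable_rV_opp.
have gI0 : 0 <= \int[mu]_x g x by exact: integral_ge0.
have fI0 : 0 <= \int[mu]_x f (- x)%R by exact: integral_ge0.
transitivity (\int[mu]_y \int[mu]_x (f (T y) * g (x + T y)%R)).
  rewrite -(ge0_integralTZr _ mfT (fun x => f0 (T x)) gI0).
  apply: eq_integral => y _.
  by rewrite (ge0_integralTZl _ (mgT y) (fun x => g0 _) (f0 _)) integral_rV_translate.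
rewrite (fubini_tonelli (fun p : V * V => f (T p.1) * g (p.2 + T p.1)%R)); first last.
- by move=> p; exact: mule_ge0.
- apply: emeasurable_funM; first exact: (measurableT_comp mfT measurable_fst).
  apply: (measurableT_comp mg); apply: measurable_rV_add; first exact: measurable_snd.
  exact: (measurableT_comp mT measurable_fst).
(* Substitute y - T x for y. As T is an additive involution, T(y - T x) = T y - x; the argument of g
   becomes T y, where g has the same value as at y. *)
transitivity (\int[mu]_x \int[mu]_y (f (T y - x)%R * g y)).
  apply: eq_integral => x _ /=.
  rewrite -(integral_rV_translate (- T x)%R); first last.
  - by move=> y; exact: mule_ge0.
  - apply: emeasurable_funM; first exact: mfT.
    apply: (measurableT_comp mg); apply: measurable_rV_add => //.
  apply: eq_integral => y _.
  have TN : T (- T x)%R = (- x)%R.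
    have T0 : T 0%R = 0%R by apply: (addrI (T 0%R)); rewrite -TD !addr0.
    by apply/eqP; rewrite -subr_eq0 opprK -{2}(TT x) -TD addNr T0.
  have -> : T (y - T x)%R = (T y - x)%R by rewrite TD TN.
  by rewrite addrCA subrr addr0 gT.
rewrite (fubini_tonelli (fun p : V * V => f (T p.2 - p.1)%R * g p.2)); first last.
- by move=> p; exact: mule_ge0.
- apply: emeasurable_funM; last exact: (measurableT_comp mg measurable_snd).
  apply: (measurableT_comp mf); apply: measurable_rV_add.
    exact: (measurableT_comp mT measurable_snd).
  apply: measurable_rV_opp; exact: measurable_fst.
rewrite -(ge0_integralTZl _ mg g0 fI0).
apply: eq_integral => y _ /=.
rewrite (ge0_integralTZr _ (mfTN' y) (fun x => f0 _) (g0 _)).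
congr (_ * _).
rewrite -(integral_rV_translate (- T y)%R (f := fun x => f (- x)%R) mfN (fun x => f0 _)).
by apply: eq_integral => x _; rewrite opprB.
Qed.

Lemma integral_rV_reflection a (f : V -> \bar R) :
  measurable_fun setT f -> (forall x, 0 <= f x) ->
  \int[mu]_x f (reflection a x) = \int[mu]_x f x.
Proof.
move=> mf f0.
rewrite (integral_rV_isometry_opp (T := reflection a))//.
(* The identity is an admissible T too, which removes the sign of -x. *)
- by rewrite -(integral_rV_isometry_opp (T := id)).
- exact: measurable_rV_reflection.
- exact: reflectionD.
- exact: reflectionK.
- by move=> x; exact: dotp_reflection.
Qed.

End isometry_invariance.

(** * The Dunkl weight *)

Section dunkl_weight_facts.
Context {R : realType} {d : nat}.
Local Notation V := 'rV[R]_d.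
Local Notation mu := (@lebesgue_rV R d).
Variables (Rp : {fset V}) (k : V -> R).

(** Replacing <a, x>^2 by <a, x>^2 + eps makes the weight differentiable across the hyperplanes,
    where |<a, x>|^(2 k) is not for small k > 0. *)
Definition smooth_weight (eps : R) (x : V) : R :=
  \prod_(a <- Rp) (dotp a x ^+ 2 + eps) `^ k a.

Lemma smooth_weight0 x : smooth_weight 0 x = dunkl_weight Rp k x.
Proof.
apply: eq_bigr => a _; rewrite addr0 powRrM; congr (_ `^ _).
by rewrite -[2]/(2%:R) powR_mulrn// real_normK ?num_real.
Qed.

Lemma smooth_weight_ge0 eps x : 0 <= smooth_weight eps x.
Proof. by apply: prodr_ge0 => a _; exact: powR_ge0. Qed.

Lemma dunkl_weight_ge0 x : 0 <= dunkl_weight Rp k x.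
Proof. by rewrite -smooth_weight0 smooth_weight_ge0. Qed.

Lemma measurable_smooth_weight eps : measurable_fun setT (smooth_weight eps).
Proof.
rewrite /smooth_weight; elim: (enum_fset Rp) => [|a s IH].
  rewrite (_ : (fun x => _) = cst 1); first exact: measurable_cst.
  by apply/funext => x; rewrite big_nil.
under eq_fun do rewrite big_cons.
apply: measurable_funM => //.
apply: (measurableT_comp (f := fun t : R => t `^ k a)); first exact: measurable_powR.
apply: measurable_funD => //; apply: measurable_funX.
rewrite (_ : dotp a = (fun x => dotp x a)); first exact: measurable_rV_dotp.
by apply/funext => x; rewrite dotpC.
Qed.

Lemma measurable_dunkl_weight : measurable_fun setT (dunkl_weight Rp k).
Proof.
by rewrite (_ : dunkl_weight Rp k = smooth_weight 0);
  [exact: measurable_smooth_weight|apply/funext => x; rewrite smooth_weight0].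
Qed.

Lemma powR_le_gauss (p c del : R) : 0 <= p -> 0 <= c -> 0 < del ->
  exists2 K : R, 0 < K & forall s, 0 <= s -> (c * s + 1) `^ p <= K * expR (del * s).
Proof.
move=> p0 c0 del0.
(* The bound ln z <= z is applied to z = eta (c s + 1). This eta makes the resulting slope p c eta
   at most del, and the added 1 covers p c = 0. *)
pose eta : R := del / (p * c + 1).
have pc : 0 < p * c + 1 by rewrite ltr_wpDl// mulr_ge0.
have eta0 : 0 < eta by rewrite divr_gt0.
exists (expR (p * (eta - ln eta))); first exact: expR_gt0.
move=> s s0; have cs : 0 < c * s + 1 by rewrite ltr_wpDl// mulr_ge0.
rewrite /powR gt_eqF// -expRD ler_expR.
have h : ln (eta * (c * s + 1)) <= eta * (c * s + 1).
  by apply/ltW/ln_sublinear/mulr_gt0.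
rewrite lnM ?posrE// in h.
have h2 : p * c * eta <= del.
  by rewrite /eta mulrA ler_pdivrMr// mulrC ler_wpM2l ?(ltW del0)// lerDl.
have h3 : p * ln (c * s + 1) <= p * (eta * (c * s + 1) - ln eta).
  by rewrite ler_wpM2l// lerBrDl.
have h4 : p * c * eta * s <= del * s by rewrite ler_wpM2r.
by move: h3 h4; lra.
Qed.

Hypothesis k_ge0 : forall a, a \in Rp -> 0 <= k a.

(** The bound is uniform in eps, as dominated convergence for eps -> 0 requires. Each root consumes
    half of the remaining exponent. *)
Lemma smooth_weight_le (del : R) : 0 < del -> exists2 K : R, 0 < K &
  forall eps x, 0 <= eps <= 1 -> smooth_weight eps x <= K * expR (del * dotp x x).
Proof.
rewrite /smooth_weight; have : {subset enum_fset Rp <= Rp} by [].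
elim: (enum_fset Rp) del => [|a s IH] del sub del0.
  exists 1 => // eps x _; rewrite big_nil mul1r -expR0 ler_expR.
  by rewrite mulr_ge0 ?dotp_ge0// ltW.
have d2 : 0 < del / 2 by rewrite divr_gt0.
have [|K K0 HK] := IH (del / 2) _ d2.
  by move=> b bs; apply: sub; rewrite in_cons bs orbT.
have ka : 0 <= k a by apply/k_ge0/sub; rewrite mem_head.
have [K' K'0 HK'] := powR_le_gauss ka (dotp_ge0 a) d2.
exists (K' * K); first exact: mulr_gt0.
move=> eps x eps01; rewrite big_cons.
have -> : del * dotp x x = del / 2 * dotp x x + del / 2 * dotp x x by field.
rewrite expRD mulrACA; apply: ler_pM.
- exact: powR_ge0.
- by apply: prodr_ge0 => b _; exact: powR_ge0.
- apply: le_trans (HK' _ (dotp_ge0 x)).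
  apply: ge0_ler_powR => //; rewrite ?nnegrE.
  + by rewrite addr_ge0 ?sqr_ge0//; case/andP: eps01.
  + by rewrite addr_ge0// mulr_ge0// dotp_ge0.
  + apply: lerD; last by case/andP: eps01.
    by rewrite -!enorm_sqr -exprMn -real_normK ?num_real// lerXn2r ?nnegrE ?mulr_ge0 ?enorm_ge0 ?normr_dotp_le.
- exact: HK.
Qed.

Lemma dunkl_weight_scale (s : R) x : 0 < s ->
  dunkl_weight Rp k (s *: x) = s `^ (2 * \sum_(a <- Rp) k a) * dunkl_weight Rp k x.
Proof.
move=> s0; rewrite /dunkl_weight mulr_sumr.
elim: (enum_fset Rp) => [|a r IH]; first by rewrite !big_nil powRr0 mulr1.
rewrite !big_cons IH powRD; last by rewrite (gt_eqF s0) implybT.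
by rewrite dotpZr normrM (gtr0_norm s0) powRM// ?(ltW s0)// mulrACA.
Qed.

End dunkl_weight_facts.

Section dunkl_weight_invariance.
Context {R : realType} {d : nat}.
Variables (Rs Rp : {fset 'rV[R]_d}) (k : 'rV[R]_d -> R).
Hypotheses (hRs : root_system Rs) (hRp : positive_subsystem Rs Rp)
  (hk : multiplicity Rs k).

Lemma smooth_weight_reflection eps a x : a \in Rs ->
  smooth_weight Rp k eps (reflection a x) = smooth_weight Rp k eps x.
Proof.
move=> aR; rewrite /smooth_weight -(prod_positive_roots_reflection
  (F := fun b => (dotp b x ^+ 2 + eps) `^ k b) hRs hRp aR)/=.
- apply: eq_big_seq => b /(positive_root hRp) bR.
  by rewrite (multiplicity_reflection hk)// reflection_dotpC.
- by move=> b; exact: powR_ge0.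
- by move=> b bR; rewrite dotpNl sqrrN (multiplicityN hk).
Qed.

End dunkl_weight_invariance.

Section boxes.
Context {R : realType}.
Local Open Scope ereal_scope.

Definition box_indic {n} (u : 'rV[R]_n) (r : R) (x : 'rV[R]_n) : R :=
  (\prod_(i < n) \1_(ball (u ord0 i) r) (x ord0 i))%R.

Lemma box_indic_ge0 n (u : 'rV[R]_n) r x : (0 <= box_indic u r x)%R.
Proof. by apply: prodr_ge0. Qed.

Lemma measurable_box_indic n (u : 'rV[R]_n) r : measurable_fun setT (box_indic u r).
Proof.
rewrite /box_indic; elim: (index_enum 'I_n) => [|i s IH].
  rewrite (_ : (fun x => _) = cst 1%R); first exact: measurable_cst.
  by apply/funext => x; rewrite big_nil.
under eq_fun do rewrite big_cons.
apply: measurable_funM => //.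
apply: (measurableT_comp (f := \1_(ball (u ord0 i) r) : R -> R)).
  by apply: measurable_indic; exact: measurable_ball.
exact: measurable_rV_coord.
Qed.

Lemma integral_box n (u : 'rV[R]_n) (r : R) : (0 <= r)%R ->
  \int[lebesgue_rV n]_x (box_indic u r x)%:E = ((r *+ 2) ^+ n)%:E.
Proof.
move=> r0; elim: n u => [|n IH] u.
  rewrite integral_rV0; last by apply/measurable_EFinP; exact: measurable_box_indic.
  by rewrite /box_indic big_ord0 expr0.
rewrite integral_rVS; first last.
- by move=> x; rewrite lee_fin box_indic_ge0.
- by apply/measurable_EFinP; exact: measurable_box_indic.
pose u' : 'rV[R]_n := \row_j u ord0 (lift ord0 j).
transitivity (\int[lebesgue_measure]_t ((r *+ 2) ^+ n * \1_(ball (u ord0 ord0) r) t)%:E).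
  apply: eq_integral => t _; rewrite mulrC EFinM -(IH u').
  rewrite -ge0_integral_mulc; first last.
  - exact: box_indic_ge0.
  - exact: measurable_box_indic.
  - by [].
  apply: eq_integral => x _; rewrite /box_indic big_ord_recl !mxE unlift_none /=.
  by congr (_ * _)%:E; apply: eq_bigr => i _; rewrite !mxE liftK.
rewrite ge0_integral_mulc; first last.
- by [].
- by apply: measurable_indic; exact: measurable_ball.
- by rewrite exprn_ge0// mulrn_wge0.
rewrite integral_indic//; last exact: measurable_ball.
rewrite setIT; have := lebesgue_measure_ball (u ord0 ord0) r0 => /= ->.
by rewrite -EFinM exprSr.
Qed.

End boxes.

(** * The normalised Dunkl measure *)

Section dunkl_density_facts.
Context {R : realType} {d : nat}.
Local Notation V := 'rV[R]_d.
Local Notation mu := (@lebesgue_rV R d).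
Variables (Rs Rp : {fset V}) (k : V -> R).
Hypotheses (hRs : root_system Rs) (hRp : positive_subsystem Rs Rp)
  (hk : multiplicity Rs k).
Local Notation v := (dunkl_weight Rp k).
Local Notation w := (dunkl_density Rp k).
Local Notation nu := (lambda_k Rp k + 1).

Let k_ge0 a : a \in Rp -> 0 <= k a.
Proof. exact: multiplicity_ge0 hRp hk a. Qed.

(** A local lower bound off all hyperplanes; applied at the vector that defines [Rp], it shows that
    the weight has positive mass. *)
Lemma dunkl_weight_near (s : seq V) (u : V) : (forall a, a \in s -> 0 <= k a) ->
  (forall a, a \in s -> dotp a u != 0) ->
  exists2 m : R, 0 < m & \forall x \near u,
    m <= \prod_(a <- s) `|dotp a x| `^ (2 * k a).
Proof.
elim: s => [|a s IH] ks us.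
  by exists 1 => //; apply: (@filterE _ (nbhs u)) => x; rewrite big_nil.
have [|b bs|m m0 Hm] := IH.
- by move=> b bs; apply: ks; rewrite in_cons bs orbT.
- by apply: us; rewrite in_cons bs orbT.
have ua : 0 < `|dotp a u| by rewrite normr_gt0 us// mem_head.
have ka : 0 <= 2 * k a by rewrite mulr_ge0// ks// mem_head.
exists ((`|dotp a u| / 2) `^ (2 * k a) * m).
  by rewrite mulr_gt0// powR_gt0// divr_gt0.
have H : \forall x \near u, `|dotp u a - dotp x a| <= `|dotp a u| / 2.
  apply: (@cvgr_dist_le _ _ _ (nbhs u) _ (fun x => dotp x a)).
    exact: continuous_dotp.
  by rewrite divr_gt0.
move: Hm H; apply: filterS2 => x mx ax; rewrite big_cons ler_pM ?powR_ge0 ?(ltW m0)//.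
apply: ge0_ler_powR => //; rewrite ?nnegrE ?divr_ge0//.
have := ler_normD (dotp u a - dotp x a) (dotp x a); rewrite subrK (dotpC a x).
by move: ax; rewrite (dotpC a u); lra.
Qed.

Local Open Scope ereal_scope.

(** [dunkl_cst] inverts a real-valued integral, which would be read as 0 were it infinite; so
    finiteness and positivity come before any use of the density. Finiteness trades the weight for a
    factor exp(|x|^2/4); positivity comes from a small box around the vector defining [Rp]. *)
Lemma integral_gauss_weight : exists2 z : R, (0 < z)%R &
  \int[mu]_x (gauss (1 / 2) x * v x)%:E = z%:E.
Proof.
have mgv : measurable_fun setT (fun x : V => (gauss (1 / 2) x * v x)%R).
  by apply: measurable_funM; [exact: measurable_gauss|exact: measurable_dunkl_weight].
have gv0 x : (0 <= gauss (1 / 2) x * v x)%R.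
  by rewrite mulr_ge0 ?gauss_ge0 ?dunkl_weight_ge0.
have q0 : (0 < 4^-1 :> R)%R by rewrite invr_gt0.
have [K K0 HK] := smooth_weight_le k_ge0 q0.
have fin : \int[mu]_x (gauss (1 / 2) x * v x)%:E < +oo.
  apply: (@le_lt_trans _ _ (\int[mu]_x (K * gauss (1 / 4) x)%:E)).
    apply: ge0_integral_mono => //.
      by apply: measurable_funM => //; exact: measurable_gauss.
    move=> x; have := HK 0%R x; rewrite lexx ler01 smooth_weight0 => /(_ isT) H.
    apply: (@le_trans _ _ (gauss (1 / 2) x * (K * expR (4^-1 * dotp x x))))%R.
      by rewrite ler_wpM2l// gauss_ge0.
    rewrite mulrCA ler_wpM2l ?(ltW K0)// /gauss -expRD ler_expR.
    by lra.
  rewrite ge0_integral_mulc ?(ltW K0)//; [|exact: measurable_gauss|exact: gauss_ge0].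
  by rewrite integral_gauss -?EFinM ?ltry.
have pos : 0 < \int[mu]_x (gauss (1 / 2) x * v x)%:E.
  have [u u0 hu] := hRp.
  have [|a aR|m m0 Hm] := @dunkl_weight_near Rp u; first by move=> a /k_ge0.
    by apply: u0; exact: (positive_root hRp).
  have Hg : \forall x \near u, (`|gauss (1 / 2) u - gauss (1 / 2) x| <= gauss (1 / 2) u / 2)%R.
    apply: (@cvgr_dist_le _ _ _ (nbhs u) _ (gauss (1 / 2))).
      exact: continuous_gauss.
    by rewrite divr_gt0// gauss_gt0.
  have /nbhs_ballP[r /= r0 Hr] : \forall x \near u,
      (gauss (1 / 2) u / 2 * m <= gauss (1 / 2) x * v x)%R.
    move: Hm Hg; apply: filterS2 => x mx gx.
    apply: ler_pM => //; [by rewrite divr_ge0// gauss_ge0|exact: ltW|].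
    by move: gx; rewrite ler_norml => /andP[]; have := gauss_gt0 (1 / 2) u; lra.
  pose c : R := (gauss (1 / 2) u / 2 * m)%R.
  have c0 : (0 < c)%R by rewrite mulr_gt0// divr_gt0// gauss_gt0.
  apply: (@lt_le_trans _ _ (\int[mu]_x (c * box_indic u r x)%:E)).
    rewrite ge0_integral_mulc ?(ltW c0)//;
      [|exact: measurable_box_indic|exact: box_indic_ge0].
    rewrite integral_box ?(ltW r0)// -EFinM lte_fin mulr_gt0// exprn_gt0//.
    by rewrite mulrn_wgt0.
  apply: ge0_integral_mono => //.
  - by apply: measurable_funM => //; exact: measurable_box_indic.
  - by move=> x; rewrite mulr_ge0 ?box_indic_ge0// ltW.
  - move=> x; have [xr|xr] := pselect (ball u r x).
      have -> : box_indic u r x = 1%R.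
        case: xr => _ xr; rewrite /box_indic big1// => i _; rewrite indicE mem_set//.
      by rewrite mulr1; exact: Hr.
    suff -> : box_indic u r x = 0%R by rewrite mulr0.
    have [i xi] : exists i, ~ ball (u ord0 i) r (x ord0 i).
      apply: contrapT => H; apply: xr; split => // i j; rewrite (ord1 i).
      by apply: contrapT => H'; apply: H; exists j.
    by rewrite /box_indic (bigD1 i)//= indicE memNset// mul0r.
exists (fine (\int[mu]_x (gauss (1 / 2) x * v x)%:E)).
  by rewrite fine_gt0// pos.
by rewrite fineK// ge0_fin_numE// ltW.
Qed.

Lemma gauss_enorm (x : V) : expR (- (enorm x ^+ 2) / 2) = gauss (1 / 2) x.
Proof. by rewrite /gauss enorm_sqr; congr expR; lra. Qed.

Lemma dunkl_cst_gt0 : (0 < dunkl_cst Rp k)%R.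
Proof.
have [z z0 Hz] := integral_gauss_weight.
rewrite /dunkl_cst invr_gt0 /Rintegral.
under eq_integral do rewrite gauss_enorm.
by rewrite Hz.
Qed.

Lemma dunkl_density_ge0 x : (0 <= w x)%R.
Proof. by rewrite mulr_ge0 ?dunkl_weight_ge0// ltW// dunkl_cst_gt0. Qed.

Lemma measurable_dunkl_density : measurable_fun setT w.
Proof. by apply: measurable_funM => //; exact: measurable_dunkl_weight. Qed.

Lemma integral_gauss_half_density : \int[mu]_x (gauss (1 / 2) x * w x)%:E = 1.
Proof.
have [z z0 Hz] := integral_gauss_weight.
under eq_integral do rewrite mulrCA.
rewrite ge0_integral_mulc ?(ltW dunkl_cst_gt0)//; first last.
- by move=> x; rewrite mulr_ge0 ?gauss_ge0 ?dunkl_weight_ge0.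
- by apply: measurable_funM; [exact: measurable_gauss|exact: measurable_dunkl_weight].
rewrite Hz /dunkl_cst /Rintegral; under eq_integral do rewrite gauss_enorm.
by rewrite Hz -EFinM mulVf// gt_eqF.
Qed.

(** On such a hyperplane the density kills whatever value the Dunkl quotient is given. *)
Lemma dunkl_density_root0 a x : a \in Rp -> dotp a x = 0%R -> k a != 0%R -> w x = 0%R.
Proof.
move=> aR ax ka; rewrite /dunkl_density /dunkl_weight (big_rem a)//= ax normr0 powR0 ?mul0r ?mulr0//.
by rewrite mulf_neq0.
Qed.

Local Opaque dunkl_cst dunkl_weight.

Lemma dunkl_density_scale (s : R) x : (0 < s)%R ->
  w (s *: x) = (s `^ (2 * \sum_(a <- Rp) k a) * w x)%R.
Proof. by move=> s0; rewrite /dunkl_density dunkl_weight_scale// mulrCA. Qed.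

(** The Jacobian contributes s^(-d) and the homogeneity of the weight s^(-2 sum k), so 2 nu is the
    homogeneous dimension of the measure. *)
Lemma integral_density_scale (s : R) (f : V -> R) : (0 < s)%R ->
  measurable_fun setT f -> (forall x, (0 <= f x)%R) ->
  \int[mu]_x (f (s *: x) * w x)%:E = (s `^ (- (2 * nu)))%:E * \int[mu]_x (f x * w x)%:E.
Proof.
move=> s0 mf f0.
have mfw : measurable_fun setT (fun x => f x * w x)%R.
  by apply: measurable_funM => //; exact: measurable_dunkl_density.
have fw0 x : 0 <= (f x * w x)%:E by rewrite lee_fin mulr_ge0// dunkl_density_ge0.
have mfw' : measurable_fun setT (fun x => (f x * w x)%:E) by exact/measurable_EFinP.
have := integral_rV_scale s0 mfw' fw0.
under eq_integral do rewrite dunkl_density_scale// mulrCA.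
rewrite ge0_integral_mulc ?powR_ge0//; first last.
- by move=> x; rewrite mulr_ge0// dunkl_density_ge0.
- apply: measurable_funM; last exact: measurable_dunkl_density.
  by apply: (measurableT_comp mf); exact: measurable_rV_scale.
move=> H; set N := (2 * \sum_(a <- Rp) k a)%R in H.
have sN : (s `^ N)^-1%:E * (s `^ N)%:E = 1.
  by rewrite -EFinM mulVf// gt_eqF// powR_gt0.
have := congr1 (fun z => (s `^ N)^-1%:E * z) H.
rewrite !muleA sN mul1e -EFinM => ->; congr (_%:E * _).
rewrite -powR_invn ?(ltW s0)// -powRN -powRD; last by rewrite (gt_eqF s0) implybT.
by congr (s `^ _)%R; rewrite /N /lambda_k; lra.
Qed.

Lemma integral_gauss_density (b : R) : (0 < b)%R ->
  \int[mu]_x (gauss b x * w x)%:E = ((2 * b) `^ (- nu))%:E.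
Proof.
move=> b0; have b2 : (0 < 2 * b)%R by rewrite mulr_gt0.
have s0 : (0 < Num.sqrt (2 * b))%R by rewrite sqrtr_gt0.
have := integral_density_scale s0 (@measurable_gauss R d (1 / 2)) (gauss_ge0 _).
rewrite integral_gauss_half_density mule1.
rewrite -powR12_sqrt ?(ltW b2)// -powRrM.
have -> : (2^-1 * - (2 * nu) = - nu)%R by lra.
move=> <-; apply: eq_integral => x _; congr (_ * _)%:E.
rewrite /gauss dotpZl dotpZr powR12_sqrt ?(ltW b2)//; congr expR.
have : (Num.sqrt (2 * b) * (Num.sqrt (2 * b) * dotp x x) = 2 * b * dotp x x)%R.
  by rewrite mulrA -expr2 sqr_sqrtr// ltW.
by lra.
Qed.

(** The origin is invariant under doubling, so its measure is 2^(-d) times itself; comparison with a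
    Gaussian shows that it is finite. In dimension 0 the origin carries unit mass, hence d > 0. *)
Lemma rV_set1_null : (0 < d)%N -> mu [set 0%R] = 0.
Proof.
move=> d0.
have m0 : measurable [set 0%R : V].
  rewrite (_ : [set 0%R] = @enorm R d @^-1` [set 0%R]).
    by rewrite -[X in measurable X]setTI; apply: measurable_enorm.
  by apply/seteqP; split => x /=; [move=> ->; exact: enorm0|move/eqP; rewrite enorm_eq0 => /eqP].
pose f (x : V) : R := \1_[set 0%R] x.
have mf : measurable_fun setT f by apply: measurable_indic.
have mEf : measurable_fun setT (fun x => (f x)%:E) by exact/measurable_EFinP.
have fE : \int[mu]_x (f x)%:E = mu [set 0%R] by rewrite integral_indic// setIT.
have fin : mu [set 0%R] < +oo.
  rewrite -fE; apply: (@le_lt_trans _ _ (\int[mu]_x (gauss 1 x)%:E)).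
    apply: ge0_integral_mono => //; first exact: measurable_gauss.
    move=> x; rewrite /f indicE; have [->|x0] := eqVneq x 0%R.
      by rewrite mem_set// /gauss dotp0r mulr0 oppr0 expR0.
    by rewrite memNset ?gauss_ge0// => /eqP; rewrite (negbTE x0).
  by rewrite integral_gauss// ltry.
have : \int[mu]_x (f (2 *: x))%:E = (2 ^- d)%:E * \int[mu]_x (f x)%:E.
  by apply: (integral_rV_scale (f := fun x => (f x)%:E)) => // x; rewrite lee_fin.
rewrite (_ : \int[mu]_x (f (2 *: x))%:E = \int[mu]_x (f x)%:E); last first.
  apply: eq_integral => x _; congr EFin; rewrite /f !indicE; congr (nat_of_bool _)%:R.
  apply/idP/idP => /set_mem /= h; apply/mem_set => /=; last by rewrite h scaler0.
  by apply/eqP; move/eqP: h; rewrite scaler_eq0 pnatr_eq0.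
rewrite fE.
have : mu [set 0%R] \is a fin_num by rewrite ge0_fin_numE.
move=> /fineK <-; rewrite -EFinM => -[].
set t := fine _ => H; congr EFin.
have h2 : (2 ^- d < 1 :> R)%R by rewrite invf_lt1 ?exprn_gt0// exprn_egt1// ?ltr1n// -lt0n.
have /eqP : (t * (1 - 2 ^- d) = 0)%R by rewrite mulrBr mulr1 mulrC -H subrr.
by rewrite mulf_eq0 => /orP[/eqP//|]; rewrite subr_eq0 eq_sym (lt_eqF h2).
Qed.

End dunkl_density_facts.

(** * Real-valued integrals and dominated convergence *)

Section real_integrals.
Context {dT : measure_display} {T : measurableType dT} {R : realType}.
Variable mu : {measure set T -> \bar R}.
Implicit Types f g : T -> R.

Definition L1 f := mu.-integrable setT (EFin \o f).

Lemma L1_measurable f : L1 f -> measurable_fun setT f.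
Proof. by move=> /integrableP[mf _]; exact/measurable_EFinP. Qed.

Lemma L1D f g : L1 f -> L1 g -> L1 (fun x => f x + g x).
Proof.
move=> Lf Lg; have := integrableD measurableT Lf Lg.
by rewrite /L1 /comp; under eq_fun do rewrite -EFinD.
Qed.

Lemma L1Z (c : R) f : L1 f -> L1 (fun x => c * f x).
Proof. by move=> Lf; exact: (integrableZl measurableT c Lf). Qed.

Lemma L1N f : L1 f -> L1 (fun x => - f x).
Proof. by move=> /(L1Z (-1)); under eq_fun do rewrite mulN1r. Qed.

Lemma L1B f g : L1 f -> L1 g -> L1 (fun x => f x - g x).
Proof. by move=> Lf Lg; apply: L1D => //; exact: L1N. Qed.

Lemma L1_sum (I : Type) (s : seq I) (F : I -> T -> R) : (forall i, L1 (F i)) ->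
  L1 (fun x => \sum_(i <- s) F i x).
Proof.
move=> LF; elim: s => [|i s IH].
  under eq_fun do rewrite big_nil; exact: integrable0.
by under eq_fun do rewrite big_cons; exact: L1D.
Qed.

Lemma L1_dom f g : measurable_fun setT f -> (forall x, `|f x| <= g x) -> L1 g -> L1 f.
Proof.
move=> mf fg; apply: (le_integrable measurableT); first exact/measurable_EFinP.
by move=> x _ /=; rewrite lee_fin (le_trans (fg x))// ler_norm.
Qed.

Lemma Rint_EFin f : L1 f -> (\int[mu]_x (f x)%:E = (\int[mu]_x f x)%R%:E)%E.
Proof.
by move=> Lf; rewrite /Rintegral fineK//; exact: (integrable_fin_num measurableT Lf).
Qed.

Lemma RintD f g : L1 f -> L1 g ->
  \int[mu]_x (f x + g x) = \int[mu]_x f x + \int[mu]_x g x.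
Proof. by move=> Lf Lg; exact: (RintegralD measurableT Lf Lg). Qed.

Lemma RintB f g : L1 f -> L1 g ->
  \int[mu]_x (f x - g x) = \int[mu]_x f x - \int[mu]_x g x.
Proof. by move=> Lf Lg; exact: (RintegralB measurableT Lf Lg). Qed.

Lemma RintZ (c : R) f : L1 f -> \int[mu]_x (c * f x) = c * \int[mu]_x f x.
Proof. by move=> Lf; rewrite RintegralZl. Qed.

Lemma RintN f : L1 f -> \int[mu]_x (- f x) = - \int[mu]_x f x.
Proof.
move=> Lf; rewrite -mulN1r -RintZ//.
by apply: eq_Rintegral => x _; rewrite mulN1r.
Qed.

Lemma Rint_sum (I : Type) (s : seq I) (F : I -> T -> R) : (forall i, L1 (F i)) ->
  \int[mu]_x (\sum_(i <- s) F i x) = \sum_(i <- s) \int[mu]_x F i x.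
Proof.
move=> LF; elim: s => [|i s IH].
  under eq_Rintegral do rewrite big_nil.
  by rewrite big_nil /Rintegral integral0.
by under eq_Rintegral do rewrite big_cons; rewrite big_cons RintD ?IH//; exact: L1_sum.
Qed.

Lemma Rint_ext f g : (forall x, f x = g x) -> \int[mu]_x f x = \int[mu]_x g x.
Proof. by move=> fg; apply: eq_Rintegral => x _; exact: fg. Qed.

Lemma Rint_dominated_cvg (F : nat -> T -> R) f g :
  (forall n, measurable_fun setT (F n)) -> (forall x, F n x @[n --> \oo] --> f x) ->
  (forall n x, `|F n x| <= g x) -> L1 g ->
  L1 f /\ \int[mu]_x F n x @[n --> \oo] --> \int[mu]_x f x.
Proof.
move=> mF Ff Fg Lg.
have mf : measurable_fun setT f.
  by apply: (measurable_fun_cvg (h := F)) => // x _; exact: Ff.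
have LF n : L1 (F n) by exact: L1_dom (mF n) (Fg n) Lg.
have [] := @dominated_convergence _ _ _ mu setT measurableT
  (fun n x => (F n x)%:E) (EFin \o f) (EFin \o g).
- by move=> n; exact/measurable_EFinP.
- exact/measurable_EFinP.
- by apply: aeW => x _ /=; apply: cvg_EFin; [exact: nearW|exact: Ff].
- exact: Lg.
- by apply: aeW => x n _ /=; rewrite lee_fin.
move=> Lf _ H; split => //.
have E n : (\int[mu]_x (F n x)%:E = (\int[mu]_x F n x)%R%:E)%E by exact: Rint_EFin.
move: H; rewrite (_ : [sequence _]_n = fun n => (\int[mu]_x F n x)%R%:E); last first.
  by apply/funext => n; exact: E.
by rewrite /= (Rint_EFin Lf) => /fine_cvgP[].
Qed.

End real_integrals.

(** * Gaussian majorants and translation invariance *)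

Section gauss_domination.
Context {R : realType} {d : nat}.
Local Notation V := 'rV[R]_d.
Local Notation mu := (@lebesgue_rV R d).
Implicit Types (x xi : V).

Lemma L1_gauss (b C : R) : 0 < b -> L1 mu (fun x => C * gauss b x).
Proof.
move=> b0; apply: L1Z; apply/integrableP; split.
  by apply/measurable_EFinP; exact: measurable_gauss.
under eq_integral do rewrite /= ger0_norm ?gauss_ge0//.
by rewrite integral_gauss// ltry.
Qed.

(** From |x + 2 h|^2 >= 0 follows |x + h|^2 >= |x|^2/2 - |h|^2: half of the exponent pays for the
    shift. *)
Lemma gauss_shift_le (b : R) x h : 0 <= b ->
  gauss b (x + h) <= expR (b * dotp h h) * gauss (b / 2) x.
Proof.
move=> b0; rewrite /gauss -expRD ler_expR.
have := dotp_ge0 (x + 2 *: h).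
rewrite !(dotpDl, dotpDr, dotpZl, dotpZr) (dotpC h x).
set X := dotp x x; set Y := dotp x h; set Z := dotp h h => H.
rewrite -subr_ge0.
have -> : b * Z - b / 2 * X - - (b * (X + Y + (Y + Z))) =
  b / 2 * (X + 2 * Y + (2 * Y + 2 * (2 * Z))) by field.
by rewrite mulr_ge0// divr_ge0.
Qed.

Lemma enorm_le_gauss (c : R) : 0 < c -> exists2 K : R, 0 < K &
  forall x, 1 + enorm x <= K * expR (c * dotp x x).
Proof.
move=> c0; exists (1 + 1 + c^-1); first by rewrite !addr_gt0// invr_gt0.
move=> x; rewrite -enorm_sqr; have t0 := enorm_ge0 x; set t := enorm x in t0 *.
apply: (@le_trans _ _ ((1 + 1 + c^-1) * (1 + c * t ^+ 2))); last first.
  rewrite ler_wpM2l ?expR_ge1Dx//.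
  by rewrite !addr_ge0// invr_ge0 ltW.
have ci : 0 < c^-1 by rewrite invr_gt0.
have cc : c^-1 * (c * t ^+ 2) = t ^+ 2 by rewrite mulrA mulVf ?gt_eqF// mul1r.
have : 0 <= c * t ^+ 2 by rewrite mulr_ge0 ?sqr_ge0// ltW.
have := sqr_ge0 (t - 1).
by rewrite !mulrDl !mulrDr cc; nra.
Qed.

Lemma integral_rV_translate_signed (h : V) (f : V -> \bar R) : measurable_fun setT f ->
  (\int[mu]_x f (x + h)%R = \int[mu]_x f x)%E.
Proof.
move=> mf; rewrite integralE [RHS]integralE; congr (_ - _)%E.
- rewrite -[RHS](integral_rV_translate h (measurable_funepos mf) (funepos_ge0 f)).
  by apply: eq_integral => x _; rewrite !funeposE.
- rewrite -[RHS](integral_rV_translate h (measurable_funeneg mf) (funeneg_ge0 f)).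
  by apply: eq_integral => x _; rewrite !funenegE.
Qed.

Lemma Rint_rV_translate (h : V) (f : V -> R) : measurable_fun setT f ->
  \int[mu]_x f (x + h) = \int[mu]_x f x.
Proof.
move=> mf; congr fine; apply: (integral_rV_translate_signed h (f := EFin \o f)).
exact/measurable_EFinP.
Qed.

Lemma Rint_rV_reflection a (f : V -> R) : measurable_fun setT f ->
  \int[mu]_x f (reflection a x) = \int[mu]_x f x.
Proof.
move=> mf; have mEf : measurable_fun setT (EFin \o f) by exact/measurable_EFinP.
congr fine; rewrite integralE [RHS]integralE; congr (_ - _)%E.
- rewrite -[RHS](integral_rV_reflection a (measurable_funepos mEf)); last first.
    exact: funepos_ge0.
  by apply: eq_integral => x _; rewrite !funeposE.
- rewrite -[RHS](integral_rV_reflection a (measurable_funeneg mEf)); last first.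
    exact: funeneg_ge0.
  by apply: eq_integral => x _; rewrite !funenegE.
Qed.

Lemma near_harmonic_lt (r : R) : 0 < r -> \forall n \near \oo, n.+1%:R^-1 < r.
Proof.
move=> r0; exists (Num.trunc r^-1) => // n /= nr.
rewrite invf_plt ?posrE// (lt_le_trans (truncnS_gt _))// ler_nat.
exact: leq_trans nr _.
Qed.

Lemma mean_value_rV (F F' : V -> R) (xi x : V) (M h : R) : 0 <= h ->
  (forall x, is_derive x xi F (F' x)) ->
  (forall t, 0 <= t <= h -> `|F' (t *: xi + x)| <= M) ->
  `|F (h *: xi + x) - F x| <= M * h.
Proof.
move=> h0 dF bM.
have dphi t : is_derive t (1 : R) (fun s => F (s *: xi + x)) (F' (t *: xi + x)).
  exact: is_derive_line.
have [|t th H] := @MVT_segment _ (fun s : R => F (s *: xi + x))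
  (fun t => F' (t *: xi + x)) 0 h h0.
- by apply: derivable_within_continuous => t _; have [] := dphi t.
move: H; rewrite scale0r add0r subr0 => ->.
by rewrite normrM (ger0_norm h0) ler_wpM2r// bM// -in_itv.
Qed.

(* The difference quotients integrate to zero by translation invariance. *)
Lemma Rint_derive_eq0 (F F' : V -> R) (xi : V) (C b : R) : 0 < b ->
  measurable_fun setT F -> (forall x, is_derive x xi F (F' x)) ->
  (forall x, `|F x| <= C * gauss b x) -> (forall x, `|F' x| <= C * gauss b x) ->
  L1 mu F' /\ \int[mu]_x F' x = 0.
Proof.
move=> b0 mF dF bF bF'.
have LF : L1 mu F by apply: L1_dom mF bF _; exact: L1_gauss.
pose q n x := n.+1%:R * (F (x + n.+1%:R^-1 *: xi) - F x).
have mFh h : measurable_fun setT (fun x : V => F (x + h)).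
  by apply: (measurableT_comp mF); exact: measurable_rV_add.
have LFh h : L1 mu (fun x => F (x + h)).
  apply: (L1_dom (g := fun x => C * (expR (b * dotp h h)) * gauss (b / 2) x)) => //.
    move=> x; apply: (le_trans (bF _)); rewrite -mulrA ler_wpM2l//; last first.
      exact/gauss_shift_le/ltW.
    by have := bF 0; rewrite /gauss dotp0r mulr0 oppr0 expR0 mulr1; exact: le_trans.
  by apply: L1_gauss; rewrite divr_gt0.
have C0 : 0 <= C.
  by have := bF 0; rewrite /gauss dotp0r mulr0 oppr0 expR0 mulr1; exact: le_trans.
have [] := @Rint_dominated_cvg _ _ _ mu q F'
  (fun x => C * expR (b * dotp xi xi) * gauss (b / 2) x).
- by move=> n; apply: measurable_funM => //; apply: measurable_funB.
- move=> x; have [dx Dx] := dF x.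
  have H : (fun h : R => h^-1 *: ((F \o shift x) (h *: xi) - F x)) @ 0^' --> F' x.
    by rewrite -Dx; exact: dx.
  apply/cvgrPdist_lt => e e0; move/cvgrPdist_lt : H => /(_ e e0).
  rewrite near_withinE => /nbhs_ballP[r /= r0 Hr].
  apply: filterS (near_harmonic_lt r0) => n nr.
  have := Hr n.+1%:R^-1; rewrite /ball/= sub0r normrN ger0_norm// => /(_ nr).
  have nz : n.+1%:R^-1 != 0 :> R by rewrite invr_eq0 pnatr_eq0.
  by move=> /(_ nz); rewrite invrK /q [x + _]addrC.
- move=> n x; rewrite /q normrM ger0_norm// mulrC -ler_pdivlMr ?ltr0Sn//.
  rewrite (addrC x); apply: (@mean_value_rV F F' xi x _ n.+1%:R^-1) => //.
  move=> t /andP[t0 tn]; apply: (le_trans (bF' _)); rewrite -mulrA ler_wpM2l//.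
  rewrite addrC; apply: (le_trans (gauss_shift_le _ _ (ltW b0))).
  rewrite ler_wpM2r ?gauss_ge0// ler_expR ler_wpM2l ?(ltW b0)//.
  rewrite dotpZl dotpZr mulrA ler_piMl ?dotp_ge0// -expr2 expr_le1//.
  by rewrite (le_trans tn)// invf_le1 ?ler1n ?ltr0Sn.
- by apply: L1_gauss; rewrite divr_gt0.
move=> LF' H; split => //.
suff E n : \int[mu]_x q n x = 0.
  by move/cvg_lim : H => <-//; under eq_fun do rewrite E; exact: lim_cst.
rewrite /q RintZ; last exact: L1B.
by rewrite RintB// Rint_rV_translate// subrr mulr0.
Qed.

End gauss_domination.

(** * Integration by parts for Dunkl operators *)

Section directional_derivatives.
Context {R : realType} {d : nat}.
Local Notation V := 'rV[R]_d.
Implicit Types (x xi : V).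

Lemma is_derive_of_line (f : V -> R) x xi (D : R) :
  is_derive (0 : R) (1 : R) (fun s => f (s *: xi + x)) D -> is_derive x xi f D.
Proof.
move=> [df Df].
have E : (fun h : R => h^-1 *: (((fun s => f (s *: xi + x)) \o shift 0) (h *: 1) -
     f (0 *: xi + x))) =
   (fun h : R => h^-1 *: ((f \o shift x) (h *: xi) - f x)).
  apply/funext => h /=; rewrite scale0r add0r addr0; congr (_ *: (f _ - _)).
  by rewrite (_ : h *: (1 : R) = h) ?[LHS]mulr1.
by apply: DeriveDef; move: df Df; rewrite /derivable /derive /= E.
Qed.

Lemma is_derive_compV (h : R -> R) (f : V -> R) x xi (dh df : R) :
  is_derive (f x) (1 : R) h dh -> is_derive x xi f df ->
  is_derive x xi (fun y => h (f y)) (dh * df).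
Proof.
move=> Hh Hf; apply: is_derive_of_line.
apply: (is_derive_comp (h := h) (f := fun s => f (s *: xi + x))).
  by rewrite scale0r add0r.
by apply: is_derive_line; rewrite scale0r add0r.
Qed.

Lemma is_derive_dotp (a x xi : V) : is_derive x xi (dotp a) (dotp a xi).
Proof.
apply: is_derive_of_line.
rewrite (_ : (fun s => _) = (fun s : R => s * dotp a xi + dotp a x)); last first.
  by apply/funext => s; rewrite dotpDr dotpZr.
rewrite -[X in is_derive _ _ _ X]addr0.
apply: is_derive_add; under eq_fun do rewrite mulrC; exact: is_derive_linear.
Qed.

Lemma is_derive_sqnorm x xi :
  is_derive x xi (fun y : V => dotp y y) (2 * dotp x xi).
Proof.
apply: is_derive_of_line.
rewrite (_ : (fun s => _) = (fun s : R => dotp xi xi * (s * s) +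
    (2 * dotp x xi * s + dotp x x))); last first.
  apply/funext => s; rewrite !(dotpDr, dotpDl, dotpZr, dotpZl) (dotpC xi x); ring.
have h1 : is_derive (0 : R) (1 : R) (fun s : R => s * s) (1 * 0 + 0 * 1).
  by apply: is_derive_mul; exact: is_derive_id.
have h2 := is_derive_linear (2 * dotp x xi) 0.
have h3 : is_derive (0 : R) (1 : R) (fun=> dotp x x) 0 by exact: is_derive_cst.
apply: (is_derive_eq (is_derive_add (is_derive_mulc (dotp xi xi) h1) (is_derive_add h2 h3))).
by rewrite mul0r mulr0 !addr0 mulr0 add0r.
Qed.

Lemma is_derive_gauss (b : R) x xi :
  is_derive x xi (gauss b) (gauss b x * - (b * (2 * dotp x xi))).
Proof.
apply: (is_derive_compV (h := expR) (f := fun y => - (b * dotp y y))).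
by apply: is_derive_opp; apply: is_derive_mulc; exact: is_derive_sqnorm.
Qed.

Lemma lipschitz_derive_le (f : V -> R) (L : R) x xi (D : R) :
  (forall x y, `|f x - f y| <= L * enorm (x - y)) -> is_derive x xi f D ->
  `|D| <= L * enorm xi.
Proof.
move=> fL [df Df].
have H : (fun h : R => h^-1 *: ((f \o shift x) (h *: xi) - f x)) @ 0^' --> D.
  by rewrite -Df; exact: df.
have H2 : (fun h : R => `|h^-1 *: ((f \o shift x) (h *: xi) - f x)|) @ 0^' --> `|D|.
  exact: cvg_norm.
rewrite -(cvg_lim _ H2)//; apply: limr_le; first by apply/cvg_ex; eexists; exact: H2.
near=> h; have h0 : h != 0 by near: h; exact: nbhs_dnbhs_neq.
rewrite normrZ normfV ler_pdivrMl ?normr_gt0//= (le_trans (fL _ _))//.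
by rewrite addrK enormZ mulrCA.
Unshelve. all: by end_near. Qed.

End directional_derivatives.

Section smooth_weight_derivative.
Context {R : realType} {d : nat}.
Local Notation V := 'rV[R]_d.
Variables (Rp : {fset V}) (k : V -> R) (eps : R).
Hypothesis eps0 : 0 < eps.
Implicit Types (x xi : V).

(** Half the logarithmic derivative of t^2 + eps: a bounded substitute for 1/t matched to
    [smooth_weight]. At eps = 0 it is 1/t, with value 0 at t = 0. *)
Definition smooth_inv (t : R) : R := t / (t ^+ 2 + eps).

Let pos t : 0 < t ^+ 2 + eps :> R.
Proof. by rewrite ltr_wpDl// sqr_ge0. Qed.

Lemma smooth_weightE x :
  smooth_weight Rp k eps x = expR (\sum_(a <- Rp) k a * ln (dotp a x ^+ 2 + eps)).
Proof.
rewrite /smooth_weight; elim: (enum_fset Rp) => [|a s IH].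
  by rewrite !big_nil expR0.
by rewrite !big_cons expRD IH /powR gt_eqF.
Qed.

Lemma is_derive_smooth_weight x xi : is_derive x xi (smooth_weight Rp k eps)
  (smooth_weight Rp k eps x *
   \sum_(a <- Rp) 2 * (k a * dotp a xi) * smooth_inv (dotp a x)).
Proof.
rewrite (_ : smooth_weight Rp k eps = fun y =>
  expR (\sum_(a <- Rp) k a * ln (dotp a y ^+ 2 + eps))); last first.
  by apply/funext => y; rewrite smooth_weightE.
apply: (is_derive_compV (h := expR) (f := fun y =>
  \sum_(a <- Rp) k a * ln (dotp a y ^+ 2 + eps))).
elim: (enum_fset Rp) => [|a s IH].
  rewrite big_nil (_ : (fun y => _) = cst 0); first exact: is_derive_cst.
  by apply/funext => y; rewrite big_nil.
rewrite big_cons (_ : (fun y => _) = fun y => k a * ln (dotp a y ^+ 2 + eps) +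
  \sum_(a <- s) k a * ln (dotp a y ^+ 2 + eps)); last first.
  by apply/funext => y; rewrite big_cons.
apply: is_derive_add => //.
have h1 : is_derive (dotp a x) (1 : R) (fun t : R => t * t + eps)
    (1 * dotp a x + dotp a x * 1 + 0).
  apply: is_derive_add.
  have H := is_derive_mul (is_derive_id (dotp a x) (1:R)) (is_derive_id (dotp a x) (1:R)).
  apply: (is_derive_eq H); ring.
have h2 : is_derive (dotp a x * dotp a x + eps) (1 : R) (@ln R)
    (dotp a x * dotp a x + eps)^-1.
  by apply: is_derive1_ln; rewrite -expr2.
have h3 := is_derive_comp (h := @ln R) (f := fun t => t * t + eps) h2 h1.
have h4 := is_derive_mulc (k a) (is_derive_compV (f := dotp a)
  (h := fun t : R => ln (t * t + eps)) h3 (is_derive_dotp a x xi)).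
apply: (is_derive_eq h4); rewrite /smooth_inv expr2.
by field; rewrite -expr2 gt_eqF.
Qed.

Lemma normr_smooth_inv_le (t : R) : eps <= 1 -> `|smooth_inv t| <= eps^-1.
Proof.
move=> e1; rewrite normrM normfV (gtr0_norm (pos t)) ler_pdivrMr//.
rewrite mulrDr mulVf ?gt_eqF// -(real_normK (num_real t)).
have ei : 1 <= eps^-1 by rewrite invf_ge1.
have := normr_ge0 t; set s := `|t| => s0.
have : 0 <= (eps^-1 - 1) * s ^+ 2 by rewrite mulr_ge0 ?subr_ge0// sqr_ge0.
have := sqr_ge0 (s - 1); nra.
Qed.

Lemma smooth_invN t : smooth_inv (- t) = - smooth_inv t.
Proof. by rewrite /smooth_inv sqrrN mulNr. Qed.

(** Unlike the bound by 1/eps, this one is uniform in eps: paired with a Lipschitz difference across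
    the hyperplane, which is of size |<a, x>|, it yields a majorant that survives eps -> 0. *)
Lemma smooth_inv_le (t : R) : `|t * smooth_inv t| <= 1.
Proof.
rewrite /smooth_inv mulrA -expr2 normrM normfV (gtr0_norm (pos t)).
by rewrite ler_pdivrMr// mul1r ger0_norm ?sqr_ge0// lerDl ltW.
Qed.

Lemma measurable_smooth_inv a : measurable_fun setT (fun x : V => smooth_inv (dotp a x)).
Proof.
have ma : measurable_fun setT (dotp a).
  rewrite (_ : dotp a = (fun x => dotp x a)); first exact: measurable_rV_dotp.
  by apply/funext => x; rewrite dotpC.
apply: continuous_measurable_rV => x.
have cd : dotp a y @[y --> x] --> dotp a x.
  by rewrite dotpC; under eq_fun do rewrite dotpC; exact: continuous_dotp.
apply: (@cvgM _ _ (nbhs x)) => //; apply: (@cvgV _ _ (nbhs x)); first by rewrite gt_eqF.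
by apply: (@cvgD _ _ _ (nbhs x)); [exact: (@cvgM _ _ (nbhs x))|exact: cvg_cst].
Qed.

End smooth_weight_derivative.

Lemma cvg_harmonic_shift {R : realType} (t : R) : t + n.+1%:R^-1 @[n --> \oo] --> t.
Proof.
rewrite -[X in _ --> X]addr0; apply: cvgD; first exact: cvg_cst.
exact: cvg_harmonic.
Qed.

Lemma powR_harmonic_cvg {R : realType} (t p : R) : 0 <= t -> 0 <= p ->
  (t + n.+1%:R^-1) `^ p @[n --> \oo] --> t `^ p.
Proof.
move=> t0 p0; have [->|pn0] := eqVneq p 0.
  by under eq_fun do rewrite powRr0; rewrite powRr0; exact: cvg_cst.
have [->|tn0] := eqVneq t 0.
  rewrite powR0//; apply: (cvg_comp (fun n => 0 + n.+1%:R^-1) (fun s : R => s `^ p));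
    last by apply: powR_cvg0; rewrite lt0r pn0.
  move=> A /= [r r0 Ar]; suff : \forall n \near \oo, A (0 + n.+1%:R^-1) by [].
  apply: filterS (near_harmonic_lt r0) => n nr.
  have n0 : 0 < n.+1%:R^-1 :> R by rewrite invr_gt0.
  by rewrite add0r; apply: Ar => //=; rewrite sub0r normrN ger0_norm ?(ltW n0).
have tp : 0 < t by rewrite lt0r tn0.
apply: (cvg_comp (fun n => t + n.+1%:R^-1) (fun s : R => s `^ p)).
  exact: cvg_harmonic_shift.
have dp : derivable (fun s : R => s `^ p) t 1.
  by apply: derivable_powR; rewrite in_itv/= tp.
exact: (differentiable_continuous (proj1 (derivable1_diffP _ _) dp)).
Qed.

(** * Integration by parts with the regularised weight, and its limit *)

Section integration_by_parts.
Context {R : realType} {d : nat}.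
Local Notation V := 'rV[R]_d.
Local Notation mu := (@lebesgue_rV R d).
Variables (Rs Rp : {fset V}) (k : V -> R).
Hypotheses (hRs : root_system Rs) (hRp : positive_subsystem Rs Rp)
  (hk : multiplicity Rs k).
Local Notation sw := (smooth_weight Rp k).
Local Notation v := (dunkl_weight Rp k).
Local Notation w := (dunkl_density Rp k).
Local Notation G := (@gauss R d (1 / 2)).
Implicit Types (x xi : V).

Let k_ge0 a : a \in Rp -> 0 <= k a.
Proof. exact: multiplicity_ge0 hRp hk a. Qed.

Lemma measurable_derive_rV (f f' : V -> R) xi : measurable_fun setT f ->
  (forall x, is_derive x xi f (f' x)) -> measurable_fun setT f'.
Proof.
move=> mf df; pose q n x := n.+1%:R * (f (x + n.+1%:R^-1 *: xi) - f x).
apply: (measurable_fun_cvg (h := q)) => [n|x _].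
  apply: measurable_funM => //; apply: measurable_funB => //.
  by apply: (measurableT_comp mf); exact: measurable_rV_add.
have [dx Dx] := df x.
have H : (fun h : R => h^-1 *: ((f \o shift x) (h *: xi) - f x)) @ 0^' --> f' x.
  by rewrite -Dx; exact: dx.
apply/cvgrPdist_lt => e e0; move/cvgrPdist_lt : H => /(_ e e0).
rewrite near_withinE => /nbhs_ballP[r /= r0 Hr].
apply: filterS (near_harmonic_lt r0) => n nr.
have := Hr n.+1%:R^-1; rewrite /ball/= sub0r normrN ger0_norm// => /(_ nr).
have nz : n.+1%:R^-1 != 0 :> R by rewrite invr_eq0 pnatr_eq0.
by move=> /(_ nz); rewrite invrK /q [x + _]addrC.
Qed.

Lemma gauss_smooth_weight_le : exists2 K : R, 0 < K &
  forall eps M (h : V -> R) x, 0 <= eps <= 1 -> `|h x| <= M * (1 + enorm x) ->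
    `|G x * sw eps x * h x| <= K * M * gauss (1 / 4) x.
Proof.
(* Of the exponent 1/2 of [G], 1/8 pays for the weight and 1/8 for the linear growth of h; 1/4 is
   left. *)
have c0 : 0 < 8^-1 :> R by rewrite invr_gt0.
have [K1 K10 HK1] := smooth_weight_le k_ge0 c0.
have [K2 K20 HK2] := @enorm_le_gauss R d 8^-1 c0.
exists (K1 * K2); first exact: mulr_gt0.
move=> eps M h x e01 hM.
have M0 : 0 <= M.
  have := le_trans (normr_ge0 _) hM; rewrite pmulr_lge0//.
  by rewrite ltr_pwDl// enorm_ge0.
rewrite !normrM (ger0_norm (gauss_ge0 _ _)) (ger0_norm (smooth_weight_ge0 _ _ _ _)).
apply: (@le_trans _ _ (G x * (K1 * expR (8^-1 * dotp x x)) *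
    (M * (K2 * expR (8^-1 * dotp x x))))).
  apply: ler_pM => //.
  - by rewrite mulr_ge0 ?gauss_ge0 ?smooth_weight_ge0.
  - by rewrite ler_wpM2l ?gauss_ge0// HK1.
  - by rewrite (le_trans hM)// ler_wpM2l// HK2.
rewrite (_ : gauss (1 / 4) x = G x * (expR (8^-1 * dotp x x) * expR (8^-1 * dotp x x))).
  by rewrite le_eqVlt; apply/orP; left; apply/eqP; ring.
rewrite /gauss -!expRD; congr expR; lra.
Qed.

Variables (f g f' g' : V -> R) (xi : V) (L : R).
Hypotheses (f1 : forall x, `|f x| <= 1) (g1 : forall x, `|g x| <= 1)
  (fL : forall x y, `|f x - f y| <= L * enorm (x - y))
  (gL : forall x y, `|g x - g y| <= L * enorm (x - y))
  (df : forall x, is_derive x xi f (f' x))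
  (dg : forall x, is_derive x xi g (g' x)).

Let mf : measurable_fun setT f.
Proof. by apply: continuous_measurable_rV; exact: lipschitz_continuous_rV fL. Qed.

Let mg : measurable_fun setT g.
Proof. by apply: continuous_measurable_rV; exact: lipschitz_continuous_rV gL. Qed.

Let mf' : measurable_fun setT f'.
Proof. exact: measurable_derive_rV mf df. Qed.

Let mg' : measurable_fun setT g'.
Proof. exact: measurable_derive_rV mg dg. Qed.

Let mdotp (a : V) : measurable_fun setT (dotp a).
Proof.
rewrite (_ : dotp a = (fun x => dotp x a)); first exact: measurable_rV_dotp.
by apply/funext => x; rewrite dotpC.
Qed.

(** What the derivative of [G] f g along xi leaves after [G] is factored out. *)
Let A x : R := f' x * g x + f x * g' x - dotp x xi * (f x * g x).

Let mA : measurable_fun setT A.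
Proof.
apply: measurable_funB.
  by apply: measurable_funD; apply: measurable_funM.
by apply: measurable_funM; [exact: measurable_rV_dotp|apply: measurable_funM].
Qed.

Let L0 : 0 <= L * enorm xi.
Proof. exact: le_trans (normr_ge0 _) (lipschitz_derive_le fL (df 0)). Qed.

Let fg1 x : `|f x * g x| <= 1.
Proof. by rewrite normrM mulr_ile1. Qed.

Let A_le x : `|A x| <= (2 * (L * enorm xi) + enorm xi) * (1 + enorm x).
Proof.
have h1 : `|f' x * g x| <= L * enorm xi.
  rewrite normrM -[leRHS]mulr1 ler_pM// (lipschitz_derive_le fL)//.
have h2 : `|f x * g' x| <= L * enorm xi.
  rewrite normrM -[leRHS]mul1r ler_pM// (lipschitz_derive_le gL)//.
have h3 : `|dotp x xi * (f x * g x)| <= enorm x * enorm xi.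
  by rewrite normrM -[leRHS]mulr1 ler_pM// normr_dotp_le.
rewrite (le_trans (ler_normB _ _))// (le_trans (lerD (ler_normD _ _) h3))//.
have := enorm_ge0 x; have := enorm_ge0 xi.
have := mulr_ge0 L0 (enorm_ge0 x); nra.
Qed.

(** Differentiating the weight produces 2 k <a, xi> [smooth_inv] f g for each root. With f_a for f
    composed with the reflection, write 2 f g as (f - f_a) g + f (g - g_a) plus f_a g + f g_a. The
    first group forms [D], which tends to the difference terms of the Dunkl operators; the second
    forms [T], which is odd under the reflection and integrates to 0. *)
Let D eps x : R := \sum_(a <- Rp) k a * dotp a xi * (smooth_inv eps (dotp a x) *
  ((f x - f (reflection a x)) * g x + f x * (g x - g (reflection a x)))).

Let T eps a x : R := k a * dotp a xi * (smooth_inv eps (dotp a x) *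
  (f (reflection a x) * g x + f x * g (reflection a x))).

Let mrefl (h : V -> R) a : measurable_fun setT h ->
  measurable_fun setT (fun x => h (reflection a x)).
Proof. by move=> mh; apply: (measurableT_comp mh); exact: measurable_rV_reflection. Qed.

Let mT eps a : 0 < eps -> measurable_fun setT (T eps a).
Proof.
move=> e0; apply: measurable_funM => //.
apply: measurable_funM; first exact: measurable_smooth_inv.
by apply: measurable_funD; apply: measurable_funM => //; exact: mrefl.
Qed.

Let mD eps : 0 < eps -> measurable_fun setT (D eps).
Proof.
move=> e0; rewrite /D; elim: (enum_fset Rp) => [|a s IH].
  by under eq_fun do rewrite big_nil; exact: measurable_cst.
under eq_fun do rewrite big_cons.
apply: measurable_funD => //; apply: measurable_funM => //.
apply: measurable_funM; first exact: measurable_smooth_inv.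
by apply: measurable_funD; apply: measurable_funM => //; apply: measurable_funB => //;
  exact: mrefl.
Qed.

Let B : R := \sum_(a <- Rp) `|k a * dotp a xi| * (4 * `|L| / enorm a).

(** Each of the two differences is at most 2 |L| |<a, x>|/|a|, and [smooth_inv_le] absorbs |<a, x>|
    at no cost in eps. *)
Let D_le eps x : 0 < eps -> `|D eps x| <= B.
Proof.
move=> e0; rewrite (le_trans (ler_norm_sum _ _ _))// big_seq [leRHS]big_seq.
apply: ler_sum => a aR; rewrite normrM ler_wpM2l//.
have an0 : a != 0 := positive_root_neq0 hRs hRp aR.
have ea : 0 < enorm a by rewrite enorm_gt0.
have h (u : V -> R) : (forall x y, `|u x - u y| <= L * enorm (x - y)) ->
    `|u x - u (reflection a x)| <= 2 * `|L| / enorm a * `|dotp a x|.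
  move=> uL; rewrite (le_trans (uL _ _))// enorm_sub_reflection//.
  rewrite (_ : L * _ = L * (2 / enorm a * `|dotp a x|)); last by ring.
  rewrite (_ : _ * `|dotp a x| = `|L| * (2 / enorm a * `|dotp a x|)); last by ring.
  by rewrite ler_wpM2r ?ler_norm// mulr_ge0// divr_ge0// ltW.
rewrite normrM.
apply: (@le_trans _ _ (`|smooth_inv eps (dotp a x)| * (4 * `|L| / enorm a * `|dotp a x|))).
  rewrite ler_wpM2l// (le_trans (ler_normD _ _))// !normrM.
  have := h _ fL; have := h _ gL.
  set X := 2 * _ / _ * _ => hg hf.
  rewrite (_ : 4 * _ / _ * _ = X * 1 + 1 * X); last by rewrite /X; field; rewrite gt_eqF.
  by apply: lerD; apply: ler_pM.
rewrite mulrCA -[leRHS]mulr1 ler_wpM2l//.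
  by rewrite divr_ge0// ?mulr_ge0// ltW.
by rewrite -normrM mulrC smooth_inv_le.
Qed.

Let L1_weighted eps M (h : V -> R) : 0 <= eps <= 1 -> measurable_fun setT h ->
  (forall x, `|h x| <= M * (1 + enorm x)) -> L1 mu (fun x => G x * sw eps x * h x).
Proof.
move=> e01 mh hM; have [K K0 HK] := gauss_smooth_weight_le.
apply: (L1_dom (g := fun x => K * M * gauss (1 / 4) x)).
- apply: measurable_funM => //; apply: measurable_funM; first exact: measurable_gauss.
  exact: measurable_smooth_weight.
- by move=> x; exact: HK.
- by apply: L1_gauss; rewrite divr_gt0.
Qed.

Let cst_le (M : R) x : 0 <= M -> M <= M * (1 + enorm x).
Proof. by move=> M0; rewrite ler_peMr// lerDl enorm_ge0. Qed.

Let T_le eps a x : 0 < eps -> eps <= 1 ->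
  `|T eps a x| <= `|k a * dotp a xi| * (eps^-1 * 2).
Proof.
move=> e0 e1; rewrite normrM ler_wpM2l// normrM ler_pM// ?normr_smooth_inv_le//.
rewrite (le_trans (ler_normD _ _))// !normrM (_ : 2 = 1 + 1)//.
by apply: lerD; rewrite mulr_ile1.
Qed.

Let T_odd eps a x : a \in Rp -> T eps a (reflection a x) = - T eps a x.
Proof.
move=> aR; have an0 : a != 0 := positive_root_neq0 hRs hRp aR.
rewrite /T reflectionK// dotp_reflectionr smooth_invN.
ring.
Qed.

Let integral_T eps a : 0 < eps -> eps <= 1 -> a \in Rp ->
  \int[mu]_x (G x * sw eps x * T eps a x) = 0.
Proof.
move=> e0 e1 aR; set I := LHS.
have mGT : measurable_fun setT (fun x => G x * sw eps x * T eps a x).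
  apply: measurable_funM; last exact: mT.
  by apply: measurable_funM; [exact: measurable_gauss|exact: measurable_smooth_weight].
have LT : L1 mu (fun x => G x * sw eps x * T eps a x).
  apply: (L1_weighted (M := `|k a * dotp a xi| * (eps^-1 * 2))) => //.
  - by rewrite (ltW e0).
  - exact: mT.
  - move=> x; apply: (le_trans (T_le _ _ e0 e1)); apply: cst_le.
    by rewrite mulr_ge0// mulr_ge0// invr_ge0 ltW.
have E : I = - I.
  rewrite -{2}/I -RintN// /I -[LHS](Rint_rV_reflection a mGT).
  apply: Rint_ext => x.
  rewrite T_odd// (smooth_weight_reflection hRs hRp hk)//; last exact: positive_root hRp _ aR.
  by rewrite /gauss dotp_reflection// mulrN.
by lra.
Qed.

Let integral_AD eps : 0 < eps -> eps <= 1 ->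
  \int[mu]_x (G x * sw eps x * (A x + D eps x)) = 0.
Proof.
move=> e0 e1; have e01 : 0 <= eps <= 1 by rewrite (ltW e0).
pose S x : R := \sum_(a <- Rp) 2 * (k a * dotp a xi) * smooth_inv eps (dotp a x).
have SE x : A x + S x * (f x * g x) = (A x + D eps x) + \sum_(a <- Rp) T eps a x.
  rewrite -[RHS]addrA; congr (A x + _); rewrite /S /D mulr_suml -big_split/=.
  by apply: eq_bigr => a _; rewrite /T; ring.
pose F x : R := G x * sw eps x * (f x * g x).
pose F' x : R := G x * sw eps x * (A x + S x * (f x * g x)).
have dF x : is_derive x xi F (F' x).
  have h1 := is_derive_mul (is_derive_gauss (1 / 2) x xi)
    (@is_derive_smooth_weight R d Rp k eps e0 x xi).
  have h2 := is_derive_mul (df x) (dg x).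
  apply: (is_derive_eq (is_derive_mul h1 h2)).
  by rewrite /F' /A -/(S x); field.
pose M := 2 * (L * enorm xi) + enorm xi + \sum_(a <- Rp)
  (`|k a * dotp a xi| * (4 * `|L| / enorm a) + `|k a * dotp a xi| * (eps^-1 * 2)).
have [K K0 HK] := gauss_smooth_weight_le.
have pos4 : 0 < 1 / 4 :> R by rewrite divr_gt0.
have S0 : 0 <= \sum_(a <- Rp) `|k a * dotp a xi| * (eps^-1 * 2).
  by apply: sumr_ge0 => a _; rewrite mulr_ge0// mulr_ge0// invr_ge0 ltW.
have B0 : 0 <= B by exact: le_trans (normr_ge0 _) (D_le 0 e0).
have bF' x : `|A x + S x * (f x * g x)| <= M * (1 + enorm x).
  rewrite SE /M big_split/= -/B addrA mulrDl.
  apply: (le_trans (ler_normD _ _)); apply: lerD.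
    rewrite mulrDl; apply: (le_trans (ler_normD _ _)); apply: lerD; first exact: A_le.
    by apply: le_trans (D_le _ e0) _; exact: cst_le.
  apply: le_trans (cst_le _ S0).
  by rewrite (le_trans (ler_norm_sum _ _ _))// ler_sum// => a _; exact: T_le.
have M1 : 0 <= M.
  have := le_trans (normr_ge0 _) (bF' 0); rewrite enorm0 addr0 mulr1//.
(* One constant must serve both [F], where |f g| <= 1, and its derivative, hence M + 1. *)
have [] := @Rint_derive_eq0 R d F F' xi (K * (M + 1)) (1 / 4) pos4.
- apply: measurable_funM; last exact: measurable_funM.
  by apply: measurable_funM; [exact: measurable_gauss|exact: measurable_smooth_weight].
- move=> x; apply: (HK eps (M + 1) (fun x => f x * g x)) => //.
  by rewrite (le_trans (fg1 x))// (le_trans _ (cst_le _ _)) ?lerDr// addr_ge0.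
- move=> x; apply: (HK eps (M + 1) (fun x => A x + S x * (f x * g x))) => //.
  by rewrite (le_trans (bF' x))// ler_wpM2r ?lerDl// addr_ge0// enorm_ge0.
move=> _.
have LAD : L1 mu (fun x => G x * sw eps x * (A x + D eps x)).
  apply: (L1_weighted (M := 2 * (L * enorm xi) + enorm xi + B)) => //.
    by apply: measurable_funD => //; exact: mD.
  move=> x; rewrite (le_trans (ler_normD _ _))// mulrDl lerD// ?A_le//.
  by apply: le_trans (D_le _ e0) _; exact: cst_le.
have LT a : L1 mu (fun x => G x * sw eps x * T eps a x).
  apply: (L1_weighted (M := `|k a * dotp a xi| * (eps^-1 * 2))) => //.
  - exact: mT.
  - move=> x; apply: (le_trans (T_le _ _ e0 e1)); apply: cst_le.
    by rewrite mulr_ge0// mulr_ge0// invr_ge0 ltW.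
rewrite (@Rint_ext _ _ _ mu _ (fun x => G x * sw eps x * (A x + D eps x) +
   \sum_(a <- Rp) G x * sw eps x * T eps a x)); last first.
  by move=> x; rewrite /F' SE mulrDr mulr_sumr.
rewrite RintD//; last exact: L1_sum.
rewrite Rint_sum// [X in _ + X]big_seq big1 ?addr0// => a aR.
exact: integral_T.
Qed.

Let smooth_inv_cvg (t : R) : smooth_inv n.+1%:R^-1 t @[n --> \oo] --> t^-1.
Proof.
rewrite /smooth_inv; have [->|t0] := eqVneq t 0.
  by under eq_fun do rewrite mul0r; rewrite invr0; exact: cvg_cst.
rewrite [X in _ --> X](_ : _ = t / (t ^+ 2)); last by field.
apply: cvgM; first exact: cvg_cst.
by apply: cvgV; [rewrite sqrf_eq0|exact: cvg_harmonic_shift].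
Qed.

Let sw_cvg x : sw n.+1%:R^-1 x @[n --> \oo] --> v x.
Proof.
rewrite -smooth_weight0 /smooth_weight; have : {subset enum_fset Rp <= Rp} by [].
elim: (enum_fset Rp) => [|a s IH] sub.
  by under eq_fun do rewrite big_nil; rewrite big_nil; exact: cvg_cst.
under eq_fun do rewrite big_cons; rewrite big_cons.
apply: cvgM; last by apply: IH => b bs; apply: sub; rewrite inE bs orbT.
rewrite addr0; apply: powR_harmonic_cvg; first exact: sqr_ge0.
by apply: k_ge0; apply: sub; rewrite inE eqxx.
Qed.

Let D_cvg x : D n.+1%:R^-1 x @[n --> \oo] --> D 0 x.
Proof.
rewrite /D; elim: (enum_fset Rp) => [|a s IH].
  by under eq_fun do rewrite big_nil; rewrite big_nil; exact: cvg_cst.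
under eq_fun do rewrite big_cons; rewrite big_cons.
apply: cvgD => //; apply: cvgM; first exact: cvg_cst.
apply: cvgM; last exact: cvg_cst.
rewrite (_ : smooth_inv 0 (dotp a x) = (dotp a x)^-1); first exact: smooth_inv_cvg.
rewrite /smooth_inv addr0; have [->|t0] := eqVneq (dotp a x) 0; last by field.
by rewrite mul0r invr0.
Qed.

(** [phif] and [phig] stand for the Dunkl derivatives of f and g along xi. The identity is the
    skew-symmetry of Dunkl operators, the last term coming from the Gaussian; it is the limit eps ->
    0 of [integral_AD]. *)
Lemma dunkl_integration_by_parts (phif phig : V -> R) :
  (forall x, f' x = phif x -
     \sum_(a <- Rp) k a * dotp a xi * real_dunkl_quotient a f x) ->
  (forall x, g' x = phig x -
     \sum_(a <- Rp) k a * dotp a xi * real_dunkl_quotient a g x) ->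
  \int[mu]_x (G x * w x *
    (phif x * g x + f x * phig x - dotp x xi * (f x * g x))) = 0.
Proof.
move=> ef eg.
have [K K0 HK] := gauss_smooth_weight_le.
pose M := 2 * (L * enorm xi) + enorm xi + B.
have e0 n : 0 < n.+1%:R^-1 :> R by rewrite invr_gt0.
have e1 n : n.+1%:R^-1 <= 1 :> R by rewrite invf_le1 ?ler1n.
have e01 n : 0 <= (n.+1%:R^-1 : R) <= 1 by rewrite ltW//= e1.
have [] := @Rint_dominated_cvg _ _ _ mu
  (fun n x => G x * sw n.+1%:R^-1 x * (A x + D n.+1%:R^-1 x))
  (fun x => G x * v x * (A x + D 0 x)) (fun x => K * M * gauss (1 / 4) x).
- move=> n; apply: measurable_funM; last by apply: measurable_funD => //; exact: mD.
  by apply: measurable_funM; [exact: measurable_gauss|exact: measurable_smooth_weight].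
- move=> x; apply: cvgM; last by apply: cvgD => //; exact: cvg_cst.
  by apply: cvgM => //; exact: cvg_cst.
- move=> n x; apply: (HK _ _ (fun x => A x + D n.+1%:R^-1 x)) => //.
  rewrite (le_trans (ler_normD _ _))// mulrDl lerD// ?A_le//.
  apply: le_trans (D_le x (e0 n)) _; apply: cst_le.
  exact: le_trans (normr_ge0 _) (D_le x (e0 n)).
- by apply: L1_gauss; rewrite divr_gt0.
move=> LL H.
have E0 : \int[mu]_x (G x * v x * (A x + D 0 x)) = 0.
  rewrite -(cvg_lim _ H)//.
  by under eq_fun do rewrite integral_AD//; exact: lim_cst.
rewrite (@Rint_ext _ _ _ mu _ (fun x => dunkl_cst Rp k * (G x * v x * (A x + D 0 x)))).
  by rewrite RintZ// E0 mulr0.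
move=> x; rewrite /dunkl_density [in LHS]mulrCA -!mulrA; congr (_ * _).
(* On a hyperplane [real_dunkl_quotient] is a derivative while the limit of the regularised quotient
   is 0. The discrepancy is harmless: there the weight vanishes unless k a = 0. *)
have [v0|v0] := eqVneq (v x) 0; first by rewrite v0 !(mul0r, mulr0).
congr (_ * (_ * _)); rewrite /A ef eg.
have Q (u : V -> R) a : a \in Rp -> k a * dotp a xi * real_dunkl_quotient a u x =
    k a * dotp a xi * ((dotp a x)^-1 * (u x - u (reflection a x))).
  move=> aR; rewrite /real_dunkl_quotient; case: eqP => [a0|_]; last by rewrite mulrC [in RHS]mulrC; congr (_ * _); rewrite mulrC.
  have [->|ka] := eqVneq (k a) 0; first by rewrite !mul0r.
  have := dunkl_density_root0 aR a0 ka; rewrite /dunkl_density.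
  move/eqP; rewrite mulf_eq0 (negbTE v0) orbF.
  by rewrite gt_eqF// (dunkl_cst_gt0 hRp hk).
have SQ (u : V -> R) : \sum_(a <- Rp) k a * dotp a xi * real_dunkl_quotient a u x =
   \sum_(a <- Rp) k a * dotp a xi * ((dotp a x)^-1 * (u x - u (reflection a x))).
  by apply: eq_big_seq => a; exact: Q.
have -> : D 0 x = (\sum_(a <- Rp) k a * dotp a xi * real_dunkl_quotient a f x) * g x +
    f x * (\sum_(a <- Rp) k a * dotp a xi * real_dunkl_quotient a g x).
  rewrite !SQ mulr_suml mulr_sumr -big_split/=; apply: eq_bigr => a _.
  rewrite (_ : smooth_inv 0 (dotp a x) = (dotp a x)^-1); first by ring.
  rewrite /smooth_inv addr0; have [->|t0] := eqVneq (dotp a x) 0; last by field.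
  by rewrite mul0r invr0.
ring.
Qed.

End integration_by_parts.

(** * The heat kernel *)

(** Dominated convergence for difference quotients along every sequence tending to 0. The derivative
    is taken at s = 1, the point where ray equations are evaluated. *)
Lemma is_derive_Rint {dT : measure_display} {T : measurableType dT} {R : realType}
    (mu : {measure set T -> \bar R}) (F : R -> T -> R) (F' M : T -> R) :
  (forall s, L1 mu (F s)) ->
  (forall y, is_derive (1 : R) (1 : R) (fun s => F s y) (F' y)) ->
  (forall s y, `|F s y - F 1 y| <= `|s - 1| * M y) -> L1 mu M ->
  L1 mu F' /\
  is_derive (1 : R) (1 : R) (fun s => \int[mu]_y F s y) (\int[mu]_y F' y).
Proof.
move=> LF dF FM LM.
pose q (h : R) y := h^-1 * (F (h + 1) y - F 1 y).
have Lq h : L1 mu (q h) by apply: L1Z; apply: L1B.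
have qcvg y : q h y @[h --> 0^'] --> F' y.
  have [dy Dy] := dF y; rewrite -Dy /q.
  have -> : (fun h : R => h^-1 * (F (h + 1) y - F 1 y)) =
      (fun h : R => h^-1 *: (((fun s => F s y) \o shift (1 : R)) (h *: (1 : R)) - F 1 y)).
    by apply/funext => h /=; rewrite (_ : h *: (1 : R) = h)// [LHS]mulr1.
  exact: dy.
have qM h y : h != 0 -> `|q h y| <= M y.
  move=> h0; rewrite /q normrM normfV ler_pdivrMl ?normr_gt0//.
  by apply: (le_trans (FM _ _)); rewrite addrK.
have H u : (forall n, u n != 0 :> R) -> u n @[n --> \oo] --> 0 ->
   L1 mu F' /\ \int[mu]_y q (u n) y @[n --> \oo] --> \int[mu]_y F' y.
  move=> u0 uc; apply: (@Rint_dominated_cvg _ _ _ mu (fun n => q (u n)) F' M) => //; last by move=> n y; exact: qM.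
  - by move=> n; apply: L1_measurable; exact: Lq.
  - by move=> y; have /cvgr_dnbhsP := qcvg y; exact.
have [] := H (fun n => n.+1%:R^-1).
- by move=> n; rewrite invr_eq0 pnatr_eq0.
- exact: cvg_harmonic.
move=> LF' _; split => //.
have K : (fun h : R => h^-1 *: (((fun s => \int[mu]_y F s y) \o shift (1 : R)) (h *: (1 : R)) -
    \int[mu]_y F 1 y)) @ 0^' --> \int[mu]_y F' y.
  apply/cvgr_dnbhsP => u [u0 uc]; have [_] := H u u0 uc.
  apply: cvg_trans; apply: near_eq_cvg; apply: nearW => n /=.
  rewrite RintZ ?RintB//; last exact: L1B.
  by rewrite (_ : u n *: (1 : R) = u n)// [LHS]mulr1.
apply: DeriveDef; first by apply/cvg_ex; eexists; exact: K.
by rewrite /derive; exact: cvg_lim K.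
Qed.

(** * Gaussian pairings of two kernels *)

Section gaussian_pairing.
Context {R : realType} {d : nat}.
Local Notation V := 'rV[R]_d.
Local Notation mu := (@lebesgue_rV R d).
Variables (Rs Rp : {fset V}) (k : V -> R).
Hypotheses (hRs : root_system Rs) (hRp : positive_subsystem Rs Rp)
  (hk : multiplicity Rs k).
Variable e : V -> V -> R[i].
Hypothesis he : is_dunkl_kernel Rp k e.
Local Notation w := (dunkl_density Rp k).
Local Notation G := (@gauss R d (1 / 2)).
Local Notation C := (ker_cos e).
Local Notation S := (ker_sin e).
Local Notation defect := (reflection_defect Rp k).
Implicit Types (x y z xi : V).

Let k_ge0 a : a \in Rp -> 0 <= k a.
Proof. exact: multiplicity_ge0 hRp hk a. Qed.

Lemma L1_gauss_density (M : R) (h : V -> R) : measurable_fun setT h ->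
  (forall x, `|h x| <= M * (1 + enorm x)) -> L1 mu (fun x => G x * w x * h x).
Proof.
move=> mh hM; have [K K0 HK] := gauss_smooth_weight_le hRp hk.
apply: (L1_dom (g := fun x => dunkl_cst Rp k * K * M * gauss (1 / 4) x)).
- apply: measurable_funM => //; apply: measurable_funM; first exact: measurable_gauss.
  exact: measurable_dunkl_density.
- move=> x; rewrite /dunkl_density -smooth_weight0.
  rewrite (_ : _ * _ * h x = dunkl_cst Rp k * (G x * smooth_weight Rp k 0 x * h x));
    last by ring.
  rewrite normrM (gtr0_norm (dunkl_cst_gt0 hRp hk)) -!mulrA ler_wpM2l//.
    by rewrite ltW// (dunkl_cst_gt0 hRp hk).
  by rewrite !mulrA -(mulrA _ _ (h x)) mulrA HK// lexx ler01.
- by apply: L1_gauss; rewrite divr_gt0.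
Qed.

Lemma measurable_ker_cos x : measurable_fun setT (C x).
Proof.
apply: continuous_measurable_rV.
exact: lipschitz_continuous_rV (ker_cos_lipschitz_r hRp hk he x).
Qed.

Lemma measurable_ker_sin x : measurable_fun setT (S x).
Proof.
apply: continuous_measurable_rV.
exact: lipschitz_continuous_rV (ker_sin_lipschitz_r hRp hk he x).
Qed.

Lemma is_derive_ker_cos_r x xi y : is_derive y xi (C x) (- dotp xi x * S x y -
  \sum_(a <- Rp) k a * dotp a xi * real_dunkl_quotient a (C x) y).
Proof.
rewrite (ker_sym hRs hRp hk he x y).2.
have -> : C x = C^~ x by apply/funext => z; rewrite (ker_sym hRs hRp hk he x z).1.
exact: is_derive_ker_cos.
Qed.

Lemma is_derive_ker_sin_r x xi y : is_derive y xi (S x) (dotp xi x * C x y -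
  \sum_(a <- Rp) k a * dotp a xi * real_dunkl_quotient a (S x) y).
Proof.
rewrite (ker_sym hRs hRp hk he x y).1.
have -> : S x = S^~ x by apply/funext => z; rewrite (ker_sym hRs hRp hk he x z).2.
exact: is_derive_ker_sin.
Qed.

Section one_slot.
Variables (c s : V -> R).
Hypotheses (mc : measurable_fun setT c) (ms : measurable_fun setT s)
  (c1 : forall y, `|c y| <= 1) (s1 : forall y, `|s y| <= 1).

(** A common form for both parts of e(x, y) conj(e(z, y)): the pair (C z, S z) gives the real part,
    (-S z, C z) the imaginary part. *)
Definition gauss_pairing x : R :=
  \int[mu]_y (G y * w y * (C x y * c y + S x y * s y)).

Let integrand_le (h : V -> R) x y : `|C x y * c y + S x y * s y| <= 2 * (1 + enorm y).
Proof.
rewrite (le_trans (ler_normD _ _))// !normrM (@le_trans _ _ (1 + 1))//.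
  by apply: lerD; apply: mulr_ile1 => //;
    [exact: (normr_ker_cos_le1 hRp hk he)|exact: (normr_ker_sin_le1 hRp hk he)].
by have := enorm_ge0 y; lra.
Qed.

Let mintegrand x : measurable_fun setT (fun y => C x y * c y + S x y * s y).
Proof.
by apply: measurable_funD; apply: measurable_funM => //;
  [exact: measurable_ker_cos|exact: measurable_ker_sin].
Qed.

Lemma L1_gauss_pairing x : L1 mu (fun y => G y * w y * (C x y * c y + S x y * s y)).
Proof. by apply: L1_gauss_density (@integrand_le c x). Qed.

Let lip x x' y : `|(C x y * c y + S x y * s y) - (C x' y * c y + S x' y * s y)| <=
  2 * (enorm y * enorm (x - x')).
Proof.
rewrite (_ : _ - _ = (C x y - C x' y) * c y + (S x y - S x' y) * s y); last by ring.
rewrite (le_trans (ler_normD _ _))// !normrM (_ : 2 * _ = enorm y * enorm (x - x') * 1 +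
  enorm y * enorm (x - x') * 1); last by ring.
by apply: lerD; apply: ler_pM => //;
  [exact: (ker_cos_lipschitz_l hRs hRp hk he)|exact: (ker_sin_lipschitz_l hRs hRp hk he)].
Qed.

Let LMe : L1 mu (fun y => G y * w y * enorm y).
Proof.
apply: (L1_gauss_density (M := 1)); first exact: measurable_enorm.
by move=> y; rewrite ger0_norm ?enorm_ge0// mul1r lerDr.
Qed.

Let Gw_ge0 y : 0 <= G y * w y.
Proof. by rewrite mulr_ge0 ?gauss_ge0// (dunkl_density_ge0 hRp hk). Qed.

Lemma continuous_gauss_pairing : continuous gauss_pairing.
Proof.
apply: (@lipschitz_continuous_rV _ _ _ (2 * \int[mu]_y (G y * w y * enorm y))) => x x'.
rewrite /gauss_pairing -RintB; [|exact: L1_gauss_pairing..].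
rewrite -mulrA (mulrC _ (enorm _)) mulrA -RintZ//.
apply: le_trans (le_normr_Rintegral measurableT _) _.
  by apply: L1B; exact: L1_gauss_pairing.
apply: le_Rintegral => //.
- apply: integrable_norm => //; apply: L1B; exact: L1_gauss_pairing.
- exact: L1Z.
move=> y _ /=; rewrite -mulrBr normrM (ger0_norm (Gw_ge0 y)).
rewrite [leRHS]mulrCA ler_wpM2l// (le_trans (lip _ _ _))//.
by rewrite le_eqVlt; apply/orP; left; apply/eqP; ring.
Qed.

(** Differentiation under the integral leaves a moment <y, x>, which is not yet a multiple of the
    pairing; integration by parts removes it below. *)
Lemma radial_gauss_pairing x : is_derive (1 : R) (1 : R)
  (fun t => gauss_pairing (t *: x))
  (\int[mu]_y (G y * w y * (dotp y x * (C x y * s y - S x y * c y))) -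
   defect gauss_pairing x).
Proof.
pose F (t : R) y := G y * w y * (C (t *: x) y * c y + S (t *: x) y * s y).
pose F' y := G y * w y * ((- dotp x y * S x y - defect (C^~ y) x) * c y +
   (dotp x y * C x y - defect (S^~ y) x) * s y).
have [] := @is_derive_Rint _ _ _ mu F F' (fun y => 2 * enorm x * (G y * w y * enorm y)).
- by move=> t; exact: L1_gauss_pairing.
- move=> y; apply: is_derive_mulc; apply: is_derive_add.
    under eq_fun do rewrite mulrC; rewrite [X in is_derive _ _ _ X]mulrC.
    by apply: is_derive_mulc; exact: (radial_ker_cos he).
  under eq_fun do rewrite mulrC; rewrite [X in is_derive _ _ _ X]mulrC.
  by apply: is_derive_mulc; exact: (radial_ker_sin he).
- move=> t y; rewrite /F -mulrBr normrM (ger0_norm (Gw_ge0 y)) [leRHS]mulrC.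
  have := lip (t *: x) (1 *: x) y; rewrite -scalerBl enormZ => H.
  set W := G y * w y; rewrite scale1r in H.
  have W0 : 0 <= W by exact: Gw_ge0.
  rewrite (_ : 2 * enorm x * (W * enorm y) * `|t - 1| =
    W * (2 * (enorm y * (`|t - 1| * enorm x)))); last by ring.
  by rewrite scale1r ler_wpM2l.
- exact: L1Z.
move=> LF' H; apply: (is_derive_eq H).
have LD : L1 mu (fun y => G y * w y * (dotp y x * (C x y * s y - S x y * c y))).
  apply: (L1_gauss_density (M := 2 * enorm x)).
    apply: measurable_funM; first exact: measurable_rV_dotp.
    by apply: measurable_funB; apply: measurable_funM => //;
      [exact: measurable_ker_cos|exact: measurable_ker_sin].
  move=> y; rewrite normrM.
  have h : `|C x y * s y - S x y * c y| <= 2.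
    rewrite (le_trans (ler_normB _ _))// !normrM (_ : 2 = 1 + 1)//.
    by apply: lerD; apply: mulr_ile1 => //;
      [exact: (normr_ker_cos_le1 hRp hk he)|exact: (normr_ker_sin_le1 hRp hk he)].
  apply: (@le_trans _ _ (enorm y * enorm x * 2)).
    by apply: ler_pM => //; exact: normr_dotp_le.
  by have := enorm_ge0 x; have := enorm_ge0 y; nra.
have LG a : L1 mu (fun y => k a * (G y * w y * (C x y * c y + S x y * s y) -
    G y * w y * (C (reflection a x) y * c y + S (reflection a x) y * s y))).
  by apply: L1Z; apply: L1B; exact: L1_gauss_pairing.
rewrite /reflection_defect /gauss_pairing.
rewrite (eq_bigr (fun a => \int[mu]_y (k a * (G y * w y * (C x y * c y + S x y * s y) -
    G y * w y * (C (reflection a x) y * c y + S (reflection a x) y * s y))))); last first.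
  move=> a _; rewrite RintZ; last by apply: L1B; exact: L1_gauss_pairing.
  by rewrite RintB//; exact: L1_gauss_pairing.
rewrite -Rint_sum// -RintB//; last exact: L1_sum.
apply: Rint_ext => y; rewrite /F' /reflection_defect (dotpC x y).
have E : \sum_(a <- Rp) k a * (G y * w y * (C x y * c y + S x y * s y) -
    G y * w y * (C (reflection a x) y * c y + S (reflection a x) y * s y)) =
  G y * w y * ((\sum_(a <- Rp) k a * (C x y - C (reflection a x) y)) * c y +
   (\sum_(a <- Rp) k a * (S x y - S (reflection a x) y)) * s y).
  by rewrite !mulr_suml -big_split/= mulr_sumr; apply: eq_bigr => a _; ring.
by rewrite E; ring.
Qed.

End one_slot.

Definition gauss_even x z : R := gauss_pairing (C z) (S z) x.
Definition gauss_odd x z : R := gauss_pairing (fun y => - S z y) (C z) x.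

Let mC := measurable_ker_cos.
Let mS := measurable_ker_sin.
Let mNS z : measurable_fun setT (fun y => - S z y).
Proof. exact: measurableT_comp (mS z). Qed.
Let C1 x y : `|C x y| <= 1. Proof. exact: (normr_ker_cos_le1 hRp hk he). Qed.
Let S1 x y : `|S x y| <= 1. Proof. exact: (normr_ker_sin_le1 hRp hk he). Qed.
Let NS1 x y : `|- S x y| <= 1. Proof. by rewrite normrN. Qed.

Let ibp x z xi (f g : V -> R) (phif phig : V -> R) :
  (forall y, `|f y| <= 1) -> (forall y, `|g y| <= 1) ->
  (forall y y', `|f y - f y'| <= enorm x * enorm (y - y')) ->
  (forall y y', `|g y - g y'| <= enorm z * enorm (y - y')) ->
  (forall y, is_derive y xi f (phif y -
     \sum_(a <- Rp) k a * dotp a xi * real_dunkl_quotient a f y)) ->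
  (forall y, is_derive y xi g (phig y -
     \sum_(a <- Rp) k a * dotp a xi * real_dunkl_quotient a g y)) ->
  \int[mu]_y (G y * w y *
    (phif y * g y + f y * phig y - dotp y xi * (f y * g y))) = 0.
Proof.
move=> f1 g1 fL gL df dg.
have fL' y y' : `|f y - f y'| <= (enorm x + enorm z) * enorm (y - y').
  by rewrite (le_trans (fL _ _))// ler_wpM2r ?enorm_ge0// lerDl enorm_ge0.
have gL' y y' : `|g y - g y'| <= (enorm x + enorm z) * enorm (y - y').
  by rewrite (le_trans (gL _ _))// ler_wpM2r ?enorm_ge0// lerDr enorm_ge0.
by apply: (dunkl_integration_by_parts hRs hRp hk f1 g1 fL' gL' df dg).
Qed.

Let L1_dot (xi : V) (f g : V -> R) : measurable_fun setT f -> measurable_fun setT g ->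
  (forall y, `|f y| <= 1) -> (forall y, `|g y| <= 1) ->
  L1 mu (fun y => G y * w y * (dotp y xi * (f y * g y))).
Proof.
move=> mf mg f1 g1; apply: (L1_gauss_density (M := enorm xi)).
  apply: measurable_funM; first exact: measurable_rV_dotp.
  exact: measurable_funM.
move=> y; rewrite !normrM.
have h : `|f y| * `|g y| <= 1 by apply: mulr_ile1.
apply: (@le_trans _ _ (enorm y * enorm xi * 1)).
  by apply: ler_pM => //; exact: normr_dotp_le.
by have := enorm_ge0 xi; have := enorm_ge0 y; nra.
Qed.

Let L1_prod (f g : V -> R) : measurable_fun setT f -> measurable_fun setT g ->
  (forall y, `|f y| <= 1) -> (forall y, `|g y| <= 1) ->
  L1 mu (fun y => G y * w y * (f y * g y)).
Proof.
move=> mf mg f1 g1; apply: (L1_gauss_density (M := 1)); first exact: measurable_funM.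
move=> y; rewrite normrM mul1r (@le_trans _ _ 1)//; first exact: mulr_ile1.
by rewrite lerDl enorm_ge0.
Qed.

Let I (f g : V -> R) : R := \int[mu]_y (G y * w y * (f y * g y)).
Let X (xi : V) (f g : V -> R) : R := \int[mu]_y (G y * w y * (dotp y xi * (f y * g y))).

Let gauss_evenE x z : gauss_even x z = I (C x) (C z) + I (S x) (S z).
Proof.
rewrite /gauss_even /gauss_pairing /I -RintD; [|exact: L1_prod..].
by apply: Rint_ext => y; ring.
Qed.

Let gauss_oddE x z : gauss_odd x z = I (S x) (C z) - I (C x) (S z).
Proof.
rewrite /gauss_odd /gauss_pairing /I -RintB; [|exact: L1_prod..].
by apply: Rint_ext => y; ring.
Qed.

(** Dunkl derivatives of kernel components are multiples of kernel components, so integration by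
    parts becomes a linear relation between the integrals [I] and [X]. The four instances below
    cover all products of C and S. *)
Let ibp_lin x z (xi : V) (c1 c2 : R) (f g f' g' : V -> R) :
  [/\ measurable_fun setT f, measurable_fun setT g, measurable_fun setT f' &
    measurable_fun setT g'] ->
  [/\ forall y, `|f y| <= 1, forall y, `|g y| <= 1, forall y, `|f' y| <= 1 &
    forall y, `|g' y| <= 1] ->
  (forall y y', `|f y - f y'| <= enorm x * enorm (y - y')) ->
  (forall y y', `|g y - g y'| <= enorm z * enorm (y - y')) ->
  (forall y, is_derive y xi f (c1 * f' y -
     \sum_(a <- Rp) k a * dotp a xi * real_dunkl_quotient a f y)) ->
  (forall y, is_derive y xi g (c2 * g' y -
     \sum_(a <- Rp) k a * dotp a xi * real_dunkl_quotient a g y)) ->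
  c1 * I f' g + c2 * I f g' - X xi f g = 0.
Proof.
move=> [mf mg mf' mg'] [f1 g1 f'1 g'1] fL gL df dg.
have L1' := L1_prod mf' mg f'1 g1; have L2' := L1_prod mf mg' f1 g'1.
have L3' := L1_dot xi mf mg f1 g1.
have <- := ibp f1 g1 fL gL df dg.
rewrite /I /X -!RintZ// -RintD; [|exact: L1Z..].
rewrite -RintB//; last by apply: L1D; exact: L1Z.
by apply: Rint_ext => y; ring.
Qed.

Let ibpCC x z xi :
  - dotp xi x * I (S x) (C z) + - dotp xi z * I (C x) (S z) - X xi (C x) (C z) = 0.
Proof.
apply: (@ibp_lin x z xi (- dotp xi x) (- dotp xi z) (C x) (C z) (S x) (S z)).
- by split.
- by split.
- exact: (ker_cos_lipschitz_r hRp hk he x).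
- exact: (ker_cos_lipschitz_r hRp hk he z).
- by move=> y; exact: is_derive_ker_cos_r.
- by move=> y; exact: is_derive_ker_cos_r.
Qed.

Let ibpSS x z xi :
  dotp xi x * I (C x) (S z) + dotp xi z * I (S x) (C z) - X xi (S x) (S z) = 0.
Proof.
apply: (@ibp_lin x z xi (dotp xi x) (dotp xi z) (S x) (S z) (C x) (C z)).
- by split.
- by split.
- exact: (ker_sin_lipschitz_r hRp hk he x).
- exact: (ker_sin_lipschitz_r hRp hk he z).
- by move=> y; exact: is_derive_ker_sin_r.
- by move=> y; exact: is_derive_ker_sin_r.
Qed.

Let ibpSC x z xi :
  dotp xi x * I (C x) (C z) + - dotp xi z * I (S x) (S z) - X xi (S x) (C z) = 0.
Proof.
apply: (@ibp_lin x z xi (dotp xi x) (- dotp xi z) (S x) (C z) (C x) (S z)).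
- by split.
- by split.
- exact: (ker_sin_lipschitz_r hRp hk he x).
- exact: (ker_cos_lipschitz_r hRp hk he z).
- by move=> y; exact: is_derive_ker_sin_r.
- by move=> y; exact: is_derive_ker_cos_r.
Qed.

Let ibpCS x z xi :
  - dotp xi x * I (S x) (S z) + dotp xi z * I (C x) (C z) - X xi (C x) (S z) = 0.
Proof.
apply: (@ibp_lin x z xi (- dotp xi x) (dotp xi z) (C x) (S z) (S x) (C z)).
- by split.
- by split.
- exact: (ker_cos_lipschitz_r hRp hk he x).
- exact: (ker_sin_lipschitz_r hRp hk he z).
- by move=> y; exact: is_derive_ker_cos_r.
- by move=> y; exact: is_derive_ker_sin_r.
Qed.

Lemma radial_gauss_even x z : is_derive (1 : R) (1 : R)
  (fun t => gauss_even (t *: x) z)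
  (- dotp x (x - z) * gauss_even x z - defect (gauss_even^~ z) x).
Proof.
apply: (is_derive_eq (radial_gauss_pairing (mC z) (mS z) (C1 z) (S1 z) x)).
congr (_ - _); rewrite gauss_evenE dotpBr.
rewrite (@Rint_ext _ _ _ mu _ (fun y => G y * w y * (dotp y x * (C x y * S z y)) -
  G y * w y * (dotp y x * (S x y * C z y)))); last by move=> y; ring.
rewrite RintB; [|exact: L1_dot..].
have := ibpCS x z x; have := ibpSC x z x; rewrite /X.
set a := dotp x x; set b := dotp x z; lra.
Qed.

Lemma radial_gauss_odd x z : is_derive (1 : R) (1 : R)
  (fun t => gauss_odd (t *: x) z)
  (- dotp x (x - z) * gauss_odd x z - defect (gauss_odd^~ z) x).
Proof.
apply: (is_derive_eq (radial_gauss_pairing (mNS z) (mC z) (NS1 z) (C1 z) x)).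
congr (_ - _); rewrite gauss_oddE dotpBr.
rewrite (@Rint_ext _ _ _ mu _ (fun y => G y * w y * (dotp y x * (C x y * C z y)) +
  G y * w y * (dotp y x * (S x y * S z y)))); last by move=> y; ring.
rewrite RintD; [|exact: L1_dot..].
have := ibpCC x z x; have := ibpSS x z x; rewrite /X.
set a := dotp x x; set b := dotp x z; lra.
Qed.

Let growth x z : - dotp x (x - z) <= enorm z * enorm x.
Proof.
rewrite dotpBr opprB (le_trans (_ : _ <= dotp x z))//; first by rewrite gerBl dotp_ge0.
by rewrite mulrC dotp_le_enorm.
Qed.

Let min_principle z (u : V -> R) : continuous u ->
  (forall x, is_derive (1 : R) (1 : R) (fun t => u (t *: x))
    (- dotp x (x - z) * u x - defect u x)) -> 0 <= u 0 -> forall x, 0 <= u x.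
Proof.
by move=> cu du u0; exact: (radial_min_principle k_ge0 cu du (growth^~ z)).
Qed.

(** The Gaussian is its own transform: it solves the same ray equation with the same value at 0, and
    the minimum principle applied to both differences acts as uniqueness. *)
Lemma gauss_even0r x : gauss_even x 0 = G x.
Proof.
have cE : continuous (gauss_even^~ 0) := continuous_gauss_pairing (mC 0) (mS 0) (C1 0) (S1 0).
have cG : continuous G by exact: continuous_gauss.
have dG y : is_derive (1 : R) (1 : R) (fun t => G (t *: y))
    (- dotp y (y - 0) * G y - defect G y).
  apply: (is_derive_eq (is_derive_ray (is_derive_gauss (1 / 2) y y))).
  rewrite subr0 /reflection_defect big1 ?subr0; last first.
    by move=> a _; rewrite /gauss dotp_reflection subrr mulr0.
  by rewrite mulrC; congr (_ * _); field.
have E00 : gauss_even 0 0 = G 0.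
  have C0 y : C 0 y = 1 by exact: (ker_cos0l he).
  have S0 y : S 0 y = 0 by exact: (ker_sin0l he).
  rewrite /gauss_even /gauss_pairing (@Rint_ext _ _ _ mu _ (fun y => G y * w y)).
    by rewrite /Rintegral (integral_gauss_half_density hRp hk) /gauss dotp0r mulr0 oppr0 expR0.
  by move=> y; rewrite C0 S0; ring.
apply/eqP; rewrite eq_le -subr_ge0 -[X in _ && X]subr_ge0; apply/andP; split.
- apply: (min_principle (z := 0) (u := fun x => G x - gauss_even x 0)).
  + by move=> y; apply: (@cvgB _ _ _ (nbhs y)); [exact: cG|exact: cE].
  + move=> y; apply: (is_derive_eq (is_derive_sub (dG y) (radial_gauss_even y 0))).
    by rewrite reflection_defectB; ring.
  + by rewrite E00 subrr.
- apply: (min_principle (z := 0) (u := fun x => gauss_even x 0 - G x)).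
  + by move=> y; apply: (@cvgB _ _ _ (nbhs y)); [exact: cE|exact: cG].
  + move=> y; apply: (is_derive_eq (is_derive_sub (radial_gauss_even y 0) (dG y))).
    by rewrite reflection_defectB; ring.
  + by rewrite E00 subrr.
Qed.

Let odd_eq0 z : gauss_odd 0 z = 0 -> forall x, gauss_odd x z = 0.
Proof.
move=> E0.
have cO : continuous (gauss_odd^~ z) := continuous_gauss_pairing (mNS z) (mC z) (NS1 z) (C1 z).
move=> x; apply/eqP; rewrite eq_le -oppr_ge0; apply/andP; split.
- apply: (min_principle (z := z) (u := fun x => - gauss_odd x z)).
  + by move=> y; apply: (@cvgN _ _ _ (nbhs y)); exact: cO.
  + move=> y; apply: (is_derive_eq (is_derive_opp (radial_gauss_odd y z))).
    rewrite (_ : defect (fun x => - gauss_odd x z) y = - defect (gauss_odd^~ z) y).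
      by ring.
    rewrite /reflection_defect -sumrN; apply: eq_bigr => a _; ring.
  + by rewrite E0 oppr0.
- by apply: (min_principle (z := z) (u := gauss_odd^~ z)) => //;
    [move=> y; exact: radial_gauss_odd|rewrite E0].
Qed.

Lemma gauss_odd0r x : gauss_odd x 0 = 0.
Proof.
apply: odd_eq0; rewrite gauss_oddE /I -RintB; [|exact: L1_prod..].
rewrite (@Rint_ext _ _ _ mu _ (fun y => 0 * (G y * w y * (C 0 y * C 0 y)))).
  by rewrite RintZ ?mul0r//; exact: L1_prod.
by move=> y; ring.
Qed.

(** The imaginary part changes sign when x and z are exchanged, so its value at x = 0 reduces to
    [gauss_odd0r]; [odd_eq0] then propagates the zero. *)
Lemma gauss_odd_eq0 x z : gauss_odd x z = 0.
Proof.
apply: odd_eq0; have := gauss_odd0r z; rewrite !gauss_oddE => /subr0_eq E.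
rewrite /I in E *.
rewrite (@Rint_ext _ _ _ mu _ (fun y => G y * w y * (C z y * S 0 y))).
  rewrite -E; apply/eqP; rewrite subr_eq0; apply/eqP.
  by apply: Rint_ext => y; congr (_ * _); rewrite mulrC.
by move=> y; congr (_ * _); rewrite mulrC.
Qed.

(** The minimum principle starts from the value at x = 0, which by symmetry is the Gaussian at z and
    hence nonnegative. *)
Lemma gauss_even_ge0 x z : 0 <= gauss_even x z.
Proof.
apply: (min_principle (z := z) (u := gauss_even^~ z)).
- exact: continuous_gauss_pairing (mC z) (mS z) (C1 z) (S1 z).
- by move=> y; exact: radial_gauss_even.
have <- : gauss_even z 0 = gauss_even 0 z.
  by rewrite /gauss_even /gauss_pairing; apply: Rint_ext => y; congr (_ * _); ring.
by rewrite gauss_even0r gauss_ge0.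
Qed.

End gaussian_pairing.

Lemma L1_norm {dT : measure_display} {T : measurableType dT} {R : realType}
    (mu : {measure set T -> \bar R}) (f : T -> R) :
  L1 mu f -> L1 mu (fun x => `|f x|).
Proof.
move=> Lf; have := integrable_norm Lf; exact.
Qed.

Lemma fubini_bounded_kernel {d1 d2 : measure_display} {T1 : measurableType d1}
    {T2 : measurableType d2} {R : realType}
    (m1 : {sigma_finite_measure set T1 -> \bar R})
    (m2 : {sigma_finite_measure set T2 -> \bar R})
    (a : T1 -> R) (b : T2 -> R) (K : T1 * T2 -> R) (M : R) :
  L1 m1 a -> L1 m2 b -> measurable_fun setT K -> (forall p, `|K p| <= M) ->
  L1 m1 (fun x => a x * \int[m2]_y (b y * K (x, y))) /\
  \int[m1]_x (a x * \int[m2]_y (b y * K (x, y))) =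
  \int[m2]_y (b y * \int[m1]_x (a x * K (x, y))).
Proof.
move=> La Lb mK KM.
pose f (p : T1 * T2) := a p.1 * b p.2 * K p.
have mf : measurable_fun setT f.
  apply: measurable_funM => //; apply: measurable_funM.
  - by apply: (measurableT_comp (L1_measurable La)).
  - by apply: (measurableT_comp (L1_measurable Lb)).
have mKl x : measurable_fun setT (fun y => K (x, y)) by exact: measurableT_comp.
have mKr y : measurable_fun setT (fun x => K (x, y)) by exact: measurableT_comp.
have L2 x : L1 m2 (fun y => b y * K (x, y)).
  apply: (L1_dom (g := fun y => M * `|b y|)).
  - by apply: measurable_funM => //; exact: (L1_measurable Lb).
  - by move=> y; rewrite normrM mulrC ler_wpM2r.
  - by apply: L1Z; exact: (L1_norm Lb).
have L1' y : L1 m1 (fun x => a x * K (x, y)).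
  apply: (L1_dom (g := fun x => M * `|a x|)).
  - by apply: measurable_funM => //; exact: (L1_measurable La).
  - by move=> x; rewrite normrM mulrC ler_wpM2r.
  - by apply: L1Z; exact: (L1_norm La).
have If : (m1 \x m2)%E.-integrable setT (EFin \o f).
  apply/integrable12ltyP; first exact/measurable_EFinP.
  apply: (@le_lt_trans _ _ (\int[m1]_x (`|a x| * (M * \int[m2]_y `|b y|))%:E)%E).
    apply: ge0_le_integral => //.
    - by move=> x _; exact: integral_ge0.
    - apply: (measurable_fun_fubini_tonelli_F (fun p => `|(f p)%:E|)%E) => //.
      by apply: measurableT_comp => //; exact/measurable_EFinP.
    - apply/measurable_EFinP; apply: measurable_funM => //.
      by apply: measurableT_comp => //; exact: (L1_measurable La).
    move=> x _; rewrite mulrA -RintZ; last exact: (L1_norm Lb).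
    rewrite -Rint_EFin; last by apply: L1Z; exact: (L1_norm Lb).
    apply: ge0_le_integral => //.
    - by do 2! apply: measurableT_comp => //; apply/measurable_EFinP; exact: measurableT_comp mf _.
    - apply/measurable_EFinP; apply: measurable_funM => //.
      by apply: measurableT_comp => //; exact: (L1_measurable Lb).
    by move=> y _; rewrite /= lee_fin /f !normrM (mulrAC _ M) ler_wpM2l// mulr_ge0.
  under eq_integral do rewrite mulrC.
  have := L1Z (M * \int[m2]_y `|b y|) (L1_norm La).
  move=> /Rint_EFin ->; exact: ltry.
have E1 : (fun x => \int[m2]_y (f (x, y))%:E)%E =
    (fun x => (a x * \int[m2]_y (b y * K (x, y)))%:E).
  apply/funext => x; rewrite -RintZ// -Rint_EFin; last exact: L1Z.
  by apply: eq_integral => y _; rewrite /f /= mulrA.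
have E2 : (fun y => \int[m1]_x (f (x, y))%:E)%E =
    (fun y => (b y * \int[m1]_x (a x * K (x, y)))%:E).
  apply/funext => y; rewrite -RintZ// -Rint_EFin; last exact: L1Z.
  by apply: eq_integral => x _; rewrite /f /= mulrCA mulrA.
split; first by have := integrable_fubini_F If; rewrite /fubini_F /= E1.
by have := @Fubini _ _ _ _ _ m1 m2 _ If; rewrite /= E1 E2 /Rintegral => ->.
Qed.

Section triples.
Context {d1 d2 d3 : measure_display} {T1 : measurableType d1}
  {T2 : measurableType d2} {T3 : measurableType d3}.

Lemma measurable_triple13 : measurable_fun setT (fun q : (T1 * T2) * T3 => (q.1.1, q.2)).
Proof.
apply/measurable_fun_pairP; split; last exact: measurable_snd.
exact: (measurableT_comp measurable_fst measurable_fst).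
Qed.

Lemma measurable_triple23 : measurable_fun setT (fun q : (T1 * T2) * T3 => (q.1.2, q.2)).
Proof.
apply/measurable_fun_pairP; split; last exact: measurable_snd.
exact: (measurableT_comp measurable_snd measurable_fst).
Qed.

End triples.

(** * The heat kernel at arbitrary time *)

Section heat_kernel.
Context {R : realType} {d : nat}.
Local Notation V := 'rV[R]_d.
Local Notation mu := (@lebesgue_rV R d).
Variables (Rs Rp : {fset V}) (k : V -> R).
Hypotheses (hRs : root_system Rs) (hRp : positive_subsystem Rs Rp)
  (hk : multiplicity Rs k).
Variable e : V -> V -> R[i].
Hypothesis he : is_dunkl_kernel Rp k e.
Local Notation w := (dunkl_density Rp k).
Local Notation nu := (lambda_k Rp k + 1).
Local Notation C := (ker_cos e).
Local Notation S := (ker_sin e).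
Implicit Types (x y z xi : V).

Let w0 x : 0 <= w x.
Proof. exact: (dunkl_density_ge0 hRp hk). Qed.

Let mw : measurable_fun setT w.
Proof. exact: measurable_dunkl_density. Qed.

Let Gw0 b y : 0 <= gauss b y * w y.
Proof. exact: mulr_ge0 (gauss_ge0 _ _) (w0 _). Qed.

Lemma L1_gauss_w (b : R) : 0 < b -> L1 mu (fun x => gauss b x * w x).
Proof.
move=> b0; apply/integrableP; split.
  by apply/measurable_EFinP; apply: measurable_funM => //; exact: measurable_gauss.
under eq_integral do rewrite /= (ger0_norm (Gw0 b _)).
by rewrite (integral_gauss_density hRp hk b0) ltry.
Qed.

Lemma Rint_gauss_w (b : R) : 0 < b -> \int[mu]_x (gauss b x * w x) = (2 * b) `^ (- nu).
Proof. by move=> b0; rewrite /Rintegral (integral_gauss_density hRp hk b0). Qed.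

Lemma L1_gauss_bounded (b M : R) (h : V -> R) : 0 < b -> measurable_fun setT h ->
  (forall x, `|h x| <= M) -> L1 mu (fun x => gauss b x * w x * h x).
Proof.
move=> b0 mh hM; apply: (L1_dom (g := fun x => M * (gauss b x * w x))).
- by apply: measurable_funM => //; apply: measurable_funM => //; exact: measurable_gauss.
- move=> x; rewrite (normrM (gauss b x * w x)) (ger0_norm (Gw0 b x)) mulrC.
  exact: ler_wpM2r (Gw0 b x) _ _ (hM x).
- exact: (L1Z M (L1_gauss_w b0)).
Qed.

Lemma Rint_density_scale (s : R) (f : V -> R) : 0 < s -> measurable_fun setT f ->
  L1 mu (fun x => f x * w x) ->
  \int[mu]_x (f (s *: x) * w x) = s `^ (- (2 * nu)) * \int[mu]_x (f x * w x).
Proof.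
move=> s0 mf Lf.
pose fp x := Num.max (f x) 0; pose fm x := Num.max (- f x) 0.
have fE x : f x = fp x - fm x.
  rewrite /fp /fm; case: (lerP (f x) 0) => h; case: (lerP (- f x) 0) => h'; lra.
have mfp : measurable_fun setT fp by exact: measurable_maxr.
have mfm : measurable_fun setT fm by apply: measurable_maxr => //; exact: measurableT_comp.
have fp0 x : 0 <= fp x by rewrite /fp le_max lexx orbT.
have fm0 x : 0 <= fm x by rewrite /fm le_max lexx orbT.
have Lg (g : V -> R) : measurable_fun setT g -> (forall x, 0 <= g x) ->
    (forall x, g x <= `|f x|) -> L1 mu (fun x => g x * w x) /\
    L1 mu (fun x => g (s *: x) * w x) /\
    \int[mu]_x (g (s *: x) * w x) = s `^ (- (2 * nu)) * \int[mu]_x (g x * w x).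
  move=> mg g0 gf.
  have Lgw : L1 mu (fun x => g x * w x).
    apply: (L1_dom (g := fun x => `|f x * w x|)); first exact: measurable_funM.
    - move=> x; rewrite (normrM (g x)) (normrM (f x)) (ger0_norm (g0 x)).
      exact: ler_wpM2r (normr_ge0 _) _ _ (gf x).
    - exact: (L1_norm Lf).
  have E := integral_density_scale hRp hk s0 mg g0.
  have mgs : measurable_fun setT (fun x => g (s *: x)).
    by apply: (measurableT_comp mg); exact: measurable_rV_scale.
  have Lgs : L1 mu (fun x => g (s *: x) * w x).
    apply/integrableP; split; first by apply/measurable_EFinP; exact: measurable_funM.
    have gw0 x : 0 <= g (s *: x) * w x by exact: mulr_ge0 (g0 _) (w0 _).
    under eq_integral do rewrite /= (ger0_norm (gw0 _)).
    by rewrite E Rint_EFin// -EFinM ltry.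
  split=> //; split => //.
  by apply: EFin_inj; rewrite -Rint_EFin// E Rint_EFin.
have [Lp [Lps Ep]] : L1 mu (fun x => fp x * w x) /\ L1 mu (fun x => fp (s *: x) * w x) /\
    \int[mu]_x (fp (s *: x) * w x) = s `^ (- (2 * nu)) * \int[mu]_x (fp x * w x).
  by apply: Lg => // x; rewrite /fp ge_max ler_norm normr_ge0.
have [Lm [Lms Em]] : L1 mu (fun x => fm x * w x) /\ L1 mu (fun x => fm (s *: x) * w x) /\
    \int[mu]_x (fm (s *: x) * w x) = s `^ (- (2 * nu)) * \int[mu]_x (fm x * w x).
  by apply: Lg => // x; rewrite /fm ge_max -normrN ler_norm normr_ge0.
rewrite (@Rint_ext _ _ _ mu _ (fun x => fp (s *: x) * w x - fm (s *: x) * w x)); last first.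
  by move=> x; rewrite [in LHS]fE mulrBl.
rewrite RintB// Ep Em -mulrBr -RintB//; congr (_ * _).
by apply: Rint_ext => x; rewrite [in RHS]fE mulrBl.
Qed.

Let mC := measurable_ker_cos hRp hk he.
Let mS := measurable_ker_sin hRp hk he.
Let C1 x y : `|C x y| <= 1. Proof. exact: (normr_ker_cos_le1 hRp hk he). Qed.
Let S1 x y : `|S x y| <= 1. Proof. exact: (normr_ker_sin_le1 hRp hk he). Qed.

Let half_power (t : R) : 0 < t -> (2 * t) `^ (- 2^-1) * (2 * t) `^ (- 2^-1) = (2 * t)^-1.
Proof.
move=> t0; have t2 : 0 < 2 * t by rewrite mulr_gt0.
rewrite -powRD; last by rewrite (gt_eqF t2) implybT.
by rewrite (_ : - 2^-1 - 2^-1 = -1) ?powR_inv1 ?ltW//; lra.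
Qed.

Let scale_gauss (t b : R) y : 0 < t ->
  gauss b ((2 * t) `^ (- 2^-1) *: y) = gauss (b / (2 * t)) y.
Proof.
move=> t0; rewrite /gauss dotpZl dotpZr (mulrA (_ `^ _)) half_power//.
by rewrite (mulrA b).
Qed.

Let scale_gauss_half (t : R) y : 0 < t ->
  gauss t ((2 * t) `^ (- 2^-1) *: y) = gauss (1 / 2) y.
Proof.
move=> t0; rewrite scale_gauss//; congr (gauss _ y).
by field; rewrite gt_eqF.
Qed.

(* Substituting y = (2t)^(-1/2) y' reduces every t to t = 1/2. *)
Let gauss_scale (t M : R) (h : V -> R) : 0 < t -> measurable_fun setT h ->
  (forall y, `|h y| <= M) ->
  \int[mu]_y (gauss t y * w y * h y) = (2 * t) `^ (- nu) *
    \int[mu]_y (gauss (1 / 2) y * w y * h ((2 * t) `^ (- 2^-1) *: y)).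
Proof.
move=> t0 mh hM; have t2 : 0 < 2 * t by rewrite mulr_gt0.
set s := (2 * t) `^ (- 2^-1); have s0 : 0 < s by exact: powR_gt0.
have := @Rint_density_scale s (fun y => gauss t y * h y) s0.
rewrite (@Rint_ext _ _ _ mu _ (fun y => gauss (1 / 2) y * w y * h (s *: y))); last first.
  by move=> y; rewrite scale_gauss_half// mulrAC.
rewrite (@Rint_ext _ _ _ mu (fun y => gauss t y * h y * w y) (fun y => gauss t y * w y * h y)); last first.
  by move=> y; rewrite mulrAC.
move=> ->; first last.
- under eq_fun do rewrite mulrAC; exact: L1_gauss_bounded t0 mh hM.
- by apply: measurable_funM => //; exact: measurable_gauss.
rewrite mulrA /s -powRrM -powRD; last by rewrite (gt_eqF t2) implybT.
rewrite (_ : - nu + _ = 0) ?powRr0 ?mul1r//; lra.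
Qed.

Definition heat_kernel (t : R) x z : R :=
  \int[mu]_y (gauss t y * w y * (C x y * C z y + S x y * S z y)).

Let even_le x z y : `|C x y * C z y + S x y * S z y| <= 2.
Proof.
rewrite (le_trans (ler_normD _ _))// !normrM (_ : 2 = 1 + 1)//.
by apply: lerD; apply: mulr_ile1.
Qed.

Let odd_le x z y : `|S x y * C z y - C x y * S z y| <= 2.
Proof.
rewrite (le_trans (ler_normB _ _))// !normrM (_ : 2 = 1 + 1)//.
by apply: lerD; apply: mulr_ile1.
Qed.

Let meven x z : measurable_fun setT (fun y => C x y * C z y + S x y * S z y).
Proof. by apply: measurable_funD; apply: measurable_funM. Qed.

Let modd x z : measurable_fun setT (fun y => S x y * C z y - C x y * S z y).
Proof. by apply: measurable_funB; apply: measurable_funM. Qed.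

Lemma heat_kernel_ge0 (t : R) x z : 0 < t -> 0 <= heat_kernel t x z.
Proof.
move=> t0; rewrite /heat_kernel (gauss_scale t0 (meven x z) (even_le x z)).
rewrite mulr_ge0 ?powR_ge0//.
set s := (2 * t) `^ (- 2^-1).
rewrite (@Rint_ext _ _ _ mu _ (fun y => gauss (1 / 2) y * w y *
   (C (s *: x) y * C (s *: z) y + S (s *: x) y * S (s *: z) y))).
  exact: (gauss_even_ge0 hRs hRp hk he).
move=> y.
by rewrite !(ker_scale hRp hk he _ _ y).1 !(ker_scale hRp hk he _ _ y).2.
Qed.

Lemma heat_odd_eq0 (t : R) x z : 0 < t ->
  \int[mu]_y (gauss t y * w y * (S x y * C z y - C x y * S z y)) = 0.
Proof.
move=> t0; rewrite (gauss_scale t0 (modd x z) (odd_le x z)).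
have := gauss_odd_eq0 hRs hRp hk he ((2 * t) `^ (- 2^-1) *: x) ((2 * t) `^ (- 2^-1) *: z).
rewrite /gauss_odd /gauss_pairing => H.
rewrite -[RHS](mulr0 ((2 * t) `^ (- nu))) -H; congr (_ * _); apply: Rint_ext => y.
rewrite !(ker_scale hRp hk he _ _ y).1 !(ker_scale hRp hk he _ _ y).2; ring.
Qed.

Lemma heat_kernel_sym t x z : heat_kernel t x z = heat_kernel t z x.
Proof. by apply: Rint_ext => y; congr (_ * _); ring. Qed.

(** The rescaled pairing at z = 0, where the kernel is 1: Gaussians are mapped to Gaussians. *)
Lemma Rint_gauss_ker_cos (u : R) x : 0 < u ->
  \int[mu]_y (gauss u y * w y * C x y) = (2 * u) `^ (- nu) * gauss (4 * u)^-1 x.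
Proof.
move=> u0; rewrite (gauss_scale u0 (mC x) (C1 x)); congr (_ * _).
have u2 : 0 < 2 * u by rewrite mulr_gt0.
have := gauss_even0r hRs hRp hk he ((2 * u) `^ (- 2^-1) *: x).
rewrite /gauss_even /gauss_pairing.
rewrite (@Rint_ext _ _ _ mu _ (fun y => gauss (1 / 2) y * w y * C x ((2 * u) `^ (- 2^-1) *: y))).
  by move=> ->; rewrite scale_gauss//; congr (gauss _ x); field; rewrite gt_eqF.
move=> y; rewrite (ker_cos0l he) (ker_sin0l he) mulr1 mulr0 addr0.
by rewrite (ker_scale hRp hk he _ _ y).1.
Qed.

Lemma Rint_gauss_ker_sin (u : R) x : 0 < u -> \int[mu]_y (gauss u y * w y * S x y) = 0.
Proof.
move=> u0; have := heat_odd_eq0 x 0 u0.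
rewrite (@Rint_ext _ _ _ mu _ (fun y => gauss u y * w y * S x y))// => y.
by rewrite (ker_cos0l he) (ker_sin0l he) mulr1 mulr0 subr0.
Qed.

Lemma measurable_ker_cos_pair : measurable_fun setT (fun p : V * V => C p.1 p.2).
Proof.
apply: lipschitz_measurable_pair => x y z.
- exact: (ker_cos_lipschitz_l hRs hRp hk he).
- exact: (ker_cos_lipschitz_r hRp hk he).
Qed.

Lemma measurable_ker_sin_pair : measurable_fun setT (fun p : V * V => S p.1 p.2).
Proof.
apply: lipschitz_measurable_pair => x y z.
- exact: (ker_sin_lipschitz_l hRs hRp hk he).
- exact: (ker_sin_lipschitz_r hRp hk he).
Qed.

Let L1_even t x z : 0 < t -> L1 mu (fun y => gauss t y * w y * (C x y * C z y + S x y * S z y)).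
Proof. by move=> t0; apply: L1_gauss_bounded (even_le x z). Qed.

Lemma measurable_heat_kernel (t : R) : 0 < t ->
  measurable_fun setT (fun p : V * V => heat_kernel t p.1 p.2).
Proof.
move=> t0.
(* Adding 2 makes the integrand nonnegative, so that Tonelli gives measurability of its integral;
   the added mass is subtracted afterwards. *)
pose F (q : (V * V) * V) : R := gauss t q.2 * w q.2 *
  (C q.1.1 q.2 * C q.1.2 q.2 + S q.1.1 q.2 * S q.1.2 q.2 + 2).
have F0 q : 0 <= F q.
  apply: mulr_ge0 (Gw0 _ _) _.
  by have := even_le q.1.1 q.1.2 q.2; rewrite ler_norml => /andP[+ _]; lra.
have mF : measurable_fun setT F.
  have mp1 := @measurable_triple13 _ _ _ V V V.
  have mp2 := @measurable_triple23 _ _ _ V V V.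
  apply: measurable_funM.
    have mgw : measurable_fun setT (fun y => gauss t y * w y).
      by apply: measurable_funM => //; exact: measurable_gauss.
    exact: (measurableT_comp mgw measurable_snd).
  apply: measurable_funD => //; apply: measurable_funD; apply: measurable_funM.
  - exact: (measurableT_comp measurable_ker_cos_pair mp1).
  - exact: (measurableT_comp measurable_ker_cos_pair mp2).
  - exact: (measurableT_comp measurable_ker_sin_pair mp1).
  - exact: (measurableT_comp measurable_ker_sin_pair mp2).
have H : measurable_fun setT (fun p : V * V => \int[mu]_y (F (p, y))%:E)%E.
  apply: (measurable_fun_fubini_tonelli_F (fun q => (F q)%:E)) => //.
  exact/measurable_EFinP.
rewrite (_ : (fun p => _) = fun p : V * V => fine (\int[mu]_y (F (p, y))%:E)%E -
   2 * \int[mu]_y (gauss t y * w y)); last first.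
  apply/funext => p; rewrite /heat_kernel -(RintZ 2 (L1_gauss_w t0)).
  rewrite -/(Rintegral _ _ _) -RintB; last exact: (L1Z 2 (L1_gauss_w t0)).
    by apply: Rint_ext => y; rewrite /F; ring.
  rewrite /F; apply: (L1_gauss_bounded (M := 4)) => //.
    exact: (measurable_funD (meven p.1 p.2) (measurable_cst _)).
  move=> y; apply: (le_trans (ler_normD _ _)); rewrite (ger0_norm (ler0n R 2)).
  by rewrite (_ : 4 = 2 + 2 :> R) ?lerD2r ?even_le// -natrD.
by apply: measurable_funB => //; exact: measurableT_comp.
Qed.

Lemma heat_kernel_le (t : R) x z : 0 < t -> `|heat_kernel t x z| <= 2 * (2 * t) `^ (- nu).
Proof.
move=> t0; rewrite -Rint_gauss_w// -(RintZ 2 (L1_gauss_w t0)).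
apply: le_trans (le_normr_Rintegral measurableT (L1_even _ _ t0)) _.
apply: le_Rintegral => //; first exact: (L1_norm (L1_even _ _ t0)).
  exact: (L1Z 2 (L1_gauss_w t0)).
move=> y _; rewrite (normrM (gauss t y * w y)) (ger0_norm (Gw0 t y)) mulrC.
exact: ler_wpM2r (Gw0 t y) _ _ (even_le x z y).
Qed.

(** Two Gaussian transforms in succession: exp(-u|z|^2) becomes a multiple of exp(-|y|^2/(4u)),
    which joins exp(-t|y|^2), and the second transform has parameter t + 1/(4u). The prefactors
    combine because 2u times 2(t + 1/(4u)) is 1 + 4tu; the sine part drops out since Gaussians have
    real transforms. *)
Lemma heat_kernel_gauss (t u : R) x : 0 < t -> 0 < u ->
  \int[mu]_z (gauss u z * w z * heat_kernel t x z) =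
  (1 + 4 * t * u) `^ (- nu) * gauss (u / (1 + 4 * t * u)) x.
Proof.
move=> t0 u0.
have tu : 0 < 1 + 4 * t * u by rewrite addr_gt0// !mulr_gt0.
have symC z y : C z y = C y z by exact: (ker_sym hRs hRp hk he z y).1.
have symS z y : S z y = S y z by exact: (ker_sym hRs hRp hk he z y).2.
have mK : measurable_fun setT (fun p : V * V => C x p.2 * C p.1 p.2 + S x p.2 * S p.1 p.2).
  apply: measurable_funD; apply: measurable_funM.
  - exact: measurableT_comp.
  - exact: measurable_ker_cos_pair.
  - exact: measurableT_comp.
  - exact: measurable_ker_sin_pair.
have Kle (p : V * V) : `|C x p.2 * C p.1 p.2 + S x p.2 * S p.1 p.2| <= 2 by exact: even_le.
rewrite /heat_kernel (fubini_bounded_kernel (L1_gauss_w u0) (L1_gauss_w t0) mK Kle).2/=.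
have inner y : \int[mu]_z (gauss u z * w z * (C x y * C z y + S x y * S z y)) =
    C x y * ((2 * u) `^ (- nu) * gauss (4 * u)^-1 y).
  rewrite (@Rint_ext _ _ _ mu _ (fun z => C x y * (gauss u z * w z * C y z) +
    S x y * (gauss u z * w z * S y z))); last by move=> z; rewrite (symC z) (symS z); ring.
  have LC : L1 mu (fun z => gauss u z * w z * C y z) by exact: L1_gauss_bounded (C1 y).
  have LS : L1 mu (fun z => gauss u z * w z * S y z) by exact: L1_gauss_bounded (S1 y).
  rewrite (RintD (L1Z _ LC) (L1Z _ LS)) (RintZ _ LC) (RintZ _ LS).
  by rewrite Rint_gauss_ker_cos// Rint_gauss_ker_sin// mulr0 addr0.
have tu' : 0 < t + (4 * u)^-1 by rewrite addr_gt0// invr_gt0 mulr_gt0.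
rewrite (@Rint_ext _ _ _ mu _ (fun y => (2 * u) `^ (- nu) *
   (gauss (t + (4 * u)^-1) y * w y * C x y))); last first.
  move=> y; rewrite inner.
  have -> : gauss (t + (4 * u)^-1) y = gauss t y * gauss (4 * u)^-1 y.
    by rewrite /gauss -expRD; congr expR; rewrite mulrDl opprD.
  by ring.
rewrite (RintZ _ (L1_gauss_bounded tu' (mC x) (C1 x))).
rewrite Rint_gauss_ker_cos// mulrA -powRM; [|by rewrite mulr_ge0// ltW..].
congr (_ `^ _ * gauss _ x).
- by field; rewrite gt_eqF.
- field; rewrite (gt_eqF u0) (gt_eqF tu) /=.
  done.
Qed.

End heat_kernel.

(** * Gamma and beta integrals *)

Section gamma_function.
Context {R : realType}.
Local Notation leb := (@lebesgue_measure R).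

Lemma fatou_le {dT : measure_display} {T : measurableType dT} (mu : {measure set T -> \bar R})
    (f_ : nat -> T -> R) (f : T -> R) (c : \bar R) :
  (forall n, measurable_fun setT (f_ n)) -> (forall n x, 0 <= f_ n x) ->
  (forall x, f_ n x @[n --> \oo] --> f x) ->
  (forall n, \int[mu]_x (f_ n x)%:E <= c)%E -> (\int[mu]_x (f x)%:E <= c)%E.
Proof.
move=> mf f0 ff fc.
have := @fatou _ _ _ mu setT measurableT (fun n x => (f_ n x)%:E).
move=> /(_ (fun n => (measurable_EFinP _ _).2 (mf n))).
move=> /(_ (fun n x _ => f0 n x)).
rewrite (_ : (fun x => limn_einf _) = (fun x => (f x)%:E)); last first.
  apply/funext => x; apply: (cvg_limn_einf_sup _).1.
  by apply: cvg_EFin; [exact: nearW|exact: ff].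
move=> H; apply: (le_trans H).
rewrite limn_einf_lim; apply: lime_le; first exact: is_cvg_einfs.
apply: nearW => n; apply: (le_trans _ (fc n)).
apply: ereal_inf_lbound; exists n => //=.
Qed.

(** The density t^(a - 1) extended by 0, so that gamma and beta integrals run over the whole line,
    where affine substitution and Tonelli apply directly. *)
Definition pos_pow (a t : R) : R := if 0 < t then t `^ (a - 1) else 0.

Lemma pos_pow_ge0 a t : 0 <= pos_pow a t.
Proof. by rewrite /pos_pow; case: ifP => // _; exact: powR_ge0. Qed.

Lemma pos_powE a t : 0 < t -> pos_pow a t = t `^ (a - 1).
Proof. by rewrite /pos_pow => ->. Qed.

Lemma measurable_pos_pow a : measurable_fun setT (pos_pow a).
Proof.
apply: measurable_fun_ifT => //; exact: measurable_fun_ltr.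
Qed.

Lemma is_derive_powR (a t : R) : 0 < t ->
  is_derive t (1 : R) (fun s : R => s `^ a) (a * t `^ (a - 1)).
Proof.
move=> t0; have tI : t \in `]0, +oo[ by rewrite in_itv/= t0.
apply: DeriveDef; first exact: derivable_powR.
by rewrite -derive1E powR_derive1.
Qed.

Lemma continuous_powR (a t : R) : 0 < t -> {for t, continuous (fun s : R => s `^ a)}.
Proof.
move=> t0; have [dp _] := is_derive_powR a t0.
exact: (differentiable_continuous (proj1 (derivable1_diffP _ _) dp)).
Qed.

(** The function (t/(1 + t))^a is a times a primitive and lies in [0, 1]. An upper bound is enough:
    the integrand serves as a majorant of the right size both at 0 and at infinity. *)
Lemma integral_pos_pow_le (a : R) : 0 < a ->
  (\int[leb]_t (pos_pow a t * (1 + t) `^ (- a - 1))%:E <= (a^-1)%:E)%E.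
Proof.
move=> a0.
pose f (t : R) := a * (t `^ (a - 1) * (1 + t) `^ (- a - 1)).
pose F (t : R) := (t / (1 + t)) `^ a.
have dF (t : R) : 0 < t -> is_derive t (1 : R) F (f t).
  move=> t0; have t1 : 0 < 1 + t by rewrite addr_gt0.
  have q0 : 0 < t / (1 + t) by rewrite divr_gt0.
  have d1 : is_derive t (1 : R) (fun s : R => 1 + s) 1.
    have := is_derive_add (is_derive_cst (1 : R) t (1 : R)) (is_derive_id t (1 : R)).
    by rewrite add0r.
  have dq : is_derive t (1 : R) (fun s : R => s / (1 + s)) ((1 + t) ^- 2).
    have n1 : 1 + t != 0 by rewrite gt_eqF.
    have dV := is_deriveV n1 d1.
    have := is_derive_mul (is_derive_id t (1 : R)) dV.
    move/is_derive_eq; apply.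
    by rewrite /GRing.scale/=; field; rewrite gt_eqF.
  have := is_derive_comp (h := fun s : R => s `^ a) (f := fun s : R => s / (1 + s)) (is_derive_powR a q0) dq.
  move/is_derive_eq; apply.
  rewrite /f -mulrA; congr (_ * _); rewrite powRM ?invr_ge0 ?ltW//.
  rewrite -mulrA; congr (_ * _).
  rewrite -(powR_invn 2 (ltW t1)) -(powR_inv1 (ltW t1)) -powRrM -powRD.
    by congr (_ `^ _); ring.
  by rewrite (gt_eqF t1) implybT.
have cf (t : R) : 0 < t -> {for t, continuous f}.
  move=> t0; apply: cvgM; first exact: cvg_cst.
  apply: cvgM; first exact: continuous_powR.
  apply: (cvg_comp (fun s : R => 1 + s) (fun s : R => s `^ (- a - 1))).
    by apply: cvgD; [exact: cvg_cst|exact: cvg_id].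
  by apply: continuous_powR; rewrite addr_gt0.
have F01 (t : R) : 0 < t -> 0 <= F t <= 1.
  move=> t0; have t1 : 0 < 1 + t by rewrite addr_gt0.
  have E1 : 1 `^ a = 1 :> R by rewrite powR1.
  rewrite powR_ge0/= -E1; apply: ge0_ler_powR; rewrite ?ltW// ?nnegrE//.
  - by rewrite divr_ge0// ltW.
  - by rewrite ltr_pdivrMr// mul1r ltrDr.
(* The right end n + 2 keeps the interval nondegenerate already for n = 0. *)
pose I n : set R := [set` `[n.+1%:R^-1, n.+2%:R]].
have Ipos n t : I n t -> 0 < t.
  by rewrite /I/= in_itv/= => /andP[+ _]; apply: lt_le_trans; rewrite invr_gt0.
have mI n : measurable (I n) by exact: measurable_itv.
apply: (@fatou_le _ _ leb (fun n t => \1_(I n) t * (pos_pow a t * (1 + t) `^ (- a - 1)))).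
- move=> n; apply: measurable_funM; first by apply: measurable_indic; exact: mI.
  apply: measurable_funM; first exact: measurable_pos_pow.
  apply: (measurableT_comp (measurable_powR _)); exact: measurable_funD.
- by move=> n t; rewrite !mulr_ge0 ?powR_ge0 ?pos_pow_ge0.
- move=> t; have [t0|t0] := ltP 0 t; last first.
    rewrite /pos_pow ltNge t0/= mul0r; under eq_fun do rewrite mulr0.
    exact: cvg_cst.
  rewrite -[X in _ --> X]mul1r; apply: cvgM; last exact: cvg_cst.
  apply: cvg_near_cst.
  near=> n; rewrite indicE mem_set// /I/= in_itv/=; apply/andP; split.
    by apply/ltW; near: n; exact: near_harmonic_lt.
  have : t <= n%:R by near: n; exact: nbhs_infty_ger.
  by move=> tn; apply: (le_trans tn); rewrite ler_nat; exact: leqW (leqnSn n).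
move=> n.
have -> : (\int[leb]_t (\1_(I n) t * (pos_pow a t * (1 + t) `^ (- a - 1)))%:E =
    \int[leb]_(t in I n) (a^-1 * f t)%:E)%E.
  rewrite [RHS]integral_mkcond; apply: eq_integral => t _.
  rewrite patchE indicE; case: ifPn => It; last by rewrite mul0r.
  rewrite mul1r pos_powE; last by apply: Ipos; exact: set_mem It.
  by rewrite /f mulKf// gt_eqF.
have nn : n.+1%:R^-1 < n.+2%:R :> R.
  rewrite (@le_lt_trans _ _ 1)// ?ltr1n// invf_le1 ?ler1n//.
have -> : (\int[leb]_(t in I n) (a^-1 * f t)%:E = (a^-1)%:E * \int[leb]_(t in I n) (f t)%:E)%E.
  have mf : measurable_fun (I n) f.
    apply: subspace_continuous_measurable_fun => //.
    by apply: continuous_in_subspaceT => t; rewrite inE => /Ipos; exact: cf.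
  rewrite -ge0_integralZl//.
  - exact: mI.
  - exact/measurable_EFinP.
  - by move=> t _; rewrite lee_fin mulr_ge0 ?(ltW a0)// mulr_ge0 ?powR_ge0.
  - by rewrite lee_fin invr_ge0 ltW.
rewrite (@continuous_FTC2 _ f F) //.
- have p1 : 0 < n.+1%:R^-1 :> R by rewrite invr_gt0.
  have p2 : 0 < n.+2%:R :> R by [].
  have /andP[h1 _] := F01 _ p1; have /andP[_ h2] := F01 _ p2.
  rewrite -EFinB -EFinM lee_fin ler_piMr ?invr_ge0 ?(ltW a0)//; lra.
- by apply: continuous_in_subspaceT => t; rewrite inE => /Ipos; exact: cf.
- have cF (t : R) : 0 < t -> {for t, continuous F}.
    move=> t0; have [dp _] := dF t t0.
    exact: (differentiable_continuous (proj1 (derivable1_diffP _ _) dp)).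
  split.
  + move=> t; rewrite in_itv/= => /andP[+ _] => /(lt_trans _) => /(_ 0) H.
    by have [] := dF t; first (by apply: H; rewrite invr_gt0).
  + by apply: cvg_at_right_filter; apply: cF; rewrite invr_gt0.
  + by apply: cvg_at_left_filter; exact: cF.
- move=> t; rewrite in_itv/= => /andP[+ _] => /(lt_trans _) => /(_ 0) H.
  rewrite derive1E; have [//|_] := dF t; first by apply: H; rewrite invr_gt0.
Unshelve. all: by end_near. Qed.

(** Up to a constant, exp(-t) is below (1 + t)^(-a - 1), so the previous integrand dominates. *)
Lemma L1_gamma (a : R) : 0 < a -> L1 leb (fun t => pos_pow a t * expR (- t)).
Proof.
move=> a0; have [K K0 HK] := @powR_le_gauss R (a + 1) 1 1 (ltW (addr_gt0 a0 ltr01)) ler01 ltr01.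
have L : L1 leb (fun t => pos_pow a t * (1 + t) `^ (- a - 1)).
  apply/integrableP; split.
    apply/measurable_EFinP; apply: measurable_funM; first exact: measurable_pos_pow.
    apply: (measurableT_comp (measurable_powR _)); exact: measurable_funD.
  under eq_integral do rewrite /= ger0_norm ?mulr_ge0 ?pos_pow_ge0 ?powR_ge0//.
  by rewrite (le_lt_trans (integral_pos_pow_le a0))// ltry.
apply: (L1_dom _ _ (L1Z K L)).
  apply: measurable_funM; first exact: measurable_pos_pow.
  by apply: measurableT_comp => //; exact: measurableT_comp.
move=> t; rewrite ger0_norm ?mulr_ge0 ?pos_pow_ge0 ?expR_ge0// /pos_pow.
case: ifP => [t0|_]; last by rewrite !mul0r mulr0.
have t1 : 0 < 1 + t by rewrite addr_gt0.
have e0 := expR_gt0 t; have p0 := powR_gt0 (a + 1) t1.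
rewrite mulrCA ler_wpM2l ?powR_ge0// expRN -opprD powRN ler_pdivlMr// mulrC ler_pdivrMr//.
by have := HK t (ltW t0); rewrite !mul1r [_ + 1]addrC.
Qed.

Lemma GammaE (a : R) : Gamma a = \int[leb]_t (pos_pow a t * expR (- t)).
Proof.
rewrite /Gamma /Rintegral integral_mkcond; congr fine; apply: eq_integral => t _.
rewrite patchE mem_setE in_itv/= andbT /pos_pow.
by case: ifP => _ //; rewrite mul0r.
Qed.

Lemma integral_gamma (a : R) : 0 < a ->
  (\int[leb]_t (pos_pow a t * expR (- t))%:E = (Gamma a)%:E)%E.
Proof. by move=> a0; rewrite GammaE Rint_EFin//; exact: L1_gamma. Qed.

Lemma integral_pos_pow_exp (a c : R) : 0 < a -> 0 < c ->
  (\int[leb]_t (pos_pow a t * expR (- (c * t)))%:E = (Gamma a * c `^ (- a))%:E)%E.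
Proof.
move=> a0 c0.
have mg : measurable_fun setT (fun t : R => (pos_pow a t * expR (- t))%:E).
  apply/measurable_EFinP; apply: measurable_funM; first exact: measurable_pos_pow.
  by apply: measurableT_comp => //; exact: measurableT_comp.
have g0 t : (0 <= (pos_pow a t * expR (- t))%:E)%E.
  by rewrite lee_fin mulr_ge0 ?pos_pow_ge0 ?expR_ge0.
have := lebesgue_integral_affine 0 c0 mg g0; rewrite integral_gamma// => H.
have E t : pos_pow a t * expR (- (c * t)) =
    c `^ (1 - a) * (pos_pow a (c * t + 0) * expR (- (c * t + 0))).
  rewrite addr0 mulrA; congr (_ * _).
  rewrite /pos_pow pmulr_rgt0//; case: ifP => t0; last by rewrite mulr0.
  rewrite powRM ?(ltW t0) ?(ltW c0)// mulrA -powRD; last by rewrite (gt_eqF c0) implybT.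
  by rewrite (_ : 1 - a + (a - 1) = 0) ?powRr0 ?mul1r//; ring.
under eq_integral do rewrite E EFinM.
rewrite ge0_integralZl//; first last.
- by rewrite lee_fin powR_ge0.
- apply: (measurableT_comp mg); apply: measurable_funD => //; exact: measurable_funM.
rewrite H -!EFinM; congr EFin; rewrite mulrA mulrC; congr (_ * _).
rewrite -(powR_inv1 (ltW c0)) -powRD; last by rewrite (gt_eqF c0) implybT.
by congr (_ `^ _); ring.
Qed.

Lemma Gamma_gt0 (a : R) : 0 < a -> 0 < Gamma a.
Proof.
move=> a0.
have G0 : 0 <= Gamma a.
  by rewrite GammaE; apply: Rintegral_ge0 => t _; rewrite mulr_ge0 ?pos_pow_ge0 ?expR_ge0.
rewrite lt0r G0 andbT; apply/eqP => G00.
(* if the integral vanished, so would that of the minorant 1_[1,2] *)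
pose m : R := Num.min 1 (2 `^ (a - 1)) * expR (- 2).
have m0 : 0 < m by rewrite mulr_gt0 ?expR_gt0// lt_min ltr01 powR_gt0.
have : ((m * 1)%:E <= \int[leb]_t (pos_pow a t * expR (- t))%:E)%E.
  rewrite (_ : ((m * 1)%:E = \int[leb]_(t in `[1%R : R, 2%R]) m%:E)%E).
    rewrite integral_mkcond; apply: ge0_le_integral => //.
    - move=> t _; rewrite patchE; case: ifP => _ //.
      by rewrite lee_fin ltW.
    - by apply/(measurable_restrictT _ _).1 => //; exact: measurable_cst.
    - apply/measurable_EFinP; apply: measurable_funM; first exact: measurable_pos_pow.
      by apply: measurableT_comp => //; exact: measurableT_comp.
    move=> t _; rewrite patchE; case: ifPn => [|_]; last first.
      by rewrite lee_fin mulr_ge0 ?pos_pow_ge0 ?expR_ge0.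
    rewrite mem_setE in_itv/= => /andP[t1 t2].
    have t0 : 0 < t by exact: lt_le_trans t1.
    rewrite lee_fin pos_powE// /m; apply: ler_pM; rewrite ?expR_ge0//.
    - rewrite ge_min; have [a1|a1] := leP 1 a.
        have E1 : 1 `^ (a - 1) = 1 :> R by rewrite powR1.
        by rewrite -{1}E1 ge0_ler_powR ?nnegrE ?subr_ge0// ltW.
      apply/orP; right; rewrite -[a - 1]opprB !powRN lef_pV2 ?posrE ?powR_gt0//.
      have ta : 0 <= 1 - a by rewrite subr_ge0 ltW.
      by rewrite ge0_ler_powR ?nnegrE// ltW.
    - by rewrite ler_expR lerN2.
  rewrite integral_cst//= lebesgue_measure_itv/= lte_fin ltr1n/= -EFinD -EFinM.
  by congr EFin; ring.
by rewrite integral_gamma// G00 mulr1 lee_fin leNgt m0.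
Qed.

Lemma measurable_pos_pow_exp (a c : R) :
  measurable_fun setT (fun t : R => (pos_pow a t * expR (- (c * t)))%:E).
Proof.
apply/measurable_EFinP; apply: measurable_funM; first exact: measurable_pos_pow.
by apply: measurableT_comp => //; apply: measurableT_comp => //; exact: measurable_funM.
Qed.

(* Tonelli for the double integral of u^(p-1) r^(b-1) e^(-u(1+r)). *)
Lemma integral_beta (b p : R) : 0 < b -> b < p ->
  (\int[leb]_r (pos_pow b r * (1 + r) `^ (- p))%:E =
   (Gamma b * Gamma (p - b) / Gamma p)%:E)%E.
Proof.
move=> b0 bp; have p0 : 0 < p by exact: lt_trans bp.
have pb : 0 < p - b by rewrite subr_gt0.
pose f (q : R * R) : R := pos_pow b q.1 * (pos_pow p q.2 * expR (- ((1 + q.1) * q.2))).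
have f0 q : 0 <= f q by rewrite !mulr_ge0 ?pos_pow_ge0 ?expR_ge0.
have mf : measurable_fun setT f.
  apply: measurable_funM; first exact: (measurableT_comp (measurable_pos_pow b)).
  apply: measurable_funM; first exact: (measurableT_comp (measurable_pos_pow p)).
  apply: measurableT_comp => //; apply: measurableT_comp => //.
  by apply: measurable_funM => //; exact: measurable_funD.
have mE : measurable_fun setT (fun q => (f q)%:E) by exact/measurable_EFinP.
have f0E q : (0 <= (f q)%:E)%E by rewrite lee_fin.
have := @fubini_tonelli _ _ _ _ _ leb leb _ mE f0E.
have -> : (\int[leb]_x \int[leb]_y (f (x, y))%:E =
   (Gamma p)%:E * \int[leb]_r (pos_pow b r * (1 + r) `^ (- p))%:E)%E.
  rewrite -ge0_integralZl//; first last.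
  - by rewrite lee_fin ltW// Gamma_gt0.
  - by move=> r _; rewrite lee_fin mulr_ge0 ?pos_pow_ge0 ?powR_ge0.
  - apply/measurable_EFinP; apply: measurable_funM; first exact: measurable_pos_pow.
    apply: (measurableT_comp (measurable_powR _)); exact: measurable_funD.
  apply: eq_integral => r _; rewrite /f /=; have [r0|r0] := ltP 0 r; last first.
    rewrite /pos_pow ltNge r0/= mul0r mule0; apply: integral0_eq => t _.
    by rewrite mul0r.
  under eq_integral do rewrite EFinM.
  rewrite ge0_integralZl ?integral_pos_pow_exp//.
  - by rewrite -!EFinM; congr EFin; ring.
  - by rewrite addr_gt0.
  - exact: measurable_pos_pow_exp.
  - by move=> t _; rewrite lee_fin mulr_ge0 ?pos_pow_ge0 ?expR_ge0.
  - by rewrite lee_fin pos_pow_ge0.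
have -> : (\int[leb]_y \int[leb]_x (f (x, y))%:E = (Gamma b * Gamma (p - b))%:E)%E.
  rewrite EFinM -(integral_gamma pb) -ge0_integralZl//; first last.
  - by rewrite lee_fin ltW// Gamma_gt0.
  - by move=> u _; rewrite lee_fin mulr_ge0 ?pos_pow_ge0 ?expR_ge0.
  - apply/measurable_EFinP; apply: measurable_funM; first exact: measurable_pos_pow.
    by apply: measurableT_comp => //; exact: measurableT_comp.
  apply: eq_integral => u _; rewrite /f /=; have [u0|u0] := ltP 0 u; last first.
    rewrite /pos_pow ltNge u0/= mul0r mule0; apply: integral0_eq => t _.
    by rewrite mul0r mulr0.
  have E r : pos_pow b r * (pos_pow p u * expR (- ((1 + r) * u))) =
      pos_pow p u * expR (- u) * (pos_pow b r * expR (- (u * r))).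
    by rewrite (_ : - ((1 + r) * u) = - u + - (u * r)) ?expRD; ring.
  under eq_integral do rewrite E EFinM.
  rewrite ge0_integralZl ?integral_pos_pow_exp//.
  - rewrite -!EFinM; congr EFin; rewrite !pos_powE//.
    have -> : u `^ (p - b - 1) = u `^ (p - 1) * u `^ (- b).
      rewrite -powRD; first by congr (_ `^ _); ring.
      by rewrite (gt_eqF u0) implybT.
    by ring.
  - exact: measurable_pos_pow_exp.
  - by move=> t _; rewrite lee_fin mulr_ge0 ?pos_pow_ge0 ?expR_ge0.
  - by rewrite lee_fin mulr_ge0 ?pos_pow_ge0 ?expR_ge0.
move=> H; have Gp := Gamma_gt0 p0.
rewrite -[LHS]mul1e -[1%E](_ : ((Gamma p)^-1%:E * (Gamma p)%:E)%E = _); last first.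
  by rewrite -EFinM mulVf// gt_eqF.
by rewrite -muleA H -EFinM mulrC.
Qed.

End gamma_function.

(** * The upper bound *)

Lemma measurable_inv_gt0 {dT : measure_display} {T : measurableType dT} {R : realType}
    (h : T -> R) : measurable_fun setT h -> (forall x, 0 < h x) ->
  measurable_fun setT (fun x => (h x)^-1).
Proof.
move=> mh h0; rewrite (_ : (fun x => _) = (fun x => h x `^ (-1))).
  exact: (measurableT_comp (measurable_powR _) mh).
by apply/funext => x; rewrite powR_inv1// ltW.
Qed.

(* Schur's test: |f(x) f(z)| <= (f(x)^2 h(z)/h(x) + f(z)^2 h(x)/h(z)) / 2. *)
Lemma schur_test {dT : measure_display} {T : measurableType dT} {R : realType}
    (mu : {sigma_finite_measure set T -> \bar R}) (K : T * T -> R) (f h w : T -> R) :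
  measurable_fun setT K -> (forall p, 0 <= K p) -> (forall x z, K (x, z) = K (z, x)) ->
  measurable_fun setT f -> measurable_fun setT h -> measurable_fun setT w ->
  (forall x, 0 < h x) -> (forall x, 0 <= w x) ->
  (\int[mu]_x \int[mu]_z (`|f x * w x| * (`|f z * w z| * K (x, z)))%:E <=
   \int[mu]_x ((f x ^+ 2 / h x * w x)%:E * \int[mu]_z (K (x, z) * (h z * w z))%:E))%E.
Proof.
move=> mK K0 Ksym mf mh mw h0 w0.
pose A (p : T * T) : R := f p.1 ^+ 2 / h p.1 * w p.1 * (K p * (h p.2 * w p.2)).
pose B (p : T * T) : R := A (p.2, p.1).
pose L (p : T * T) : R := `|f p.1 * w p.1| * (`|f p.2 * w p.2| * K p).
have hh x : 0 <= h x by exact: ltW.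
have hV x : 0 <= (h x)^-1 by rewrite invr_ge0.
have q0 x : 0 <= f x ^+ 2 / h x * w x.
  by apply: mulr_ge0 => //; apply: mulr_ge0 => //; exact: sqr_ge0.
have A0 p : 0 <= A p by apply: mulr_ge0 => //; apply: mulr_ge0 => //; exact: mulr_ge0.
have m1 (g : T -> R) : measurable_fun setT g -> measurable_fun setT (fun p : T * T => g p.1).
  by move=> mg; exact: (measurableT_comp mg measurable_fst).
have m2 (g : T -> R) : measurable_fun setT g -> measurable_fun setT (fun p : T * T => g p.2).
  by move=> mg; exact: (measurableT_comp mg measurable_snd).
have mhV : measurable_fun setT (fun x => (h x)^-1).
  exact: measurable_inv_gt0.
have mq : measurable_fun setT (fun x => f x ^+ 2 / h x * w x).
  by apply: measurable_funM => //; apply: measurable_funM => //; exact: measurable_funX.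
have mA : measurable_fun setT A.
  apply: measurable_funM; first exact: (m1 (fun x => f x ^+ 2 / h x * w x)).
  by apply: measurable_funM => //; exact: (m2 (fun x => h x * w x) (measurable_funM mh mw)).
have mB : measurable_fun setT B.
  by apply: (measurableT_comp mA); apply/measurable_fun_pairP; split;
    [exact: measurable_snd|exact: measurable_fst].
have mfw : measurable_fun setT (fun x => `|f x * w x|).
  by apply: measurableT_comp => //; exact: measurable_funM.
have mL : measurable_fun setT L.
  apply: measurable_funM; first exact: (m1 _ mfw).
  by apply: measurable_funM => //; exact: (m2 _ mfw).
have LAB p : L p <= 2^-1 * (A p + B p).
  rewrite /L /B /A /= !normrM (ger0_norm (w0 _)) (ger0_norm (w0 p.2)).
  rewrite (_ : K (p.2, p.1) = K p); last by case: p => x z; rewrite Ksym.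
  have hx := h0 p.1; have hz := h0 p.2.
  set hx' := h p.1 in hx *; set hz' := h p.2 in hz *.
  rewrite -(real_normK (num_real (f p.1))) -(real_normK (num_real (f p.2))).
  set a := `|f p.1|; set b := `|f p.2|.
  set M := w p.1 * w p.2 * K p.
  have M0 : 0 <= M by rewrite !mulr_ge0.
  rewrite (_ : a * _ * _ = M * (a * b)); last by rewrite /M; ring.
  rewrite (_ : 2^-1 * _ = M * (2^-1 * (a ^+ 2 * hz' / hx' + b ^+ 2 * hx' / hz'))); last first.
    by rewrite /M; ring.
  rewrite ler_wpM2l// -subr_ge0.
  rewrite (_ : _ - _ = (a * hz' - b * hx') ^+ 2 / (2 * hx' * hz')).
    by rewrite divr_ge0 ?sqr_ge0// !mulr_ge0 ?ltW.
  by field; rewrite !gt_eqF.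
have mE (g : T * T -> R) : measurable_fun setT g -> measurable_fun setT (fun p => (g p)%:E).
  by move=> mg; exact/measurable_EFinP.
have L0 p : 0 <= L p by rewrite !mulr_ge0.
have B0 p : 0 <= B p by exact: A0.
have swapE : (\int[(mu \x mu)%E]_p (B p)%:E = \int[(mu \x mu)%E]_p (A p)%:E)%E.
  by rewrite (fubini_tonelli1 _ (mE _ mB))// (fubini_tonelli2 _ (mE _ mA)).
rewrite -(fubini_tonelli1 (fun p => (L p)%:E) (mE _ mL)); last by move=> p; rewrite lee_fin.
apply: (@le_trans _ _ (\int[(mu \x mu)%E]_p (A p)%:E)%E).
  apply: (@le_trans _ _ (\int[(mu \x mu)%E]_p (2^-1 * (A p + B p))%:E)%E).
    apply: ge0_integral_mono => //.
    by apply: measurable_funM => //; exact: measurable_funD.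
  rewrite ge0_integral_mulc//; [|exact: measurable_funD|by move=> p; rewrite addr_ge0].
  under eq_integral do rewrite EFinD.
  rewrite ge0_integralD//; [|by move=> p _; rewrite lee_fin|exact: mE|by move=> p _; rewrite lee_fin|exact: mE].
  have half (X : \bar R) : (0 <= X -> (2^-1)%:E * (X + X) <= X)%E.
    case: X => [r| |] // r0; last exact: leey.
    by rewrite -EFinD -EFinM lee_fin; lra.
  by rewrite swapE; apply: half; apply: integral_ge0 => p _; rewrite lee_fin.
rewrite (fubini_tonelli1 _ (mE _ mA)); last by move=> p; rewrite lee_fin.
rewrite le_eqVlt; apply/orP; left; apply/eqP; apply: eq_integral => x _.
rewrite /fubini_F /A /=; under eq_integral do rewrite EFinM.
rewrite ge0_integralZl//.
- apply/measurable_EFinP; apply: measurable_funM; first exact: measurableT_comp.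
  exact: measurable_funM.
- by move=> z _; rewrite lee_fin !mulr_ge0// ltW.
- by rewrite lee_fin.
Qed.

(** * Gaussian-weighted energy of the transform *)

Section energy.
Context {R : realType} {d : nat}.
Local Notation V := 'rV[R]_d.
Local Notation mu := (@lebesgue_rV R d).
Variables (Rs Rp : {fset V}) (k : V -> R).
Hypotheses (hRs : root_system Rs) (hRp : positive_subsystem Rs Rp)
  (hk : multiplicity Rs k).
Variable e : V -> V -> R[i].
Hypothesis he : is_dunkl_kernel Rp k e.
Local Notation w := (dunkl_density Rp k).
Local Notation C := (ker_cos e).
Local Notation S := (ker_sin e).
Implicit Types (x y z : V).

Let w0 x : 0 <= w x.
Proof. exact: (dunkl_density_ge0 hRp hk). Qed.

Let mw : measurable_fun setT w.
Proof. exact: measurable_dunkl_density. Qed.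

Definition cos_transform (f : V -> R) y : R := \int[mu]_x (f x * w x * C x y).
Definition sin_transform (f : V -> R) y : R := \int[mu]_x (f x * w x * S x y).

(** Fubini moves the y-integral inside for each product of kernel components; the integrability
    claims are what lets [transform_energyE] add these products up. *)
Let bilinear (t : R) (f g : V -> R) (k1 k2 : V -> V -> R) : 0 < t ->
  L1 mu (fun x => f x * w x) -> L1 mu (fun x => g x * w x) ->
  measurable_fun setT (fun p : V * V => k1 p.1 p.2) ->
  measurable_fun setT (fun p : V * V => k2 p.1 p.2) ->
  (forall x y, `|k1 x y| <= 1) -> (forall x y, `|k2 x y| <= 1) ->
  [/\ L1 mu (fun y => gauss t y * w y * ((\int[mu]_x (f x * w x * k1 x y)) *
     (\int[mu]_z (g z * w z * k2 z y)))),
    (forall x, L1 mu (fun z => g z * w z * \int[mu]_y (gauss t y * w y * (k1 x y * k2 z y)))),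
    L1 mu (fun x => f x * w x * \int[mu]_z (g z * w z *
      \int[mu]_y (gauss t y * w y * (k1 x y * k2 z y)))) &
  \int[mu]_y (gauss t y * w y * ((\int[mu]_x (f x * w x * k1 x y)) *
     (\int[mu]_z (g z * w z * k2 z y)))) =
  \int[mu]_x (f x * w x * \int[mu]_z (g z * w z *
      \int[mu]_y (gauss t y * w y * (k1 x y * k2 z y))))].
Proof.
move=> t0 Lf Lg mk1 mk2 k11 k21.
have Lt := L1_gauss_w hRp hk t0.
have mswap : measurable_fun setT (fun p : V * V => (p.2, p.1)).
  by apply/measurable_fun_pairP; split; [exact: measurable_snd|exact: measurable_fst].
have mk1' : measurable_fun setT (fun p : V * V => k1 p.2 p.1).
  exact: (measurableT_comp mk1 mswap).
have mk2' : measurable_fun setT (fun p : V * V => k2 p.2 p.1).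
  exact: (measurableT_comp mk2 mswap).
have mk1x x : measurable_fun setT (k1 x).
  exact: (measurableT_comp mk1 (pair1_measurable x)).
have [LT2 _] := fubini_bounded_kernel Lt Lg mk2' (fun p => k21 p.2 p.1).
have [L1' E1] := fubini_bounded_kernel LT2 Lf mk1' (fun p => k11 p.2 p.1).
have [L1'' _] := fubini_bounded_kernel Lf LT2 mk1 (fun p => k11 p.1 p.2).
have Lk x : L1 mu (fun y => gauss t y * w y * k1 x y).
  by apply: (L1_gauss_bounded hRp hk t0 (mk1x x)); exact: k11.
have inner x : \int[mu]_y (gauss t y * w y * (\int[mu]_z (g z * w z * k2 z y)) * k1 x y) =
    \int[mu]_z (g z * w z * \int[mu]_y (gauss t y * w y * (k1 x y * k2 z y))).
  have [_ E] := fubini_bounded_kernel (Lk x) Lg mk2' (fun p => k21 p.2 p.1).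
  rewrite (@Rint_ext _ _ _ mu _ (fun y => gauss t y * w y * k1 x y *
    (\int[mu]_z (g z * w z * k2 z y)))); last by move=> y; rewrite mulrAC.
  rewrite E /=; apply: Rint_ext => z; congr (_ * _).
  by apply: Rint_ext => y; rewrite mulrA.
have EI : (fun y => gauss t y * w y * ((\int[mu]_x (f x * w x * k1 x y)) *
     (\int[mu]_z (g z * w z * k2 z y)))) = (fun y => gauss t y * w y *
   (\int[mu]_z (g z * w z * k2 z y)) * (\int[mu]_x (f x * w x * k1 x y))).
  by apply/funext => y; rewrite mulrA mulrAC.
have EO : (fun x => f x * w x * \int[mu]_z (g z * w z *
      \int[mu]_y (gauss t y * w y * (k1 x y * k2 z y)))) =
    (fun x => f x * w x * \int[mu]_y (gauss t y * w y *
      (\int[mu]_z (g z * w z * k2 z y)) * k1 x y)).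
  by apply/funext => x; rewrite inner.
rewrite EI EO; split => // x.
have [L2 _] := fubini_bounded_kernel Lg (Lk x) mk2 (fun p => k21 p.1 p.2).
move: L2; congr (L1 mu _); apply/funext => z; congr (_ * _).
by apply: Rint_ext => y; rewrite mulrA.
Qed.

Variables (f1 f2 : V -> R).
Hypotheses (mf1 : measurable_fun setT f1) (mf2 : measurable_fun setT f2)
  (Lf1 : L1 mu (fun x => f1 x * w x)) (Lf2 : L1 mu (fun x => f2 x * w x)).

(** Real part of F_k(f1 + i f2), the conjugate kernel being C - i S; [im_transform] is the imaginary
    part. *)
Definition re_transform y : R := cos_transform f1 y + sin_transform f2 y.
Definition im_transform y : R := cos_transform f2 y - sin_transform f1 y.

Let C1 x y : `|C x y| <= 1. Proof. exact: (normr_ker_cos_le1 hRp hk he). Qed.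
Let S1 x y : `|S x y| <= 1. Proof. exact: (normr_ker_sin_le1 hRp hk he). Qed.
Let mC := measurable_ker_cos_pair hRs hRp hk he.
Let mS := measurable_ker_sin_pair hRs hRp hk he.

Let pairing (f g : V -> R) t : R :=
  \int[mu]_x (f x * w x * \int[mu]_z (g z * w z * heat_kernel Rp k e t x z)).

(** In the expansion the mixed terms in f1 and f2 meet the imaginary part of the kernel integral,
    which vanishes by [heat_odd_eq0]; hence the two real functions decouple. *)
Lemma transform_energyE (t : R) : 0 < t ->
  L1 mu (fun y => gauss t y * w y * (re_transform y ^+ 2 + im_transform y ^+ 2)) /\
  \int[mu]_y (gauss t y * w y * (re_transform y ^+ 2 + im_transform y ^+ 2)) =
  pairing f1 f1 t + pairing f2 f2 t.
Proof.
move=> t0.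
have [La Aa Ba Ea] := bilinear t0 Lf1 Lf1 mC mC C1 C1.
have [Lb Ab Bb Eb] := bilinear t0 Lf1 Lf1 mS mS S1 S1.
have [Lc Ac Bc Ec] := bilinear t0 Lf2 Lf2 mC mC C1 C1.
have [Ld Ad Bd Ed] := bilinear t0 Lf2 Lf2 mS mS S1 S1.
have [Le Ae Be Ee] := bilinear t0 Lf1 Lf2 mC mS C1 S1.
have [Lg Ag Bg Eg] := bilinear t0 Lf1 Lf2 mS mC S1 C1.
have mCx x : measurable_fun setT (C x) by exact: (measurable_ker_cos hRp hk he).
have mSx x : measurable_fun setT (S x) by exact: (measurable_ker_sin hRp hk he).
have LCC x z : L1 mu (fun y => gauss t y * w y * (C x y * C z y)).
  apply: (L1_gauss_bounded hRp hk t0 (M := 1)); first exact: measurable_funM.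
  by move=> y; rewrite normrM mulr_ile1.
have LSS x z : L1 mu (fun y => gauss t y * w y * (S x y * S z y)).
  apply: (L1_gauss_bounded hRp hk t0 (M := 1)); first exact: measurable_funM.
  by move=> y; rewrite normrM mulr_ile1.
have LCS x z : L1 mu (fun y => gauss t y * w y * (C x y * S z y)).
  apply: (L1_gauss_bounded hRp hk t0 (M := 1)); first exact: measurable_funM.
  by move=> y; rewrite normrM mulr_ile1.
have LSC x z : L1 mu (fun y => gauss t y * w y * (S x y * C z y)).
  apply: (L1_gauss_bounded hRp hk t0 (M := 1)); first exact: measurable_funM.
  by move=> y; rewrite normrM mulr_ile1.
have Ep x z : \int[mu]_y (gauss t y * w y * (C x y * C z y)) +
    \int[mu]_y (gauss t y * w y * (S x y * S z y)) = heat_kernel Rp k e t x z.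
  by rewrite -RintD//; apply: Rint_ext => y; rewrite -mulrDr.
have Eo x z : \int[mu]_y (gauss t y * w y * (S x y * C z y)) =
    \int[mu]_y (gauss t y * w y * (C x y * S z y)).
  apply/eqP; rewrite -subr_eq0 -RintB//; apply/eqP.
  rewrite -[RHS](heat_odd_eq0 hRs hRp hk he x z t0).
  by apply: Rint_ext => y; rewrite -mulrBr.
pose D y : R := gauss t y * w y.
have EQ y : gauss t y * w y * (re_transform y ^+ 2 + im_transform y ^+ 2) =
  (D y * (cos_transform f1 y * cos_transform f1 y) +
   D y * (sin_transform f1 y * sin_transform f1 y)) +
  (D y * (cos_transform f2 y * cos_transform f2 y) +
   D y * (sin_transform f2 y * sin_transform f2 y)) +
  2 * (D y * (cos_transform f1 y * sin_transform f2 y) -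
   D y * (sin_transform f1 y * cos_transform f2 y)).
  by rewrite /D /re_transform /im_transform; ring.
have P f : L1 mu (fun x => f x * w x * \int[mu]_z (f z * w z * \int[mu]_y (gauss t y * w y * (C x y * C z y)))) ->
    L1 mu (fun x => f x * w x * \int[mu]_z (f z * w z * \int[mu]_y (gauss t y * w y * (S x y * S z y)))) ->
    (forall x, L1 mu (fun z => f z * w z * \int[mu]_y (gauss t y * w y * (C x y * C z y)))) ->
    (forall x, L1 mu (fun z => f z * w z * \int[mu]_y (gauss t y * w y * (S x y * S z y)))) ->
  \int[mu]_x (f x * w x * \int[mu]_z (f z * w z * \int[mu]_y (gauss t y * w y * (C x y * C z y)))) +
  \int[mu]_x (f x * w x * \int[mu]_z (f z * w z * \int[mu]_y (gauss t y * w y * (S x y * S z y)))) =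
  pairing f f t.
  move=> h1 h2 h3 h4; rewrite -(RintD h1 h2); apply: Rint_ext => x.
  rewrite -mulrDr -(RintD (h3 x) (h4 x)); congr (_ * _); apply: Rint_ext => z.
  by rewrite -mulrDr Ep.
have Dab := L1D La Lb; have Dcd := L1D Lc Ld; have Deg := L1Z 2 (L1B Le Lg).
have E : (fun y => gauss t y * w y * (re_transform y ^+ 2 + im_transform y ^+ 2)) = _ :=
  funext EQ.
rewrite E; split; first by apply: L1D => //; exact: L1D.
rewrite RintD//; last exact: L1D.
rewrite (RintD Dab Dcd) (RintD La Lb) (RintD Lc Ld) (RintZ _ (L1B Le Lg)) (RintB Le Lg).
have P1 := etrans (f_equal2 +%R Ea Eb) (P f1 Ba Bb Aa Ab).
have P2 := etrans (f_equal2 +%R Ec Ed) (P f2 Bc Bd Ac Ad).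
have Q : \int[mu]_y (D y * (cos_transform f1 y * sin_transform f2 y)) -
   \int[mu]_y (D y * (sin_transform f1 y * cos_transform f2 y)) = 0.
  apply/eqP; rewrite subr_eq0; apply/eqP; apply: (etrans Ee); apply/esym/(etrans Eg).
  by apply: Rint_ext => x; congr (_ * _); apply: Rint_ext => z; rewrite Eo.
have := f_equal2 +%R (f_equal2 +%R P1 P2) (f_equal (fun r : R => 2 * r) Q).
by rewrite mulr0 addr0.
Qed.

Let pairing_le (f : V -> R) (t : R) : 0 < t -> L1 mu (fun x => f x * w x) ->
  ((pairing f f t)%:E <= \int[mu]_x \int[mu]_z
     (`|f x * w x| * (`|f z * w z| * heat_kernel Rp k e t x z))%:E)%E.
Proof.
move=> t0 Lf.
have mK := measurable_heat_kernel hRs hRp hk he t0.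
have Kle (p : V * V) := heat_kernel_le hRp hk he p.1 p.2 t0.
have K0 x z : 0 <= heat_kernel Rp k e t x z by exact: (heat_kernel_ge0 hRs hRp hk he).
have mKx x : measurable_fun setT (fun z => heat_kernel Rp k e t x z).
  exact: (measurableT_comp mK (pair1_measurable x)).
have [LP _] := fubini_bounded_kernel Lf Lf mK Kle.
have L1x (g : V -> R) x : L1 mu g -> L1 mu (fun z => g z * heat_kernel Rp k e t x z).
  move=> Lg; apply: (L1_dom (g := fun z => 2 * (2 * t) `^ (- (lambda_k Rp k + 1)) * `|g z|)).
  - by apply: measurable_funM => //; exact: (L1_measurable Lg).
  - by move=> z; rewrite normrM mulrC ler_wpM2r//; exact: (Kle (x, z)).
  - by apply: L1Z; exact: L1_norm.
apply: (@le_trans _ _ (\int[mu]_x `|f x * w x * \int[mu]_z (f z * w z * heat_kernel Rp k e t x z)|)%:E).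
  by rewrite lee_fin; apply: (le_trans (ler_norm _)); exact: le_normr_Rintegral.
have [LN _] := fubini_bounded_kernel (L1_norm Lf) (L1_norm Lf) mK Kle.
apply: (@le_trans _ _ (\int[mu]_x (`|f x * w x| * \int[mu]_z (`|f z * w z| * heat_kernel Rp k e t x z)))%:E).
  rewrite lee_fin; apply: le_Rintegral => //; first exact: L1_norm LP.
  move=> x _; rewrite normrM ler_wpM2l//.
  apply: (le_trans (le_normr_Rintegral measurableT (L1x _ x Lf))).
  apply: le_Rintegral => //.
  - exact: L1_norm (L1x _ x Lf).
  - exact: L1x (L1_norm Lf).
  - by move=> z _; rewrite normrM (ger0_norm (K0 _ _)).
rewrite -Rint_EFin// le_eqVlt; apply/orP; left; apply/eqP.
apply: eq_integral => x _; have LL := L1x _ x (L1_norm Lf).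
by rewrite -(RintZ _ LL) -Rint_EFin//; exact: L1Z.
Qed.

Lemma transform_energy_le (t : R) (h : V -> R) : 0 < t ->
  measurable_fun setT h -> (forall x, 0 < h x) ->
  (\int[mu]_y (gauss t y * w y * (re_transform y ^+ 2 + im_transform y ^+ 2))%:E <=
   \int[mu]_x (((f1 x ^+ 2 + f2 x ^+ 2) / h x * w x)%:E *
     \int[mu]_z (heat_kernel Rp k e t x z * (h z * w z))%:E))%E.
Proof.
move=> t0 mh h0; have [LE E] := transform_energyE t0.
have mK := measurable_heat_kernel hRs hRp hk he t0.
have K0 x z : 0 <= heat_kernel Rp k e t x z by exact: (heat_kernel_ge0 hRs hRp hk he).
rewrite Rint_EFin// E EFinD.
pose I x := (\int[mu]_z (heat_kernel Rp k e t x z * (h z * w z))%:E)%E.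
have I0 x : (0 <= I x)%E.
  apply: integral_ge0 => z _; rewrite lee_fin.
  exact: (mulr_ge0 (K0 _ _) (mulr_ge0 (ltW (h0 _)) (w0 _))).
have mI : measurable_fun setT I.
  apply: (measurable_fun_fubini_tonelli_F (fun p : V * V =>
    (heat_kernel Rp k e t p.1 p.2 * (h p.2 * w p.2))%:E)).
  - apply/measurable_EFinP; apply: measurable_funM => //.
    exact: (measurableT_comp (measurable_funM mh mw) measurable_snd).
  - move=> p; rewrite lee_fin.
    exact: (mulr_ge0 (K0 _ _) (mulr_ge0 (ltW (h0 _)) (w0 _))).
have mq (f : V -> R) : measurable_fun setT f -> measurable_fun setT (fun x => f x ^+ 2 / h x * w x).
  move=> mf; apply: measurable_funM => //; apply: measurable_funM; first exact: measurable_funX.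
  exact: measurable_inv_gt0.
have q0 (f : V -> R) x : 0 <= f x ^+ 2 / h x * w x.
  by apply: mulr_ge0 => //; rewrite divr_ge0 ?sqr_ge0// ltW.
have P (f : V -> R) : measurable_fun setT f -> L1 mu (fun x => f x * w x) ->
    ((pairing f f t)%:E <= \int[mu]_x ((f x ^+ 2 / h x * w x)%:E * I x))%E.
  move=> mf Lf; apply: (le_trans (pairing_le t0 Lf)).
  apply: (@schur_test _ _ _ mu (fun p : V * V => heat_kernel Rp k e t p.1 p.2)) => //.
  by move=> x z; rewrite heat_kernel_sym.
apply: (le_trans (leeD (P _ mf1 Lf1) (P _ mf2 Lf2))).
rewrite -ge0_integralD//.
- rewrite le_eqVlt; apply/orP; left; apply/eqP; apply: eq_integral => x _.
  by rewrite -/(I x) -ge0_muleDl ?lee_fin// -EFinD -mulrDl -mulrDl.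
- by move=> x _; rewrite mule_ge0 ?lee_fin.
- apply: emeasurable_funM => //; apply/measurable_EFinP; exact: mq.
- by move=> x _; rewrite mule_ge0 ?lee_fin.
- apply: emeasurable_funM => //; apply/measurable_EFinP; exact: mq.
Qed.

End energy.

Lemma lee_mull {R : realDomainType} (c a b : \bar R) :
  (0 <= c -> a <= b -> c * a <= c * b)%E.
Proof. by move=> c0; exact: lee_wpmul2l. Qed.

(** * Integration in t against the Schur weight *)

Section pitt_upper.
Context {R : realType} {d : nat}.
Local Notation V := 'rV[R]_d.
Local Notation mu := (@lebesgue_rV R d).
Local Notation leb := (@lebesgue_measure R).
Variables (Rs Rp : {fset V}) (k : V -> R).
Hypotheses (d_gt0 : (0 < d)%N) (hRs : root_system Rs)
  (hRp : positive_subsystem Rs Rp) (hk : multiplicity Rs k).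
Variable e : V -> V -> R[i].
Hypothesis he : is_dunkl_kernel Rp k e.
Local Notation w := (dunkl_density Rp k).
Local Notation nu := (lambda_k Rp k + 1).
Local Notation K := (heat_kernel Rp k e).
Implicit Types (x y z : V).

Let w0 x : 0 <= w x.
Proof. exact: (dunkl_density_ge0 hRp hk). Qed.

Let mw : measurable_fun setT w.
Proof. exact: measurable_dunkl_density. Qed.

Lemma lambda_k_gt0 : 0 < nu.
Proof.
rewrite /lambda_k (_ : _ + 1 = d%:R / 2 + \sum_(a <- Rp) k a); last by ring.
apply: ltr_pwDl; first by rewrite divr_gt0// ltr0n.
by rewrite big_seq; apply: sumr_ge0 => a; exact: (multiplicity_ge0 hRp hk).
Qed.

Lemma measurable_dotp_self : measurable_fun setT (fun x : V => dotp x x).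
Proof.
under eq_fun do rewrite -enorm_sqr.
by apply: measurable_funX; exact: measurable_enorm.
Qed.

Lemma powR_nu_le1 (c : R) : 0 <= c -> (1 + c) `^ (- nu) <= 1.
Proof.
move=> c0; have c1 : 1 <= 1 + c by rewrite lerDl.
have E1 : 1 `^ nu = 1 :> R by rewrite powR1.
have h : 1 <= (1 + c) `^ nu.
  rewrite -{1}E1; apply: ge0_ler_powR => //; rewrite ?nnegrE//; first exact: ltW lambda_k_gt0.
  exact: le_trans c1.
by rewrite powRN invf_le1// (lt_le_trans ltr01).
Qed.

Lemma gauss_le1 (b : R) x : 0 <= b -> gauss b x <= 1.
Proof.
move=> b0; rewrite /gauss -expR0 ler_expR oppr_le0.
by rewrite mulr_ge0 ?dotp_ge0.
Qed.

Lemma gauss_harmonic_cvg x : gauss n.+1%:R^-1 x @[n --> \oo] --> (1 : R).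
Proof.
have H : - (n.+1%:R^-1 * dotp x x) @[n --> \oo] --> (0 : R).
  rewrite -[X in _ --> X]oppr0 -[X in _ --> - X](mul0r (dotp x x)); apply: cvgN.
  by apply: cvgM; [exact: cvg_harmonic|exact: cvg_cst].
rewrite -[X in _ --> X]expR0; apply: continuous_cvg H.
exact: continuous_expR.
Qed.

Let K0 (t : R) x z : 0 < t -> 0 <= K t x z.
Proof. by move=> t0; exact: (heat_kernel_ge0 hRs hRp hk he). Qed.

Let mKx (t : R) x : 0 < t -> measurable_fun setT (K t x).
Proof.
move=> t0; exact: (measurableT_comp (measurable_heat_kernel hRs hRp hk he t0) (pair1_measurable x)).
Qed.

Lemma integral_heat_kernel_gauss (t u : R) x : 0 < t -> 0 < u ->
  (\int[mu]_z (K t x z * (gauss u z * w z))%:E =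
   ((1 + 4 * t * u) `^ (- nu) * gauss (u / (1 + 4 * t * u)) x)%:E)%E.
Proof.
move=> t0 u0; rewrite -(heat_kernel_gauss hRs hRp hk he x t0 u0).
have L := L1_gauss_bounded hRp hk u0 (mKx x t0) (fun z => heat_kernel_le hRp hk he x z t0).
by rewrite -Rint_EFin//; apply: eq_integral => z _; rewrite mulrC.
Qed.

(** The Gaussians exp(-|z|^2/(n + 1)) tend to 1 and their images under [K t] are at most 1. Fatou's
    lemma suffices, since only an upper bound enters Schur's test. *)
Lemma integral_heat_kernel_le1 (t : R) x : 0 < t ->
  (\int[mu]_z (K t x z * (1 * w z))%:E <= 1)%E.
Proof.
move=> t0; apply: (@fatou_le _ _ _ mu (fun n z => K t x z * (gauss n.+1%:R^-1 z * w z))).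
- move=> n; apply: measurable_funM; first exact: mKx.
  by apply: measurable_funM => //; exact: measurable_gauss.
- by move=> n z; exact: (mulr_ge0 (K0 _ _ t0) (mulr_ge0 (gauss_ge0 _ _) (w0 _))).
- move=> z; apply: cvgM; first exact: cvg_cst.
  by apply: cvgM; [exact: gauss_harmonic_cvg|exact: cvg_cst].
move=> n; have u0 : 0 < n.+1%:R^-1 :> R by rewrite invr_gt0.
rewrite integral_heat_kernel_gauss// lee_fin.
have tu : 0 <= 4 * t * n.+1%:R^-1 by rewrite !mulr_ge0// ltW.
apply: mulr_ile1; [exact: powR_ge0|exact: gauss_ge0|exact: powR_nu_le1|].
by apply: gauss_le1; rewrite divr_ge0// addr_ge0.
Qed.

Variables (f1 f2 : V -> R).
Hypotheses (mf1 : measurable_fun setT f1) (mf2 : measurable_fun setT f2)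
  (Lf1 : L1 mu (fun x => f1 x * w x)) (Lf2 : L1 mu (fun x => f2 x * w x)).
Local Notation F2 := (fun x => f1 x ^+ 2 + f2 x ^+ 2).
Local Notation E2 := (fun y => re_transform Rp k e f1 f2 y ^+ 2 + im_transform Rp k e f1 f2 y ^+ 2).

Let E20 y : 0 <= E2 y. Proof. by rewrite addr_ge0 ?sqr_ge0. Qed.
Let F20 y : 0 <= F2 y. Proof. by rewrite addr_ge0 ?sqr_ge0. Qed.

Let mF2 : measurable_fun setT F2.
Proof. by apply: measurable_funD; exact: measurable_funX. Qed.

Let mE2w : measurable_fun setT (fun y => E2 y * w y).
Proof.
(* Measurability of the weighted squared transform is recovered from the integrability of its energy
   at t = 1 by multiplying the Gaussian away. *)
have [L _] := transform_energyE hRs hRp hk he Lf1 Lf2 ltr01.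
have mg : measurable_fun setT (fun y : V => expR (1 * dotp y y)).
  apply: measurableT_comp => //; apply: measurable_funM => //; exact: measurable_dotp_self.
rewrite (_ : (fun y => _) = (fun y => expR (1 * dotp y y) * (gauss 1 y * w y * E2 y))).
  by apply: measurable_funM => //; exact: (L1_measurable L).
apply/funext => y; have E1 : expR (1 * dotp y y) * gauss 1 y = 1.
  by rewrite /gauss expRN mulfV// gt_eqF// expR_gt0.
set a := expR _ in E1 *; set b := gauss 1 y in E1 *; set c := w y.
rewrite (_ : a * _ = a * b * (E2 y * c)); last by ring.
by rewrite E1 mul1r.
Qed.

Lemma plancherel_le :
  (\int[mu]_y (E2 y * w y)%:E <= \int[mu]_x (F2 x * w x)%:E)%E.
Proof.
apply: (@fatou_le _ _ _ mu (fun n y => gauss n.+1%:R^-1 y * (E2 y * w y))).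
- by move=> n; exact: (measurable_funM (@measurable_gauss R d _) mE2w).
- by move=> n y; exact: (mulr_ge0 (gauss_ge0 _ _) (mulr_ge0 (E20 _) (w0 _))).
- move=> y; rewrite -[X in _ --> X]mul1r; apply: cvgM; last exact: cvg_cst.
  exact: gauss_harmonic_cvg.
move=> n; have t0 : 0 < n.+1%:R^-1 :> R by rewrite invr_gt0.
have := transform_energy_le hRs hRp hk he mf1 mf2 Lf1 Lf2 t0 (measurable_cst (1 : R)) (fun=> ltr01).
under [X in (X <= _)%E -> _]eq_integral do rewrite mulrAC -mulrA.
move=> H; apply: (le_trans H); apply: ge0_le_integral => //.
- move=> x _; apply: mule_ge0.
    by rewrite lee_fin divr1; exact: (mulr_ge0 (F20 _) (w0 _)).
  by apply: integral_ge0 => z _; rewrite lee_fin mul1r; exact: (mulr_ge0 (K0 _ _ t0) (w0 _)).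
- apply: emeasurable_funM.
    apply/measurable_EFinP; apply: measurable_funM => //.
    by under eq_fun do rewrite divr1.
  apply: (measurable_fun_fubini_tonelli_F (fun p : V * V => (K n.+1%:R^-1 p.1 p.2 * (1 * w p.2))%:E)).
    apply/measurable_EFinP; apply: measurable_funM; first exact: (measurable_heat_kernel hRs hRp hk he t0).
    by apply: measurable_funM => //; exact: (measurableT_comp mw measurable_snd).
  by move=> p; rewrite lee_fin mul1r; exact: (mulr_ge0 (K0 _ _ t0) (w0 _)).
- by apply/measurable_EFinP; exact: measurable_funM.
move=> x _; rewrite divr1 -[leRHS]mule1.
apply: lee_mull (integral_heat_kernel_le1 x t0).
by rewrite lee_fin; exact: (mulr_ge0 (F20 _) (w0 _)).
Qed.

Section positive_exponent.
Variable beta : R.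
Hypotheses (beta_gt0 : 0 < beta) (beta_lt : beta < nu).
(** Exponent of the Schur weight. By this choice s/2 - beta = nu - s/2 = (nu - beta)/2, so both
    integrations in [double_integral] produce the same value of Gamma; beta < nu makes them
    converge. *)
Let s : R := nu + beta.
Let s2 : 0 < s / 2.
Proof. by rewrite divr_gt0// addr_gt0// lambda_k_gt0. Qed.
Let sb : 0 < s / 2 - beta.
Proof. by rewrite /s; have := beta_lt; lra. Qed.

(** [K t] applied to the Gaussian of parameter u, times the density that superposes Gaussians to
    |x|^(-s). The denominator is written as a power so that joint measurability follows from that of
    [powR]. *)
Let damped (t u : R) x : R :=
  pos_pow (s / 2) u * ((1 + 4 * t * u) `^ (- nu) * gauss (u * (1 + 4 * t * u) `^ (- 1)) x).
Let I t x : \bar R := (\int[leb]_u (damped t u x)%:E)%E.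

Let damped_ge0 t u x : 0 <= damped t u x.
Proof. by rewrite /damped !mulr_ge0 ?pos_pow_ge0 ?powR_ge0 ?gauss_ge0. Qed.

Let mdamped : measurable_fun setT (fun q : (R * V) * R => damped q.1.1 q.2 q.1.2).
Proof.
have m11 : measurable_fun setT (fun q : (R * V) * R => q.1.1).
  exact: (measurableT_comp (measurable_fst) (measurable_fst)).
have mtu : measurable_fun setT (fun q : (R * V) * R => 1 + 4 * q.1.1 * q.2).
  apply: measurable_funD => //; apply: measurable_funM; last exact: measurable_snd.
  exact: measurable_funM.
apply: measurable_funM; first exact: (measurableT_comp (measurable_pos_pow _) measurable_snd).
apply: measurable_funM; first exact: (measurableT_comp (measurable_powR _) mtu).
rewrite /gauss; apply: measurableT_comp => //; apply: measurableT_comp => //.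
apply: measurable_funM.
  apply: measurable_funM; first exact: measurable_snd.
  exact: (measurableT_comp (measurable_powR _) mtu).
apply: (measurableT_comp measurable_dotp_self).
exact: (measurableT_comp (measurable_snd) (measurable_fst)).
Qed.

Let I0 t x : (0 <= I t x)%E.
Proof. by apply: integral_ge0 => u _; rewrite lee_fin. Qed.

Let mI : measurable_fun setT (fun p : R * V => I p.1 p.2).
Proof.
apply: (measurable_fun_fubini_tonelli_F (m2 := leb) (fun q : (R * V) * R => (damped q.1.1 q.2 q.1.2)%:E)).
  exact/measurable_EFinP.
by move=> q; rewrite lee_fin.
Qed.

(* The value 1 at the origin is immaterial; it only keeps the weight positive. *)
Let h x : R := if 0 < enorm x then enorm x `^ (- s) else 1.

Let h0 x : 0 < h x.
Proof. by rewrite /h; case: ifP => // x0; exact: powR_gt0. Qed.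

Let mh : measurable_fun setT h.
Proof.
apply: measurable_fun_ifT => //.
  by apply: measurable_fun_ltr => //; exact: measurable_enorm.
exact: (measurableT_comp (measurable_powR _) (@measurable_enorm R d)).
Qed.

Let sq_powR (r p : R) : 0 < r -> (r ^+ 2) `^ p = r `^ (2 * p).
Proof.
move=> r0; rewrite -[2%N]/(2%N) -powR_mulrn ?ltW// -powRrM.
by congr (_ `^ _); ring.
Qed.

(** Off the origin this is Euler's integral, with equality. At the origin h is set to 1 and the
    comparison exp(-u) <= 1 suffices. *)
Let h_le z : ((Gamma (s / 2) * h z)%:E <= \int[leb]_u (pos_pow (s / 2) u * gauss u z)%:E)%E.
Proof.
rewrite /h; case: ifPn => [z0|z0].
  have zz : 0 < dotp z z by rewrite -enorm_sqr exprn_gt0.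
  under eq_integral do rewrite /gauss (mulrC _ (dotp z z)).
  rewrite integral_pos_pow_exp// lee_fin -enorm_sqr sq_powR//.
  by rewrite mulrN mulrCA mulfV ?mulr1.
have zz : dotp z z = 0.
  have : enorm z == 0 by rewrite eq_le leNgt z0 enorm_ge0.
  by rewrite -enorm_sqr => /eqP ->; rewrite expr0n.
rewrite mulr1 -integral_gamma//; apply: ge0_integral_mono.
- apply: measurable_funM; first exact: measurable_pos_pow.
  by apply: measurableT_comp => //; exact: measurableT_comp.
- apply: measurable_funM; first exact: measurable_pos_pow.
  rewrite /gauss zz; apply: measurableT_comp => //; apply: measurableT_comp => //.
  exact: measurable_funM.
- by move=> u; rewrite mulr_ge0 ?pos_pow_ge0 ?expR_ge0.
move=> u; rewrite /pos_pow; case: ifP => u0; last by rewrite !mul0r.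
by rewrite ler_wpM2l ?powR_ge0// /gauss zz ler_expR mulr0 lerN2 ltW.
Qed.

(** Tonelli moves [K t] inside the superposition of Gaussians; the inequality is inherited from
    [h_le]. *)
Let heat_h_le t x : 0 < t -> ((Gamma (s / 2))%:E *
   \int[mu]_z (K t x z * (h z * w z))%:E <= I t x)%E.
Proof.
move=> t0; have Gs := Gamma_gt0 s2.
have mgauss2 : measurable_fun setT (fun p : V * R => gauss p.2 p.1).
  rewrite /gauss; apply: measurableT_comp => //; apply: measurableT_comp => //.
  apply: measurable_funM; first exact: measurable_snd.
  exact: (measurableT_comp measurable_dotp_self measurable_fst).
pose g (p : V * R) : R := K t x p.1 * w p.1 * (pos_pow (s / 2) p.2 * gauss p.2 p.1).
have g0 p : 0 <= g p.
  by apply: mulr_ge0 (mulr_ge0 (K0 _ _ t0) (w0 _)) (mulr_ge0 (pos_pow_ge0 _ _) (gauss_ge0 _ _)).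
have mKw : measurable_fun setT (fun z => K t x z * w z).
  by apply: measurable_funM => //; exact: mKx.
have mg : measurable_fun setT g.
  apply: measurable_funM; first exact: (measurableT_comp mKw measurable_fst).
  apply: measurable_funM => //; exact: (measurableT_comp (measurable_pos_pow _) measurable_snd).
apply: (@le_trans _ _ (\int[mu]_z \int[leb]_u (g (z, u))%:E)%E).
  rewrite -ge0_integralZl//; first last.
  - by rewrite lee_fin ltW.
  - by move=> z _; rewrite lee_fin; exact: (mulr_ge0 (K0 _ _ t0) (mulr_ge0 (ltW (h0 _)) (w0 _))).
  - by apply/measurable_EFinP; apply: measurable_funM; [exact: mKx|exact: measurable_funM].
  apply: ge0_le_integral => //.
  - move=> z _; rewrite mule_ge0 ?lee_fin ?(ltW Gs)//.
    exact: (mulr_ge0 (K0 _ _ t0) (mulr_ge0 (ltW (h0 _)) (w0 _))).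
  - apply: emeasurable_funM => //; apply/measurable_EFinP.
    by apply: measurable_funM; [exact: mKx|exact: measurable_funM].
  - apply: (measurable_fun_fubini_tonelli_F (m2 := leb) (fun p => (g p)%:E)); first exact/measurable_EFinP.
    by move=> p; rewrite lee_fin.
  move=> z _; rewrite /g /=; under eq_integral do rewrite EFinM.
  rewrite ge0_integralZl//.
  - rewrite -EFinM (_ : Gamma (s / 2) * _ = K t x z * w z * (Gamma (s / 2) * h z)); last by ring.
    rewrite EFinM; apply: lee_mull (h_le z).
    by rewrite lee_fin; exact: (mulr_ge0 (K0 _ _ t0) (w0 _)).
  - apply/measurable_EFinP; apply: measurable_funM; first exact: measurable_pos_pow.
    exact: (measurableT_comp mgauss2 (pair1_measurable z)).
  - by move=> u _; rewrite lee_fin mulr_ge0 ?pos_pow_ge0 ?gauss_ge0.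
  - by rewrite lee_fin; exact: (mulr_ge0 (K0 _ _ t0) (w0 _)).
rewrite (fubini_tonelli (m1 := mu) (m2 := leb) (fun p : V * R => (g p)%:E)) /=; first last.
- by move=> p; rewrite lee_fin.
- exact/measurable_EFinP.
rewrite le_eqVlt; apply/orP; left; apply/eqP; apply: eq_integral => u _.
rewrite /damped; have [u0|u0] := ltP 0 u; last first.
  rewrite /g /= /pos_pow ltNge u0/= mul0r.
  by rewrite integral0_eq// => z _; rewrite mul0r mulr0.
have E z : g (z, u) = pos_pow (s / 2) u * (K t x z * (gauss u z * w z)).
  by rewrite /g /=; ring.
under eq_integral do rewrite E EFinM.
rewrite ge0_integralZl//.
- rewrite integral_heat_kernel_gauss// -EFinM; congr EFin; congr (_ * (_ * gauss (_ * _) x)).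
  by rewrite powR_inv1// addr_ge0// !mulr_ge0// ltW.
- apply/measurable_EFinP; apply: measurable_funM; first exact: mKx.
  by apply: measurable_funM => //; exact: measurable_gauss.
- by move=> z _; rewrite lee_fin; exact: (mulr_ge0 (K0 _ _ t0) (mulr_ge0 (gauss_ge0 _ _) (w0 _))).
- by rewrite lee_fin pos_pow_ge0.
Qed.

(** The substitution r = 4 u t decouples the variables: the u-integral is a gamma integral with
    parameter |x|^2/(1 + r), and what remains in r is a beta integral. The factor 4^(-beta) of the
    sharp constant comes from this substitution in t^(beta - 1) dt. *)
Let double_integral x : 0 < dotp x x ->
  (\int[leb]_t ((pos_pow beta t)%:E * I t x) =
   (4 `^ (- beta) * Gamma (s / 2 - beta) * dotp x x `^ (- (s / 2 - beta)) *
    (Gamma beta * Gamma (s / 2 - beta) / Gamma (s / 2)))%:E)%E.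
Proof.
set X := dotp x x => X0.
pose J (p : R * R) : R := pos_pow beta p.1 * damped p.1 p.2 x.
pose g (u r : R) : R := pos_pow beta r * ((1 + r) `^ (- nu) * gauss (u * (1 + r) `^ (- 1)) x).
pose M (p : R * R) : R := pos_pow (s / 2) p.1 * ((4 * p.1) `^ (- beta) * g p.1 p.2).
have J0 p : 0 <= J p by rewrite mulr_ge0 ?pos_pow_ge0.
have g0 u r : 0 <= g u r by rewrite !mulr_ge0 ?pos_pow_ge0 ?powR_ge0 ?gauss_ge0.
have M0 p : 0 <= M p.
  exact: (mulr_ge0 (pos_pow_ge0 _ _) (mulr_ge0 (powR_ge0 _ _) (g0 _ _))).
have mJ : measurable_fun setT J.
  apply: measurable_funM; first exact: (measurableT_comp (measurable_pos_pow _) measurable_fst).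
  have m3 : measurable_fun setT (fun p : R * R => ((p.1, x), p.2)).
    apply/measurable_fun_pairP; split; last exact: measurable_snd.
    by apply/measurable_fun_pairP; split; [exact: measurable_fst|exact: measurable_cst].
  exact: (measurableT_comp mdamped m3).
have mpow (a c : R) : measurable_fun setT (fun p : R * R => (1 + p.2) `^ a).
  apply: (measurableT_comp (measurable_powR _)); apply: measurable_funD => //; exact: measurable_snd.
have mg : measurable_fun setT (fun p : R * R => g p.1 p.2).
  apply: measurable_funM; first exact: (measurableT_comp (measurable_pos_pow _) measurable_snd).
  apply: measurable_funM; first exact: mpow.
  rewrite /gauss; apply: measurableT_comp => //; apply: measurableT_comp => //.
  apply: measurable_funM => //; apply: measurable_funM; first exact: measurable_fst.
  exact: mpow.
have mM : measurable_fun setT M.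
  apply: measurable_funM; first exact: (measurableT_comp (measurable_pos_pow _) measurable_fst).
  apply: measurable_funM => //; apply: (measurableT_comp (measurable_powR _)).
  by apply: measurable_funM => //; exact: measurable_fst.
have mJE : measurable_fun setT (fun p => (J p)%:E) by exact/measurable_EFinP.
have mME : measurable_fun setT (fun p => (M p)%:E) by exact/measurable_EFinP.
have mdu t : measurable_fun setT (fun u => (damped t u x)%:E).
  apply/measurable_EFinP; exact: (measurableT_comp mdamped (pair1_measurable (t, x))).
transitivity (\int[leb]_t \int[leb]_u (J (t, u))%:E)%E.
  apply: eq_integral => t _; rewrite /J /I /=; under [RHS]eq_integral do rewrite EFinM.
  rewrite ge0_integralZl ?lee_fin ?pos_pow_ge0//; first exact: mdu.
  by move=> u _; rewrite lee_fin.
rewrite (fubini_tonelli (m1 := leb) (m2 := leb) (fun p => (J p)%:E) mJE); last by move=> p; rewrite lee_fin.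
transitivity (\int[leb]_u \int[leb]_r (M (u, r))%:E)%E.
  apply: eq_integral => u _; rewrite /J /M /=; have [u0|u0] := ltP 0 u; last first.
    rewrite /damped /pos_pow [0 < u]ltNge u0/=.
    by rewrite !integral0_eq// => t _; rewrite !mul0r ?mulr0.
  have u4 : 0 < 4 * u by rewrite mulr_gt0.
  have E t : pos_pow beta t * damped t u x =
      pos_pow (s / 2) u * (4 * u) `^ (1 - beta) * g u (4 * u * t + 0).
    rewrite /damped /g addr0 (_ : 4 * t * u = 4 * u * t); last by ring.
    rewrite [pos_pow beta (4 * u * t)]/pos_pow [pos_pow beta t]/pos_pow pmulr_rgt0//.
    case: ifP => t0; last by rewrite !(mul0r, mulr0).
    rewrite (powRM _ (ltW u4) (ltW t0)).
    have E1 : (4 * u) `^ (1 - beta) * (4 * u) `^ (beta - 1) = 1.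
      rewrite -powRD; last by rewrite (gt_eqF u4) implybT.
      by rewrite (_ : 1 - beta + (beta - 1) = 0) ?powRr0//; ring.
    rewrite -[LHS]mul1r -[X in X * _ = _]E1; ring.
  under eq_integral do rewrite E EFinM.
  have mgu : measurable_fun setT (fun r => (g u r)%:E).
    by apply/measurable_EFinP; exact: (measurableT_comp mg (pair1_measurable u)).
  have := lebesgue_integral_affine 0 u4 mgu (fun r => g0 u r) => H.
  have mga : measurable_fun setT (fun r => (g u (4 * u * r + 0))%:E).
    apply: (measurableT_comp mgu); apply: measurable_funD => //; exact: measurable_funM.
  have g0E r : (0 <= (g u r)%:E)%E by rewrite lee_fin.
  have c0 (a : R) : (0 <= (pos_pow (s / 2) u * (4 * u) `^ a)%:E)%E.
    by rewrite lee_fin mulr_ge0 ?pos_pow_ge0 ?powR_ge0.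
  rewrite (ge0_integralTZl leb mga (fun r => g0E _) (c0 _)).
  rewrite H muleA -EFinM; under [RHS]eq_integral do rewrite mulrA EFinM.
  rewrite (ge0_integralTZl leb mgu g0E (c0 _)).
  congr (_ * _)%E; congr EFin; rewrite -mulrA; congr (_ * _).
  rewrite -(powR_inv1 (ltW u4)) -powRD; last by rewrite (gt_eqF u4) implybT.
  by congr (_ `^ _); ring.
rewrite (fubini_tonelli (m1 := leb) (m2 := leb) (fun p => (M p)%:E) mME); last by move=> p; rewrite lee_fin.
rewrite EFinM -(integral_beta beta_gt0 (_ : beta < s / 2)); last by rewrite -subr_gt0.
rewrite -ge0_integralZl//; first last.
- by rewrite lee_fin !mulr_ge0 ?powR_ge0// ltW// Gamma_gt0.
- by move=> r _; rewrite lee_fin mulr_ge0 ?pos_pow_ge0 ?powR_ge0.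
- apply/measurable_EFinP; apply: measurable_funM; first exact: measurable_pos_pow.
  by apply: (measurableT_comp (measurable_powR _)); exact: measurable_funD.
apply: eq_integral => r _; rewrite /M /g /=; have [r0|r0] := ltP 0 r; last first.
  rewrite /pos_pow [0 < r]ltNge r0/= mul0r mule0.
  by apply: integral0_eq => u _; rewrite !(mul0r, mulr0).
have r1 : 0 < 1 + r by rewrite addr_gt0.
have Xr : 0 < X * (1 + r) `^ (- 1) by rewrite mulr_gt0 ?powR_gt0.
have E u : pos_pow (s / 2) u * ((4 * u) `^ (- beta) * (pos_pow beta r *
    ((1 + r) `^ (- nu) * gauss (u * (1 + r) `^ (- 1)) x))) =
    4 `^ (- beta) * pos_pow beta r * (1 + r) `^ (- nu) *
    (pos_pow (s / 2 - beta) u * expR (- (X * (1 + r) `^ (- 1) * u))).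
  rewrite /pos_pow r0; case: ifP => u0; last by rewrite !(mul0r, mulr0).
  rewrite (powRM _ _ (ltW u0))// /gauss -/X (_ : u * _ * X = X * (1 + r) `^ (- 1) * u); last by ring.
  have -> : u `^ (s / 2 - beta - 1) = u `^ (s / 2 - 1) * u `^ (- beta).
    rewrite -powRD; last by rewrite (gt_eqF u0) implybT.
    by congr (_ `^ _); ring.
  ring.
under eq_integral do rewrite E EFinM.
rewrite ge0_integralZl//; first last.
- by rewrite lee_fin !mulr_ge0 ?powR_ge0 ?pos_pow_ge0.
- by move=> u _; rewrite lee_fin mulr_ge0 ?pos_pow_ge0 ?expR_ge0.
- exact: measurable_pos_pow_exp.
rewrite integral_pos_pow_exp// -!EFinM; congr EFin.
rewrite powRM ?powR_ge0 ?(ltW X0)// -powRrM.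
(* Exponent count: -nu + (s/2 - beta) = -s/2 because s = nu + beta. *)
have -> : (1 + r) `^ (- (s / 2)) = (1 + r) `^ (- nu) * (1 + r) `^ (- 1 * - (s / 2 - beta)).
  rewrite -powRD; last by rewrite (gt_eqF r1) implybT.
  by congr (_ `^ _); rewrite /s; field.
ring.
Qed.

Lemma pitt_upper_real :
  (\int[mu]_y ((enorm y `^ (- beta)) ^+ 2 * (E2 y * w y))%:E <=
   ((4 `^ (- beta) * (Gamma ((nu - beta) / 2) / Gamma ((nu + beta) / 2)) ^+ 2))%:E *
   \int[mu]_x ((enorm x `^ beta) ^+ 2 * (F2 x * w x))%:E)%E.
Proof.
have Gs := Gamma_gt0 s2; have Gb := Gamma_gt0 beta_gt0.
pose q x : R := F2 x / h x * w x.
have q0 x : 0 <= q x.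
  by apply: mulr_ge0 (divr_ge0 (F20 _) (ltW (h0 _))) (w0 _).
have mq : measurable_fun setT q.
  by apply: measurable_funM => //; apply: measurable_funM => //; exact: measurable_inv_gt0.
pose N (p : R * V) : \bar R := ((pos_pow beta p.1)%:E * ((q p.2)%:E * I p.1 p.2))%E.
have N0 p : (0 <= N p)%E.
  by rewrite /N mule_ge0 ?lee_fin ?pos_pow_ge0// mule_ge0 ?lee_fin.
have mN : measurable_fun setT N.
  apply: emeasurable_funM.
    apply/measurable_EFinP; exact: (measurableT_comp (measurable_pos_pow _) measurable_fst).
  apply: emeasurable_funM => //.
  apply/measurable_EFinP; exact: (measurableT_comp mq measurable_snd).
have mgauss2 : measurable_fun setT (fun p : V * R => gauss p.2 p.1).
  rewrite /gauss; apply: measurableT_comp => //; apply: measurableT_comp => //.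
  apply: measurable_funM; first exact: measurable_snd.
  exact: (measurableT_comp measurable_dotp_self measurable_fst).
pose P (p : V * R) : R := E2 p.1 * w p.1 * (pos_pow beta p.2 * gauss p.2 p.1).
have EW0 y : 0 <= E2 y * w y by exact: (mulr_ge0 (E20 _) (w0 _)).
have P0 p : 0 <= P p.
  exact: (mulr_ge0 (EW0 _) (mulr_ge0 (pos_pow_ge0 _ _) (gauss_ge0 _ _))).
have mP : measurable_fun setT P.
  apply: measurable_funM; first exact: (measurableT_comp mE2w measurable_fst).
  apply: measurable_funM => //; exact: (measurableT_comp (measurable_pos_pow _) measurable_snd).
have mpow (a : R) : measurable_fun setT (fun x : V => (enorm x `^ a) ^+ 2).
  apply: measurable_funX; exact: (measurableT_comp (measurable_powR _) (@measurable_enorm R d)).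
have step1 : ((Gamma beta)%:E * \int[mu]_y ((enorm y `^ (- beta)) ^+ 2 * (E2 y * w y))%:E <=
    \int[leb]_t ((pos_pow beta t)%:E * \int[mu]_y (gauss t y * w y * E2 y)%:E))%E.
  apply: (@le_trans _ _ (\int[mu]_y \int[leb]_t (P (y, t))%:E)%E).
    rewrite -ge0_integralZl//; first last.
    - by rewrite lee_fin ltW.
    - by move=> y _; rewrite lee_fin; exact: (mulr_ge0 (sqr_ge0 _) (EW0 _)).
    - by apply/measurable_EFinP; exact: (measurable_funM (mpow _) mE2w).
    apply: ge0_le_integral => //.
    - move=> y _; rewrite mule_ge0 ?lee_fin ?(ltW Gb)//.
      exact: (mulr_ge0 (sqr_ge0 _) (EW0 _)).
    - by apply: emeasurable_funM => //; apply/measurable_EFinP; exact: (measurable_funM (mpow _) mE2w).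
    - apply: (measurable_fun_fubini_tonelli_F (m2 := leb) (fun p => (P p)%:E)).
        exact/measurable_EFinP.
      by move=> p; rewrite lee_fin.
    move=> y _; rewrite /P /=; under eq_integral do rewrite EFinM.
    rewrite ge0_integralZl//; first last.
    - by rewrite lee_fin.
    - by move=> t _; rewrite lee_fin mulr_ge0 ?pos_pow_ge0 ?gauss_ge0.
    - apply/measurable_EFinP; apply: measurable_funM; first exact: measurable_pos_pow.
      exact: (measurableT_comp mgauss2 (pair1_measurable y)).
    rewrite -EFinM (mulrA (Gamma beta)) (mulrC (Gamma beta * _)) EFinM; apply: lee_mull; first by rewrite lee_fin.
    (* At y = 0 the negative power of 0 is 0 by the convention of [powR], so the left side vanishes;
       Euler's integral requires |y| > 0. *)
    have [y0|y0] := eqVneq (enorm y) 0.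
      rewrite y0 powR0 ?oppr_eq0 ?gt_eqF// expr0n mulr0.
      by apply: integral_ge0 => t _; rewrite lee_fin mulr_ge0 ?pos_pow_ge0 ?gauss_ge0.
    have yy : 0 < enorm y by rewrite lt0r y0 enorm_ge0.
    have yd : 0 < dotp y y by rewrite -enorm_sqr exprn_gt0.
    under eq_integral do rewrite /gauss (mulrC _ (dotp y y)).
    rewrite integral_pos_pow_exp// lee_fin -enorm_sqr sq_powR//.
    rewrite -[X in _ * X <= _]powR_mulrn ?powR_ge0// -powRrM.
    by rewrite le_eqVlt; apply/orP; left; apply/eqP; congr (_ * _ `^ _); ring.
  rewrite (fubini_tonelli (m1 := mu) (m2 := leb) (fun p : V * R => (P p)%:E)) /=; first last.
  - by move=> p; rewrite lee_fin.
  - exact/measurable_EFinP.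
  rewrite le_eqVlt; apply/orP; left; apply/eqP; apply: eq_integral => t _.
  have E y : P (y, t) = pos_pow beta t * (gauss t y * w y * E2 y).
    by rewrite /P /=; set c := w y; ring.
  under eq_integral do rewrite E EFinM.
  rewrite ge0_integralZl//.
  - apply/measurable_EFinP; under eq_fun do rewrite mulrAC -mulrA.
    exact: (measurable_funM (@measurable_gauss R d _) mE2w).
  - by move=> y _; rewrite lee_fin; exact: (mulr_ge0 (mulr_ge0 (gauss_ge0 _ _) (w0 _)) (E20 _)).
  - by rewrite lee_fin pos_pow_ge0.
(* Schur's test at each fixed t > 0, followed by [heat_h_le]; the factor Gamma(s/2) normalises the
   Gaussian superposition of h. *)
have step2 : ((Gamma (s / 2))%:E *
    \int[leb]_t ((pos_pow beta t)%:E * \int[mu]_y (gauss t y * w y * E2 y)%:E) <=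
    \int[leb]_t \int[mu]_x N (t, x))%E.
  have mEt : measurable_fun setT (fun t : R => \int[mu]_y (gauss t y * w y * E2 y)%:E)%E.
    apply: (measurable_fun_fubini_tonelli_F (m2 := mu) (fun p : R * V => (gauss p.1 p.2 * w p.2 * E2 p.2)%:E)).
      apply/measurable_EFinP; under eq_fun do rewrite mulrAC -mulrA.
      apply: measurable_funM; last exact: (measurableT_comp mE2w measurable_snd).
      rewrite /gauss; apply: measurableT_comp => //; apply: measurableT_comp => //.
      apply: measurable_funM; first exact: measurable_fst.
      exact: (measurableT_comp measurable_dotp_self measurable_snd).
    by move=> p; rewrite lee_fin; exact: (mulr_ge0 (mulr_ge0 (gauss_ge0 _ _) (w0 _)) (E20 _)).
  have Et0 t : (0 <= \int[mu]_y (gauss t y * w y * E2 y)%:E)%E.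
    apply: integral_ge0 => y _; rewrite lee_fin.
    exact: (mulr_ge0 (mulr_ge0 (gauss_ge0 _ _) (w0 _)) (E20 _)).
  have mpE : measurable_fun setT (fun t : R => (pos_pow beta t)%:E).
    by apply/measurable_EFinP; exact: measurable_pos_pow.
  have mNt : measurable_fun setT (fun t : R => \int[mu]_x N (t, x))%E.
    exact: (measurable_fun_fubini_tonelli_F (m2 := mu) N mN N0).
  rewrite -ge0_integralZl//; first last.
  - by rewrite lee_fin ltW.
  - by move=> t _; rewrite mule_ge0 ?lee_fin ?pos_pow_ge0.
  - exact: emeasurable_funM.
  apply: ge0_le_integral => //.
  - by move=> t _; rewrite mule_ge0 ?lee_fin ?(ltW Gs)// mule_ge0 ?lee_fin ?pos_pow_ge0.
  - by apply: emeasurable_funM => //; exact: emeasurable_funM.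
  move=> t _; have [t0|t0] := ltP 0 t; last first.
    rewrite {1}/pos_pow ltNge t0/= mul0e mule0.
    by apply: integral_ge0 => x _; exact: N0.
  have mIt : measurable_fun setT (I t) by exact: (measurableT_comp mI (pair1_measurable t)).
  have mqI : measurable_fun setT (fun x => (q x)%:E * I t x)%E.
    by apply: emeasurable_funM => //; exact/measurable_EFinP.
  rewrite /N /= ge0_integralZl//; first last.
  - by rewrite lee_fin pos_pow_ge0.
  - by move=> x _; rewrite mule_ge0 ?lee_fin.
  rewrite muleCA; apply: lee_mull; first by rewrite lee_fin pos_pow_ge0.
  pose H x := (\int[mu]_z (K t x z * (h z * w z))%:E)%E.
  have H0 x : (0 <= H x)%E.
    apply: integral_ge0 => z _; rewrite lee_fin.
    exact: (mulr_ge0 (K0 _ _ t0) (mulr_ge0 (ltW (h0 _)) (w0 _))).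
  have mH : measurable_fun setT H.
    apply: (measurable_fun_fubini_tonelli_F (m2 := mu) (fun p : V * V => (K t p.1 p.2 * (h p.2 * w p.2))%:E)).
      apply/measurable_EFinP; apply: measurable_funM; first exact: (measurable_heat_kernel hRs hRp hk he t0).
      exact: (measurableT_comp (measurable_funM mh mw) measurable_snd).
    by move=> p; rewrite lee_fin; exact: (mulr_ge0 (K0 _ _ t0) (mulr_ge0 (ltW (h0 _)) (w0 _))).
  have mqH : measurable_fun setT (fun x => (q x)%:E * H x)%E.
    by apply: emeasurable_funM => //; exact/measurable_EFinP.
  apply: (@le_trans _ _ ((Gamma (s / 2))%:E * \int[mu]_x ((q x)%:E * H x))%E).
    apply: lee_mull; first by rewrite lee_fin ltW.
    exact: (transform_energy_le hRs hRp hk he mf1 mf2 Lf1 Lf2 t0 mh h0).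
  rewrite -ge0_integralZl//; first last.
  - by rewrite lee_fin ltW.
  - by move=> x _; rewrite mule_ge0 ?lee_fin.
  apply: ge0_le_integral => //.
  - by move=> x _; rewrite mule_ge0 ?lee_fin ?(ltW Gs)// mule_ge0 ?lee_fin.
  - exact: emeasurable_funM.
  by move=> x _; rewrite muleCA; apply: lee_mull; [rewrite lee_fin|exact: heat_h_le].
(* The constant of [double_integral]; dividing it by Gamma(s/2) Gamma(beta) at the end leaves
   4^(-beta) times a perfect square. *)
pose c : R := 4 `^ (- beta) * Gamma (s / 2 - beta) * (Gamma beta * Gamma (s / 2 - beta) / Gamma (s / 2)).
have Gsb := Gamma_gt0 sb.
have c0 : 0 <= c.
  by apply: mulr_ge0 (mulr_ge0 (powR_ge0 _ _) (ltW Gsb)) (divr_ge0 (mulr_ge0 (ltW Gb) (ltW Gsb)) (ltW Gs)).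
have FW0 x : 0 <= (enorm x `^ beta) ^+ 2 * (F2 x * w x).
  exact: (mulr_ge0 (sqr_ge0 _) (mulr_ge0 (F20 _) (w0 _))).
have mFW : measurable_fun setT (fun x => (enorm x `^ beta) ^+ 2 * (F2 x * w x)).
  by apply: measurable_funM => //; exact: measurable_funM.
have step3 : (\int[leb]_t \int[mu]_x N (t, x) <=
    c%:E * \int[mu]_x ((enorm x `^ beta) ^+ 2 * (F2 x * w x))%:E)%E.
  rewrite (fubini_tonelli (m1 := leb) (m2 := mu) N mN N0) -ge0_integralZl//; first last.
  - by move=> x _; rewrite lee_fin.
  - exact/measurable_EFinP.
  (* Only almost everywhere: [double_integral] needs x away from the origin, which is a null set. *)
  apply: ae_ge0_le_integral => //.
  - by move=> x _; exact: integral_ge0.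
  - exact: (measurable_fun_fubini_tonelli_G (m1 := leb) N mN N0).
  - by move=> x _; rewrite mule_ge0 ?lee_fin.
  - by apply: emeasurable_funM => //; exact/measurable_EFinP.
  exists [set 0]; split; [|exact: (rV_set1_null d_gt0)|].
    rewrite (_ : [set 0] = @enorm R d @^-1` [set 0]).
      by rewrite -[X in measurable X]setTI; exact: measurable_enorm.
    by apply/seteqP; split => x /=; [move=> ->; exact: enorm0|move/eqP; rewrite enorm_eq0 => /eqP].
  move=> x /=; apply: contra_notP => x0 _.
  have xx : 0 < enorm x by rewrite lt0r enorm_ge0 enorm_eq0 andbT; exact/eqP.
  have xd : 0 < dotp x x by rewrite -enorm_sqr exprn_gt0.
  have E t : N (t, x) = ((q x)%:E * ((pos_pow beta t)%:E * I t x))%E by rewrite /N /= muleCA.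
  under eq_integral do rewrite E.
  have mIx : measurable_fun setT (fun t => I t x) by exact: (measurableT_comp mI (pair2_measurable x)).
  rewrite ge0_integralZl ?lee_fin//; first last.
  - by move=> t _; rewrite mule_ge0 ?lee_fin ?pos_pow_ge0.
  - by apply: emeasurable_funM => //; apply/measurable_EFinP; exact: measurable_pos_pow.
  rewrite double_integral// -!EFinM lee_fin le_eqVlt; apply/orP; left; apply/eqP.
  rewrite /q /h xx -enorm_sqr sq_powR// -[X in _ = c * (X * _)]powR_mulrn ?powR_ge0// -powRrM.
  rewrite powRN invrK.
  (* The factor 1/h contributes |x|^s and the double integral |x|^(-2 (s/2 - beta)); together they
     form the weight |x|^(2 beta). *)
  have -> : enorm x `^ (beta * 2) = enorm x `^ s * enorm x `^ (2 * - (s / 2 - beta)).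
    rewrite -powRD; last by rewrite (gt_eqF xx) implybT.
    by congr (_ `^ _); field.
  by rewrite /c; set W := w x; ring.
have H : (((Gamma (s / 2) * Gamma beta)%:E *
    \int[mu]_y ((enorm y `^ (- beta)) ^+ 2 * (E2 y * w y))%:E) <=
    c%:E * \int[mu]_x ((enorm x `^ beta) ^+ 2 * (F2 x * w x))%:E)%E.
  rewrite EFinM -muleA; apply: le_trans step3; apply: le_trans step2.
  by apply: lee_mull step1; rewrite lee_fin; exact: ltW Gs.
have a0 := mulr_gt0 Gs Gb.
set A := (\int[mu]_y _)%E in H *.
rewrite -[A]mul1e (_ : 1%E = (((Gamma (s / 2) * Gamma beta)^-1)%:E * (Gamma (s / 2) * Gamma beta)%:E)%E).
  rewrite -muleA; apply: (@le_trans _ _ (((Gamma (s / 2) * Gamma beta)^-1)%:E *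
     (c%:E * \int[mu]_x ((enorm x `^ beta) ^+ 2 * (F2 x * w x))%:E))%E).
    by apply: lee_mull H; rewrite lee_fin invr_ge0 ltW.
  rewrite muleA -EFinM le_eqVlt; apply/orP; left; apply/eqP; congr (_%:E * _)%E.
  rewrite (_ : (nu - beta) / 2 = s / 2 - beta) /c; last by rewrite /s; field.
  have key (p g1 g2 g3 : R) : 0 < g2 -> 0 < g3 ->
      (g2 * g3)^-1 * (p * g1 * (g3 * g1 / g2)) = p * (g1 / g2) ^+ 2.
    by move=> g20 g30; field; rewrite !gt_eqF.
  exact: key.
by rewrite -EFinM mulVf// gt_eqF.
Qed.

End positive_exponent.
End pitt_upper.

(** * The inequality on Schwartz functions *)

Section schwartz_pitt.
Context {R : realType} {d : nat}.
Local Notation V := 'rV[R]_d.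
Local Notation mu := (@lebesgue_rV R d).
Local Notation leb := (@lebesgue_measure R).
Variables (Rs Rp : {fset V}) (k : V -> R).
Hypotheses (d_gt0 : (0 < d)%N) (hRs : root_system Rs)
  (hRp : positive_subsystem Rs Rp) (hk : multiplicity Rs k).
Variable e : V -> V -> R[i].
Hypothesis he : is_dunkl_kernel Rp k e.
Local Notation w := (dunkl_density Rp k).
Local Notation nu := (lambda_k Rp k + 1).
Implicit Types (x y z : V).

Let w0 x : 0 <= w x.
Proof. exact: (dunkl_density_ge0 hRp hk). Qed.

Let mw : measurable_fun setT w.
Proof. exact: measurable_dunkl_density. Qed.

(* Integrate Gamma(m) (1 + |x|^2)^(-m) = int t^(m-1) e^(-t) e^(-t |x|^2) dt against w. *)
Lemma L1_density_decay (m : R) : nu < m ->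
  L1 mu (fun x => (1 + dotp x x) `^ (- m) * w x).
Proof.
move=> num; have nu0 := lambda_k_gt0 d_gt0 hRp hk.
have m0 : 0 < m by exact: lt_trans num.
have Gm := Gamma_gt0 m0.
have x1 x : 0 < 1 + dotp x x by rewrite ltr_pwDl// dotp_ge0.
have f0 x : 0 <= (1 + dotp x x) `^ (- m) * w x by exact: (mulr_ge0 (powR_ge0 _ _) (w0 _)).
have mf : measurable_fun setT (fun x => (1 + dotp x x) `^ (- m) * w x).
  apply: measurable_funM => //; apply: (measurableT_comp (measurable_powR _)).
  by apply: measurable_funD => //; exact: measurable_dotp_self.
apply/integrableP; split; first exact/measurable_EFinP.
under eq_integral do rewrite /= (ger0_norm (f0 _)).
pose g (p : V * R) : R := w p.1 * (pos_pow m p.2 * expR (- ((1 + dotp p.1 p.1) * p.2))).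
have g0 p : 0 <= g p by exact: (mulr_ge0 (w0 _) (mulr_ge0 (pos_pow_ge0 _ _) (expR_ge0 _))).
have mg : measurable_fun setT (fun p => (g p)%:E).
  apply/measurable_EFinP; apply: measurable_funM; first exact: (measurableT_comp mw measurable_fst).
  apply: measurable_funM; first exact: (measurableT_comp (measurable_pos_pow _) measurable_snd).
  apply: measurableT_comp => //; apply: measurableT_comp => //.
  apply: measurable_funM; last exact: measurable_snd.
  by apply: measurable_funD => //; exact: (measurableT_comp measurable_dotp_self measurable_fst).
have E1 : (\int[mu]_x \int[leb]_t (g (x, t))%:E =
    (Gamma m)%:E * \int[mu]_x ((1 + dotp x x) `^ (- m) * w x)%:E)%E.
  rewrite -ge0_integralTZl; first last.
  - by rewrite lee_fin ltW.
  - by move=> x; rewrite lee_fin.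
  - exact/measurable_EFinP.
  apply: eq_integral => x _; rewrite /g /=; under eq_integral do rewrite EFinM.
  rewrite ge0_integralTZl; first last.
  - by rewrite lee_fin.
  - by move=> t; rewrite lee_fin mulr_ge0 ?pos_pow_ge0 ?expR_ge0.
  - exact: measurable_pos_pow_exp.
  rewrite integral_pos_pow_exp// -!EFinM; congr EFin.
  by set W := w x; ring.
have E2 : (\int[mu]_x \int[leb]_t (g (x, t))%:E =
    (2 `^ (- nu) * Gamma (m - nu))%:E)%E.
  rewrite (fubini_tonelli (m1 := mu) (m2 := leb) (fun p => (g p)%:E) mg); last first.
    by move=> p; rewrite lee_fin.
  have mn0 : 0 < m - nu by rewrite subr_gt0.
  rewrite EFinM -(integral_gamma mn0) -ge0_integralTZl; first last.
  - by rewrite lee_fin powR_ge0.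
  - by move=> t; rewrite lee_fin mulr_ge0 ?pos_pow_ge0 ?expR_ge0.
  - by have := measurable_pos_pow_exp (m - nu) 1; under eq_fun do rewrite mul1r.
  apply: eq_integral => t _; rewrite /g /=; have [t0|t0] := ltP 0 t; last first.
    rewrite /pos_pow ltNge t0/= mul0r mule0; apply: integral0_eq => x _.
    by rewrite !mul0r mulr0.
  have E x : w x * (pos_pow m t * expR (- ((1 + dotp x x) * t))) =
      pos_pow m t * expR (- t) * (gauss t x * w x).
    rewrite /gauss (_ : - ((1 + _) * t) = - t + - (t * dotp x x)); last by ring.
    by rewrite expRD; set W := w x; ring.
  under eq_integral do rewrite E EFinM.
  rewrite ge0_integralTZl; first last.
  - by rewrite lee_fin mulr_ge0 ?pos_pow_ge0 ?expR_ge0.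
  - by move=> x; rewrite lee_fin; exact: (mulr_ge0 (gauss_ge0 _ _) (w0 _)).
  - by apply/measurable_EFinP; exact: (measurable_funM (@measurable_gauss R d _) mw).
  rewrite (integral_gauss_density hRp hk t0) -!EFinM; congr EFin.
  rewrite powRM ?(ltW t0)// !pos_powE//.
  have -> : t `^ (m - nu - 1) = t `^ (m - 1) * t `^ (- nu).
    rewrite -powRD; last by rewrite (gt_eqF t0) implybT.
    by congr (_ `^ _); ring.
  ring.
move: E1; rewrite E2 => E; rewrite -[X in (X < _)%E]mul1e.
rewrite (_ : 1%E = ((Gamma m)^-1%:E * (Gamma m)%:E)%E); last by rewrite -EFinM mulVf// gt_eqF.
by rewrite -muleA -E -EFinM ltry.
Qed.

Lemma normc_sqr (z : R[i]) : Normc.normc z ^+ 2 = complex.Re z ^+ 2 + complex.Im z ^+ 2.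
Proof. by case: z => a b /=; rewrite sqr_sqrtr// addr_ge0 ?sqr_ge0. Qed.

Lemma normr_Re_le (z : R[i]) : `|complex.Re z| <= Normc.normc z.
Proof.
case: z => a b /=; rewrite -sqrtr_sqr ler_sqrt ?addr_ge0 ?sqr_ge0//.
by rewrite lerDl sqr_ge0.
Qed.

Lemma normr_Im_le (z : R[i]) : `|complex.Im z| <= Normc.normc z.
Proof.
case: z => a b /=; rewrite -sqrtr_sqr ler_sqrt ?addr_ge0 ?sqr_ge0//.
by rewrite lerDr sqr_ge0.
Qed.

Lemma schwartz_measurable (f : V -> R[i]) : schwartz f ->
  measurable_fun setT (fun x => complex.Re (f x)) /\
  measurable_fun setT (fun x => complex.Im (f x)).
Proof.
move=> /(_ [::])[/= df _]; split; apply: continuous_measurable_rV => x;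
  apply: differentiable_continuous; [exact: (df x).1|exact: (df x).2].
Qed.

Lemma schwartz_L1 (f : V -> R[i]) : schwartz f ->
  L1 mu (fun x => complex.Re (f x) * w x) /\ L1 mu (fun x => complex.Im (f x) * w x).
Proof.
move=> sf; have [mre mim] := schwartz_measurable sf.
have [m num] : exists m : nat, nu < m%:R.
  by exists (Num.bound nu); have := archi_boundP (ltW (lambda_k_gt0 d_gt0 hRp hk)).
(* Decay of order 2m in 1 + |x| gives a bound by (1 + |x|^2)^(-m), which is integrable against the
   density because m > nu. *)
have [/= _ /(_ (m + m)%N)[M HM]] := sf [::].
have L := L1_density_decay num.
have fM x : Normc.normc (f x) <= M * (1 + dotp x x) `^ (- m%:R).
  have e0 := enorm_ge0 x; have x1 : 0 < 1 + enorm x by rewrite ltr_pwDl.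
  have d1 : 0 < 1 + dotp x x by rewrite ltr_pwDl// dotp_ge0.
  rewrite powRN powR_mulrn ?(ltW d1)// ler_pdivlMr ?exprn_gt0//.
  apply: le_trans (HM x); rewrite mulrC ler_wpM2r//.
    by case: (f x) => a b /=; exact: sqrtr_ge0.
  rewrite exprD -exprMn lerXn2r ?nnegrE ?(ltW d1)//; first by rewrite mulr_ge0// ltW.
  by rewrite -enorm_sqr; nra.
have dom (g : V -> R) : measurable_fun setT g -> (forall x, `|g x| <= Normc.normc (f x)) ->
    L1 mu (fun x => g x * w x).
  move=> mg gf; apply: (L1_dom _ _ (L1Z M L)); first exact: measurable_funM.
  move=> x; rewrite (normrM (g x)) (ger0_norm (w0 x)) [leRHS]mulrA.
  exact: ler_wpM2r (w0 x) _ _ (le_trans (gf x) (fM x)).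
by split; apply: dom => // x; [exact: normr_Re_le|exact: normr_Im_le].
Qed.

Lemma dunkl_transform_ReIm (f : V -> R[i]) y :
  measurable_fun setT (fun x => complex.Re (f x)) ->
  measurable_fun setT (fun x => complex.Im (f x)) ->
  L1 mu (fun x => complex.Re (f x) * w x) -> L1 mu (fun x => complex.Im (f x) * w x) ->
  complex.Re (dunkl_transform Rp k e f y) =
    re_transform Rp k e (fun x => complex.Re (f x)) (fun x => complex.Im (f x)) y /\
  complex.Im (dunkl_transform Rp k e f y) =
    im_transform Rp k e (fun x => complex.Re (f x)) (fun x => complex.Im (f x)) y.
Proof.
move=> mre mim Lre Lim.
have mcy : measurable_fun setT (fun x => ker_cos e x y).
  exact: (measurableT_comp (measurable_ker_cos_pair hRs hRp hk he) (pair2_measurable y)).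
have msy : measurable_fun setT (fun x => ker_sin e x y).
  exact: (measurableT_comp (measurable_ker_sin_pair hRs hRp hk he) (pair2_measurable y)).
have bd (g : V -> R) (q : V -> R) : L1 mu g -> measurable_fun setT q ->
    (forall x, `|q x| <= 1) -> L1 mu (fun x => g x * q x).
  move=> Lg mq q1; apply: (L1_dom _ _ (L1_norm Lg)).
    by apply: measurable_funM => //; exact: (L1_measurable Lg).
  by move=> x; rewrite normrM ler_piMr.
have c1 x : `|ker_cos e x y| <= 1 by exact: (normr_ker_cos_le1 hRp hk he).
have s1 x : `|ker_sin e x y| <= 1 by exact: (normr_ker_sin_le1 hRp hk he).
have LC g : L1 mu g -> L1 mu (fun x => g x * ker_cos e x y) by move=> Lg; exact: bd.
have LS g : L1 mu g -> L1 mu (fun x => g x * ker_sin e x y) by move=> Lg; exact: bd.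
rewrite /dunkl_transform /dunkl_integral /re_transform /im_transform.
rewrite /cos_transform /sin_transform /=; split.
- rewrite -(RintD (LC _ Lre) (LS _ Lim)); apply: Rint_ext => x.
  rewrite /ker_cos /ker_sin; case: (f x) => a b; case: (e x y) => c s /=.
  by set W := w x; ring.
- rewrite -(RintB (LC _ Lim) (LS _ Lre)); apply: Rint_ext => x.
  rewrite /ker_cos /ker_sin; case: (f x) => a b; case: (e x y) => c s /=.
  by set W := w x; ring.
Qed.

Lemma dunkl_norm2_power_mul (s : R) (f : V -> R[i]) :
  (dunkl_norm2 Rp k (norm_power_mul s f) = (\int[mu]_x ((enorm x `^ s) ^+ 2 *
    ((complex.Re (f x) ^+ 2 + complex.Im (f x) ^+ 2) * w x))%:E) `^ 2^-1)%E.
Proof.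
congr (_ `^ _)%E; apply: eq_integral => x _; congr EFin.
rewrite /norm_power_mul normc_sqr; case: (f x) => a b /=.
by set W := w x; set p := _ `^ _; ring.
Qed.

Lemma pitt_bound_schwartz (beta : R) : 0 <= beta -> beta < nu ->
  pitt_bound Rp k e beta [set f | schwartz f]
    (2 `^ (- beta) * (Gamma ((nu - beta) / 2) / Gamma ((nu + beta) / 2))).
Proof.
move=> b0 bnu f /= sf; have [mre mim] := schwartz_measurable sf.
have [Lre Lim] := schwartz_L1 sf.
pose f1 x := complex.Re (f x); pose f2 x := complex.Im (f x).
have nu0 := lambda_k_gt0 d_gt0 hRp hk.
have nb1 : 0 < (nu - beta) / 2 by rewrite divr_gt0 ?subr_gt0.
have nb2 : 0 < (nu + beta) / 2 by rewrite divr_gt0// ltr_wpDr.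
have G1 := Gamma_gt0 nb1; have G2 := Gamma_gt0 nb2.
set C0 := 2 `^ (- beta) * _.
have C00 : 0 <= C0 by rewrite mulr_ge0 ?powR_ge0// divr_ge0 ?ltW.
rewrite !dunkl_norm2_power_mul.
set A := (\int[mu]_x _)%E; set B := (X in (_ <= C0%:E * X `^ _)%E).
have B0 : (0 <= B)%E.
  apply: integral_ge0 => x _; rewrite lee_fin.
  exact: (mulr_ge0 (sqr_ge0 _) (mulr_ge0 (addr_ge0 (sqr_ge0 _) (sqr_ge0 _)) (w0 _))).
have A0 : (0 <= A)%E.
  apply: integral_ge0 => x _; rewrite lee_fin.
  exact: (mulr_ge0 (sqr_ge0 _) (mulr_ge0 (addr_ge0 (sqr_ge0 _) (sqr_ge0 _)) (w0 _))).
have AE : A = (\int[mu]_y ((enorm y `^ (- beta)) ^+ 2 *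
    ((re_transform Rp k e f1 f2 y ^+ 2 + im_transform Rp k e f1 f2 y ^+ 2) * w y))%:E)%E.
  apply: eq_integral => y _; have [-> ->] := dunkl_transform_ReIm y mre mim Lre Lim.
  by [].
have AB : (A <= (C0 ^+ 2)%:E * B)%E.
  (* The factor Gamma(beta) of the t-integration has a pole at 0, so beta = 0 goes through
     [plancherel_le], the constant being 1. *)
  have [bz|bp] := eqVneq beta 0; last first.
    have bp0 : 0 < beta by rewrite lt0r bp.
    rewrite AE; apply: le_trans (pitt_upper_real d_gt0 hRs hRp hk he mre mim Lre Lim bp0 bnu) _.
    rewrite le_eqVlt; apply/orP; left; apply/eqP; congr (_%:E * _)%E.
    rewrite [C0 ^+ 2]exprMn; congr (_ * _).
    by rewrite expr2 -powRM//; congr (_ `^ _); rewrite -natrM.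
  have C01 : C0 = 1.
    have G : 0 < Gamma (nu / 2) by have := G1; rewrite bz subr0.
    by rewrite /C0 bz oppr0 powRr0 mul1r addr0 divff// gt_eqF.
  rewrite C01 expr1n mul1e.
  have -> : A = (\int[mu]_y ((re_transform Rp k e f1 f2 y ^+ 2 +
      im_transform Rp k e f1 f2 y ^+ 2) * w y)%:E)%E.
    rewrite AE; apply: eq_integral => y _.
    by rewrite bz oppr0 powRr0 (expr1n _ 2) (mul1r (_ * w y)).
  have -> : B = (\int[mu]_x ((f1 x ^+ 2 + f2 x ^+ 2) * w x)%:E)%E.
    by apply: eq_integral => y _; rewrite bz powRr0 (expr1n _ 2) (mul1r (_ * w y)).
  exact: (plancherel_le d_gt0 hRs hRp hk he mre mim Lre Lim).
have -> : C0%:E = ((C0 ^+ 2)%:E `^ 2^-1)%E.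
  by rewrite poweR_EFin powR12_sqrt ?sqr_ge0// sqrtr_sqr ger0_norm.
rewrite -poweRM//; last by rewrite lee_fin sqr_ge0.
apply: gt0_ler_poweR => //; rewrite ?in_itv/= ?leey ?andbT//.
by rewrite mule_ge0// lee_fin sqr_ge0.
Qed.

End schwartz_pitt.

(** * Sharpness *)

Section log_riemann_sums.
Context {R : realType}.
Local Notation leb := (@lebesgue_measure R).
Implicit Types (a u v q : R).

(** For positive u and v this is psi_a(v/u): homogeneous of degree 0, and a function of i - j alone
    at u = q^i, v = q^j. *)
Definition mellin_kernel a u v : R := (u * v) `^ (a / 2) * (u + v) `^ (- a).

Definition mellin_mass a : R := Gamma (a / 2) ^+ 2 / Gamma a.

(** The kernel divided by v, since the scale-invariant measure is dv/v, and extended by 0 to the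
    whole line. *)
Let kernel_over a u v : R := pos_pow (a / 2) v * (u `^ (a / 2) * (u + v) `^ (- a)).

Let kernel_over_ge0 a u v : 0 <= kernel_over a u v.
Proof. by rewrite /kernel_over !mulr_ge0 ?pos_pow_ge0 ?powR_ge0. Qed.

Let measurable_kernel_over a u : measurable_fun setT (kernel_over a u).
Proof.
apply: measurable_funM; first exact: measurable_pos_pow.
apply: measurable_funM => //; apply: (measurableT_comp (measurable_powR _)).
exact: measurable_funD.
Qed.

Let kernel_overE a u v : 0 < u -> 0 < v -> kernel_over a u v = mellin_kernel a u v / v.
Proof.
move=> u0 v0; rewrite /kernel_over /mellin_kernel pos_powE// powRM ?ltW//.
have -> : v `^ (a / 2 - 1) = v `^ (a / 2) / v.
  by rewrite -(powR_inv1 (ltW v0)) -powRD// (gt_eqF v0) implybT.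
ring.
Qed.

Let kernel_over_scale a u v : 0 < u ->
  kernel_over a u (u * v) = u^-1 * kernel_over a 1 v.
Proof.
move=> u0; rewrite /kernel_over /pos_pow pmulr_rgt0//; case: ifP => v0; last first.
  by rewrite !mul0r mulr0.
rewrite powRM ?ltW// (_ : u + u * v = u * (1 + v)); last by ring.
rewrite powRM ?(ltW u0) ?addr_ge0 ?(ltW v0)//.
rewrite powR1 mul1r.
have E : u^-1 = u `^ (a / 2 - 1) * u `^ (a / 2) * u `^ (- a).
  rewrite -!powRD ?(gt_eqF u0) ?implybT// -(powR_inv1 (ltW u0)); congr (_ `^ _); lra.
rewrite E; ring.
Qed.

Let integral_kernel_over a u : 0 < a -> 0 < u ->
  (\int[leb]_v (kernel_over a u v)%:E = (mellin_mass a)%:E)%E.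
Proof.
move=> a0 u0.
have a2 : 0 < a / 2 by rewrite divr_gt0.
have aa : a / 2 < a by rewrite ltr_pdivrMr// mulr_natr mulr2n ltrDl.
have H1 : (\int[leb]_v (kernel_over a 1 v)%:E = (mellin_mass a)%:E)%E.
  rewrite /kernel_over /mellin_mass.
  under eq_integral do rewrite powR1 mul1r.
  rewrite (integral_beta a2 aa) expr2.
  by rewrite (_ : a - a / 2 = a / 2)//; lra.
have mk : measurable_fun setT (fun v => (kernel_over a u v)%:E).
  by apply/measurable_EFinP; exact: measurable_kernel_over.
have := lebesgue_integral_affine 0 u0 mk (fun v => kernel_over_ge0 a u v).
under eq_integral do rewrite addr0 kernel_over_scale// EFinM.
rewrite ge0_integralTZl; first last.
- by rewrite lee_fin invr_ge0 ltW.
- by move=> v; rewrite lee_fin.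
- by apply/measurable_EFinP; exact: measurable_kernel_over.
rewrite H1 => H.
have uu : (u%:E * (u^-1)%:E = 1)%E by rewrite -EFinM mulfV// gt_eqF.
by rewrite -[LHS]mul1e -uu -muleA -H muleA uu mul1e.
Qed.

Let L1_kernel_over a u : 0 < a -> 0 < u -> L1 leb (kernel_over a u).
Proof.
move=> a0 u0; apply/integrableP; split.
  by apply/measurable_EFinP; exact: measurable_kernel_over.
under eq_integral do rewrite /= (ger0_norm (kernel_over_ge0 _ _ _)).
by rewrite integral_kernel_over// ltry.
Qed.

(** Half-open intervals make consecutive pieces add up exactly. *)
Let ind (b c v : R) : R := \1_([set` `[b, c[]) v.

Let indE (b c v : R) : ind b c v = ((b <= v) && (v < c))%:R.
Proof.
rewrite /ind indicE; congr (_%:R); congr nat_of_bool.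
by apply/idP/idP => [/set_mem|H]; [|apply/mem_set]; rewrite /= in_itv.
Qed.

Let measurable_ind (b c : R) : measurable_fun setT (ind b c).
Proof.
have mI : measurable ([set` `[b, c[] : set R) by exact: measurable_itv.
exact: measurable_indic.
Qed.

Let integral_ind (b c : R) : b <= c -> (\int[leb]_v (ind b c v)%:E = (c - b)%:E)%E.
Proof.
have mI : measurable ([set` `[b, c[] : set R) by exact: measurable_itv.
move=> bc; rewrite /ind (integral_indic leb measurableT mI).
transitivity (leb ([set` `[b, c[] : set R)); first by rewrite setIT.
rewrite lebesgue_measure_itv/= lte_fin; have [bc'|cb] := ltP b c.
  by rewrite -EFinB.
by rewrite (@le_anti _ _ b c) ?bc// subrr.
Qed.

Let L1_ind (b c : R) : b <= c -> L1 leb (ind b c).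
Proof.
move=> bc; apply/integrableP; split; first by apply/measurable_EFinP; exact: measurable_ind.
under eq_integral do rewrite /= ger0_norm ?indE ?ler0n// -indE.
by rewrite integral_ind// ltry.
Qed.

Let piece a u (b c : R) : R := \int[leb]_v (ind b c v * kernel_over a u v).

Let L1_piece a u (b c : R) : 0 < a -> 0 < u ->
  L1 leb (fun v => ind b c v * kernel_over a u v).
Proof.
move=> a0 u0; apply: (L1_dom _ _ (L1_kernel_over a0 u0)).
  exact: (measurable_funM (measurable_ind b c) (measurable_kernel_over a u)).
move=> v; rewrite normrM (ger0_norm (kernel_over_ge0 _ _ _)) indE.
by case: (_ && _); rewrite ?normr1 ?mul1r// normr0 mul0r.
Qed.

Let pieceD a u (b c d : R) : 0 < a -> 0 < u -> b <= c -> c <= d ->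
  piece a u b c + piece a u c d = piece a u b d.
Proof.
move=> a0 u0 bc cd; rewrite /piece -RintD//; [|exact: L1_piece..].
apply: Rint_ext => v; rewrite -mulrDl !indE; congr (_ * _).
have [vc|cv] := ltP v c.
  by rewrite (lt_le_trans vc cd) addr0.
by rewrite andbF (le_trans bc cv) add0r.
Qed.

Let piece_le_mass a u (b c : R) : 0 < a -> 0 < u -> piece a u b c <= mellin_mass a.
Proof.
move=> a0 u0; have -> : mellin_mass a = \int[leb]_v kernel_over a u v.
  by rewrite /Rintegral integral_kernel_over.
apply: le_Rintegral => //; [exact: L1_piece|exact: L1_kernel_over|].
move=> v _; rewrite indE; case: (_ && _); rewrite ?mul1r// mul0r//.
Qed.

Let le_piece a u (b c m : R) : 0 < a -> 0 < u -> b <= c ->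
  (forall v, b <= v < c -> m <= kernel_over a u v) -> m * (c - b) <= piece a u b c.
Proof.
move=> a0 u0 bc H; have -> : m * (c - b) = \int[leb]_v (m * ind b c v).
  by rewrite RintZ ?L1_ind// /Rintegral integral_ind.
apply: le_Rintegral => //; [by apply: L1Z; exact: L1_ind|exact: L1_piece|].
move=> v _; rewrite indE; case: (boolP (b <= v < c)) => bv.
  by rewrite mulr1 mul1r H.
by rewrite mulr0 mul0r.
Qed.

Let piece_le a u (b c m : R) : 0 < a -> 0 < u -> b <= c ->
  (forall v, b <= v < c -> kernel_over a u v <= m) -> piece a u b c <= m * (c - b).
Proof.
move=> a0 u0 bc H; have -> : m * (c - b) = \int[leb]_v (m * ind b c v).
  by rewrite RintZ ?L1_ind// /Rintegral integral_ind.
apply: le_Rintegral => //; [exact: L1_piece|by apply: L1Z; exact: L1_ind|].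
move=> v _; rewrite indE; case: (boolP (b <= v < c)) => bv.
  by rewrite mulr1 mul1r H.
by rewrite mulr0 mul0r.
Qed.

Let powR_ge (x y p : R) : 0 < p -> 0 <= x -> x <= y -> x `^ p <= y `^ p.
Proof. by move=> p0 x0 xy; rewrite ge0_ler_powR ?nnegrE ?(ltW p0)// (le_trans x0). Qed.

Let powRN_le (x y p : R) : 0 < p -> 0 < x -> x <= y -> y `^ (- p) <= x `^ (- p).
Proof.
move=> p0 x0 xy; rewrite !powRN lef_pV2 ?posrE ?powR_gt0//; last exact: lt_le_trans xy.
exact: powR_ge (ltW x0) xy.
Qed.

(* On [b, q b) numerator and denominator of the kernel vary by a factor q. *)
Let piece_lower a u q b : 0 < a -> 0 < u -> 1 < q -> 0 < b ->
  (q - 1) * (q `^ (- (1 + a)) * mellin_kernel a u b) <= piece a u b (q * b).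
Proof.
move=> a0 u0 q1 b0; have q0 : 0 < q by exact: lt_trans q1.
have a2 : 0 < a / 2 by rewrite divr_gt0.
have bq : b <= q * b by rewrite ler_peMl ?(ltW b0)// ltW.
apply: le_trans (le_piece (m := q `^ (- (1 + a)) * mellin_kernel a u b / b) a0 u0 bq _).
  by rewrite le_eqVlt; apply/orP; left; apply/eqP; field; rewrite gt_eqF.
move=> v /andP[bv vq]; have v0 : 0 < v by exact: lt_le_trans bv.
rewrite kernel_overE// /mellin_kernel.
have -> : q `^ (- (1 + a)) = q^-1 * q `^ (- a).
  rewrite -(powR_inv1 (ltW q0)) -powRD; last by rewrite (gt_eqF q0) implybT.
  by congr (_ `^ _); ring.
rewrite (_ : _ / b = (u * b) `^ (a / 2) * (q `^ (- a) * (u + b) `^ (- a)) * (q * b)^-1); last first.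
  by rewrite invfM; ring.
apply: ler_pM; rewrite ?invr_ge0 ?mulr_ge0 ?powR_ge0 ?(ltW q0) ?(ltW b0)//; last first.
  by rewrite lef_pV2 ?posrE ?mulr_gt0// ltW.
apply: ler_pM; rewrite ?mulr_ge0 ?powR_ge0//.
  exact: (powR_ge a2 (mulr_ge0 (ltW u0) (ltW b0)) (ler_wpM2l (ltW u0) bv)).
rewrite -powRM ?(ltW q0) ?addr_ge0 ?(ltW u0) ?(ltW b0)//.
apply: powRN_le => //; first by rewrite addr_gt0.
rewrite mulrDr lerD//; last exact: ltW.
by rewrite ler_peMl ?(ltW u0)// ltW.
Qed.

(** Upper counterpart of [piece_lower]: 1/v and (u + v)^(-a) decrease in v, so only the numerator
    costs a factor q^(a/2). *)
Let piece_upper a u q b : 0 < a -> 0 < u -> 1 < q -> 0 < b ->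
  piece a u b (q * b) <= (q - 1) * (q `^ (a / 2) * mellin_kernel a u b).
Proof.
move=> a0 u0 q1 b0; have q0 : 0 < q by exact: lt_trans q1.
have a2 : 0 < a / 2 by rewrite divr_gt0.
have bq : b <= q * b by rewrite ler_peMl ?(ltW b0)// ltW.
apply: le_trans (piece_le (m := q `^ (a / 2) * mellin_kernel a u b / b) a0 u0 bq _) _; last first.
  by rewrite le_eqVlt; apply/orP; left; apply/eqP; field; rewrite gt_eqF.
move=> v /andP[bv vq]; have v0 : 0 < v by exact: lt_le_trans bv.
rewrite kernel_overE// /mellin_kernel !mulrA.
apply: ler_pM; rewrite ?invr_ge0 ?mulr_ge0 ?powR_ge0 ?(ltW v0)//; last first.
  by rewrite lef_pV2 ?posrE.
apply: ler_pM; rewrite ?mulr_ge0 ?powR_ge0//; last first.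
  by apply: powRN_le; rewrite ?addr_gt0 ?lerD2l.
rewrite -powRM ?(ltW q0) ?mulr_ge0 ?(ltW u0) ?(ltW b0)//.
apply: (powR_ge a2 (mulr_ge0 (ltW u0) (ltW v0))).
by rewrite (mulrCA q); exact: (ler_wpM2l (ltW u0) (ltW vq)).
Qed.

Let sum_pieces a u q n : 0 < a -> 0 < u -> 1 < q ->
  \sum_(j < n) piece a u (q ^+ j) (q * q ^+ j) = piece a u 1 (q ^+ n).
Proof.
move=> a0 u0 q1; elim: n => [|n IH].
  rewrite big_ord0 /piece (@Rint_ext _ _ _ leb _ (fun v => 0 * kernel_over a u v)).
    by rewrite RintZ ?mul0r//; exact: L1_kernel_over.
  move=> v; rewrite indE expr0 mul0r; have [v1|v1] := ltP v 1.
    by rewrite mul0r.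
  by rewrite andbF mul0r.
rewrite big_ord_recr/= IH -exprS pieceD//; first by rewrite exprn_ege1// ltW.
by rewrite ler_eXn2l// ltW.
Qed.

(** Up to the power of q, a row is bounded by an integral over part of the half-line, whose full
    value does not depend on u; rows near the ends merely lose mass. *)
Lemma mellin_row_le a u q n : 0 < a -> 0 < u -> 1 < q ->
  (q - 1) * q `^ (- (1 + a)) * \sum_(j < n) mellin_kernel a u (q ^+ j) <= mellin_mass a.
Proof.
move=> a0 u0 q1; have q0 : 0 < q by exact: lt_trans q1.
apply: le_trans (piece_le_mass 1 (q ^+ n) a0 u0).
rewrite -sum_pieces// mulr_sumr; apply: ler_sum => j _.
by rewrite -mulrA piece_lower// exprn_gt0.
Qed.

(** The mass within a factor q^M of the diagonal, which every row at least M steps away from both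
    ends is sure to see. *)
Let core a q M : R := piece a 1 (q ^- M) (q ^+ M).

Let mule_cancel u (X Y : \bar R) : 0 < u -> ((u^-1)%:E * X = (u^-1)%:E * Y)%E -> X = Y.
Proof.
move=> u0 H; have uu : (u%:E * (u^-1)%:E = 1)%E by rewrite -EFinM mulfV// gt_eqF.
by rewrite -[LHS]mul1e -uu -muleA H muleA uu mul1e.
Qed.

Let piece_scale a u (b c : R) : 0 < a -> 0 < u ->
  piece a u (u * b) (u * c) = piece a 1 b c.
Proof.
move=> a0 u0.
have mk (u' b' c' : R) : measurable_fun setT (fun v => (ind b' c' v * kernel_over a u' v)%:E).
  apply/measurable_EFinP.
  exact: (measurable_funM (measurable_ind b' c') (measurable_kernel_over a u')).
have k0 (u' b' c' v : R) : (0 <= (ind b' c' v * kernel_over a u' v)%:E)%E.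
  by rewrite lee_fin mulr_ge0// indE ler0n.
have := lebesgue_integral_affine 0 u0 (mk u (u * b) (u * c)) (k0 u _ _).
have E v : ind (u * b) (u * c) (u * v + 0) * kernel_over a u (u * v + 0) =
    u^-1 * (ind b c v * kernel_over a 1 v).
  rewrite addr0 kernel_over_scale// !indE ler_pM2l// ltr_pM2l//; ring.
under eq_integral do rewrite E EFinM.
have uV : (0 <= (u^-1)%:E)%E by rewrite lee_fin invr_ge0 ltW.
rewrite (ge0_integralTZl leb (mk 1 b c) (k0 1 b c) uV).
move=> H; exact: (congr1 fine (esym (mule_cancel u0 H))).
Qed.

Let piece_mono a u (b b' c c' : R) : 0 < a -> 0 < u -> b' <= b -> c <= c' ->
  piece a u b c <= piece a u b' c'.
Proof.
move=> a0 u0 bb cc; apply: le_Rintegral => //; [exact: L1_piece..|].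
move=> v _; apply: ler_wpM2r => //; rewrite !indE.
case: (leP b v) => bv /=; last by [].
rewrite (le_trans bb bv) /=; case: (ltP v c) => vc //.
by rewrite (lt_le_trans vc cc).
Qed.

(** Scaling by q^i moves the window [q^(-M), q^M] to [q^(i - M), q^(i + M)], which the two
    conditions on i keep inside the range [1, q^n] of the row. *)
Lemma mellin_row_ge a q n M (i : nat) : 0 < a -> 1 < q -> (M <= i)%N -> (i + M <= n)%N ->
  core a q M <= (q - 1) * q `^ (a / 2) * \sum_(j < n) mellin_kernel a (q ^+ i) (q ^+ j).
Proof.
move=> a0 q1 Mi iM; have q0 : 0 < q by exact: lt_trans q1.
have qi : 0 < q ^+ i by rewrite exprn_gt0.
apply: (@le_trans _ _ (piece a (q ^+ i) 1 (q ^+ n))); last first.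
  rewrite -sum_pieces// mulr_sumr; apply: ler_sum => j _.
  by rewrite -mulrA piece_upper// exprn_gt0.
rewrite /core -(piece_scale _ _ a0 qi); apply: piece_mono => //.
- by rewrite ler_pdivlMr ?exprn_gt0// mul1r ler_eXn2l.
- by rewrite -exprD ler_eXn2l.
Qed.

Let near_expr_gt q (c : R) : 1 < q -> \forall n \near \oo, c < q ^+ n.
Proof.
move=> q1; have : `|q^-1| < 1.
  by rewrite ger0_norm ?invr_ge0 ?(le_trans ler01 (ltW q1))// invf_lt1 ?(lt_trans ltr01 q1).
move=> /cvg_expr cq; have q0 : 0 < q by exact: lt_trans q1.
have c0 : 0 < (`|c| + 1)^-1 by rewrite invr_gt0 ltr_wpDl.
have := @cvgr_lt _ _ _ _ _ _ cq _ c0 => /(_ _) /filterS; apply => n.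
rewrite /= exprVn ltf_pV2 ?posrE ?exprn_gt0 ?ltr_wpDl//.
by apply: le_lt_trans; rewrite (le_trans (ler_norm c)) ?lerDl.
Qed.

(** Fatou's lemma for M -> oo: the windows exhaust the half-line. *)
Let core_le_mass a q (c : R) : 0 < a -> 1 < q -> (forall M, core a q M <= c) -> mellin_mass a <= c.
Proof.
move=> a0 q1 H; have q0 : 0 < q by exact: lt_trans q1.
rewrite -lee_fin -(integral_kernel_over a0 ltr01).
apply: (@fatou_le _ _ _ leb (fun M v => ind (q ^- M) (q ^+ M) v * kernel_over a 1 v)).
- move=> n.
  exact: (measurable_funM (measurable_ind _ _) (measurable_kernel_over a 1)).
- by move=> n v; rewrite mulr_ge0// indE ler0n.
- move=> v; have [v0|v0] := ltP 0 v; last first.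
    rewrite /kernel_over /pos_pow ltNge v0/= mul0r; under eq_fun do rewrite mulr0.
    exact: cvg_cst.
  rewrite -[X in _ --> X]mul1r; apply: cvgM; last exact: cvg_cst.
  apply: cvg_near_cst; near=> n.
  have vn : v < q ^+ n by near: n; exact: near_expr_gt.
  have vn' : v^-1 < q ^+ n by near: n; exact: near_expr_gt.
  rewrite indE vn andbT ltW//.
  by rewrite invf_plt ?posrE ?exprn_gt0.
move=> M; rewrite Rint_EFin ?lee_fin; first exact: H.
exact: L1_piece.
Unshelve. all: by end_near. Qed.

Let mellin_mass_ge0 a : 0 < a -> 0 <= mellin_mass a.
Proof. by move=> a0; rewrite mulr_ge0 ?sqr_ge0// invr_ge0 ltW// Gamma_gt0. Qed.

Let le_of_linear (x y c : R) : (forall n, n%:R * x <= n%:R * y + c) -> x <= y.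
Proof.
move=> H; rewrite leNgt; apply/negP => yx.
have xy0 : 0 < x - y by rewrite subr_gt0.
have := truncnS_gt (c / (x - y)); rewrite ltr_pdivrMr// mulrBr.
have := H (Num.truncn (c / (x - y))).+1; lra.
Qed.

(** In matrices of size n + 2M, n interior rows see at least [core] and every row at most the full
    mass. The 2M remaining rows cost a term independent of n, which [le_of_linear] discards; then M
    -> oo, and finally q -> 1. *)
Lemma mellin_toeplitz_limit (a1 a2 P Q : R) : 0 < a1 -> 0 < a2 -> 0 <= P -> 0 <= Q ->
  (forall q n, 1 < q ->
    P * (\sum_(i < n) \sum_(j < n) mellin_kernel a1 (q ^+ i) (q ^+ j)) <=
    Q * (\sum_(i < n) \sum_(j < n) mellin_kernel a2 (q ^+ i) (q ^+ j))) ->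
  P * mellin_mass a1 <= Q * mellin_mass a2.
Proof.
move=> a10 a20 P0 Q0 H.
(* The exponent collects the loss q^(a1/2) of the lower row bound and q^(1 + a2) of the upper one;
   both tend to 1 with q. *)
have key q : 1 < q -> P * mellin_mass a1 <= Q * mellin_mass a2 * q `^ (a1 / 2 + (1 + a2)).
  move=> q1; have q0 : 0 < q by exact: lt_trans q1.
  have q10 : 0 < q - 1 by rewrite subr_gt0.
  have qa (x : R) : 0 < q `^ x by exact: powR_gt0.
  rewrite powRD ?(gt_eqF q0) ?implybT//.
  set B := Q * mellin_mass a2 * _.
  have B0 : 0 <= B by rewrite mulr_ge0 ?(mulr_ge0 (ltW (qa _)) (ltW (qa _)))// mulr_ge0 ?mellin_mass_ge0.
  have [->|Pn0] := eqVneq P 0; first by rewrite mul0r.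
  have Pp : 0 < P by rewrite lt_neqAle eq_sym Pn0.
  rewrite mulrC -ler_pdivlMr//; apply: (core_le_mass a10 q1) => M.
  rewrite ler_pdivlMr// mulrC; apply: le_of_linear => n.
  have HU : (q - 1) * (\sum_(i < n + M.*2) \sum_(j < n + M.*2) mellin_kernel a2 (q ^+ i) (q ^+ j))
      <= (n + M.*2)%:R * (mellin_mass a2 * q `^ (1 + a2)).
    rewrite mulr_sumr mulr_natl -[X in _ <= _ *+ X]card_ord -sumr_const.
    apply: ler_sum => i _.
    have := mellin_row_le (n + M.*2) a20 (exprn_gt0 i q0) q1.
    by rewrite -mulrA mulrCA powRN mulrC ler_pdivrMr.
  have HL : n%:R * core a1 q M <= (q - 1) * q `^ (a1 / 2) *
      (\sum_(i < n + M.*2) \sum_(j < n + M.*2) mellin_kernel a1 (q ^+ i) (q ^+ j)).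
    pose F i := \sum_(j < n + M.*2) mellin_kernel a1 (q ^+ i) (q ^+ j).
    have F0 i : 0 <= F i by apply: sumr_ge0 => j _; rewrite mulr_ge0 ?powR_ge0.
    apply: (@le_trans _ _ ((q - 1) * q `^ (a1 / 2) * \sum_(M <= i < M + n) F i)).
      rewrite mulr_sumr mulr_natl -[X in _ *+ X](addKn M) -sumr_const_nat.
      rewrite [X in X <= _]big_nat_cond [X in _ <= X]big_nat_cond.
      apply: ler_sum => i; rewrite andbT => /andP[Mi iM].
      by apply: mellin_row_ge => //; rewrite -addnn addnA leq_add2r addnC ltnW.
    rewrite ler_pM2l ?mulr_gt0//.
    rewrite -[X in _ <= X](big_mkord xpredT F).
    rewrite (big_cat_nat (leq0n M) _)/=; last by rewrite -addnn addnCA leq_addr.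
    rewrite (big_cat_nat (p := (n + M.*2)%N) (leq_addr n M) _)/=; last by rewrite -addnn addnA (addnC n M) leq_addr.
    rewrite -[X in X <= _]add0r lerD ?sumr_ge0//.
    by rewrite -[X in X <= _]addr0 lerD ?sumr_ge0.
  have HH := ler_wpM2l (mulr_ge0 (ltW q10) (ltW (qa (a1 / 2)))) (H q (n + M.*2)%N q1).
  move: HU HL HH; set S2 := \sum_(i < _) _; set S1 := \sum_(i < _) _ => HU HL HH.
  apply: (@le_trans _ _ (P * ((q - 1) * q `^ (a1 / 2) * S1))).
    by rewrite mulrCA ler_wpM2l.
  rewrite mulrCA; apply: (le_trans HH).
  have -> : (q - 1) * q `^ (a1 / 2) * (Q * S2) = q `^ (a1 / 2) * Q * ((q - 1) * S2) by ring.
  apply: le_trans (ler_wpM2l (mulr_ge0 (ltW (qa _)) Q0) HU) _.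
  have -> : q `^ (a1 / 2) * Q * ((n + M.*2)%:R * (mellin_mass a2 * q `^ (1 + a2))) =
      n%:R * B + (M.*2)%:R * B by rewrite /B natrD; ring.
  exact: lexx.
have c : Q * mellin_mass a2 * (1 + n.+1%:R^-1) `^ (a1 / 2 + (1 + a2)) @[n --> \oo] -->
    Q * mellin_mass a2 * 1 `^ (a1 / 2 + (1 + a2)).
  apply: cvgM; first exact: cvg_cst.
  by apply: powR_harmonic_cvg => //; rewrite !addr_ge0 ?divr_ge0 ?ltW.
rewrite powR1 mulr1 in c.
rewrite -(cvg_lim _ c)//; apply: limr_ge; first by apply/cvg_ex; eexists; exact: c.
by apply: nearW => n; apply: key; rewrite ltrDl invr_gt0.
Qed.

End log_riemann_sums.

(** * Gaussian sums are Schwartz functions *)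

Section gaussian_schwartz_functions.
Context {R : realType} {d : nat}.
Local Notation V := 'rV[R]_d.
Implicit Types (f g : V -> R) (x : V).

(** A class that contains the test functions and is stable under directional derivatives, so that a
    Gaussian bound on its members settles all Schwartz estimates at once. Multiplication by single
    coordinates is enough, since differentiating a Gaussian produces <x, xi>. *)
Inductive gaussian_polynomial : (V -> R) -> Prop :=
| gaussian_polynomial_gauss b : 0 < b -> gaussian_polynomial (gauss b)
| gaussian_polynomial_scale c f :
    gaussian_polynomial f -> gaussian_polynomial (fun x => c * f x)
| gaussian_polynomial_add f g : gaussian_polynomial f ->
    gaussian_polynomial g -> gaussian_polynomial (fun x => f x + g x)
| gaussian_polynomial_coord i f :
    gaussian_polynomial f -> gaussian_polynomial (fun x => x ord0 i * f x).

Let differentiable_coord0 (i : 'I_d) x : differentiable (fun y : V => y ord0 i) x.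
Proof. exact: differentiable_coord. Qed.

Let differentiable_gauss b x : differentiable (@gauss R d b) x.
Proof.
have dq : differentiable (fun y : V => - (b * dotp y y)) x.
  have -> : (fun y : V => - (b * dotp y y)) =
      - (b *: \sum_(i < d) ((fun y : V => y ord0 i) * (fun y : V => y ord0 i))).
    apply/funext => y; rewrite /dotp fctE; congr (- (b * _)).
    by rewrite fct_sumE; apply: eq_bigr.
  apply: differentiableN; apply: differentiableZ; apply: differentiable_sum => i.
  by apply: differentiableM.
have de : differentiable (@expR R) (- (b * dotp x x)).
  by apply/derivable1_diffP; exact: derivable_expR.
exact: (differentiable_comp dq de).
Qed.

Lemma gaussian_polynomial_differentiable f x : gaussian_polynomial f -> differentiable f x.
Proof.
elim=> [b b0|c g _ dg|g h _ dg _ dh|i g _ dg].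
- exact: differentiable_gauss.
- exact: (differentiableZ c dg).
- exact: (differentiableD dg dh).
- exact: (differentiableM (differentiable_coord0 i x) dg).
Qed.

Lemma gaussian_polynomial_derive f (xi : V) : gaussian_polynomial f ->
  exists2 g, gaussian_polynomial g & forall x, is_derive x xi f (g x).
Proof.
elim=> [b b0|c g _ [g' pg dg]|g h _ [g' pg dg] _ [h' ph dh]|i g pg0 [g' pg dg]].
- have pl (x0 : V) : exists2 l : V -> R, gaussian_polynomial l &
      forall x, l x = dotp x xi * gauss b x.
    (* The factor <x, xi> is built one coordinate at a time, as the constructors allow, starting
       from 0 times a Gaussian in the role of the zero function. *)
    have H (r : seq 'I_d) : exists2 l : V -> R, gaussian_polynomial l &
        forall x, l x = (\sum_(i <- r) x ord0 i * xi ord0 i) * gauss b x.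
      elim: r => [|i r [l pl lE]].
        exists (fun x => 0 * gauss b x).
          exact/gaussian_polynomial_scale/gaussian_polynomial_gauss.
        by move=> x; rewrite big_nil.
      exists (fun x => x ord0 i * (xi ord0 i * gauss b x) + l x).
        apply: gaussian_polynomial_add => //; apply: gaussian_polynomial_coord.
        exact/gaussian_polynomial_scale/gaussian_polynomial_gauss.
      by move=> x; rewrite big_cons lE mulrDl mulrA.
    exact: H.
  have [l gl lE] := pl 0.
  exists (fun x => (- (2 * b)) * l x); first exact: gaussian_polynomial_scale.
  move=> x; apply: (is_derive_eq (is_derive_gauss b x xi)).
  by rewrite lE; set G := gauss b x; ring.
- exists (fun x => c * g' x); first exact: gaussian_polynomial_scale.
  by move=> x; exact: is_derive_mulc.
- exists (fun x => g' x + h' x); first exact: gaussian_polynomial_add.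
  by move=> x; exact: is_derive_add.
- exists (fun x => xi ord0 i * g x + x ord0 i * g' x).
    apply: gaussian_polynomial_add; first exact: gaussian_polynomial_scale.
    exact: gaussian_polynomial_coord.
  move=> x; have dx : is_derive x xi (fun y : V => y ord0 i) (xi ord0 i).
    have := is_derive_dotp (basis_vec i) x xi.
    have -> : dotp (basis_vec i) = (fun y : V => y ord0 i).
      by apply/funext => y; rewrite dotpC dotp_basis_vec.
    by [].
  exact: (is_derive_mul dx (dg x)).
Qed.

Let weight_le_gauss (N : nat) b : 0 < b ->
  exists2 K : R, 0 < K & forall x : V, (1 + enorm x) ^+ N * gauss b x <= K * gauss (b / 2) x.
Proof.
move=> b0; have b2 : 0 < b / 2 by rewrite divr_gt0.
have [K K0 HK] := @powR_le_gauss R N%:R 2 (b / 2) (ler0n _ _) (ler0n _ _) b2.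
exists (2 ^+ N * K); first by rewrite mulr_gt0 ?exprn_gt0.
move=> x; set s := dotp x x; have s0 : 0 <= s by exact: dotp_ge0.
have e0 := enorm_ge0 x.
have es : 1 + enorm x <= 2 * (2 * s + 1).
  have := enorm_sqr x; rewrite -/s => <-; have := sqr_ge0 (enorm x - 1); nra.
have h : (1 + enorm x) ^+ N <= 2 ^+ N * (K * expR (b / 2 * s)).
  apply: (@le_trans _ _ ((2 * (2 * s + 1)) ^+ N)).
    by rewrite lerXn2r ?nnegrE ?addr_ge0// mulr_ge0// addr_ge0// mulr_ge0.
  rewrite exprMn ler_wpM2l ?exprn_ge0// -powR_mulrn; first exact: HK.
  by rewrite addr_ge0// mulr_ge0.
apply: le_trans (ler_wpM2r (gauss_ge0 b x) h) _.
have -> : gauss (b / 2) x = expR (b / 2 * s) * gauss b x.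
  by rewrite /gauss -/s -expRD; congr expR; field.
by rewrite !mulrA.
Qed.

Lemma gaussian_polynomial_le f : gaussian_polynomial f ->
  exists b K, [/\ 0 < b, 0 < K & forall x, `|f x| <= K * gauss b x].
Proof.
elim=> [b b0|c g _ [b [K [b0 K0 H]]]|g h _ [b [K [b0 K0 H]]] _ [b' [K' [b0' K0' H']]]
  |i g _ [b [K [b0 K0 H]]]].
- by exists b, 1; split=> // x; rewrite mul1r (ger0_norm (gauss_ge0 b x)).
- exists b, ((`|c| + 1) * K); split=> //; first by rewrite mulr_gt0 ?ltr_wpDl.
  move=> x; rewrite normrM -mulrA; apply: ler_pM => //.
  by rewrite lerDl.
- have mono (t u : R) x : t <= u -> gauss u x <= gauss t x.
    by move=> tu; rewrite /gauss ler_expR lerN2 ler_wpM2r ?dotp_ge0.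
  exists (Num.min b b'), (K + K'); split; [by rewrite lt_min b0|exact: addr_gt0|].
  move=> x; apply: (le_trans (ler_normD _ _)); rewrite mulrDl; apply: lerD.
    apply: (le_trans (H x)); apply: (ler_wpM2l (ltW K0)); apply: mono.
    by rewrite ge_min lexx.
  apply: (le_trans (H' x)); apply: (ler_wpM2l (ltW K0')); apply: mono.
  by rewrite ge_min lexx orbT.
- have [K' K0' H'] := weight_le_gauss 1 b0.
  exists (b / 2), (K * K'); split; [by rewrite divr_gt0|exact: mulr_gt0|].
  move=> x; rewrite normrM -mulrA.
  apply: (@le_trans _ _ ((1 + enorm x) ^+ 1 * (K * gauss b x))).
    apply: ler_pM => //; apply: (le_trans (normr_coord_le_enorm x i)).
    by rewrite expr1 lerDr.
  by rewrite mulrCA; apply: (ler_wpM2l (ltW K0)); exact: H'.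
Qed.

Lemma gaussian_polynomial_schwartz f : gaussian_polynomial f ->
  schwartz (fun x => (f x +i* 0)%C).
Proof.
move=> pf s.
have [g pg ->] : exists2 g, gaussian_polynomial g &
    iter_partial s (fun x => (f x +i* 0)%C) = (fun x => (g x +i* 0)%C).
  elim: s => [|j s [g pg IH]]; first by exists f.
  have [g' pg' dg] := gaussian_polynomial_derive (basis_vec j) pg.
  exists g' => //=; rewrite IH; apply/funext => x; rewrite /cderive/=.
  by rewrite (@derive_val _ _ _ _ _ _ _ (dg x)) (derive_cst (0 : R)).
split.
  move=> x; split => /=; first exact: gaussian_polynomial_differentiable.
  exact: differentiable_cst.
move=> N; have [b [K [b0 K0 H]]] := gaussian_polynomial_le pg.
have [K' K0' H'] := weight_le_gauss N b0.
exists (K * K') => x.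
have -> : Normc.normc (g x +i* 0)%C = `|g x|.
  by rewrite /Normc.normc/= (expr0n _ 2)/= addr0 sqrtr_sqr.
have e0 : 0 <= (1 + enorm x) ^+ N by rewrite exprn_ge0// addr_ge0// enorm_ge0.
apply: le_trans (ler_wpM2l e0 (H x)) _.
rewrite mulrCA; apply: (ler_wpM2l (ltW K0)); apply: le_trans (H' x) _.
by rewrite ler_piMr ?(ltW K0')// /gauss -expR0 ler_expR oppr_le0 mulr_ge0 ?dotp_ge0// divr_ge0 ?ltW.
Qed.

Lemma gaussian_sum_polynomial n (c u : nat -> R) : (forall i, 0 < u i) ->
  gaussian_polynomial (fun x => \sum_(i < n) c i * gauss (u i) x).
Proof.
move=> u0; elim: n => [|n IH].
  have -> : (fun x => \sum_(i < 0) c i * gauss (u i) x) = (fun x => 0 * gauss 1 x).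
    by apply/funext => x; rewrite big_ord0 mul0r.
  exact/gaussian_polynomial_scale/gaussian_polynomial_gauss.
have -> : (fun x => \sum_(i < n.+1) c i * gauss (u i) x) =
    (fun x => \sum_(i < n) c i * gauss (u i) x + c n * gauss (u n) x).
  by apply/funext => x; rewrite big_ord_recr.
apply: gaussian_polynomial_add => //.
exact/gaussian_polynomial_scale/gaussian_polynomial_gauss.
Qed.

End gaussian_schwartz_functions.

(** * Moments of Gaussians under the Dunkl measure *)

Section gaussian_moments.
Context {R : realType} {d : nat}.
Local Notation V := 'rV[R]_d.
Local Notation mu := (@lebesgue_rV R d).
Local Notation leb := (@lebesgue_measure R).
Variables (Rs Rp : {fset V}) (k : V -> R).
Hypotheses (d_gt0 : (0 < d)%N) (hRp : positive_subsystem Rs Rp) (hk : multiplicity Rs k).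
Local Notation w := (dunkl_density Rp k).
Local Notation nu := (lambda_k Rp k + 1).
Implicit Types (x y z : V).

Let w0 x : 0 <= w x.
Proof. exact: (dunkl_density_ge0 hRp hk). Qed.

Let mw : measurable_fun setT w.
Proof. exact: measurable_dunkl_density. Qed.

Let menorm (s : R) : measurable_fun setT (fun x : V => (enorm x `^ s) ^+ 2).
Proof.
apply: measurable_funX; apply: (measurableT_comp (measurable_powR _)).
exact: measurable_enorm.
Qed.

Let W (s b : R) x : R := (enorm x `^ s) ^+ 2 * (gauss b x * w x).

Let W0 s b x : 0 <= W s b x.
Proof. exact: (mulr_ge0 (sqr_ge0 _) (mulr_ge0 (gauss_ge0 _ _) (w0 _))). Qed.

Let mW s b : measurable_fun setT (W s b).
Proof. exact: (measurable_funM (menorm s) (measurable_funM (@measurable_gauss R d b) mw)). Qed.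

(** Kept in the extended reals: finiteness is not known in advance and comes out of [moment_shift]
    together with the value. *)
Let M s : \bar R := (\int[mu]_x (W s 1 x)%:E)%E.

Let M_ge0 s : (0 <= M s)%E.
Proof. by apply: integral_ge0 => x _; rewrite lee_fin. Qed.

Let moment_scale s b : 0 < b -> (\int[mu]_x (W s b x)%:E = (b `^ (- (nu + s)))%:E * M s)%E.
Proof.
move=> b0; have r0 : 0 < Num.sqrt b by rewrite sqrtr_gt0.
pose f x := (enorm x `^ s) ^+ 2 * gauss 1 x.
have f0 x : 0 <= f x by exact: (mulr_ge0 (sqr_ge0 _) (gauss_ge0 _ _)).
have mf : measurable_fun setT f by exact: (measurable_funM (menorm s) (@measurable_gauss R d 1)).
have H := integral_density_scale hRp hk r0 mf f0.
have E x : f (Num.sqrt b *: x) * w x = b `^ s * W s b x.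
  have -> : f (Num.sqrt b *: x) = b `^ s * ((enorm x `^ s) ^+ 2 * gauss b x).
    rewrite /f enormZ (ger0_norm (ltW r0)) powRM ?enorm_ge0 ?(ltW r0)// exprMn -mulrA.
    congr (_ * (_ * _)).
      rewrite -(powR_mulrn 2 (powR_ge0 _ _)) -powRrM -(powR12_sqrt (ltW b0)) -powRrM.
      by congr (_ `^ _); field.
    by rewrite /gauss dotpZl dotpZr mul1r (mulrA (Num.sqrt b)) -expr2 sqr_sqrtr ?(ltW b0).
  by rewrite /W; set w1 := w x; ring.
have mWE : measurable_fun setT (fun x => (W s b x)%:E) by apply/measurable_EFinP.
have bs0 : (0 <= (b `^ s)%:E)%E by rewrite lee_fin powR_ge0.
have WE0 x : (0 <= (W s b x)%:E)%E by rewrite lee_fin.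
have H2 : (\int[mu]_x (f (Num.sqrt b *: x) * w x)%:E = (b `^ s)%:E * \int[mu]_x (W s b x)%:E)%E.
  rewrite -(ge0_integralTZl mu mWE WE0 bs0); apply: eq_integral => x _.
  by rewrite E EFinM.
have H3 : (\int[mu]_x (f x * w x)%:E = M s)%E.
  by apply: eq_integral => x _; rewrite /W mulrA.
rewrite H2 H3 in H.
have bb : ((b `^ (- s))%:E * (b `^ s)%:E = 1)%E.
  rewrite -EFinM -powRD; last by rewrite (gt_eqF b0) implybT.
  by rewrite addNr powRr0.
rewrite -[LHS]mul1e -bb -muleA H muleA -EFinM; congr (_%:E * _)%E.
rewrite -(powR12_sqrt (ltW b0)) -powRrM -powRD; last by rewrite (gt_eqF b0) implybT.
by congr (_ `^ _); field.
Qed.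

(* Integrate [pos_pow p r * W q (1 + r) x] over r and x in both orders. *)
Let moment_shift q p : 0 < p -> p < nu + q ->
  (M q * (Gamma p * Gamma (nu + q - p) / Gamma (nu + q))%:E = (Gamma p)%:E * M (q - p))%E.
Proof.
move=> p0 pq.
pose N (z : R * V) : \bar R := (pos_pow p z.1 * W q (1 + z.1) z.2)%:E.
have N0 (z : R * V) : (0 <= N z)%E by rewrite lee_fin mulr_ge0 ?pos_pow_ge0.
have mN : measurable_fun setT N.
  apply/measurable_EFinP; apply: measurable_funM.
    by apply: (measurableT_comp (measurable_pos_pow p) measurable_fst).
  apply: measurable_funM; first exact: (measurableT_comp (menorm q) measurable_snd).
  apply: measurable_funM; last exact: (measurableT_comp mw measurable_snd).
  rewrite /gauss; apply: (measurableT_comp (@measurable_expR R)).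
  apply: measurableT_comp => //; apply: measurable_funM.
    by apply: measurable_funD => //; exact: measurable_fst.
  exact: (measurableT_comp (@measurable_dotp_self R d) measurable_snd).
have E1 : (\int[leb]_r \int[mu]_x N (r, x) =
    M q * (Gamma p * Gamma (nu + q - p) / Gamma (nu + q))%:E)%E.
  rewrite -(integral_beta p0 pq).
  have mB : measurable_fun setT (fun r : R => (pos_pow p r * (1 + r) `^ (- (nu + q)))%:E).
    apply/measurable_EFinP; apply: measurable_funM; first exact: measurable_pos_pow.
    apply: (measurableT_comp (measurable_powR _)); exact: measurable_funD.
  rewrite -ge0_integralZl//; last by move=> r _; rewrite lee_fin mulr_ge0 ?pos_pow_ge0 ?powR_ge0.
  apply: eq_integral => r _; have [r0|r0] := ltP 0 r; last first.
    rewrite /N /pos_pow /= ltNge r0/= mul0r mule0.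
    by under eq_integral do rewrite mul0r; rewrite integral0.
  rewrite /N /=; under eq_integral do rewrite EFinM.
  rewrite ge0_integralZl//; first last.
  - by rewrite lee_fin pos_pow_ge0.
  - by move=> x _; rewrite lee_fin.
  - by apply/measurable_EFinP.
  by rewrite moment_scale ?addr_gt0// EFinM muleA muleC.
have E2 : (\int[mu]_x \int[leb]_r N (r, x) = (Gamma p)%:E * M (q - p))%E.
  rewrite -ge0_integralZl//; first last.
  - by rewrite lee_fin ltW// Gamma_gt0.
  - by move=> x _; rewrite lee_fin.
  - by apply/measurable_EFinP.
  apply: ae_eq_integral => //.
  - exact: (measurable_fun_fubini_tonelli_G (m1 := leb) N mN N0).
  - by apply: emeasurable_funM => //; apply/measurable_EFinP.
  exists [set 0]; split; [|exact: (rV_set1_null d_gt0)|].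
    rewrite (_ : [set 0] = @enorm R d @^-1` [set 0]).
      by rewrite -[X in measurable X]setTI; exact: measurable_enorm.
    by apply/seteqP; split => x /=; [move=> ->; exact: enorm0|move/eqP; rewrite enorm_eq0 => /eqP].
  move=> x /=; apply: contra_notP => x0 _.
  have xx : 0 < enorm x by rewrite lt0r enorm_ge0 enorm_eq0 andbT; exact/eqP.
  have xd : 0 < dotp x x by rewrite -enorm_sqr exprn_gt0.
  have E r : N (r, x) = ((W q 1 x)%:E * (pos_pow p r * expR (- (dotp x x * r)))%:E)%E.
    rewrite /N /= -EFinM; congr EFin; rewrite /W.
    have -> : gauss (1 + r) x = gauss 1 x * expR (- (dotp x x * r)).
      by rewrite /gauss -expRD; congr expR; ring.
    by set w1 := w x; ring.
  under eq_integral do rewrite E.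
  rewrite ge0_integralZl ?lee_fin//; first last.
  - by move=> r _; rewrite lee_fin mulr_ge0 ?pos_pow_ge0 ?expR_ge0.
  - exact: measurable_pos_pow_exp.
  rewrite integral_pos_pow_exp// -!EFinM; congr EFin; rewrite /W -enorm_sqr.
  rewrite -(powR_mulrn 2 (enorm_ge0 x)) -powRrM -!(powR_mulrn 2 (powR_ge0 _ _)) -!powRrM.
  have -> : enorm x `^ ((q - p) * 2%:R) = enorm x `^ (q * 2%:R) * enorm x `^ (2%:R * - p).
    rewrite -powRD; last by rewrite (gt_eqF xx) implybT.
    by congr (_ `^ _); ring.
  by set w1 := w x; ring.
by rewrite -E1 -E2 (fubini_tonelli (m1 := leb) (m2 := mu) N mN N0).
Qed.

Let M0 : M 0 = ((2 `^ (- nu)))%:E.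
Proof.
have := integral_gauss_density hRp hk (@ltr01 R); rewrite mulr1 => <-.
by apply: eq_integral => x _; rewrite /W powRr0 (expr1n _ 2) (mul1r (_ * w x)).
Qed.

Let mule_solve (a t : R) (m : \bar R) : 0 < a -> (m * a%:E = t%:E)%E -> m = (t / a)%:E.
Proof.
by move=> a0 H; rewrite EFinM -H -muleA -EFinM mulfV ?gt_eqF// mule1.
Qed.

(** Case q = 0 of [moment_shift], where [M] 0 is known; [M_pos] takes q = p instead and solves for
    the other moment. *)
Let M_neg p : 0 < p -> p < nu -> M (- p) = (2 `^ (- nu) * (Gamma (nu - p) / Gamma nu))%:E.
Proof.
move=> p0 pnu; have := @moment_shift 0 p p0; rewrite addr0 sub0r M0 => /(_ pnu).
have G := Gamma_gt0 p0; have := Gamma_gt0 (lt_trans p0 pnu); move: G.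
move: (Gamma p) (Gamma nu) (Gamma (nu - p)) (2 `^ _) (M (- p)) => a b c t m a0 b0 H.
have /(mule_solve a0) -> : (m * a%:E = (t * (a * c / b))%:E)%E by rewrite muleC -H.
by congr EFin; field; rewrite !gt_eqF.
Qed.

Let M_pos p : 0 < p -> M p = (2 `^ (- nu) * (Gamma (nu + p) / Gamma nu))%:E.
Proof.
move=> p0; have nu0 := lambda_k_gt0 d_gt0 hRp hk.
have pq : p < nu + p by rewrite ltrDr.
have := moment_shift p0 pq; rewrite addrK subrr M0.
have := Gamma_gt0 p0; have := Gamma_gt0 nu0; have := Gamma_gt0 (addr_gt0 nu0 p0).
move: (Gamma p) (Gamma nu) (Gamma (nu + p)) (2 `^ _) (M p) => a b c t m c0 b0 a0.
have h : 0 < a * b / c by rewrite divr_gt0// mulr_gt0.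
rewrite -EFinM => /(mule_solve h) ->.
by congr EFin; field; rewrite !gt_eqF.
Qed.

Lemma gauss_moment s b : 0 < nu + s -> 0 < b ->
  (\int[mu]_x ((enorm x `^ s) ^+ 2 * (gauss b x * w x))%:E =
   (b `^ (- (nu + s)) * (2 `^ (- nu) * (Gamma (nu + s) / Gamma nu)))%:E)%E.
Proof.
move=> s0 b0; rewrite -/(W s b) moment_scale// EFinM; congr (_ * _)%E.
have [sp|sn|sE] := ltgtP 0 s.
- exact: M_pos.
- have sN : 0 < - s by rewrite oppr_gt0.
  have sn' : - s < nu by rewrite -subr_gt0 opprK.
  by have := M_neg sN sn'; rewrite opprK.
- by rewrite -sE M0 addr0 divff ?mulr1// gt_eqF// (Gamma_gt0 (lambda_k_gt0 d_gt0 hRp hk)).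
Qed.

Lemma gauss_sum_moment s n (c b : nat -> R) : 0 < nu + s -> (forall i, 0 < b i) ->
  (\int[mu]_x ((enorm x `^ s) ^+ 2 * ((\sum_(i < n) c i * gauss (b i) x) ^+ 2 * w x))%:E =
   (2 `^ (- nu) * (Gamma (nu + s) / Gamma nu) *
    \sum_(i < n) \sum_(j < n) c i * c j * (b i + b j) `^ (- (nu + s)))%:E)%E.
Proof.
move=> s0 b0.
have L (i j : nat) : L1 mu (W s (b i + b j)).
  apply/integrableP; split; first by apply/measurable_EFinP.
  under eq_integral do rewrite /= (ger0_norm (W0 _ _ _)).
  have fin (m : \bar R) (r : R) : m = r%:E -> (m < +oo)%E by move=> ->; exact: ltry.
  exact: (fin _ _ (gauss_moment s0 (addr_gt0 (b0 i) (b0 j)))).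
have E x : (enorm x `^ s) ^+ 2 * ((\sum_(i < n) c i * gauss (b i) x) ^+ 2 * w x) =
    \sum_(i < n) \sum_(j < n) c i * c j * W s (b i + b j) x.
  rewrite (expr2 (\sum_(i < n) _)) big_distrlr/= mulr_suml mulr_sumr; apply: eq_bigr => i _.
  rewrite mulr_suml mulr_sumr; apply: eq_bigr => j _.
  have -> : W s (b i + b j) x = (enorm x `^ s) ^+ 2 * (gauss (b i) x * gauss (b j) x * w x).
    by rewrite /W /gauss -expRD mulrDl opprD.
  by set w1 := w x; ring.
have Lj i : L1 mu (fun x => \sum_(j < n) c i * c j * W s (b i + b j) x).
  by apply: L1_sum => j; exact: L1Z.
under eq_integral do rewrite E.
rewrite Rint_EFin; last by apply: L1_sum => i; exact: Lj.
rewrite Rint_sum; last by move=> i; exact: Lj.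
congr EFin; rewrite mulr_sumr; apply: eq_bigr => i _.
rewrite Rint_sum; last by move=> j; exact: L1Z.
rewrite mulr_sumr; apply: eq_bigr => j _; rewrite RintZ//.
have -> : \int[mu]_x W s (b i + b j) x =
    (b i + b j) `^ (- (nu + s)) * (2 `^ (- nu) * (Gamma (nu + s) / Gamma nu)).
  exact: (congr1 fine (gauss_moment s0 (addr_gt0 (b0 i) (b0 j)))).
by ring.
Qed.

End gaussian_moments.

(** * The lower bound from radial test functions *)

Section sharpness.
Context {R : realType} {d : nat}.
Local Notation V := 'rV[R]_d.
Local Notation mu := (@lebesgue_rV R d).
Variables (Rs Rp : {fset V}) (k : V -> R).
Hypotheses (d_gt0 : (0 < d)%N) (hRs : root_system Rs)
  (hRp : positive_subsystem Rs Rp) (hk : multiplicity Rs k).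
Variable e : V -> V -> R[i].
Hypothesis he : is_dunkl_kernel Rp k e.
Local Notation w := (dunkl_density Rp k).
Local Notation nu := (lambda_k Rp k + 1).
Implicit Types (x y : V).

Let L1_gauss_ker (b : R) y (K : V -> V -> R) : 0 < b ->
  measurable_fun setT (fun p : V * V => K p.1 p.2) -> (forall x y, `|K x y| <= 1) ->
  L1 mu (fun x => gauss b x * w x * K x y).
Proof.
move=> b0 mK K1; apply: (L1_gauss_bounded hRp hk b0 _ (fun x => K1 x y)).
exact: (measurableT_comp mK (pair2_measurable y)).
Qed.

Lemma gauss_sum_re_transform n (c b : nat -> R) y : (forall i, 0 < b i) ->
  re_transform Rp k e (fun x => \sum_(i < n) c i * gauss (b i) x) (fun=> 0) y =
  \sum_(i < n) (c i * (2 * b i) `^ (- nu)) * gauss (4 * b i)^-1 y.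
Proof.
move=> b0; rewrite /re_transform /cos_transform /sin_transform.
rewrite (@Rint_ext _ _ _ mu (fun x => 0 * w x * ker_sin e x y) (fun x => 0 * (gauss 1 x * w x))); last first.
  by move=> x; rewrite !mul0r.
rewrite (RintZ _ (L1_gauss_w hRp hk ltr01)) mul0r addr0.
have L i : L1 mu (fun x => c i * (gauss (b i) x * w x * ker_cos e x y)).
  apply: L1Z; apply: L1_gauss_ker => //; first exact: (measurable_ker_cos_pair hRs hRp hk he).
  exact: (normr_ker_cos_le1 hRp hk he).
rewrite (@Rint_ext _ _ _ mu _ (fun x => \sum_(i < n) c i * (gauss (b i) x * w x * ker_cos e x y))); last first.
  move=> x; rewrite !mulr_suml; apply: eq_bigr => i _.
  by set W := w x; ring.
rewrite Rint_sum//; apply: eq_bigr => i _; rewrite RintZ; last first.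
  apply: L1_gauss_ker => //; first exact: (measurable_ker_cos_pair hRs hRp hk he).
  exact: (normr_ker_cos_le1 hRp hk he).
rewrite -mulrA -(Rint_gauss_ker_cos hRs hRp hk he y (b0 i)); congr (_ * _).
by apply: Rint_ext => x; rewrite (ker_sym hRs hRp hk he x y).1.
Qed.

Lemma gauss_sum_im_transform n (c b : nat -> R) y : (forall i, 0 < b i) ->
  im_transform Rp k e (fun x => \sum_(i < n) c i * gauss (b i) x) (fun=> 0) y = 0.
Proof.
move=> b0; rewrite /im_transform /cos_transform /sin_transform.
rewrite (@Rint_ext _ _ _ mu (fun x => 0 * w x * ker_cos e x y) (fun x => 0 * (gauss 1 x * w x))); last first.
  by move=> x; rewrite !mul0r.
rewrite (RintZ _ (L1_gauss_w hRp hk ltr01)) mul0r sub0r.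
have L i : L1 mu (fun x => gauss (b i) x * w x * ker_sin e x y).
  apply: L1_gauss_ker => //; first exact: (measurable_ker_sin_pair hRs hRp hk he).
  exact: (normr_ker_sin_le1 hRp hk he).
rewrite (@Rint_ext _ _ _ mu _ (fun x => \sum_(i < n) c i * (gauss (b i) x * w x * ker_sin e x y))); last first.
  move=> x; rewrite !mulr_suml; apply: eq_bigr => i _.
  by set W := w x; ring.
rewrite Rint_sum; last by move=> i; exact: L1Z.
rewrite big1 ?oppr0// => i _; rewrite RintZ//.
rewrite (@Rint_ext _ _ _ mu _ (fun x => gauss (b i) x * w x * ker_sin e y x)).
  by rewrite (Rint_gauss_ker_sin hRs hRp hk he y (b0 i)) mulr0.
by move=> x; rewrite (ker_sym hRs hRp hk he x y).2.
Qed.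

Variable beta : R.
Hypotheses (beta_ge0 : 0 <= beta) (beta_lt : beta < nu).

Let nu0 : 0 < nu. Proof. exact: (lambda_k_gt0 d_gt0 hRp hk). Qed.
Let nub : 0 < nu - beta. Proof. by rewrite subr_gt0. Qed.
Let nuB : 0 < nu + beta. Proof. exact: ltr_wpDr. Qed.

(** A truncated Riemann sum, in log u, for the Gaussian superposition of |x|^(-(nu + beta)), the
    Schur weight, which is not itself a Schwartz function. The exponent of the coefficients is the
    one that turns the quadratic form of [test_norm] into [mellin_kernel]. *)
Let test_function (q : R) n x : R[i] :=
  ((\sum_(i < n) (q ^+ i) `^ ((nu + beta) / 2) * gauss (q ^+ i) x) +i* 0)%C.

Let test_norm q n : 1 < q ->
  dunkl_norm2 Rp k (norm_power_mul beta (test_function q n)) =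
  ((2 `^ (- nu) * (Gamma (nu + beta) / Gamma nu) *
    \sum_(i < n) \sum_(j < n) mellin_kernel (nu + beta) (q ^+ i) (q ^+ j))%:E `^ 2^-1)%E.
Proof.
move=> q1; have q0 (i : nat) : 0 < q ^+ i by rewrite exprn_gt0// (lt_trans ltr01).
rewrite dunkl_norm2_power_mul; congr (_ `^ _)%E.
under eq_integral do rewrite /test_function /= expr0n/= addr0.
rewrite (gauss_sum_moment d_gt0 hRp hk n (fun i => (q ^+ i) `^ ((nu + beta) / 2)) nuB q0).
congr EFin; congr (_ * _); apply: eq_bigr => i _; apply: eq_bigr => j _.
by rewrite -powRM ?ltW.
Qed.

(** The transform of exp(-u|x|^2) is (2u)^(-nu) exp(-|y|^2/(4u)). With 1/(4u) + 1/(4v) = (u +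
    v)/(4uv), the powers of uv add up to (nu + beta)/2 - nu + (nu - beta) = (nu - beta)/2 and those
    of 4 to -nu + (nu - beta) = -beta. *)
Let test_transform_norm q n : 1 < q ->
  dunkl_norm2 Rp k (norm_power_mul (- beta) (dunkl_transform Rp k e (test_function q n))) =
  ((4 `^ (- beta) * (2 `^ (- nu) * (Gamma (nu - beta) / Gamma nu)) *
    \sum_(i < n) \sum_(j < n) mellin_kernel (nu - beta) (q ^+ i) (q ^+ j))%:E `^ 2^-1)%E.
Proof.
move=> q1; have q0 (i : nat) : 0 < q ^+ i by rewrite exprn_gt0// (lt_trans ltr01).
have u0 (i : nat) : 0 < (4 * q ^+ i)^-1 by rewrite invr_gt0 mulr_gt0.
pose c (i : nat) := (q ^+ i) `^ ((nu + beta) / 2).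
have sf : schwartz (test_function q n).
  exact: (gaussian_polynomial_schwartz (gaussian_sum_polynomial n c q0)).
have [mre mim] := schwartz_measurable sf.
have [Lre Lim] := schwartz_L1 d_gt0 hRp hk sf.
have E y : (enorm y `^ (- beta)) ^+ 2 *
    ((complex.Re (dunkl_transform Rp k e (test_function q n) y) ^+ 2 +
      complex.Im (dunkl_transform Rp k e (test_function q n) y) ^+ 2) * w y) =
    (enorm y `^ (- beta)) ^+ 2 *
    ((\sum_(i < n) (c i * (2 * q ^+ i) `^ (- nu)) * gauss (4 * q ^+ i)^-1 y) ^+ 2 * w y).
  have [-> ->] := dunkl_transform_ReIm hRs hRp hk he y mre mim Lre Lim.
  have re := gauss_sum_re_transform n c y q0.
  have im := gauss_sum_im_transform n c y q0.
  rewrite -[X in X ^+ 2 + _]/(re_transform Rp k e (fun x => \sum_(i < n) c i * gauss (q ^+ i) x) (fun=> 0) y).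
  rewrite -[X in _ + X ^+ 2]/(im_transform Rp k e (fun x => \sum_(i < n) c i * gauss (q ^+ i) x) (fun=> 0) y).
  by rewrite re im (expr0n _ 2) addr0.
rewrite dunkl_norm2_power_mul; congr (_ `^ _)%E.
under eq_integral do rewrite E.
rewrite (gauss_sum_moment d_gt0 hRp hk n (fun i => c i * (2 * q ^+ i) `^ (- nu)) nub u0).
congr EFin; rewrite [4 `^ _ * _]mulrC -[RHS]mulrA; congr (_ * _).
rewrite mulr_sumr; apply: eq_bigr => i _; rewrite mulr_sumr; apply: eq_bigr => j _.
rewrite /c; set u := q ^+ i; set v := q ^+ j.
have up : 0 < u by exact: q0. have vp : 0 < v by exact: q0.
rewrite mulrACA -powRM ?(ltW up) ?(ltW vp)// -powRM ?mulr_ge0 ?(ltW up) ?(ltW vp)//.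
have uv0 : 0 < u * v by rewrite mulr_gt0.
have -> : (4 * u)^-1 + (4 * v)^-1 = (4 * (u * v) / (u + v))^-1.
  by field; rewrite !gt_eqF// addr_gt0.
rewrite (_ : 2 * u * (2 * v) = 4 * (u * v)); last by ring.
rewrite /mellin_kernel (powRM _ (ler0n _ 4) (ltW uv0)).
have dp : 0 < u + v by rewrite addr_gt0.
have -> : (4 * (u * v) / (u + v))^-1 `^ (- (nu - beta)) =
    4 `^ (nu - beta) * (u * v) `^ (nu - beta) * (u + v) `^ (- (nu - beta)).
  rewrite -powR_inv1 ?divr_ge0 ?mulr_ge0 ?(ltW up) ?(ltW vp) ?(ltW dp)// -powRrM mulN1r opprK.
  rewrite powRM ?mulr_ge0 ?invr_ge0 ?(ltW up) ?(ltW vp) ?(ltW dp)// powRM ?(ltW uv0)//.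
  by rewrite -[in X in _ * X](powR_inv1 (ltW dp)) -powRrM mulN1r.
have p4 : 4 `^ (- beta) = 4 `^ (- nu) * 4 `^ (nu - beta) :> R.
  by rewrite -powRD ?pnatr_eq0 ?implybT//; congr (_ `^ _); ring.
have puv : (u * v) `^ ((nu - beta) / 2) = (u * v) `^ ((nu + beta) / 2) * (u * v) `^ (- nu) * (u * v) `^ (nu - beta).
  by rewrite -!powRD ?(gt_eqF uv0) ?implybT//; congr (_ `^ _); field.
by rewrite p4 puv; ring.
Qed.

Lemma pitt_bound_radial_ge (C : R) :
  pitt_bound Rp k e beta [set f | schwartz f /\ radial f] C ->
  2 `^ (- beta) * (Gamma ((nu - beta) / 2) / Gamma ((nu + beta) / 2)) <= C.
Proof.
move=> H.
set A := 2 `^ (- nu) * (Gamma (nu + beta) / Gamma nu).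
set B := 2 `^ (- nu) * (Gamma (nu - beta) / Gamma nu).
have A0 : 0 < A by rewrite mulr_gt0 ?powR_gt0// divr_gt0// Gamma_gt0.
have B0 : 0 < B by rewrite mulr_gt0 ?powR_gt0// divr_gt0// Gamma_gt0.
have mk0 a u v : 0 <= mellin_kernel a u v :> R by rewrite mulr_ge0 ?powR_ge0.
have S0 a (q : R) n : 0 <= \sum_(i < n) \sum_(j < n) mellin_kernel a (q ^+ i) (q ^+ j).
  by apply: sumr_ge0 => i _; apply: sumr_ge0 => j _.
have p40 : 0 < 4 `^ (- beta) :> R by rewrite powR_gt0.
have Hs q n : 1 < q ->
  Num.sqrt (4 `^ (- beta) * B * \sum_(i < n) \sum_(j < n) mellin_kernel (nu - beta) (q ^+ i) (q ^+ j)) <=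
  C * Num.sqrt (A * \sum_(i < n) \sum_(j < n) mellin_kernel (nu + beta) (q ^+ i) (q ^+ j)).
  move=> q1; have q0 (i : nat) : 0 < q ^+ i by rewrite exprn_gt0// (lt_trans ltr01).
  have sf : schwartz (test_function q n) /\ radial (test_function q n).
    split.
      exact: (gaussian_polynomial_schwartz (gaussian_sum_polynomial n
        (fun i => (q ^+ i) `^ ((nu + beta) / 2)) q0)).
    move=> x y xy; congr (_ +i* _)%C; apply: eq_bigr => i _.
    by rewrite /gauss -!enorm_sqr xy.
  have := H _ sf; rewrite test_norm// test_transform_norm//.
  rewrite !poweR_EFin -EFinM lee_fin !powR12_sqrt//.
  - exact: (mulr_ge0 (ltW A0) (S0 _ _ _)).
  - exact: (mulr_ge0 (mulr_ge0 (ltW p40) (ltW B0)) (S0 _ _ _)).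
(* [C] is an arbitrary real and its sign is needed before squaring; a single Gaussian, with q = 2
   and n = 1, already has a positive left side. *)
have C_ge0 : 0 <= C.
  rewrite leNgt; apply/negP => C0; have q12 : 1 < 2 :> R by rewrite ltr1n.
  have := Hs 2 1%N q12; rewrite !big_ord1 leNgt => /negP; apply.
  apply: (@le_lt_trans _ _ 0).
    by rewrite nmulr_rle0 ?sqrtr_ge0.
  have mp a u v : 0 < u -> 0 < v -> 0 < mellin_kernel a u v :> R.
    by move=> up vp; rewrite mulr_gt0 ?powR_gt0 ?mulr_gt0 ?addr_gt0.
  by rewrite sqrtr_gt0; apply: (mulr_gt0 (mulr_gt0 p40 B0)); apply: mp; rewrite exprn_gt0.
have key : 4 `^ (- beta) * B * mellin_mass (nu - beta) <= C ^+ 2 * A * mellin_mass (nu + beta).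
  apply: mellin_toeplitz_limit => //.
  - exact: (mulr_ge0 (ltW p40) (ltW B0)).
  - exact: (mulr_ge0 (sqr_ge0 C) (ltW A0)).
  move=> q n q1; have := Hs q n q1.
  set X := (X in Num.sqrt X <= _); set S2 := (X in _ <= _ * Num.sqrt (A * X)) => XY.
  have X0 : 0 <= X by exact: (mulr_ge0 (mulr_ge0 (ltW p40) (ltW B0)) (S0 _ _ _)).
  have S20 : 0 <= A * S2 by exact: (mulr_ge0 (ltW A0) (S0 _ _ _)).
  have := ler_pM (sqrtr_ge0 _) (sqrtr_ge0 _) XY XY.
  by rewrite -!expr2 sqr_sqrtr// exprMn sqr_sqrtr// mulrA.
have g1 : 0 < Gamma ((nu - beta) / 2) by rewrite Gamma_gt0// divr_gt0.
have g2 : 0 < Gamma ((nu + beta) / 2) by rewrite Gamma_gt0// divr_gt0.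
have G1 := Gamma_gt0 nub; have G2 := Gamma_gt0 nuB; have G := Gamma_gt0 nu0.
have t0 : 0 < 2 `^ (- nu) :> R by rewrite powR_gt0.
have p4 : 4 `^ (- beta) = (2 `^ (- beta)) ^+ 2 :> R.
  by rewrite expr2 -powRM//; congr (_ `^ _); rewrite -natrM.
move: key; rewrite /A /B /mellin_mass p4.
have s0 : 0 < 2 `^ (- beta) :> R by rewrite powR_gt0.
clear -C_ge0 g1 g2 G1 G2 G t0 s0.
move: g1 g2 G1 G2 G t0 s0.
move: (Gamma ((nu - beta) / 2)) (Gamma ((nu + beta) / 2)) (Gamma (nu - beta))
  (Gamma (nu + beta)) (Gamma nu) (2 `^ (- nu)) (2 `^ (- beta)).
move=> a b c e' g t s a0 b0 c0 e0 g0 t0 s0 key.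
(* Gamma(nu - beta) and Gamma(nu + beta) from the moments cancel the denominators of [mellin_mass];
   both sides become squares with a common factor, and roots can be taken. *)
have E1 : s ^+ 2 * (t * (c / g)) * (a ^+ 2 / c) = t / g * (s * a) ^+ 2.
  by field; rewrite !gt_eqF.
have E2 : C ^+ 2 * (t * (e' / g)) * (b ^+ 2 / e') = t / g * (C * b) ^+ 2.
  by field; rewrite !gt_eqF.
rewrite E1 E2 ler_pM2l ?divr_gt0// in key.
rewrite mulrA ler_pdivrMr//.
by rewrite -(@ler_pXn2r _ 2) ?nnegrE ?mulr_ge0 ?(ltW s0) ?(ltW a0) ?(ltW b0).
Qed.

End sharpness.

Theorem theorem3p1 (R : realType) (d : nat) (hd : (1 <= d)%N)
    (Rs Rp : {fset 'rV[R]_d}) (k : 'rV[R]_d -> R)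
    (hRs : root_system Rs) (hRp : positive_subsystem Rs Rp)
    (hk : multiplicity Rs k)
    (e : 'rV[R]_d -> 'rV[R]_d -> R[i]) (he : is_dunkl_kernel Rp k e)
    (beta : R) (hbeta0 : 0 <= beta) (hbeta1 : beta < lambda_k Rp k + 1) :
  let C0 : R := 2 `^ (- beta) * (Gamma ((lambda_k Rp k + 1 - beta) / 2) /
                                 Gamma ((lambda_k Rp k + 1 + beta) / 2)) in
  is_smallest_constant
    (pitt_bound Rp k e beta [set f | schwartz f]) C0 /\
  (forall C : R,
     pitt_bound Rp k e beta [set f | schwartz f /\ radial f] C -> C0 <= C).
Proof.
split; last by move=> C; exact: (pitt_bound_radial_ge hd hRs hRp hk he).
split; first exact: (pitt_bound_schwartz hd hRs hRp hk he).
move=> C HC; apply: (pitt_bound_radial_ge hd hRs hRp hk he hbeta0 hbeta1).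
by move=> f [sf _]; exact: HC.
Qed.
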